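(* Let $\overline X$ be a compact connected complex manifold of dimension $n$, $D\subset\overline X$ a smooth connected effective divisor, $X=\overline X-D$. Suppose that the initial Kähler metric $\omega_X(0)$ on $X$ has conical standard spatial asymptotics associated to $\omega_D$ (more precisely, to $(\omega_D,h_D)$). Let $(X,\omega_X(\cdot))$ be the Kähler-Ricci flow starting from $\omega_X(0)$. (a) For any time $t\ge0$ at which the flow exists, the Kähler metric $\omega_X(t)$ has conical standard spatial asymptotics associated to $\omega_D$ (to $(\omega_D,h_D)$). (b) Suppose that the flow $(X,\omega_X(\cdot))$ exists for all positive time. Let $\omega_\infty(\cdot)$ be a parabolic blowdown limit. Then any asymptotic expansion of $\omega_\infty(\cdot)$, in powers of $z$ and $\bar z$, equals the formal gradient expanding soliton $\omega_{\mathrm{sol}}(\cdot)$ associated to $\omega_D$.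
   Context: $\Delta\subset\mathbb C$ is the open unit disk, $\Delta^*=\Delta-\{0\}$. The Kähler-Ricci flow is $\partial_t\omega=-\mathrm{Ric}(\omega)$, $\mathrm{Ric}(\omega)=-\sqrt{-1}\partial\overline\partial\log\det(g_{i\bar j})$, with complete time slices and bounded curvature on compact time intervals. **Conical standard spatial asymptotics.** $L_D$ is the holomorphic line bundle associated to $D$, $\sigma$ a holomorphic section of $L_D$ with zero set $D$, nondegenerate at $D$, $h$ a Hermitian metric on $L_D$, $h_D$ its restriction to $L_D|_D$. A local parametrization at $\overline x\in D$ is a biholomorphism $F_{\overline x}:\Delta^n\to U$, $(z,w)\mapsto F_{\overline x}(z,w)$, onto a neighborhood $U$ of $\overline x$, with $F_{\overline x}(0)=\overline x$ and $F_{\overline x}(\Delta^*\times\Delta^{n-1})=U\cap X$; $G_{\overline x}(w)=F_{\overline x}(0,w)$; $\alpha_r(z,w)=(rz,w)$. Writing $\sigma=z\,e$ on $U$, put $h(w)=|c|^2|e|_h^2(F_{\overline x}(0,w))$ with $c\ne0$ a constant (allowed because $z$ may be multiplied by a constant). For a Kähler metric $\omega_D$ on $D$, $\omega_X$ has conical standard spatial asymptotics associated to $(\omega_D,h_D)$ if for every $\overline x\in D$ and every $F_{\overline x}$, for suitable $c$, $$\lim_{r\to0}r^2\alpha_r^*F_{\overline x}^*\omega_X=\sqrt{-1}\,\frac{\big(\frac{dz}z+\frac{\partial_wh}h\big)\wedge\big(\frac{d\bar z}{\bar z}+\frac{\partial_{\bar w}h}h\big)}{h|z|^2}+\frac{G_{\overline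 x}^*\omega_D}{h|z|^2},$$ with smooth convergence on every $\{0<R_1<|z|<R_2<1\}\times\Delta^{n-1}$. **The cone.** Let $E=L_D|_D$ (the normal bundle of $D$), with $h_D$ scaled so that $c=1$, and let $E'$ be the complement of the zero section of $E$. For (b), $\omega_D$ is the curvature form $-\sqrt{-1}\partial\overline\partial\log|s|_{h_D}^2$ ($s$ a local nonvanishing holomorphic section of $E$). Let $|S|^2$ be the function $e\mapsto|e|^2_{h_D}$ on $E'$; locally $|S|^2=h(w)z\bar z$ with $z$ the fiber coordinate and $w$ coordinates on $D$. Put $\omega_0=\sqrt{-1}\partial\overline\partial|S|^{-2}$. Then $(E',\omega_0)$ is the Kähler cone $(CY-\star,\omega_{CY})$ with vertex $\star$ over the unit circle bundle $Y\subset E$, with radial function $|S|^{-1}$; it is the asymptotic cone of $(X,\omega_X(0))$. Going to infinity in the cone corresponds to $z\to0$. **Parabolic blowdown limit.** There is $\epsilon>0$ so that for any $r_i\to\infty$, after passing to a subsequence, there is a Kähler-Ricci flow $\omega_\infty(\cdot)$ on $\{(x,t)\in(CY-\star)\times[0,\infty):0\le t\le\epsilon\,d_{CY}(x,\star)^2\}$ with $\omega_\infty(0)=\omega_{CY}$ and $\omega_\infty(t)=\lim_i r_i^{-2}\omega_X(r_i^2t)$, with smooth convergence on annuli (after pullback by embeddings of annuli of $CY-\star$ into $X$ under which the complex structures converge to that of $E'$). Any such $\omega_\infty(\cdot)$ is called a parabolic blowdown limit. **The formal soliton.** Let $V=z\partial_z+\bar z\partial_{\bar z}$ on $E'$. There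 are unique smooth functions $u_{(k)}$, $k=1,2,\dots$, on $E'$ with $\mathcal L_Vu_{(k)}=k\,u_{(k)}$ such that, as an identity of formal series graded by $\mathcal L_V$-weight, $\log\frac{(\omega_0-\mathrm{Ric}(\omega_0)+\sqrt{-1}\partial\overline\partial\sum_{k>0}u_{(k)})^n}{\omega_0^n}=\sum_{k>0}(\frac k2+1)u_{(k)}$. Then $\omega_{\mathrm{sol}}(1)=\omega_0-\mathrm{Ric}(\omega_0)+\sqrt{-1}\partial\overline\partial\sum_{k>0}u_{(k)}$ formally satisfies the expanding soliton equation $\mathrm{Ric}(\omega)+\frac12\mathcal L_V\omega=-\omega$, and the associated flow is $\omega_{\mathrm{sol}}(t)=\omega_0-t\,\mathrm{Ric}(\omega_0)+\sqrt{-1}\partial\overline\partial\sum_{k>0}t^{\frac k2+1}u_{(k)}$. **Asymptotic expansion.** An asymptotic expansion of $\omega_\infty(\cdot)$ in powers of $z,\bar z$ is an expansion $\omega_\infty(t)\sim\omega_0-t\,\mathrm{Ric}(\omega_0)+\sqrt{-1}\sum_{k=0}^\infty\partial\overline\partial v_{(k)}(t)$ as $z\to0$, with $v_{(k)}(t)$ smooth functions on $E'$ depending smoothly on $t$ and satisfying $\mathcal L_Vv_{(k)}=k\,v_{(k)}$, where $\sim$ means that a potential $v(t)$ for $\omega_\infty(t)-\omega_0+t\,\mathrm{Ric}(\omega_0)$ satisfies, for every $K$, $v-\sum_{k\le K}v_{(k)}=o(|S|^K)$ locally uniformly in $t$, together with the same estimates after applying $\partial_t,z\partial_z,\bar z\partial_{\bar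 z},\partial_w,\partial_{\bar w}$ any number of times. It equals $\omega_{\mathrm{sol}}(\cdot)$ if the two series of forms agree weight by weight. *)

(* Defs.v *)
From HB Require Import structures.
From mathcomp Require Import all_boot all_order all_algebra.
From mathcomp Require Import all_classical all_reals all_analysis.
From mathcomp Require Import complex.
Import Order.TTheory GRing.Theory Num.Theory numFieldNormedType.Exports.

Set Implicit Arguments.
Unset Strict Implicit.
Unset Printing Implicit Defensive.

Local Open Scope classical_set_scope.
Local Open Scope ring_scope.

(* The complex numbers over R, presented as a numClosedFieldType so that the
   topology of 'rV[Cx R]_n is inferred. *)
Definition Cx (R : realType) : numClosedFieldType := complex R.

Notation Cn R n := ('rV[Cx R]_n).

Definition rc (R : realType) (x : R) : Cx R := Complex x 0.
Definition cre (R : realType) (z : Cx R) : R := complex.Re z.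
Definition cim (R : realType) (z : Cx R) : R := complex.Im z.

(** * Calculus on R x C^n *)

Section Calculus.
Variables (R : realType) (n : nat).
Implicit Types (f : R * Cn R n -> Cx R) (q : R * Cn R n).

Definition cderivable (c : R -> Cx R) (t : R) : Prop :=
  derivable (fun s => cre (c s)) t 1 /\ derivable (fun s => cim (c s)) t 1.

Definition cderiv (c : R -> Cx R) (t : R) : Cx R :=
  Complex (derive1 (fun s => cre (c s)) t) (derive1 (fun s => cim (c s)) t).

(* The real coordinate directions of R x C^n: [None] is time, [Some (j, false)]
   is x_j and [Some (j, true)] is y_j, where z_j = x_j + i y_j. *)
Definition shift (a : option ('I_n * bool)) q (s : R) : R * Cn R n :=
  match a with
  | None => (q.1 + s, q.2)
  | Some (j, b) =>
      (q.1, q.2 + (rc s * (if b then 'i else 1)) *: delta_mx 0 j)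
  end.

Definition pder (a : option ('I_n * bool)) f q : Cx R :=
  cderiv (fun s => f (shift a q s)) 0.

Definition pders (s : seq (option ('I_n * bool))) f : R * Cn R n -> Cx R :=
  foldr pder f s.

Definition smooth_st (O : set (R * Cn R n)) f : Prop :=
  forall s q, O q ->
    {for q, continuous (pders s f)} /\
    forall a, cderivable (fun r => pders s f (shift a q r)) 0.

(* Smoothness on an arbitrary subset: local existence of smooth extensions. *)
Definition smooth_upto (A : set (R * Cn R n)) f : Prop :=
  forall q, A q -> exists O f',
    [/\ open O, O q, smooth_st O f' & forall q', O q' -> A q' -> f q' = f' q'].

Definition smooth_on (V : set (Cn R n)) (f : Cn R n -> Cx R) : Prop :=
  smooth_st (setT `*` V) (fun q => f q.2).

(* d/dz_j if b = false, d/d(conj z_j) if b = true. *)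
Definition wirt (j : 'I_n) (b : bool) f q : Cx R :=
  (pder (Some (j, false)) f q
   + (if b then 'i else - 'i) * pder (Some (j, true)) f q) / 2%:R.

Definition dz (j : 'I_n) (f : Cn R n -> Cx R) (p : Cn R n) : Cx R :=
  wirt j false (fun q => f q.2) (0, p).
Definition dzb (j : 'I_n) (f : Cn R n -> Cx R) (p : Cn R n) : Cx R :=
  wirt j true (fun q => f q.2) (0, p).

Definition holo_on (V : set (Cn R n)) (f : Cn R n -> Cx R) : Prop :=
  smooth_on V f /\ forall p j, V p -> dzb j f p = 0.

Definition smooth_cvg (I : Type) (F : set_system I) (K : set (R * Cn R n))
    (f : I -> R * Cn R n -> Cx R) (f0 : R * Cn R n -> Cx R) : Prop :=
  forall s (e : R), 0 < e ->
    \forall i \near F, forall q, K q ->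
      `|pders s (f i) q - pders s f0 q| <= rc e.

Definition holo_map (k : nat) (O : set (Cn R n)) (c : Cn R n -> Cn R k) : Prop :=
  forall j, holo_on O (fun p => c p 0 j).
Definition smooth_map (k : nat) (O : set (Cn R n)) (c : Cn R n -> Cn R k) : Prop :=
  forall j, smooth_on O (fun p => c p 0 j).

(* The real differential of c at p, applied to the real tangent vector u. *)
Definition dmap (k : nat) (c : Cn R n -> Cn R k) (p u : Cn R n) : Cn R k :=
  \row_j cderiv (fun s => c (p + rc s *: u) 0 j) 0.

Definition polydisc : set (Cn R n) := [set p | forall j, `|p 0 j| < 1].

End Calculus.
Arguments polydisc {R} n.

(** * Hermitian matrices of (1,1)-forms

   The real (1,1)-form  i sum_kl G_kl dz^k /\ d(conj z^l)  is represented by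
   its coefficient matrix G. *)

Section Forms.
Variables (R : realType) (n : nat).
Implicit Types (G : 'M[Cx R]_n) (g : Cn R n -> 'M[Cx R]_n).

Definition sesq G (u v : Cn R n) : Cx R :=
  \sum_k \sum_l G k l * u 0 k * (v 0 l)^*.

Definition hermpos G : Prop :=
  (forall k l, G l k = (G k l)^*) /\ forall u, u != 0 -> 0 < sesq G u u.

(* The value of the 2-form on a pair of real tangent vectors. *)
Definition form2 G (u v : Cn R n) : Cx R := 'i * (sesq G u v - sesq G v u).

Definition dform_closed g (p : Cn R n) : Prop :=
  forall i j k,
    dz k (fun q => g q i j) p = dz i (fun q => g q k j) p.

Definition ddbar (f : Cn R n -> R) (p : Cn R n) : 'M[Cx R]_n :=
  \matrix_(i, j) dz i (dzb j (fun q => rc (f q))) p.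

Definition Ric g (p : Cn R n) : 'M[Cx R]_n :=
  - ddbar (fun q => ln (cre (\det (g q)))) p.

Definition pull (k : nat) (tau : Cn R k -> Cn R n) g (p : Cn R k) : 'M[Cx R]_k :=
  let J : 'M[Cx R]_(n, k) := \matrix_(a, i) dz i (fun q => tau q 0 a) p in
  J^T *m g (tau p) *m map_mx Num.conj J.

(* R(a, conj b, c, conj d) for the Kaehler curvature tensor
   R_{i jb k lb} = - d_k d_lb g_{i jb} + g^{qb p} d_k g_{i qb} d_lb g_{p jb}. *)
Definition curv g (p : Cn R n) (a b c d : Cn R n) : Cx R :=
  \sum_k \sum_l
    sesq (- (\matrix_(i, j) dz k (dzb l (fun q => g q i j)) p)
          + (\matrix_(i, j) dz k (fun q => g q i j) p) *m invmx (g p)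
            *m (\matrix_(i, j) dzb l (fun q => g q i j) p)) a b
    * c 0 k * (d 0 l)^*.

End Forms.

(** * Manifolds through parametrizations *)

Record param (R : realType) (T : Type) (n : nat) := Param {
  pdom : set (Cn R n);
  pmap :> Cn R n -> T
}.

(* c expresses phi : T -> T' from the parametrization psi to chi, over O. *)
Definition represents (R : realType) (T T' : Type) (n n' : nat) (phi : T -> T')
    (psi : param R T n) (chi : param R T' n')
    (O : set (Cn R n)) (c : Cn R n -> Cn R n') : Prop :=
  [/\ open O, O `<=` pdom psi, forall p, O p -> pdom chi (c p)
    & forall p, O p -> phi (psi p) = chi (c p)].

Definition holo_compat (R : realType) (T : Type) (n : nat)
    (psi chi : param R T n) : Prop :=
  forall p p', pdom psi p -> pdom chi p' -> psi p = chi p' ->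
    exists O tau, [/\ O p, represents id psi chi O tau & holo_map O tau].

Definition topo_param (R : realType) (T : topologicalType) (n : nat)
    (psi : param R T n) : Prop :=
  [/\ open (pdom psi),
      forall p p', pdom psi p -> pdom psi p' -> psi p = psi p' -> p = p',
      forall U : set T, open U -> open (pdom psi `&` psi @^-1` U)
    & forall V : set (Cn R n), open V -> V `<=` pdom psi -> open (psi @` V)].

Record complexManifold (R : realType) (n : nat) := ComplexManifold {
  cm_space :> topologicalType;
  cm_atlas : set (param R cm_space n);
  cm_hausdorff : hausdorff_space cm_space;
  cm_second_countable : @second_countable cm_space;
  cm_topo : forall psi, cm_atlas psi -> topo_param psi;
  cm_cover : forall x : cm_space,
    exists2 psi, cm_atlas psi & exists2 p, pdom psi p & psi p = x;
  cm_compat : forall psi chi, cm_atlas psi -> cm_atlas chi -> holo_compat psi chi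
}.

(* The maximal atlas: biholomorphisms from open subsets of C^n onto open
   subsets of M. *)
Definition holo_param (R : realType) (n : nat) (M : complexManifold R n)
    (psi : param R M n) : Prop :=
  topo_param psi /\
  forall chi, cm_atlas chi -> holo_compat psi chi /\ holo_compat chi psi.

Definition holo_fun (R : realType) (n : nat) (M : complexManifold R n)
    (U : set M) (f : M -> Cx R) : Prop :=
  forall psi, cm_atlas psi -> holo_on (pdom psi `&` psi @^-1` U) (f \o psi).

Definition smooth_fun (R : realType) (n : nat) (M : complexManifold R n)
    (U : set M) (f : M -> Cx R) : Prop :=
  forall psi, cm_atlas psi -> smooth_on (pdom psi `&` psi @^-1` U) (f \o psi).

(** * Kaehler metrics and Kaehler-Ricci flows

   A (1,1)-form on the manifold swept out by a family P of compatible
   parametrizations is given by its coefficient matrices in each of them. *)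

Definition tensor (R : realType) (T : Type) (n : nat) :=
  param R T n -> Cn R n -> 'M[Cx R]_n.

Section Kaehler.
Variables (R : realType) (T : Type) (n : nat) (P : set (param R T n)).

Definition kahler (g : tensor R T n) : Prop :=
  (forall psi, P psi ->
     (forall i j, smooth_on (pdom psi) (fun p => g psi p i j)) /\
     forall p, pdom psi p -> hermpos (g psi p) /\ dform_closed (g psi) p) /\
  (forall psi chi O tau, P psi -> P chi ->
     represents id psi chi O tau -> holo_map O tau ->
     forall p, O p -> g psi p = pull tau (g chi) p).

(* Kaehler-Ricci flow on a spacetime region W, smooth up to the boundary of W;
   by continuity it is enough to ask for closedness and for the evolution
   equation in the interior. *)
Definition kr_flow (W : set (R * T)) (g : R -> tensor R T n) : Prop :=
  (forall psi, P psi ->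
     let Wpsi := [set q : R * Cn R n | pdom psi q.2 /\ W (q.1, psi q.2)] in
     [/\ forall i j, smooth_upto Wpsi (fun q => g q.1 psi q.2 i j),
         forall q, Wpsi q -> hermpos (g q.1 psi q.2)
       & forall q, Wpsi° q ->
           dform_closed (g q.1 psi) q.2 /\
           forall i j, pder None (fun q' => g q'.1 psi q'.2 i j) q
                       = - Ric (g q.1 psi) q.2 i j]) /\
  (forall psi chi O tau, P psi -> P chi ->
     represents id psi chi O tau -> holo_map O tau ->
     forall t p, O p -> W (t, psi p) -> g t psi p = pull tau (g t chi) p).

Definition speed (g : tensor R T n) (gam : R -> T) (s v : R) : Prop :=
  exists psi c,
    [/\ P psi,
        \forall s' \near s, pdom psi (c s') /\ gam s' = psi (c s'),
        forall j, \forall s' \near s, cderivable (fun r => c r 0 j) s',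
        forall j, {for s, continuous (cderiv (fun r => c r 0 j) : R -> Cx R)}
      & let c' := \row_j cderiv (fun r => c r 0 j) s in
        v = Num.sqrt (cre (sesq (g psi (c s)) c' c'))].

Definition lengths (g : tensor R T n) (x y : T) : set R :=
  [set l | exists (gam : R -> T) (v : R -> R),
     [/\ gam 0 = x, gam 1 = y,
         forall s, 0 <= s <= 1 -> speed g gam s (v s)
       & l = \int[lebesgue_measure]_(s in `[0, 1]) v s]].

(* [exists2 l, lengths g x y l & l < e] says that the Riemannian distance from
   x to y is less than e. *)
Definition complete_metric (X : set T) (g : tensor R T n) : Prop :=
  forall x : nat -> T, (forall i, X (x i)) ->
    (forall e : R, 0 < e -> exists N, forall i j, (N <= i)%N -> (N <= j)%N ->
       exists2 l, lengths g (x i) (x j) l & l < e) ->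
    exists2 y, X y & forall e : R, 0 < e ->
      \forall i \near \oo, exists2 l, lengths g (x i) y l & l < e.

Definition curv_bound (g : tensor R T n) (K : R) : Prop :=
  forall psi p, P psi -> pdom psi p ->
    forall a b c d, sesq (g psi p) a a = 1 -> sesq (g psi p) b b = 1 ->
      sesq (g psi p) c c = 1 -> sesq (g psi p) d d = 1 ->
      `|curv (g psi) p a b c d| <= rc K.

(* The flow on the manifold with underlying set X, over the time interval I. *)
Definition complete_kr_flow (X : set T) (I : set R) (g : R -> tensor R T n) : Prop :=
  [/\ is_interval I /\ I 0 /\ (forall t, I t -> 0 <= t),
      forall t, I t -> kahler (g t),
      kr_flow [set q | I q.1 /\ X q.2] g,
      forall t, I t -> complete_metric X (g t)
    & forall t1, I t1 -> exists K, forall t, 0 <= t <= t1 -> curv_bound (g t) K].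

End Kaehler.

(** * Line bundles *)

Record lineBundle (R : realType) (n : nat) (M : complexManifold R n) :=
  LineBundle {
  lb_fiber :> M -> lmodType (Cx R);
  lb_frames : set (set M * (forall x, lb_fiber x));
  lb_open : forall f, lb_frames f -> open f.1;
  lb_cover : forall x, exists2 f, lb_frames f & f.1 x;
  lb_basis : forall f x, lb_frames f -> f.1 x ->
    f.2 x != 0 /\ forall v, exists a, v = a *: f.2 x;
  lb_trans : forall f f', lb_frames f -> lb_frames f' ->
    exists2 a, holo_fun (f.1 `&` f'.1) a
             & forall x, f.1 x -> f'.1 x -> f'.2 x = a x *: f.2 x
}.

Section LineBundle.
Variables (R : realType) (n : nat) (M : complexManifold R n) (L : lineBundle M).

Definition holo_section (U : set M) (s : forall x, L x) : Prop :=
  forall f, lb_frames f -> exists2 a, holo_fun (U `&` f.1) a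
    & forall x, U x -> f.1 x -> s x = a x *: f.2 x.

(* h x v is the squared norm of v. *)
Definition hermitian_metric (h : forall x, L x -> R) : Prop :=
  [/\ forall x (a : Cx R) v, rc (h x (a *: v)) = `|a| ^+ 2 * rc (h x v),
      forall x v, v != 0 -> 0 < h x v
    & forall f, lb_frames f -> smooth_fun f.1 (fun x => rc (h x (f.2 x)))].

(* A section vanishing exactly on D, to first order; a line bundle with such a
   section is the line bundle associated to D. *)
Definition defining_section (D : set M) (s : forall x, L x) : Prop :=
  [/\ holo_section setT s,
      forall x, s x = 0 <-> D x
    & forall f a, lb_frames f -> holo_fun f.1 a ->
        (forall x, f.1 x -> s x = a x *: f.2 x) ->
        forall psi p, cm_atlas psi -> pdom psi p -> f.1 (psi p) -> D (psi p) ->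
          exists j, dz j (a \o psi) p != 0].

End LineBundle.

(** * Smooth divisors and conical asymptotics *)

Definition zc (R : realType) (m : nat) (p : Cn R m.+1) : Cx R := p 0 ord0.
Definition wc (R : realType) (m : nat) (p : Cn R m.+1) : Cn R m :=
  \row_k p 0 (lift ord0 k).
Definition zw (R : realType) (m : nat) (z : Cx R) (w : Cn R m) : Cn R m.+1 :=
  \row_j oapp (fun k => w 0 k) z (unlift ord0 j).

Section Divisor.
Variables (R : realType) (m : nat) (M : complexManifold R m.+1) (D : set M).

Definition local_param (x : M) (F : param R M m.+1) : Prop :=
  [/\ holo_param F, pdom F = polydisc m.+1, F 0 = x
    & F @` [set p | polydisc m.+1 p /\ zc p != 0]
      = F @` polydisc m.+1 `&` ~` D].

Definition smooth_divisor : Prop :=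
  [/\ closed D, D !=set0, connected D
    & forall x, D x -> exists F, local_param x F].

Definition X_params : set (param R M m.+1) :=
  [set psi | holo_param psi /\ forall p, pdom psi p -> ~ D (psi p)].

Definition Xpart (F : param R M m.+1) : param R M m.+1 :=
  Param [set p | polydisc m.+1 p /\ zc p != 0] F.

Definition Gof (F : param R M m.+1) : param R M m :=
  Param (polydisc m) (fun w => F (zw 0 w)).

Definition D_params : set (param R M m) :=
  [set psi | exists x F, [/\ D x, local_param x F & psi = Gof F]].

Definition cone_model (hh : Cn R m -> R) (gD : Cn R m -> 'M[Cx R]_m)
    (p : Cn R m.+1) : 'M[Cx R]_m.+1 :=
  let z := zc p in let w := wc p in
  let theta := zw z^-1 (\row_k (dz k (fun w' => rc (hh w')) w / rc (hh w))) in
  (rc (hh w) * `|z| ^+ 2)^-1 *: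
    (theta^T *m map_mx Num.conj theta
     + \matrix_(i, j)
         match unlift ord0 i, unlift ord0 j with
         | Some k, Some l => gD w k l
         | _, _ => 0
         end).

Definition alpha (r : R) (p : Cn R m.+1) : Cn R m.+1 := zw (rc r * zc p) (wc p).

Variable L : lineBundle M.
Variables (sigma : forall x, L x) (h : forall x, L x -> R).
Variable (gD : tensor R M m).

(* Smooth convergence on {R1 < |z| < R2} x Delta^m is C^oo convergence on
   compact subsets in the w variable. *)
Definition conical_at (g : tensor R M m.+1) (F : param R M m.+1) (c : Cx R) : Prop :=
  exists e : forall x, L x,
    [/\ holo_section (F @` polydisc m.+1) e,
        forall p, polydisc m.+1 p -> e (F p) != 0,
        forall p, polydisc m.+1 p -> sigma (F p) = zc p *: e (F p)
      & forall (R1 R2 rho : R), 0 < R1 -> R1 < R2 -> R2 < 1 -> rho < 1 ->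
        forall i j,
        smooth_cvg (0^'+)
          [set q | rc R1 < `|zc q.2| < rc R2 /\ forall k, `|wc q.2 0 k| <= rc rho]
          (fun (r : R) q => rc (r ^+ 2) * pull (alpha r) (g (Xpart F)) q.2 i j)
          (fun q => cone_model (fun w => h (c *: e (F (zw 0 w)))) (gD (Gof F)) q.2 i j)].

Definition conical_asymptotics (g : tensor R M m.+1) : Prop :=
  forall x F, D x -> local_param x F -> exists2 c, c != 0 & conical_at g F c.

Definition conical_asymptotics1 (g : tensor R M m.+1) : Prop :=
  forall x F, D x -> local_param x F -> conical_at g F 1.

Definition curvature_form : Prop :=
  forall x F f w, D x -> local_param x F -> lb_frames f ->
    polydisc m w -> f.1 (F (zw 0 w)) ->
    gD (Gof F) w = - ddbar (fun w' => ln (h (f.2 (F (zw 0 w'))))) w.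

End Divisor.

(** * The cone E' = L|_D minus the zero section *)

Section Cone.
Variables (R : realType) (m : nat) (M : complexManifold R m.+1) (D : set M).
Variables (L : lineBundle M) (h : forall x, L x -> R).

(* The total space of L; E' is the subset of nonzero vectors over D. *)
Definition total_space := {x : M & L x}.

Definition E'set : set total_space := [set e | D (projT1 e) /\ projT2 e != 0 :> L (projT1 e)].

Definition S2 (e : total_space) : R := h (projT2 e).

Definition E_param (F : param R M m.+1) (f : set M * (forall x, L x)) :
    param R total_space m.+1 :=
  Param [set p | [/\ zc p != 0, polydisc m (wc p) & f.1 (F (zw 0 (wc p)))]]
        (fun p => existT (fun x => L x : Type) (F (zw 0 (wc p)))
                         (zc p *: f.2 (F (zw 0 (wc p))))).

Definition E_params : set (param R total_space m.+1) :=
  [set psi | exists x F f,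
     [/\ D x, local_param D x F, lb_frames f & psi = E_param F f]].

Definition omega0 : tensor R total_space m.+1 :=
  fun psi => ddbar (fun p => (S2 (psi p))^-1).

(* d_t, z d_z, zb d_zb, d_w, d_wb *)
Definition lop (a : option ('I_m.+1 * bool)) (f : R * Cn R m.+1 -> Cx R)
    (q : R * Cn R m.+1) : Cx R :=
  match a with
  | None => pder None f q
  | Some (j, b) =>
      (if j == ord0 then (if b then (zc q.2)^* else zc q.2) else 1) * wirt j b f q
  end.

Definition lops (s : seq (option ('I_m.+1 * bool))) (f : R * Cn R m.+1 -> Cx R) :=
  foldr lop f s.

(* L_V f = k f *)
Definition has_weight (k : nat) (f : total_space -> R) : Prop :=
  forall psi p, E_params psi -> pdom psi p ->
    let fpsi := fun q : R * Cn R m.+1 => rc (f (psi q.2)) in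
    lop (Some (ord0, false)) fpsi (0, p) + lop (Some (ord0, true)) fpsi (0, p)
    = k%:R * rc (f (psi p)).

(** ** The formal soliton *)

(* Coefficient of X^k in log P, for P with constant term 1. *)
Definition formal_log_coef (k : nat) (P : {poly Cx R}) : Cx R :=
  (\sum_(1 <= l < k.+1) ((-1) ^+ l.+1 / l%:R) *: (P - 1) ^+ l)`_k.

(* The component of weight j - 2 of
   omega0 - Ric(omega0) + i ddbar sum_(k > 0) u_k. *)
Definition soliton_part (u : nat -> total_space -> R) (psi : param R total_space m.+1)
    (p : Cn R m.+1) (j : nat) : 'M[Cx R]_m.+1 :=
  match j with
  | 0 => omega0 psi p
  | 1 => 0
  | 2 => - Ric (omega0 psi) p
  | k.+2 => ddbar (fun q => u k (psi q)) p
  end.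

(* The formal variable X records the weight; the components of index > k do not
   contribute to the coefficient of X^k. *)
Definition soliton_ratio (u : nat -> total_space -> R) (psi : param R total_space m.+1)
    (p : Cn R m.+1) (k : nat) : {poly Cx R} :=
  \det (\sum_(j < k.+1)
          'X^j *: map_mx polyC (invmx (omega0 psi p) *m soliton_part u psi p j)).

Definition formal_soliton (u : nat -> total_space -> R) : Prop :=
  forall k, (0 < k)%N ->
    [/\ forall psi, E_params psi -> smooth_on (pdom psi) (fun p => rc (u k (psi p))),
        has_weight k (u k)
      & forall psi p, E_params psi -> pdom psi p ->
          formal_log_coef k (soliton_ratio u psi p k)
          = rc ((k%:R / 2%:R + 1) * u k (psi p))].

(* The component of weight k >= 0 of omega_sol(t). *)
Definition sol_form (u : nat -> total_space -> R) (t : R) (k : nat) : tensor R total_space m.+1 :=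
  fun psi p =>
    if k == 0%N then - (rc t *: Ric (omega0 psi) p)
    else rc (powR t (k%:R / 2%:R + 1)) *: ddbar (fun q => u k (psi q)) p.

(** ** Asymptotic expansions *)

(* The component of weight k >= 0 of
   omega0 - t Ric(omega0) + i sum_k ddbar v_k(t). *)
Definition exp_form (v : nat -> R -> total_space -> R) (t : R) (k : nat) :
    tensor R total_space m.+1 :=
  fun psi p =>
    (if k == 0%N then - (rc t *: Ric (omega0 psi) p) else 0)
    + ddbar (fun q => v k t (psi q)) p.

Definition asymptotic_expansion (g : R -> tensor R total_space m.+1)
    (vk : nat -> R -> total_space -> R) : Prop :=
  [/\ forall k psi, E_params psi ->
        smooth_upto [set q | 0 <= q.1 /\ pdom psi q.2]
          (fun q => rc (vk k q.1 (psi q.2))),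
      forall k t, 0 <= t -> has_weight k (vk k t)
    & exists v : R -> total_space -> R,
      (forall t1 : R, 0 < t1 -> exists2 d : R, 0 < d & forall psi, E_params psi ->
         let N := [set q : R * Cn R m.+1 |
                     [/\ 0 <= q.1 <= t1, pdom psi q.2 & S2 (psi q.2) < d]] in
         smooth_upto N (fun q => rc (v q.1 (psi q.2))) /\
         forall q, N q ->
           ddbar (fun p => v q.1 (psi p)) q.2
           = g q.1 psi q.2 - omega0 psi q.2 + rc q.1 *: Ric (omega0 psi) q.2) /\
      (forall (K : nat) s (t1 e : R) psi (W : set (Cn R m)),
         0 < t1 -> 0 < e -> E_params psi ->
         compact W -> W `<=` [set w | pdom psi (zw 1 w)] ->
         exists2 d : R, 0 < d & forall t p,
           0 < t <= t1 -> W (wc p) -> 0 < `|zc p| < rc d ->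
           `|lops s (fun q => rc (v q.1 (psi q.2)
                                  - \sum_(k < K.+1) vk k q.1 (psi q.2))) (t, p)|
           <= rc (e * Num.sqrt (S2 (psi p)) ^+ K))].

(** ** Parabolic blowdown limits *)

(* The radial function of the cone is |S|^-1. *)
Definition annulus (a b : R) : set total_space :=
  [set e | E'set e /\ a < (Num.sqrt (S2 e))^-1 < b].

Definition cone_region (eps : R) : set (R * total_space) :=
  [set q | E'set q.2 /\ 0 <= q.1 <= eps * (Num.sqrt (S2 q.2))^-1 ^+ 2].

Definition annulus_embedding (A : set total_space) (phi : total_space -> M) : Prop :=
  [/\ forall x y, A x -> A y -> phi x = phi y -> x = y,
      forall x, A x -> ~ D (phi x)
    & forall psi p, E_params psi -> pdom psi p -> A (psi p) ->
        exists chi O c,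
          [/\ X_params D chi, O p, represents phi psi chi O c, smooth_map O c
            & forall u, dmap c p u = 0 -> u = 0]].

(* W s p u v is (phi^* g(s)) (u, v) and J p u is (phi^* J_X) u, at psi(p). *)
Definition pulled_back (A : set total_space) (phi : total_space -> M)
    (psi : param R total_space m.+1) (g : R -> tensor R M m.+1)
    (W : R -> Cn R m.+1 -> Cn R m.+1 -> Cn R m.+1 -> Cx R)
    (J : Cn R m.+1 -> Cn R m.+1 -> Cn R m.+1) : Prop :=
  forall chi O c p, X_params D chi -> represents phi psi chi O c ->
    smooth_map O c -> O p -> A (psi p) ->
    (forall s u v, W s p u v = form2 (g s chi (c p)) (dmap c p u) (dmap c p v)) /\
    (forall u, dmap c p (J p u) = 'i *: dmap c p u).

Definition blowdown_limit (g : R -> tensor R M m.+1) (eps : R)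
    (ginf : R -> tensor R total_space m.+1) : Prop :=
  [/\ kr_flow E_params (cone_region eps) ginf,
      forall psi p, E_params psi -> pdom psi p -> ginf 0 psi p = omega0 psi p
    & exists2 r : nat -> R, r @ \oo --> +oo &
      forall a b : R, 0 < a -> a < b ->
      exists2 phi : nat -> total_space -> M,
        (\forall i \near \oo, annulus_embedding (annulus a b) (phi i)) &
        forall psi, E_params psi -> exists W J,
          (\forall i \near \oo,
             pulled_back (annulus a b) (phi i) psi g (W i) (J i)) /\
          forall K : set (Cn R m.+1), compact K ->
            K `<=` [set p | pdom psi p /\ annulus a b (psi p)] ->
            (forall u v,
               smooth_cvg \oo
                 [set q | K q.2 /\
                    0 < q.1 < eps * (Num.sqrt (S2 (psi q.2)))^-1 ^+ 2]
                 (fun i q => rc ((r i) ^- 2) * W i ((r i) ^+ 2 * q.1) q.2 u v)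
                 (fun q => form2 (ginf q.1 psi q.2) u v)) /\
            (forall u j,
               smooth_cvg \oo [set q | K q.2]
                 (fun i q => J i q.2 u 0 j)
                 (fun=> ('i *: u : Cn R m.+1) 0 j))].

End Cone.

(* Main.v *)
Require Import Defs.
From HB Require Import structures.
From mathcomp Require Import all_boot all_order all_algebra.
From mathcomp Require Import all_classical all_reals all_analysis.
From mathcomp Require Import perm spectral complex ring lra zify.
Import Order.TTheory GRing.Theory Num.Theory numFieldNormedType.Exports.
Set Implicit Arguments.
Unset Strict Implicit.
Unset Printing Implicit Defensive.
Local Open Scope classical_set_scope.
Local Open Scope ring_scope.

(**
  Part (a).  Fix a local parametrization and put G_r = r^2 alpha_r^* F^* omega_X.  In these coordinates
  d_t G_r = r^2 (G_r^(-1) d dbar G_r + quadratic terms), so a lower and an upper bound for G_r, which the curvature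
  bound propagates from time 0, give interior Bernstein estimates for all derivatives, uniformly in small r and up
  to the initial time.  Every derivative of G_r then moves by O(r^2) on a bounded time interval and the limit as
  r -> 0 does not change.

  Part (b).  On a chart of the cone write omega_infty = omega_0 - t Ric(omega_0) + i ddbar v, so the flow says
  d_t ddbar v = ddbar log det(omega_0^(-1) omega_infty).  Pull this back by (z, w) |-> (l z, w) with l -> 0.  The
  right-hand side becomes ddbar log det(1 + l^2 omega_0^(-1) (- t Ric(omega_0) + ddbar v^l)), and the expansion of v
  turns both sides into polynomials in l up to o(l^k) with all the derivatives that occur.  Comparing coefficients
  of l^k gives d_t ddbar v_k = ddbar c_k, where c_k is the coefficient of weight k of the formal logarithm and involves
  only v_0, ..., v_(k-2).  The uniformity of the expansion as t -> 0 gives ddbar v_k(0) = 0, and by induction on k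
  ddbar v_k = t^(k/2 + 1) ddbar u_k.
*)

(** * Complex numbers *)

(** Both parts are shaped by the need for constants that do not see the scaling parameter. In part
    (a) the derivatives of one order are bounded from those of the order below by the maximum
    principle for zeta^2 X (M + E), with X and E the squared norms of the two orders. From order two
    on the nonlinear source has smaller weight than X^2 and is absorbed. At order one the weights
    agree and nothing is left to spare: there E is the squared distance of the metric to its value
    at the start of a short time step, small by the Lipschitz bound in time that the curvature bound
    provides. The length of the step does not depend on r, so finitely many steps, each losing one
    derivative, cover the time interval; the factor r^2 of the equation is used only at the end. In
    part (b) no logarithm of a complex function is taken: the second derivatives of log F are
    written as rational expressions in F and its derivatives, and compared with those of a truncated
    power series, which is a polynomial in l when F is. All comparisons are made at one fixed point,
    with l -> 0 as the only variable. *)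

Section ComplexNumbers.
Variable R : realType.
Implicit Types (x y : R) (z w : Cx R).

(** The norm of [Cx R] takes its values in [Cx R]; the modulus is kept as a real number so that all
    estimates take place in the ordered field [R]. *)
Definition nm z : R := Num.sqrt (cre z ^+ 2 + cim z ^+ 2).

Lemma normE z : `|z| = rc (nm z). Proof. by case: z. Qed.
Lemma complexP z w : cre z = cre w -> cim z = cim w -> z = w.
Proof. by case: z => a b; case: w => c d /= -> ->. Qed.
Lemma creD z w : cre (z + w) = cre z + cre w. Proof. by case: z; case: w. Qed.
Lemma cimD z w : cim (z + w) = cim z + cim w. Proof. by case: z; case: w. Qed.
Lemma creN z : cre (- z) = - cre z. Proof. by case: z. Qed.
Lemma cimN z : cim (- z) = - cim z. Proof. by case: z. Qed.
Lemma creM z w : cre (z * w) = cre z * cre w - cim z * cim w.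
Proof. by case: z; case: w. Qed.
Lemma cimM z w : cim (z * w) = cre z * cim w + cim z * cre w.
Proof. by case: z; case: w. Qed.
Lemma cre_conj z : cre z^* = cre z. Proof. by case: z. Qed.
Lemma cim_conj z : cim z^* = - cim z. Proof. by case: z. Qed.
Lemma cre_i : cre ('i : Cx R) = 0. Proof. by []. Qed.
Lemma cim_i : cim ('i : Cx R) = 1. Proof. by []. Qed.
Lemma cre0 : cre (0 : Cx R) = 0. Proof. by []. Qed.
Lemma cim0 : cim (0 : Cx R) = 0. Proof. by []. Qed.
Lemma cre1 : cre (1 : Cx R) = 1. Proof. by []. Qed.
Lemma cim1 : cim (1 : Cx R) = 0. Proof. by []. Qed.
Lemma creK x : cre (rc x) = x. Proof. by []. Qed.
Lemma cim_rc x : cim (rc x) = 0. Proof. by []. Qed.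
Definition cE := (creD, cimD, creN, cimN, creM, cimM, cre_conj, cim_conj, cre_i, cim_i,
  cre0, cim0, cre1, cim1, creK, cim_rc).
Lemma cre_sum (T : Type) (r : seq T) (P : pred T) (F : T -> Cx R) :
  cre (\sum_(i <- r | P i) F i) = \sum_(i <- r | P i) cre (F i).
Proof. by apply: (big_morph (@cre R)) => // a b; rewrite creD. Qed.

Lemma rcD x y : rc (x + y) = rc x + rc y.
Proof. by apply: complexP; rewrite !cE //= addr0. Qed.
Lemma rcN x : rc (- x) = - rc x.
Proof. by apply: complexP; rewrite !cE //= oppr0. Qed.
Lemma rcB x y : rc (x - y) = rc x - rc y. Proof. by rewrite rcD rcN. Qed.
Lemma rcM x y : rc (x * y) = rc x * rc y.
Proof. by apply: complexP; rewrite !cE; ring. Qed.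
Lemma rc0 : rc (0 : R) = 0. Proof. by []. Qed.
Lemma rc1 : rc (1 : R) = 1. Proof. by []. Qed.
Lemma rcX x k : rc (x ^+ k) = rc x ^+ k.
Proof. by elim: k => [|k IH]; rewrite ?expr0 // !exprS rcM IH. Qed.
Lemma rc_nat k : rc (k%:R : R) = k%:R.
Proof. by elim: k => [|k IH] //; rewrite -!natr1 rcD IH. Qed.
Lemma rcV x : rc x^-1 = (rc x)^-1.
Proof.
have [->|x0] := eqVneq x 0; first by rewrite invr0 rc0 invr0.
have rx0 : rc x != 0 by apply/eqP => /(congr1 (@cre R)) /= /eqP; rewrite (negPf x0).
by apply: (mulfI rx0); rewrite -rcM !mulfV.
Qed.
Lemma rc_sum (T : Type) (r : seq T) (P : pred T) (F : T -> R) :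
  rc (\sum_(i <- r | P i) F i) = \sum_(i <- r | P i) rc (F i).
Proof. by apply: (big_morph (@rc R)) => // a b; rewrite rcD. Qed.
Lemma rc_prod (T : Type) (r : seq T) (P : pred T) (F : T -> R) :
  rc (\prod_(i <- r | P i) F i) = \prod_(i <- r | P i) rc (F i).
Proof. by apply: (big_morph (@rc R)) => // a b; rewrite rcM. Qed.
Lemma rc_inj : injective (@rc R). Proof. by move=> x y []. Qed.
Lemma rc_le x y : (rc x <= rc y) = (x <= y). Proof. by rewrite lecE /= eqxx. Qed.
Lemma rc_lt x y : (rc x < rc y) = (x < y). Proof. by rewrite ltcE /= eqxx. Qed.
Lemma rc_eq0 x : (rc x == 0) = (x == 0).
Proof. by apply/eqP/eqP => [/(congr1 (@cre R))|->]. Qed.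
Lemma rc_ge0 z : 0 <= z -> z = rc (cre z).
Proof. by rewrite lecE /= => /andP[/eqP i0 _]; apply: complexP; rewrite // cE. Qed.
Lemma rc_conj x : (rc x)^* = rc x.
Proof. by apply: complexP; rewrite !cE ?oppr0. Qed.
Lemma rc_crealE z : cim z = 0 -> z = rc (cre z).
Proof. by move=> z0; apply: complexP. Qed.

Lemma nm_sq z : nm z ^+ 2 = cre z ^+ 2 + cim z ^+ 2.
Proof. by rewrite sqr_sqrtr // addr_ge0 ?sqr_ge0. Qed.
Lemma nm_ge0 z : 0 <= nm z. Proof. exact: sqrtr_ge0. Qed.
Lemma nmM z w : nm (z * w) = nm z * nm w.
Proof. by apply: rc_inj; rewrite rcM -!normE normrM. Qed.
Lemma nmD z w : nm (z + w) <= nm z + nm w.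
Proof. by rewrite -rc_le rcD -!normE ler_normD. Qed.
Lemma nmN z : nm (- z) = nm z. Proof. by apply: rc_inj; rewrite -!normE normrN. Qed.
Lemma nmB z w : nm (z - w) <= nm z + nm w. Proof. by rewrite -(nmN w) nmD. Qed.
Lemma nmBC z w : nm (z - w) = nm (w - z). Proof. by rewrite -nmN opprB. Qed.
Lemma nm0 : nm 0 = 0. Proof. by apply: rc_inj; rewrite -normE normr0. Qed.
Lemma nm1 : nm 1 = 1. Proof. by apply: rc_inj; rewrite -normE normr1. Qed.
Lemma nm_eq0 z : (nm z == 0) = (z == 0). Proof. by rewrite -rc_eq0 -normE normr_eq0. Qed.
Lemma nm_rc x : nm (rc x) = `|x|.
Proof. by rewrite /nm !cE expr0n addr0 sqrtr_sqr. Qed.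
Lemma nm_conj z : nm z^* = nm z. Proof. by rewrite /nm !cE sqrrN. Qed.
Lemma nm_i : nm 'i = 1. Proof. by rewrite /nm !cE expr0n expr1n add0r sqrtr1. Qed.
Lemma nmX z k : nm (z ^+ k) = nm z ^+ k.
Proof. by elim: k => [|k IH]; rewrite ?expr0 ?nm1 // !exprS nmM IH. Qed.
Lemma nmV z : nm z^-1 = (nm z)^-1.
Proof. by apply: rc_inj; rewrite rcV -!normE normfV. Qed.
Lemma nm_sum (T : Type) (r : seq T) (P : pred T) (F : T -> Cx R) :
  nm (\sum_(i <- r | P i) F i) <= \sum_(i <- r | P i) nm (F i).
Proof.
elim/big_rec2: _ => [|i y1 y2 _ IH]; first by rewrite nm0.
by apply: le_trans (nmD _ _) _; rewrite lerD2l.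
Qed.
Lemma cre_le z : `|cre z| <= nm z.
Proof. by rewrite -sqrtr_sqr ler_wsqrtr // lerDl sqr_ge0. Qed.
Lemma cim_le z : `|cim z| <= nm z.
Proof. by rewrite -sqrtr_sqr ler_wsqrtr // lerDr sqr_ge0. Qed.
Lemma nm_le z : nm z <= `|cre z| + `|cim z|.
Proof.
rewrite -(ger0_norm (addr_ge0 (normr_ge0 (cre z)) (normr_ge0 (cim z)))) -sqrtr_sqr.
by rewrite ler_wsqrtr // sqrrD !real_normK ?num_real // addrAC lerDl mulrn_wge0 ?mulr_ge0.
Qed.
Lemma conjM_nm z : z * z^* = rc (nm z ^+ 2).
Proof. by apply: complexP; rewrite nm_sq !cE; ring. Qed.
Lemma norm_le z x : (`|z| <= rc x) = (nm z <= x). Proof. by rewrite normE rc_le. Qed.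
Lemma norm_lt z x : (`|z| < rc x) = (nm z < x). Proof. by rewrite normE rc_lt. Qed.
Lemma conjCi : ('i : Cx R)^* = - 'i.
Proof. by apply: complexP; rewrite !cE ?oppr0. Qed.
Lemma gt0_rc (e : Cx R) : 0 < e -> exists2 x : R, 0 < x & e = rc x.
Proof.
by move=> e0; exists (cre e); [rewrite -rc_lt -rc_ge0 ?ltW|exact/rc_ge0/ltW].
Qed.
End ComplexNumbers.

(** * Limits of complex-valued functions *)

Section ComplexTopology.
Variable R : realType.

Lemma cvg_nm (T : Type) (F : set_system T) (FF : Filter F) (f : T -> Cx R) (l : Cx R) :
  (f @ F --> l) <-> (forall e : R, 0 < e -> \forall x \near F, nm (f x - l) < e).
Proof.
rewrite cvgrPdist_lt; split=> H e e0.
  have : 0 < rc e by rewrite -[0]/(rc 0) rc_lt.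
  by move/H; apply: filterS => x; rewrite norm_lt nmBC.
have [x x0 ->] := gt0_rc e0; have := H x x0.
by apply: filterS => y; rewrite norm_lt nmBC.
Qed.

Section Maps.
Variables (T : Type) (F : set_system T) (FF : Filter F) (f : T -> Cx R) (l : Cx R).
Hypothesis fl : f @ F --> l.

Lemma cvg_cre : (fun x => cre (f x)) @ F --> cre l.
Proof.
apply/cvgrPdist_lt => e e0; have := (cvg_nm FF f l).1 fl e e0.
by apply: filterS => x; apply: le_lt_trans; rewrite distrC -creN -creD cre_le.
Qed.
Lemma cvg_cim : (fun x => cim (f x)) @ F --> cim l.
Proof.
apply/cvgrPdist_lt => e e0; have := (cvg_nm FF f l).1 fl e e0.
by apply: filterS => x; apply: le_lt_trans; rewrite distrC -cimN -cimD cim_le.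
Qed.
Lemma cvg_conj : (fun x => (f x)^*) @ F --> l^*.
Proof.
apply/cvg_nm => e e0; have := (cvg_nm FF f l).1 fl e e0.
by apply: filterS => x; rewrite -(rmorphB (Num.conj : {rmorphism _ -> _})) nm_conj.
Qed.
Lemma cvg_nmf : (fun x => nm (f x)) @ F --> nm l.
Proof.
apply/cvgrPdist_lt => e e0; have := (cvg_nm FF f l).1 fl e e0.
apply: filterS => x; apply: le_lt_trans.
rewrite ler_norml; have := nmD (f x - l) l; have := nmD (l - f x) (f x).
by rewrite !subrK (nmBC l (f x)) => *; apply/andP; split; lra.
Qed.
End Maps.
Lemma cvg_rc (T : Type) (F : set_system T) (FF : Filter F) (f : T -> R) (l : R) :
  f @ F --> l -> (fun x => rc (f x)) @ F --> rc l.
Proof.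
move/cvgrPdist_lt => H; apply/cvg_nm => e e0; have := H e e0.
by apply: filterS => x; rewrite -rcB nm_rc distrC.
Qed.
End ComplexTopology.

(** Existence and value of the derivative in a single relation, so that the rules of calculus
    compose; [cderivable] and [cderiv] keep the two apart. *)
Definition is_cder (R : realType) (c : R -> Cx R) (t : R) (l : Cx R) : Prop :=
  is_derive t 1 (fun s => cre (c s)) (cre l) /\ is_derive t 1 (fun s => cim (c s)) (cim l).

Section CurveDerivative.
Variable R : realType.
Implicit Types (c d : R -> Cx R) (t : R) (k l : Cx R).

Lemma is_derive1E (f : R -> R) t (k : R) : is_derive t 1 f k <-> derivable f t 1 /\ derive1 f t = k.
Proof.
by split=> [[? <-]|[? <-]]; [rewrite derive1E|split; rewrite // -derive1E].
Qed.
Lemma cderivableP c t : cderivable c t <-> is_cder c t (cderiv c t).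
Proof.
split=> [[d1 d2]|[/is_derive1E[? _] /is_derive1E[? _]]]; last by [].
by split; apply/is_derive1E.
Qed.
Lemma is_cderE c t l : is_cder c t l -> cderiv c t = l.
Proof. by case=> /is_derive1E[_ a] /is_derive1E[_ b]; apply: complexP. Qed.
Lemma is_cder_cderivable c t l : is_cder c t l -> cderivable c t.
Proof. by case=> /is_derive1E[a _] /is_derive1E[b _]. Qed.
Lemma is_cder_eq c t k l : k = l -> is_cder c t k -> is_cder c t l.
Proof. by move=> ->. Qed.
Lemma is_derive_near (f g : R -> R) t (k : R) : (\forall s \near t, f s = g s) ->
  is_derive t 1 f k -> is_derive t 1 g k.
Proof.
move=> fg [df <-].
split; last by rewrite (near_eq_derive _ fg).
exact: near_eq_derivable fg df.
Qed.
Lemma is_cder_near c d t l : (\forall s \near t, c s = d s) -> is_cder c t l -> is_cder d t l.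
Proof.
move=> cd [a b]; split.
  by apply: is_derive_near a; apply: filterS cd => s ->.
by apply: is_derive_near b; apply: filterS cd => s ->.
Qed.
Lemma is_cderC k t : is_cder (fun=> k) t 0.
Proof. by split; exact: is_derive_cst. Qed.
Lemma is_cderD c d t k l : is_cder c t k -> is_cder d t l -> is_cder (fun s => c s + d s) t (k + l).
Proof.
move=> [a b] [a' b']; split; rewrite cE.
  by rewrite (_ : (fun _ => _) = (fun s => cre (c s)) \+ (fun s => cre (d s))); [exact: is_deriveD|apply/funext => s; rewrite /= cE].
by rewrite (_ : (fun _ => _) = (fun s => cim (c s)) \+ (fun s => cim (d s))); [exact: is_deriveD|apply/funext => s; rewrite /= cE].
Qed.
Lemma is_cderN c t k : is_cder c t k -> is_cder (fun s => - c s) t (- k).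
Proof.
move=> [a b]; split; rewrite cE.
  by rewrite (_ : (fun _ => _) = - (fun s => cre (c s))); [exact: is_deriveN|apply/funext => s; rewrite cE].
by rewrite (_ : (fun _ => _) = - (fun s => cim (c s))); [exact: is_deriveN|apply/funext => s; rewrite cE].
Qed.
Lemma is_cder_conj c t k : is_cder c t k -> is_cder (fun s => (c s)^*) t k^*.
Proof.
move=> [a b]; split; rewrite cE.
  by rewrite (_ : (fun _ => _) = (fun s => cre (c s))); last by apply/funext => s; rewrite cE.
by rewrite (_ : (fun _ => _) = - (fun s => cim (c s))); [exact: is_deriveN|apply/funext => s; rewrite cE].
Qed.
Lemma is_cderM c d t k l : is_cder c t k -> is_cder d t l ->
  is_cder (fun s => c s * d s) t (k * d t + c t * l).
Proof.
move=> [a b] [a' b']; split.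
  rewrite (_ : (fun _ => _) = (fun s => cre (c s)) * (fun s => cre (d s)) - (fun s => cim (c s)) * (fun s => cim (d s))); last by apply/funext => s; rewrite cE.
  have := is_deriveB (is_deriveM a a') (is_deriveM b b').
  by congr is_derive; rewrite !cE /GRing.scale /=; ring.
rewrite (_ : (fun _ => _) = (fun s => cre (c s)) * (fun s => cim (d s)) + (fun s => cim (c s)) * (fun s => cre (d s))); last by apply/funext => s; rewrite cE.
have := is_deriveD (is_deriveM a b') (is_deriveM b a').
by congr is_derive; rewrite !cE /GRing.scale /=; ring.
Qed.
Lemma is_cder_rc (f : R -> R) t (k : R) : is_derive t 1 f k -> is_cder (fun s => rc (f s)) t (rc k).
Proof. by move=> H; split=> //=; exact: is_derive_cst. Qed.
Lemma is_derive_1comp (g f : R -> R) t (k l : R) : is_derive t 1 f k -> is_derive (f t) 1 g l ->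
  is_derive t 1 (fun s => g (f s)) (l * k).
Proof.
by move=> a b; have := is_derive1_comp b a; rewrite mulrC.
Qed.
Lemma is_cder_comp_rc (g : R -> R) c t k (l : R) : is_cder c t k -> is_derive (cre (c t)) 1 g l ->
  is_cder (fun s => rc (g (cre (c s)))) t (rc (l * cre k)).
Proof. by move=> [a _] b; apply: is_cder_rc; exact: is_derive_1comp. Qed.
Lemma is_cder_shift c t k : is_cder c t k <-> is_cder (fun s => c (t + s)) 0 k.
Proof.
have H (f : R -> R) (t0 u0 l : R) : is_derive (t0 + u0) 1 f l -> is_derive u0 1 (fun s => f (t0 + s)) l.
  move=> H; rewrite -[l]mulr1; apply: (is_derive_1comp _ H).
  by have := is_deriveD (is_derive_cst t0 u0 1) (is_derive_id u0 1); rewrite add0r.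
split=> [[a b]|[a b]].
  by split; [apply: (H (fun s => cre (c s)))|apply: (H (fun s => cim (c s)))]; rewrite ?addr0.
split.
  rewrite (_ : (fun s => cre (c s)) = (fun s => (fun r => cre (c (t + r))) (- t + s))).
    by apply: (H (fun r => cre (c (t + r)))); rewrite addNr.
  by apply/funext => s /=; rewrite addNKr.
rewrite (_ : (fun s => cim (c s)) = (fun s => (fun r => cim (c (t + r))) (- t + s))).
  by apply: (H (fun r => cim (c (t + r)))); rewrite addNr.
by apply/funext => s /=; rewrite addNKr.
Qed.
Lemma is_cder_continuous c t k : is_cder c t k -> {for t, continuous c}.
Proof.
move=> [[a _] [b _]]; apply/cvg_nm => e e0.
have /cvgrPdist_lt/(_ (e / 2)) := differentiable_continuous ((derivable1_diffP _ _).1 a).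
have /cvgrPdist_lt/(_ (e / 2)) := differentiable_continuous ((derivable1_diffP _ _).1 b).
have e20 : 0 < e / 2 by rewrite divr_gt0.
move=> /(_ e20) H1 /(_ e20); apply: filterS2 H1 => s H1 H2.
apply: le_lt_trans (nm_le _) _; rewrite !cE.
by rewrite (distrC (cre (c s))) (distrC (cim (c s))); lra.
Qed.
End CurveDerivative.

(** * Smooth functions on R x C^n *)

(* Sealed because conversion otherwise unfolds derivatives eagerly. *)
Fact pd_seal : {d : forall (R : realType) (n : nat), option ('I_n * bool) ->
    (R * Cn R n -> Cx R) -> R * Cn R n -> Cx R | d = @pder}.
Proof. by eexists. Qed.
Definition pd (R : realType) (n : nat) := sval pd_seal R n.
Lemma pdE (R : realType) (n : nat) : @pd R n = @pder R n.
Proof. by rewrite /pd (svalP pd_seal). Qed.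

Section Spacetime.
Variables (R : realType) (n : nat).
Notation S := (R * Cn R n)%type.
Notation sh := (@Defs.shift R n).
Implicit Types (f g : S -> Cx R) (q : S) (O : set S) (a b : option ('I_n * bool)).

Lemma is_cder_ext (c d : R -> Cx R) t l : c =1 d -> is_cder c t l -> is_cder d t l.
Proof. by move=> /funext ->. Qed.

Lemma cvg_row (T : Type) (F : set_system T) (FF : Filter F) (k : nat) (f : T -> Cn R k) (l : Cn R k) :
  (forall j, (fun x => f x 0 j) @ F --> l 0 j) -> f @ F --> l.
Proof.
move=> H A [P nP PA].
have : F (fun x => forall j, P 0 j (f x 0 j)).
  by apply: filter_forall => j; exact: (H j _ (nP 0 j)).
suff H1 : (fun x => forall j, P 0 j (f x 0 j)) `<=` f @^-1` A by move/(filterS H1).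
by move=> x Hx; apply: PA => i j; rewrite ord1; apply: Hx.
Qed.

Lemma cvg_coord (k : nat) (l : Cn R k) (j : 'I_k) : (fun p : Cn R k => p 0 j) @ l --> l 0 j.
Proof. exact: coord_continuous. Qed.

Lemma sh0 a q : sh a q 0 = q.
Proof.
case: a => [[j b]|]; rewrite /Defs.shift ?addr0; last by case: q.
by rewrite rc0 mul0r scale0r addr0; case: q.
Qed.
Lemma shD a q x y : sh a q (x + y) = sh a (sh a q x) y.
Proof.
case: a => [[j b]|]; rewrite /Defs.shift /= ?addrA //.
by rewrite rcD mulrDl scalerDl addrA.
Qed.
Lemma shC a b q x y : sh a (sh b q y) x = sh b (sh a q x) y.
Proof.
case: a => [[j b1]|]; case: b => [[k b2]|]; rewrite /Defs.shift /=; by [congr pair; exact: addrAC|].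
Qed.

Lemma cvg_pair2 (T : Type) (F : set_system T) (t : R) (p : Cn R n) (u : T -> R) (v : T -> Cn R n) :
  Filter F -> u @ F --> t -> v @ F --> p -> (fun y => (u y, v y)) @ F --> (t, p).
Proof. by move=> FF ut vp; exact: cvg_pair ut vp. Qed.

Lemma cvg_sh (T : Type) (F : set_system T) (FF : Filter F) a (u : T -> S) (x : T -> R) q r :
  u @ F --> q -> x @ F --> r -> (fun y => sh a (u y) (x y)) @ F --> sh a q r.
Proof.
case: q => t p; move=> ul xr.
have u1 : (fun y => (u y).1) @ F --> t by apply: (cvg_comp _ _ ul); exact: cvg_fst.
have u2 : (fun y => (u y).2) @ F --> p by apply: (cvg_comp _ _ ul); exact: cvg_snd.
case: a => [[j b]|]; rewrite /Defs.shift; last first.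
  by apply: (@cvg_pair2 _ _ (t + r) p); [exact: cvgD|exact: u2].
apply: (@cvg_pair2 _ _ t); [exact: u1|apply: cvg_row => k].
rewrite !mxE; under eq_fun do rewrite !mxE.
apply: (@cvgD _ _ _ _ _ _ _ (p 0 k)); first exact: (cvg_comp _ _ u2 (@cvg_coord _ _ k)).
by apply: cvgM; [apply: cvgM; [exact: cvg_rc|exact: cvg_cst]|exact: cvg_cst].
Qed.

Lemma near_sh a q (A : set S) : nbhs q A -> \forall r \near (0 : R), A (sh a q r).
Proof.
move=> nA; have : (fun r => sh a q r) @ (0 : R) --> q.
  by rewrite -[X in _ --> X](sh0 a); apply: cvg_sh; [exact: cvg_cst|exact: cvg_id].
by move/(_ _ nA).
Qed.

Lemma near_sh2 a b q (A : set S) : nbhs q A ->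
  exists2 e : R, 0 < e & forall x y, `|x| < e -> `|y| < e -> A (sh a (sh b q y) x).
Proof.
move=> nA; have : (fun z : R * R => sh a (sh b q z.2) z.1) @ ((0, 0) : R * R) --> q.
  rewrite -[X in _ --> X](sh0 a) -{2}(sh0 b q); apply: cvg_sh; last exact: cvg_fst.
  by apply: cvg_sh; [exact: cvg_cst|exact: cvg_snd].
move/(_ _ nA) => /nbhs_ballP[e /= e0 H]; exists e => // x y xe ye.
by apply: (H (x, y)); split; rewrite /ball /= sub0r normrN.
Qed.

Lemma pd_near f g a q : (\forall q' \near q, f q' = g q') -> pd a f q = pd a g q.
Proof.
move=> /near_sh => /(_ a) H; rewrite pdE /pder /cderiv !derive1E.
by congr Complex; apply: near_eq_derive; apply: filterS H => r ->.
Qed.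

Lemma is_cder_pd a f q : cderivable (fun r => f (sh a q r)) 0 <->
  is_cder (fun r => f (sh a q r)) 0 (pd a f q).
Proof. rewrite pdE; exact: cderivableP. Qed.

Lemma pd_cder a f q l : is_cder (fun r => f (sh a q r)) 0 l -> pd a f q = l.
Proof. by move=> H; rewrite pdE /pder (is_cderE H). Qed.

(** Recursion on the derivative that is taken first, whereas [smooth_st] speaks of all words of
    derivatives at once: closure under products, inverses and logarithms is an induction on the
    order. *)
Fixpoint Ck (k : nat) O f : Prop :=
  (forall q, O q -> {for q, continuous f}) /\
  if k is k'.+1 then
    (forall a q, O q -> cderivable (fun r => f (sh a q r)) 0) /\ forall a, Ck k' O (pd a f)
  else True.

Lemma Ck_cts k O f q : Ck k O f -> O q -> {for q, continuous f}.
Proof. by case: k => [|k] [H _] /H. Qed.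
Lemma CkS k O f : Ck k.+1 O f -> Ck k O f.
Proof.
elim: k f => [|k IH] f [c [d H]]; first by split.
by split=> //; split=> // a; apply: IH.
Qed.

Lemma smooth_stP O f : smooth_st O f <-> forall k, Ck k O f.
Proof.
split=> [H k|H].
  elim: k f H => [|k IH] f H; first by split=> // q /(H [::])[].
  split=> [q /(H [::])[]//|]; split=> [a q /(H [::])[] //|a].
  by apply: IH => s q Oq; have := H (rcons s a) q Oq; rewrite /pders foldr_rcons pdE.
move=> s; elim/last_ind: s f H => [|s a IH] f H q Oq.
  by case: (H 1%N) => c [d _]; split; [exact: c|move=> a; exact: d].
have -> : pders (rcons s a) f = pders s (pd a f) by rewrite /pders foldr_rcons pdE.
apply: (IH (pd a f) _ q Oq) => k.
by case: (H k.+1) => _ [_]; exact.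
Qed.

Lemma Ck_sub k O O' f : O' `<=` O -> Ck k O f -> Ck k O' f.
Proof.
elim: k f => [|k IH] f sO [c H]; split=> [q /sO/c//|] //.
by case: H => d H; split=> [a q /sO/d //|a]; exact: (IH _ sO (H a)).
Qed.

Section OpenSet.
Variables (O : set S) (oO : open O).

Lemma near_O q : O q -> \forall q' \near q, O q'. Proof. by move=> Oq; exact: (open_nbhs_nbhs (conj oO Oq)). Qed.

Lemma pd_eq f g a q : (forall q', O q' -> f q' = g q') -> O q -> pd a f q = pd a g q.
Proof. by move=> fg /near_O nO; apply: pd_near; apply: filterS nO. Qed.

Lemma continuous_eqO f g q : (forall q', O q' -> f q' = g q') -> O q ->
  {for q, continuous f} -> {for q, continuous g}.
Proof.
move=> fg Oq cf; have fq : (fun x => f x) @ q --> f q := cf.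
suff : (fun x => g x) @ q --> g q by [].
rewrite -(fg q Oq); apply/cvg_nm => e e0; have /cvg_nm/(_ e e0) := fq.
by apply: filterS2 (near_O Oq) => q' /fg ->.
Qed.

Lemma Ck_eq k f g : (forall q', O q' -> f q' = g q') -> Ck k O f -> Ck k O g.
Proof.
elim: k f g => [|k IH] f g fg [c H].
  split; [move=> q Oq|by []]; exact: continuous_eqO fg Oq (c q Oq).
split=> [q Oq|]; first exact: continuous_eqO fg Oq (c q Oq).
case: H => d H; split=> [a q Oq|a]; last by apply: IH (H a) => q Oq; exact: pd_eq.
have /is_cder_pd D := d a q Oq; apply: is_cder_cderivable (is_cder_near _ D).
by apply: filterS (near_sh a (near_O Oq)) => r /fg.
Qed.

(** The derivatives are supplied as explicit functions; regularity of the next order is then asked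
    of these formulas and not of the limits that define [pd]. *)
Lemma Ck_intro k h h' : (forall q, O q -> {for q, continuous h}) ->
  (forall a q, O q -> is_cder (fun r => h (sh a q r)) 0 (h' a q)) ->
  (forall a, Ck k O (h' a)) -> Ck k.+1 O h.
Proof.
move=> c d H; split=> //; split=> [a q Oq|a]; first exact: is_cder_cderivable (d a q Oq).
by apply: Ck_eq (H a) => q Oq; symmetry; apply: pd_cder; exact: d.
Qed.

Lemma Ck_der k f a q : Ck k.+1 O f -> O q -> is_cder (fun r => f (sh a q r)) 0 (pd a f q).
Proof. by case=> _ [d _] Oq; apply/is_cder_pd; exact: d. Qed.
Lemma Ck_pd k f a : Ck k.+1 O f -> Ck k O (pd a f).
Proof. by case=> _ [_]; exact. Qed.

Lemma Ck_cst k c : Ck k O (fun=> c).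
Proof.
elim: k c => [|k IH] c; first by split=> // q _; exact: cvg_cst.
by apply: (@Ck_intro k (fun=> c) (fun _ _ => 0)) => // [q _|a q _]; [exact: cvg_cst|exact: is_cderC].
Qed.
Lemma CkD k f g : Ck k O f -> Ck k O g -> Ck k O (fun q => f q + g q).
Proof.
have C j f' g' : Ck j O f' -> Ck j O g' -> forall q, O q -> {for q, continuous (fun q => f' q + g' q)}.
  by move=> F G q Oq; apply: cvgD; [exact: (Ck_cts F)|exact: (Ck_cts G)].
elim: k f g => [|k IH] f g F G; first by split=> //; exact: (C 0%N).
apply: (@Ck_intro k _ (fun a q => pd a f q + pd a g q)) => [||a]; first exact: C F G.
  by move=> a q Oq; apply: is_cderD; [exact: Ck_der F Oq|exact: Ck_der G Oq].
by apply: IH; [exact: Ck_pd F|exact: Ck_pd G].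
Qed.
Lemma CkM k f g : Ck k O f -> Ck k O g -> Ck k O (fun q => f q * g q).
Proof.
have C j f' g' : Ck j O f' -> Ck j O g' -> forall q, O q -> {for q, continuous (fun q => f' q * g' q)}.
  by move=> F G q Oq; apply: cvgM; [exact: (Ck_cts F)|exact: (Ck_cts G)].
elim: k f g => [|k IH] f g F G; first by split=> //; exact: (C 0%N).
apply: (@Ck_intro k _ (fun a q => pd a f q * g q + f q * pd a g q)) => [||a]; first exact: C F G.
  move=> a q Oq; have := is_cderM (Ck_der a F Oq) (Ck_der a G Oq).
  by rewrite sh0.
apply: CkD; apply: IH; first [exact: Ck_pd F|exact: Ck_pd G|exact: CkS].
Qed.
Lemma Ck_conj k f : Ck k O f -> Ck k O (fun q => (f q)^*).
Proof.
elim: k f => [|k IH] f F; first by split=> // q Oq; apply: cvg_conj; exact: (Ck_cts F).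
apply: (@Ck_intro k _ (fun a q => (pd a f q)^*)) => [q Oq||a].
- by apply: cvg_conj; exact: (Ck_cts F).
- by move=> a q Oq; apply: is_cder_conj; exact: Ck_der F Oq.
- by apply: IH; exact: Ck_pd F.
Qed.

(** The inverse is conj(c) / |c|^2, so only the inverse of a nonvanishing real function has to be
    differentiated. *)
Lemma is_cderV (c : R -> Cx R) t k : c t != 0 -> is_cder c t k ->
  is_cder (fun s => (c s)^-1) t (- k / (c t * c t)).
Proof.
move=> c0 ck.
have ck' := is_cderM ck (is_cder_conj ck).
have N0 : cre (c t * (c t)^*) != 0 by rewrite conjM_nm creK expf_neq0 // nm_eq0.
have iv : is_derive (cre (c t * (c t)^*)) 1 (fun x : R => x^-1) (- (cre (c t * (c t)^*)) ^- 2).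
  have := is_deriveV N0 (is_derive_id (cre (c t * (c t)^*)) 1).
  by rewrite /GRing.scale /= mulr1.
have := is_cderM (is_cder_conj ck) (is_cder_comp_rc ck' iv).
set w := (X in is_cder _ _ X); set u := (X in _ -> is_cder _ _ X).
have -> : w = u.
  rewrite /w /u rcM rcN !rcV rcX.
  have -> : rc (cre (c t * (c t)^*)) = c t * (c t)^* by rewrite conjM_nm.
  have -> : rc (cre (k * (c t)^* + c t * k^*)) = k * (c t)^* + c t * k^*.
    by apply: complexP; rewrite !cE //; ring.
  have c0' : (c t)^* != 0 by rewrite conjC_eq0.
  by field; rewrite c0 c0'.
apply: is_cder_near.
have cc := is_cder_continuous ck.
have : \forall s \near t, c s != 0.
  have n0 : 0 < nm (c t) by rewrite lt_neqAle eq_sym nm_eq0 c0 nm_ge0.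
  have cc' : (fun s => c s) @ t --> c t := cc.
  have /cvg_nm/(_ _ n0) := cc'; apply: filterS => s; apply: contraTneq => ->.
  by rewrite sub0r nmN ltxx.
apply: filterS => s s0; rewrite conjM_nm creK rcV -conjM_nm.
have s0' : (c s)^* != 0 by rewrite conjC_eq0.
by field; rewrite s0 s0'.
Qed.

Lemma CkV k f : (forall q, O q -> f q != 0) -> Ck k O f -> Ck k O (fun q => (f q)^-1).
Proof.
move=> f0; elim: k f f0 => [|k IH] f f0 F.
  by split=> // q Oq; apply: cvgV; [exact: f0|exact: (Ck_cts F)].
apply: (@Ck_intro k _ (fun a q => - pd a f q * ((f q)^-1 * (f q)^-1))) => [q Oq||a].
- by apply: cvgV; [exact: f0|exact: (Ck_cts F)].
- move=> a q Oq; have := @is_cderV (fun r => f (sh a q r)) 0 _ _ (Ck_der a F Oq).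
  by rewrite sh0 invfM; apply; exact: f0.
- apply: CkM; last by apply: CkM; apply: IH => //; exact: CkS.
  apply: (@Ck_eq k (fun q => -1 * pd a f q)); first by move=> q _; rewrite mulN1r.
  by apply: CkM; [exact: Ck_cst|exact: Ck_pd F].
Qed.

Lemma Ck_ln k (f : S -> R) : (forall q, O q -> 0 < f q) -> Ck k O (fun q => rc (f q)) ->
  Ck k O (fun q => rc (ln (f q))).
Proof.
move=> f0.
have C j : Ck j O (fun q => rc (f q)) -> forall q, O q -> {for q, continuous (fun q => rc (ln (f q)))}.
  move=> F q Oq; apply: cvg_rc.
  have /cvg_cre /= : (fun q => rc (f q)) @ q --> rc (f q) := Ck_cts F Oq.
  move=> H; apply: (cvg_comp _ _ H); exact/continuous_ln/f0.
case: k => [F|k F]; first by split=> // q Oq; exact: C F _ Oq.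
apply: (@Ck_intro k _ (fun a q => pd a (fun q => rc (f q)) q * (rc (f q))^-1)) => [||a].
- exact: C F.
- move=> a q Oq; have D := Ck_der a F Oq.
  have := is_cder_comp_rc D (_ : is_derive (cre (rc (f (sh a q 0)))) 1 (@ln R) (f q)^-1).
  rewrite /= sh0 => /(_ (is_derive1_ln (f0 _ Oq))).
  apply: is_cder_eq; rewrite rcM mulrC rcV; congr (_ * _).
  by symmetry; apply: rc_crealE; case: D => _ /is_derive1E[_]; rewrite derive1_cst.
- by apply: CkM; [exact: Ck_pd F|apply: CkV; [move=> q Oq; rewrite rc_eq0 gt_eqF ?f0|exact: CkS]].
Qed.

Lemma Ck_coord k j : Ck k O (fun q => q.2 0 j).
Proof.
have C q : {for q, continuous (fun q : S => q.2 0 j)}.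
  have H : (fun q : S => q.2) @ q --> q.2 by exact: cvg_snd.
  exact: (cvg_comp _ _ H (@cvg_coord _ _ j)).
case: k => [|k]; first by split; [move=> q _; exact: C|by []].
apply: (@Ck_intro k _ (fun a _ => if a is Some (i, b) then (if i == j then (if b then 'i else 1) else 0) else 0)) => [q _|a q _|a]; [exact: C| |exact: Ck_cst].
case: a => [[i b]|] /=; last exact: is_cderC.
under [X in is_cder X]eq_fun do rewrite !mxE /=.
rewrite (eq_sym j i); case: eqVneq => [ij|ne]; last first.
  by apply: is_cder_ext (is_cderC (q.2 0 j) 0) => s; rewrite mulr0 addr0.
have := is_cderD (is_cderC (q.2 0 j) 0) (is_cderM (is_cder_rc (is_derive_id (0 : R) 1)) (is_cderC (if b then 'i else 1) 0)).
rewrite add0r rc1 mul1r mulr0 addr0; apply: is_cder_ext => s.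
by rewrite mulr1.
Qed.
End OpenSet.

(** * Symmetry of mixed partial derivatives *)

Section Schwarz.
Variables (phi phix phixy : R -> R -> R) (e : R).
Hypotheses (Hx : forall x y : R, `|x| < e -> `|y| < e -> is_derive x 1 (phi ^~ y) (phix x y))
  (Hxy : forall x y : R, `|x| < e -> `|y| < e -> is_derive y 1 (phix x) (phixy x y)).

Lemma mvt0 (u u' : R -> R) (h : R) : 0 < h -> (forall x, 0 <= x <= h -> is_derive x 1 u (u' x)) ->
  exists2 c, 0 < c < h & u h - u 0 = u' c * h.
Proof.
move=> h0 H; have [x||c ch ->] := @MVT R u u' 0 h h0.
- by rewrite in_itv /= => xh; apply: H; lra.
- apply: derivable_within_continuous => x; rewrite in_itv /= => xh.
  by case: (H x xh).
- by exists c; rewrite ?subr0 //; rewrite in_itv /= in ch.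
Qed.

(** Mean value theorem in x for the difference in y, and then in y for the partial derivative in
    x. *)
Lemma second_difference (h : R) : 0 < h -> h < e ->
  exists x y, [/\ 0 < x < h, 0 < y < h &
    phi h h - phi h 0 - (phi 0 h - phi 0 0) = phixy x y * h ^+ 2].
Proof.
move=> h0 he.
have N x : 0 <= x <= h -> `|x| < e by move=> xh; rewrite ger0_norm; lra.
have [|x xh E] := @mvt0 (fun x => phi x h - phi x 0) (fun x => phix x h - phix x 0) h h0.
  move=> x xh; apply: (is_deriveB (Hx (N _ xh) (N _ _)) (Hx (N _ xh) (N _ _))); lra.
have [|y yh E2] := @mvt0 (phix x) (phixy x) h h0.
  by move=> y yh; apply: Hxy; apply: N; lra.
by exists x, y; split=> //; rewrite E E2; ring.
Qed.
End Schwarz.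

(** The second difference over a small square is symmetric in the two variables, so the two mixed
    derivatives take a common value at two points of the square. If they differed at the origin,
    continuity would exclude this on a square where each stays within half of the difference. *)
Lemma schwarz_real (phi phix phiy phixy phiyx : R -> R -> R) (e : R) : 0 < e ->
  (forall x y : R, `|x| < e -> `|y| < e -> [/\ is_derive x 1 (phi ^~ y) (phix x y),
     is_derive y 1 (phi x) (phiy x y), is_derive y 1 (phix x) (phixy x y) &
     is_derive x 1 (phiy ^~ y) (phiyx x y)]) ->
  (forall r, 0 < r -> exists2 d, 0 < d & forall x y, `|x| < d -> `|y| < d ->
     `|phixy x y - phixy 0 0| < r /\ `|phiyx x y - phiyx 0 0| < r) ->
  phixy 0 0 = phiyx 0 0.
Proof.
move=> e0 H C; apply/eqP; apply: contraT => ne.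
have r0 : 0 < `|phixy 0 0 - phiyx 0 0| / 2 by rewrite divr_gt0 // normr_gt0 subr_eq0.
have [d d0 Hd] := C _ r0; set h := Num.min d e / 2.
have m0 : 0 < Num.min d e by rewrite lt_min d0 e0.
have md : Num.min d e <= d by rewrite ge_min lexx.
have me : Num.min d e <= e by rewrite ge_min lexx orbT.
have h0 : 0 < h by rewrite /h; lra.
have hd : h < d by rewrite /h; lra.
have he : h < e by rewrite /h; lra.
have N x : 0 < x < h -> `|x| < d by move=> xh; rewrite gtr0_norm; lra.
have [x [y [xh yh E1]]] := @second_difference phi phix phixy e (fun x y i j => let: And4 u _ _ _ := H x y i j in u) (fun x y i j => let: And4 _ _ u _ := H x y i j in u) h h0 he.
have [y' [x' [yh' xh' E2]]] := @second_difference (fun y x => phi x y) (fun y x => phiy x y) (fun y x => phiyx x y) e (fun y x i j => let: And4 _ u _ _ := H x y j i in u) (fun y x i j => let: And4 _ _ _ u := H x y j i in u) h h0 he.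
have E : phixy x y = phiyx x' y'.
  apply: (@mulIf _ (h ^+ 2)); first by rewrite expf_neq0 // gt_eqF.
  by rewrite -E1 -E2; ring.
have [A _] := Hd x y (N _ xh) (N _ yh); have [_ B] := Hd x' y' (N _ xh') (N _ yh').
rewrite E in A; have : `|phixy 0 0 - phiyx 0 0| <= `|phiyx x' y' - phixy 0 0| + `|phiyx x' y' - phiyx 0 0|.
  by rewrite [X in _ <= X + _]distrC; apply: le_trans (ler_normD _ _); rewrite addrA subrK.
lra.
Qed.

Lemma Ck_der_at O k f a q x : Ck k.+1 O f -> O (sh a q x) ->
  is_cder (fun r => f (sh a q r)) x (pd a f (sh a q x)).
Proof.
move=> F Oq; apply/is_cder_shift.
have := Ck_der a F Oq; congr is_cder; apply/funext => r.
by rewrite shD.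
Qed.

Lemma pdC O f a b q : open O -> Ck 3 O f -> O q -> pd a (pd b f) q = pd b (pd a f) q.
Proof.
move=> oO F Oq.
have [e e0 He] := near_sh2 a b (near_O oO Oq).
have He' x y : `|x| < e -> `|y| < e -> O (sh b (sh a q x) y) by move=> xe ye; rewrite -shC; exact: He.
have D g k x y : Ck k.+1 O g -> `|x| < e -> `|y| < e ->
    is_cder (fun x => g (sh a (sh b q y) x)) x (pd a g (sh a (sh b q y) x)) /\
    is_cder (fun y => g (sh a (sh b q y) x)) y (pd b g (sh a (sh b q y) x)).
  move=> G xe ye; split; first exact: Ck_der_at G (He _ _ xe ye).
  by under eq_fun do rewrite shC; rewrite shC; exact: Ck_der_at G (He' _ _ xe ye).
have Fa := Ck_pd a F; have Fb := Ck_pd b F.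
have C r : 0 < r -> exists2 d : R, 0 < d & forall x y, `|x| < d -> `|y| < d ->
    nm (pd b (pd a f) (sh a (sh b q y) x) - pd b (pd a f) q) < r /\
    nm (pd a (pd b f) (sh a (sh b q y) x) - pd a (pd b f) q) < r.
  move=> r0.
  have c1 : (fun x => pd b (pd a f) x) @ q --> pd b (pd a f) q := Ck_cts (Ck_pd b Fa) Oq.
  have c2 : (fun x => pd a (pd b f) x) @ q --> pd a (pd b f) q := Ck_cts (Ck_pd a Fb) Oq.
  move/cvg_nm: c1 => /(_ _ r0) /(near_sh2 a b)[d1 d10 H1].
  move/cvg_nm: c2 => /(_ _ r0) /(near_sh2 a b)[d2 d20 H2].
  exists (Num.min d1 d2); first by rewrite lt_min d10 d20.
  by move=> x y; rewrite !lt_min => /andP[? ?] /andP[? ?]; split; [exact: H1|exact: H2].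
have q0 : sh a (sh b q 0) 0 = q by rewrite !sh0.
symmetry; apply: complexP.
  have := @schwarz_real (fun x y => cre (f (sh a (sh b q y) x)))
    (fun x y => cre (pd a f (sh a (sh b q y) x))) (fun x y => cre (pd b f (sh a (sh b q y) x)))
    (fun x y => cre (pd b (pd a f) (sh a (sh b q y) x)))
    (fun x y => cre (pd a (pd b f) (sh a (sh b q y) x))) e e0.
  rewrite !q0; apply.
    move=> x y xe ye; have [[p1 _] [p2 _]] := D f _ x y F xe ye.
    have [_ [p3 _]] := D _ _ x y Fa xe ye; have [[p4 _] _] := D _ _ x y Fb xe ye.
    by split; [exact: p1|exact: p2|exact: p3|exact: p4].
  move=> r /C[d d0 H]; exists d => // x y xd yd; have [A B] := H x y xd yd.
  by rewrite -!creN -!creD; split; apply: le_lt_trans (cre_le _) _.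
have := @schwarz_real (fun x y => cim (f (sh a (sh b q y) x)))
    (fun x y => cim (pd a f (sh a (sh b q y) x))) (fun x y => cim (pd b f (sh a (sh b q y) x)))
    (fun x y => cim (pd b (pd a f) (sh a (sh b q y) x)))
    (fun x y => cim (pd a (pd b f) (sh a (sh b q y) x))) e e0.
rewrite !q0; apply.
  move=> x y xe ye; have [[_ p1] [_ p2]] := D f _ x y F xe ye.
  have [_ [_ p3]] := D _ _ x y Fa xe ye; have [[_ p4] _] := D _ _ x y Fb xe ye.
  by split; [exact: p1|exact: p2|exact: p3|exact: p4].
move=> r /C[d d0 H]; exists d => // x y xd yd; have [A B] := H x y xd yd.
by rewrite -!cimN -!cimD; split; apply: le_lt_trans (cim_le _) _.
Qed.
End Spacetime.

(* [dd None] is d/dt, [dd (Some (j, false))] is d/dz_j and [dd (Some (j, true))] is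
   d/d(conj z_j). *)
Definition dd_def (R : realType) (n : nat) (a : option ('I_n * bool)) (f : R * Cn R n -> Cx R) q : Cx R :=
  if a is Some (j, b) then
    (pd (Some (j, false)) f q + (if b then 'i else - 'i) * pd (Some (j, true)) f q) / 2
  else pd None f q.
Fact dd_seal : {d : forall (R : realType) (n : nat), option ('I_n * bool) ->
    (R * Cn R n -> Cx R) -> R * Cn R n -> Cx R | d = dd_def}.
Proof. by eexists. Qed.
Definition dd (R : realType) (n : nat) := sval dd_seal R n.
Lemma ddE (R : realType) (n : nat) a (f : R * Cn R n -> Cx R) q :
  dd a f q = if a is Some (j, b) then
    (pd (Some (j, false)) f q + (if b then 'i else - 'i) * pd (Some (j, true)) f q) / 2
  else pd None f q.
Proof. by rewrite /dd (svalP dd_seal). Qed.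
Lemma wirtE (R : realType) (n : nat) j b (f : R * Cn R n -> Cx R) q : wirt j b f q = dd (Some (j, b)) f q.
Proof. by rewrite ddE pdE. Qed.
Lemma pderNE (R : realType) (n : nat) (f : R * Cn R n -> Cx R) q : pder None f q = dd None f q.
Proof. by rewrite ddE pdE. Qed.
Definition flip (n : nat) (a : option ('I_n * bool)) :=
  if a is Some (j, b) then Some (j, ~~ b) else None.

(** * Wirtinger derivatives as derivations *)

Section Derivations.
Variables (R : realType) (n : nat) (O : set (R * Cn R n)) (oO : open O).
Notation S := (R * Cn R n)%type.
Implicit Types (f g : S -> Cx R) (q : S) (a : option ('I_n * bool)).
Notation sm := (smooth_st O).

Lemma dd_near f g a q : (\forall q' \near q, f q' = g q') -> dd a f q = dd a g q.
Proof.
move=> fg; rewrite !ddE; case: a => [[j b]|]; last exact: pd_near.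
by rewrite !(pd_near _ fg).
Qed.
Lemma dd_eq f g a q : (forall q', O q' -> f q' = g q') -> O q -> dd a f q = dd a g q.
Proof. by move=> fg /(near_O oO) nO; apply: dd_near; apply: filterS nO. Qed.
Lemma sm_eq f g : (forall q', O q' -> f q' = g q') -> sm f -> sm g.
Proof. by move=> fg /smooth_stP F; apply/smooth_stP => k; exact: (Ck_eq oO fg (F k)). Qed.
Lemma sm_cts f q : sm f -> O q -> {for q, continuous f}.
Proof. by move=> /smooth_stP/(_ 0%N) F Oq; exact: Ck_cts F Oq. Qed.
Lemma sm_cst c : sm (fun=> c). Proof. by apply/smooth_stP => k; exact: Ck_cst. Qed.
Lemma smD f g : sm f -> sm g -> sm (fun q => f q + g q).
Proof. by move=> /smooth_stP F /smooth_stP G; apply/smooth_stP => k; exact: CkD. Qed.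
Lemma smM f g : sm f -> sm g -> sm (fun q => f q * g q).
Proof. by move=> /smooth_stP F /smooth_stP G; apply/smooth_stP => k; exact: CkM. Qed.
Lemma smZ c f : sm f -> sm (fun q => c * f q).
Proof. by move=> F; exact: (smM (sm_cst c) F). Qed.
Lemma smN f : sm f -> sm (fun q => - f q).
Proof. by move=> /(smZ (-1)); apply: sm_eq => q _; rewrite mulN1r. Qed.
Lemma smB f g : sm f -> sm g -> sm (fun q => f q - g q).
Proof. by move=> F G; exact: (smD F (smN G)). Qed.
Lemma sm_conj f : sm f -> sm (fun q => (f q)^*).
Proof. by move=> /smooth_stP F; apply/smooth_stP => k; exact: Ck_conj. Qed.
Lemma smV f : (forall q, O q -> f q != 0) -> sm f -> sm (fun q => (f q)^-1).
Proof. by move=> f0 /smooth_stP F; apply/smooth_stP => k; exact: CkV. Qed.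
Lemma sm_ln (f : S -> R) : (forall q, O q -> 0 < f q) -> sm (fun q => rc (f q)) ->
  sm (fun q => rc (ln (f q))).
Proof. by move=> f0 /smooth_stP F; apply/smooth_stP => k; exact: Ck_ln. Qed.
Lemma sm_coord j : sm (fun q => q.2 0 j).
Proof. by apply/smooth_stP => k; exact: Ck_coord. Qed.
Lemma sm_sum (T : Type) (r : seq T) (P : pred T) (F : T -> S -> Cx R) :
  (forall i, sm (F i)) -> sm (fun q => \sum_(i <- r | P i) F i q).
Proof.
move=> H; elim: r => [|i r IH].
  by apply: (sm_eq _ (sm_cst 0)) => q _; rewrite big_nil.
case Pi : (P i); last by apply: (sm_eq _ IH) => q _; rewrite big_cons Pi.
by apply: (sm_eq _ (smD (H i) IH)) => q _; rewrite big_cons Pi.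
Qed.
Lemma sm_prod (T : Type) (r : seq T) (P : pred T) (F : T -> S -> Cx R) :
  (forall i, sm (F i)) -> sm (fun q => \prod_(i <- r | P i) F i q).
Proof.
move=> H; elim: r => [|i r IH].
  by apply: (sm_eq _ (sm_cst 1)) => q _; rewrite big_nil.
case Pi : (P i); last by apply: (sm_eq _ IH) => q _; rewrite big_cons Pi.
by apply: (sm_eq _ (smM (H i) IH)) => q _; rewrite big_cons Pi.
Qed.
Lemma sm_det (k : nat) (A : S -> 'M[Cx R]_k) : (forall i j, sm (fun q => A q i j)) ->
  sm (fun q => \det (A q)).
Proof. by move=> H; apply: sm_sum => s; apply: smZ; apply: sm_prod => i; exact: H. Qed.
Lemma sm_pd f a : sm f -> sm (pd a f).
Proof. by move=> /smooth_stP F; apply/smooth_stP => k; exact: Ck_pd (F k.+1). Qed.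
Lemma sm_dd f a : sm f -> sm (dd a f).
Proof.
move=> F; case: a => [[j b]|]; last by apply: (sm_eq _ (sm_pd None F)) => q _; rewrite ddE.
have H : sm (fun q => 2^-1 * (pd (Some (j, false)) f q + (if b then 'i else - 'i) * pd (Some (j, true)) f q)).
  by apply: smZ; apply: smD; [exact: sm_pd|apply: smZ; exact: sm_pd].
by apply: (sm_eq _ H) => q _; rewrite ddE mulrC.
Qed.

Lemma sm_der f a q : sm f -> O q -> is_cder (fun r => f (Defs.shift a q r)) 0 (pd a f q).
Proof. by move=> /smooth_stP/(_ 1%N) F Oq; exact: Ck_der F Oq. Qed.

Lemma dd_cst c a q : dd a (fun=> c) q = 0.
Proof.
have P b : pd b (fun=> c) q = 0 by apply: pd_cder; exact: is_cderC.
by rewrite ddE; case: a => [[j b]|]; rewrite !P // mulr0 addr0 mul0r.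
Qed.
Lemma ddD f g a q : sm f -> sm g -> O q -> dd a (fun q => f q + g q) q = dd a f q + dd a g q.
Proof.
move=> F G Oq.
have P b : pd b (fun q => f q + g q) q = pd b f q + pd b g q.
  by apply: pd_cder; apply: is_cderD; exact: sm_der.
by rewrite !ddE; case: a => [[j b]|]; rewrite !P; [field|].
Qed.
Lemma ddM f g a q : sm f -> sm g -> O q ->
  dd a (fun q => f q * g q) q = dd a f q * g q + f q * dd a g q.
Proof.
move=> F G Oq.
have P b : pd b (fun q => f q * g q) q = pd b f q * g q + f q * pd b g q.
  apply: pd_cder; have := is_cderM (sm_der b F Oq) (sm_der b G Oq).
  by rewrite sh0.
by rewrite !ddE; case: a => [[j b]|]; rewrite !P; [field|].
Qed.
Lemma ddZ c f a q : sm f -> O q -> dd a (fun q => c * f q) q = c * dd a f q.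
Proof. by move=> F Oq; rewrite (ddM _ (sm_cst c) F) // dd_cst mul0r add0r. Qed.
Lemma ddN f a q : sm f -> O q -> dd a (fun q => - f q) q = - dd a f q.
Proof.
move=> F Oq; rewrite -mulN1r -(ddZ _ _ F) //; congr (dd a _ q).
by apply/funext => x; rewrite mulN1r.
Qed.
Lemma ddB f g a q : sm f -> sm g -> O q -> dd a (fun q => f q - g q) q = dd a f q - dd a g q.
Proof. by move=> F G Oq; rewrite (ddD _ F (smN G)) // ddN. Qed.
Lemma dd_conj f a q : sm f -> O q -> dd a (fun q => (f q)^*) q = (dd (flip a) f q)^*.
Proof.
move=> F Oq.
have P b : pd b (fun q => (f q)^*) q = (pd b f q)^*.
  by apply: pd_cder; apply: is_cder_conj; exact: sm_der.
rewrite !ddE; case: a => [[j b]|] /=; rewrite !P; last by [].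
rewrite rmorphM rmorphD rmorphM fmorphV rmorph_nat; congr ((_ + _ * _) / _).
by case: b; rewrite /= ?rmorphN /= conjCi ?opprK.
Qed.
Lemma dd_sum (T : Type) (r : seq T) (P : pred T) (F : T -> S -> Cx R) a q :
  (forall i, sm (F i)) -> O q ->
  dd a (fun q => \sum_(i <- r | P i) F i q) q = \sum_(i <- r | P i) dd a (F i) q.
Proof.
move=> H Oq; elim: r => [|i r IH].
  by rewrite big_nil (_ : (fun _ => _) = fun=> 0) ?dd_cst //; apply/funext => x; rewrite big_nil.
rewrite big_cons -IH; case Pi : (P i).
  rewrite -(ddD _ (H i) (sm_sum _ _ H)) //; congr (dd a _ q).
  by apply/funext => x; rewrite big_cons Pi.
by congr (dd a _ q); apply/funext => x; rewrite big_cons Pi.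
Qed.
(** Differentiate f f^-1 = 1, the smoothness of f^-1 being known already. *)
Lemma ddV f a q : (forall q, O q -> f q != 0) -> sm f -> O q ->
  dd a (fun q => (f q)^-1) q = - dd a f q / (f q * f q).
Proof.
move=> f0 F Oq; have fq := f0 q Oq.
have := ddM a F (smV f0 F) Oq; rewrite (@dd_eq _ (fun=> 1)) ?dd_cst //; last first.
  by move=> q' Oq'; rewrite mulfV ?f0.
move=> /eqP; rewrite eq_sym addr_eq0 => /eqP E; apply: (mulfI fq).
by rewrite -[LHS]opprK -E; field.
Qed.
Lemma dd_ln (f : S -> R) a q : (forall q, O q -> 0 < f q) -> sm (fun q => rc (f q)) -> O q ->
  dd a (fun q => rc (ln (f q))) q = dd a (fun q => rc (f q)) q / rc (f q).
Proof.
move=> f0 F Oq.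
have P b : pd b (fun q => rc (ln (f q))) q = pd b (fun q => rc (f q)) q / rc (f q).
  apply: pd_cder; have D := sm_der b F Oq.
  have := is_cder_comp_rc D (_ : is_derive (cre (rc (f (Defs.shift b q 0)))) 1 (@ln R) (f q)^-1).
  rewrite /= sh0 => /(_ (is_derive1_ln (f0 _ Oq))).
  apply: is_cder_eq; rewrite rcM mulrC rcV; congr (_ * _).
  by symmetry; apply: rc_crealE; case: D => _ /is_derive1E[_]; rewrite derive1_cst.
by rewrite !ddE; case: a => [[j b]|]; rewrite !P; [field; rewrite rc_eq0 gt_eqF ?f0|].
Qed.
Lemma pd_coord j a q : pd a (fun q : S => q.2 0 j) q =
  if a is Some (i, b) then (if i == j then (if b then 'i else 1) else 0) else 0.
Proof.
apply: pd_cder; case: a => [[i b]|] /=; last exact: is_cderC.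
under [X in is_cder X]eq_fun do rewrite !mxE /=.
rewrite (eq_sym j i); case: eqVneq => [ij|ne]; last first.
  by apply: is_cder_ext (is_cderC (q.2 0 j) 0) => s; rewrite mulr0 addr0.
have := is_cderD (is_cderC (q.2 0 j) 0) (is_cderM (is_cder_rc (is_derive_id (0 : R) 1)) (is_cderC (if b then 'i else 1) 0)).
rewrite add0r rc1 mul1r mulr0 addr0; apply: is_cder_ext => s.
by rewrite mulr1.
Qed.
Lemma dd_coord j a q : dd a (fun q : S => q.2 0 j) q = (a == Some (j, false))%:R.
Proof.
rewrite ddE; case: a => [[i b]|]; rewrite !pd_coord //.
rewrite (_ : (Some (i, b) == Some (j, false)) = (i == j) && ~~ b); last by case: b.
have ii : 'i * 'i = -1 :> Cx R by rewrite -expr2 sqrCi.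
have [_|_] := eqVneq i j; case: b; rewrite /= ?mulr0 ?addr0 ?mul0r //.
  by rewrite ii subrr mul0r.
by rewrite mulNr ii opprK divff // pnatr_eq0.
Qed.
Lemma ddC f a b q : sm f -> O q -> dd a (dd b f) q = dd b (dd a f) q.
Proof.
move=> F Oq.
have P c d : pd c (pd d f) q = pd d (pd c f) q.
  by apply: (pdC _ _ oO _ Oq); have /smooth_stP := F.
have L c (k : Cx R) d d' : pd c (fun q => (pd d f q + k * pd d' f q) / 2) q =
    (pd c (pd d f) q + k * pd c (pd d' f) q) / 2.
  apply: pd_cder.
  have H := is_cderM (is_cderD (sm_der c (sm_pd d F) Oq) (is_cderM (is_cderC k 0) (sm_der c (sm_pd d' F) Oq))) (is_cderC 2^-1 0).
  by move: H; rewrite !sh0 mul0r add0r mulr0 addr0.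
have E c : dd c f = (if c is Some (j, b) then fun q => (pd (Some (j, false)) f q
   + (if b then 'i else - 'i) * pd (Some (j, true)) f q) / 2%:R else pd None f).
  by apply/funext => x; rewrite ddE; case: c => [[]|].
rewrite (E a) (E b) !ddE; case: a => [[i b1]|]; case: b => [[j b2]|]; rewrite ?L; last by [].
- rewrite (P (Some (i, true)) (Some (j, true))) (P (Some (i, true)) (Some (j, false))).
  by rewrite (P (Some (i, false)) (Some (j, true))) (P (Some (i, false)) (Some (j, false))); field.
- by rewrite !(P None).
- by rewrite !(P None).
Qed.
Lemma pd_ddE f j b q : sm f -> O q -> pd (Some (j, b)) f q =
  if b then 'i * (dd (Some (j, false)) f q - dd (Some (j, true)) f q)
  else dd (Some (j, false)) f q + dd (Some (j, true)) f q.
Proof.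
move=> F Oq; rewrite !ddE.
have ii : 'i * 'i = -1 :> Cx R by rewrite -expr2 sqrCi.
case: b; last by field.
set x := pd _ f q; set y := pd _ f q.
have -> : 'i * ((y + - 'i * x) / 2 - (y + 'i * x) / 2) = - ('i * 'i) * x :> Cx R by field.
by rewrite ii opprK mul1r.
Qed.
End Derivations.

Section Conjugation.
Variable R : realType.
Implicit Types z w : Cx R.
Lemma cjD z w : (z + w)^* = z^* + w^*.
Proof. by apply: complexP; rewrite !cE; ring. Qed.
Lemma cjM z w : (z * w)^* = z^* * w^*.
Proof. by apply: complexP; rewrite !cE; ring. Qed.
Lemma cjN z : (- z)^* = - z^*.
Proof. by apply: complexP; rewrite !cE; ring. Qed.
Lemma cjK z : z^*^* = z.
Proof. by apply: complexP; rewrite !cE ?opprK. Qed.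
Lemma cj_sum (T : Type) (r : seq T) (P : pred T) (F : T -> Cx R) :
  (\sum_(i <- r | P i) F i)^* = \sum_(i <- r | P i) (F i)^*.
Proof. by apply: (big_morph (fun z : Cx R => z^*)); [exact: cjD|exact: (@rc_conj R 0)]. Qed.
End Conjugation.

(** * Directional derivatives and the Levi form at a maximum *)

Section Directional.
Variables (R : realType) (n : nat) (O : set (R * Cn R n)) (oO : open O).
Notation S := (R * Cn R n)%type.
Notation sh := (@Defs.shift R n).
Implicit Types (f g : S -> Cx R) (q : S) (a : option ('I_n * bool)).
Notation sm := (smooth_st O).

Lemma near0_lt (d : R) : 0 < d -> \forall s \near (0 : R), `|s| < d.
Proof. by move=> d0; exists d => //= y; rewrite /ball_ /= sub0r normrN. Qed.
Lemma near0S (A B : set R) : A `<=` B -> (\forall s \near (0 : R), A s) -> \forall s \near (0 : R), B s.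
Proof. by move=> AB; apply: filterS. Qed.
Lemma derivable_quotient (u : R -> R) (l : R) : u 0 = 0 ->
  (forall e, 0 < e -> \forall s \near (0 : R), `|u s - s * l| <= e * `|s|) -> is_derive (0 : R) 1 u l.
Proof.
move=> u0 H.
have C : (fun h : R => h^-1 *: ((u \o shift (0 : R)) (h *: (1 : R)) - u 0)) @ (0 : R)^' --> l.
  apply/cvgrPdist_le => e e0; have := H e e0 => He.
  near=> h; have h0 : h != 0 by near: h; exact: nbhs_dnbhs_neq.
  rewrite /= u0 subr0 addr0 /GRing.scale /= mulr1 distrC.
  have -> : h^-1 * u h - l = h^-1 * (u h - h * l) by field.
  rewrite normrM normfV -ler_pdivlMl ?invrK ?invr_gt0 ?normr_gt0 // [leRHS]mulrC.
  by near: h; exact: nbhs_dnbhs He.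
split; first by apply: cvgP C.
exact: cvg_lim C.
Unshelve. all: by end_near. Qed.

(** The base point [u s] moves while a step of length s c is made in direction a. The mean value
    theorem gives the partial derivative at a point near q, and its continuity replaces it by the
    value at q. This is the one-coordinate step from continuous partial derivatives to the chain
    rule along lines. *)
Lemma shift_increment f a q (u : R -> S) (c : R) : sm f -> O q -> u @ (0 : R) --> q -> u 0 = q ->
  is_cder (fun s => f (sh a (u s) (s * c)) - f (u s)) 0 (rc c * pd a f q).
Proof.
move=> F Oq uq u0.
have Fa := sm_pd a F.
have K (e : R) : 0 < e -> \forall s \near (0 : R), forall x : R, `|x| <= `|s * c| ->
    O (sh a (u s) x) /\ nm (pd a f (sh a (u s) x) - pd a f q) < e.
  move=> e0.
  have N : \forall q' \near q, O q' /\ nm (pd a f q' - pd a f q) < e.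
    have cf : (fun x => pd a f x) @ q --> pd a f q := sm_cts Fa Oq.
    by move/cvg_nm: cf => /(_ _ e0); apply: filterS2 (near_O oO Oq).
  have : (fun z : R * R => sh a (u z.1) z.2) @ ((0, 0) : R * R) --> q.
    rewrite -[X in _ --> X](sh0 a); apply: cvg_sh; last exact: cvg_snd.
    exact: (cvg_comp _ _ (@cvg_fst _ _ (nbhs (0 : R)) (nbhs (0 : R)) _) uq).
  move/(_ _ N) => /nbhs_ballP[d /= d0 Hd].
  have dc : 0 < d / (`|c| + 1) by rewrite divr_gt0 // ltr_wpDl.
  near=> s => x xs; apply: (Hd (s, x)); split; rewrite /ball /= sub0r normrN.
    by near: s; exact: near0_lt.
  apply: le_lt_trans xs _; rewrite normrM; apply: (@le_lt_trans _ _ (`|s| * (`|c| + 1))).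
    by rewrite ler_wpM2l // lerDl.
  rewrite -ltr_pdivlMr ?ltr_wpDl //; near: s; apply: near0_lt; exact: dc.
have M (v : Cx R -> R) : (v = @cre R \/ v = @cim R) -> is_derive (0 : R) 1 (fun s => v (f (sh a (u s) (s * c)) - f (u s))) (v (rc c * pd a f q)).
  move=> vE.
  have vB z w : v (z - w) = v z - v w by case: vE => ->; rewrite !cE.
  have vc z : v (rc c * z) = c * v z by case: vE => ->; rewrite !cE; ring.
  have vn z : `|v z| <= nm z by case: vE => ->; [exact: cre_le|exact: cim_le].
  have vd w x l : is_cder w x l -> is_derive x 1 (fun s => v (w s)) (v l) by case: vE => -> [].
  apply: derivable_quotient; first by rewrite mul0r sh0 subrr; case: vE => ->.
  move=> e e0; have e1 : 0 < e / (`|c| + 1) by rewrite divr_gt0 // ltr_wpDl.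
  apply: filterS (K _ e1) => s Hs; rewrite vB vc.
  have D (x : R) : `|x| <= `|s * c| -> is_derive x 1 (fun x => v (f (sh a (u s) x))) (v (pd a f (sh a (u s) x))).
    move=> /Hs[Ox _]; apply: vd; have /smooth_stP/(_ 1%N) F1 := F; exact: Ck_der_at F1 Ox.
  have [y ys E] : exists2 y, `|y| <= `|s * c| & v (f (sh a (u s) (s * c))) - v (f (u s)) = v (pd a f (sh a (u s) y)) * (s * c).
    have [sc0|sc0|->] := ltgtP (s * c) 0.
    - have [x xi||] := @MVT R (fun x => v (f (sh a (u s) x))) (fun x => v (pd a f (sh a (u s) x))) (s * c) 0 sc0.
      + by apply: D; rewrite in_itv /= in xi; rewrite !ltr0_norm; lra.
      + apply: derivable_within_continuous => x xi; rewrite in_itv /= in xi.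
        have /D[] // : `|x| <= `|s * c| by rewrite (ltr0_norm sc0) ler0_norm; lra.
      + move=> y; rewrite in_itv /= => yi; rewrite sh0 sub0r => E; exists y.
          by rewrite !ltr0_norm; lra.
        by rewrite -[LHS]opprB E mulrN opprK.
    - have [x xi||] := @MVT R (fun x => v (f (sh a (u s) x))) (fun x => v (pd a f (sh a (u s) x))) 0 (s * c) sc0.
      + by apply: D; rewrite in_itv /= in xi; rewrite !gtr0_norm; lra.
      + apply: derivable_within_continuous => x xi; rewrite in_itv /= in xi.
        have /D[] // : `|x| <= `|s * c| by rewrite (gtr0_norm sc0) ger0_norm; lra.
      + move=> y; rewrite in_itv /= => yi; rewrite sh0 subr0 => E; exists y => //.
        by rewrite !gtr0_norm; lra.
    - by exists 0; rewrite ?normr0 // sh0 mulr0 subrr.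
  rewrite E; have [_ Hy] := Hs _ ys.
  have -> : v (pd a f (sh a (u s) y)) * (s * c) - s * (c * v (pd a f q)) =
    v (pd a f (sh a (u s) y) - pd a f q) * (s * c) by rewrite vB; ring.
  rewrite !normrM; apply: (@le_trans _ _ (e / (`|c| + 1) * (`|s| * `|c|))).
    by apply: ler_wpM2r; [rewrite mulr_ge0|apply: le_trans (vn _) (ltW Hy)].
  rewrite (mulrC `|s|) mulrA ler_wpM2r // -mulrA ler_piMr ?ltW // mulrC.
  by rewrite ltr_pdivrMr ?mul1r ?ltrDl // ltr_wpDl.
by split; [apply: (M (@cre R)); left|apply: (M (@cim R)); right].
Unshelve. all: by end_near. Qed.

(** A displacement cut into successive coordinate steps with speeds [ac.2]; the derivative along it
    is then a telescoping sum of increments of the type of [shift_increment]. *)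
Fixpoint shs (l : seq (option ('I_n * bool) * R)) (s : R) q : S :=
  if l is ac :: l' then sh ac.1 (shs l' s q) (s * ac.2) else q.

Lemma shs0 l q : shs l 0 q = q.
Proof. by elim: l => //= ac l IH; rewrite mul0r sh0. Qed.
Lemma cvg_shs l q : (fun s => shs l s q) @ (0 : R) --> q.
Proof.
elim: l => [|ac l IH] /=; first by move=> A Aq; apply: (@near0S setT) => [s _|]; [exact: (@nbhs_singleton _ q A Aq)|exact: filterT].
have H : (fun s : R => s * ac.2) @ (0 : R) --> (0 : R).
  by rewrite -[X in _ --> X](mul0r ac.2); apply: cvgM; [exact: cvg_id|exact: cvg_cst].
by have := @cvg_sh _ _ _ _ (nbhs_filter (0 : R)) ac.1 _ _ _ _ IH H; rewrite sh0.
Qed.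

Lemma is_cder_shs f l q : sm f -> O q ->
  is_cder (fun s => f (shs l s q)) 0 (\sum_(ac <- l) rc ac.2 * pd ac.1 f q).
Proof.
move=> F Oq; elim: l => [|ac l IH] /=; first by rewrite big_nil; exact: is_cderC.
rewrite big_cons; have := is_cderD (shift_increment ac.1 ac.2 F Oq (@cvg_shs l q) (shs0 l q)) IH.
by apply: is_cder_ext => s; rewrite subrK.
Qed.

Lemma near_cvg (T : Type) (F : set_system T) (FF : Filter F) (u : T -> S) q (A : set S) :
  u @ F --> q -> nbhs q A -> \forall x \near F, A (u x).
Proof. by move=> uq nA; exact: (uq _ nA). Qed.

(** The derivative along the real tangent vector v, in Wirtinger form. *)
Definition along (v : Cn R n) f q : Cx R :=
  \sum_j (v 0 j * dd (Some (j, false)) f q + (v 0 j)^* * dd (Some (j, true)) f q).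

Lemma is_cder_along f (v : Cn R n) q : sm f -> O q ->
  is_cder (fun s => f (q.1, q.2 + rc s *: v)) 0 (along v f q).
Proof.
move=> F Oq.
pose l := flatten [seq [:: (Some (j, false), cre (v 0 j)); (Some (j, true), cim (v 0 j))] | j <- index_enum 'I_n].
have := is_cder_shs l F Oq; rewrite /l.
have -> : \sum_(ac <- flatten [seq [:: (Some (j, false), cre (v 0 j)); (Some (j, true), cim (v 0 j))] | j <- index_enum 'I_n]) rc ac.2 * pd ac.1 f q = along v f q.
  rewrite big_flatten big_map /along; apply: eq_bigr => j _.
  rewrite !big_cons big_nil (pd_ddE _ _ F Oq) (pd_ddE _ _ F Oq) /=.
  have {3 4}-> : v 0 j = rc (cre (v 0 j)) + 'i * rc (cim (v 0 j)).
    by apply: complexP; rewrite !cE; ring.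
  rewrite cjD cjM !rc_conj conjCi; ring.
apply: is_cder_ext => s; congr f.
have H (r : seq 'I_n) : shs (flatten [seq [:: (Some (j, false), cre (v 0 j)); (Some (j, true), cim (v 0 j))] | j <- r]) s q
    = (q.1, q.2 + \sum_(j <- r) (rc s * v 0 j) *: delta_mx 0 j).
  elim: r => [|j r IH] /=; first by rewrite big_nil addr0; case: (q).
  rewrite IH /=; congr pair; rewrite big_cons -!addrA; congr (_ + _).
  rewrite addrC; congr (_ + _); rewrite -scalerDl mulr1; congr (_ *: _).
  rewrite !rcM -(mulrA (rc s)) -mulrDr; congr (_ * _).
  by apply: complexP; rewrite !cE; ring.
rewrite H; congr (_, _ + _).
by rewrite [in RHS](row_sum_delta v) scaler_sumr; apply: eq_bigr => j _; rewrite scalerA.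
Qed.

Lemma sm_along v f : sm f -> sm (along v f).
Proof.
move=> F; apply: (sm_sum oO) => j.
by apply: (smD oO); apply: (smZ oO); exact: (sm_dd oO).
Qed.

Lemma second_derivative_test (g g' : R -> R) (g2 : R) :
  (\forall s \near (0 : R), is_derive (s : R) 1 g (g' s)) -> is_derive (0 : R) 1 g' g2 ->
  (\forall s \near (0 : R), g s <= g 0) -> g2 <= 0.
Proof.
move=> D1 D2 M; rewrite leNgt; apply/negP => g20.
have g'0 : g' 0 = 0.
  have D0 : is_derive (0 : R) 1 g (g' 0) by exact: (nbhs_singleton D1).
  have [e /= e0 He] := (@nbhs_ballP _ _ _ _).1 M.
  have [d /= d0 Hd] := (@nbhs_ballP _ _ _ _).1 D1.
  have m0 : 0 < Num.min e d by rewrite lt_min e0 d0.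
  have := @derive1_at_max R g (- Num.min e d) (Num.min e d) 0 _ _ _ _.
  move=> X; have : is_derive (0 : R) 1 g 0.
  apply: X.
  - by rewrite ltW // gtrN.
  - move=> x xi; have /Hd[] // : ball (0 : R) d x.
    rewrite /ball /= sub0r normrN ltr_norml; move: xi; rewrite in_itv /=.
    have : Num.min e d <= d by rewrite ge_min lexx orbT.
    by move=> *; apply/andP; split; lra.
  - by rewrite in_itv /= oppr_lt0 m0.
  - move=> x xi; apply: He; rewrite /ball /= sub0r normrN ltr_norml; move: xi; rewrite in_itv /=.
    have : Num.min e d <= e by rewrite ge_min lexx.
    by move=> *; apply/andP; split; lra.
  by move=> /is_derive1E[_ E]; have /is_derive1E[_ <-] := D0.
have P : \forall s \near (0 : R), 0 < s -> 0 < g' s.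
  have [dg E2] := D2.
  have C : (fun h : R => h^-1 *: ((g' \o shift (0 : R)) (h *: (1 : R)) - g' 0)) @ (0 : R)^' --> g2 by rewrite -E2; exact: dg.
  move/cvgrPdist_lt: C => /(_ _ g20); rewrite /dnbhs /within /=; apply: near0S => s Hs s0.
  have := Hs (lt0r_neq0 s0); rewrite /= g'0 subr0 addr0 /GRing.scale /= mulr1 ltr_norml => /andP[_].
  rewrite ltrBlDr ltrDl => A; by rewrite -(pmulr_rgt0 _ (_ : 0 < s^-1)) ?invr_gt0.
have [e /= e0 He] := (@nbhs_ballP _ _ _ _).1 (filterI D1 (filterI M P)).
have B (x : R) : 0 <= x <= e / 2 -> ball (0 : R) e x.
  by move=> xe; rewrite /ball /= sub0r normrN ger0_norm; lra.
have e2 : 0 < e / 2 by lra.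
have [c ce E] := mvt0 e2 (fun x xe => (He x (B x xe)).1).
have h1 : 0 <= e / 2 <= e / 2 by lra.
have h2 : 0 <= c <= e / 2 by lra.
have [_ [Mx _]] := He _ (B _ h1); have [_ [_ Pc]] := He c (B c h2).
have : 0 < g' c * (e / 2) by rewrite mulr_gt0 // Pc //; lra.
by rewrite -E subr_gt0 ltNge Mx.
Qed.

(** The second real derivatives along v and along i v are nonpositive. In their sum the terms with
    two holomorphic or two conjugate derivatives cancel, and four times the Levi form in direction v
    remains. *)
Lemma levi_max (F : S -> R) q (v : Cn R n) : sm (fun q => rc (F q)) -> O q ->
  (\forall q' \near q, q'.1 = q.1 -> F q' <= F q) ->
  cre (\sum_k \sum_l v 0 k * (v 0 l)^* * dd (Some (k, false)) (dd (Some (l, true)) (fun q => rc (F q))) q) <= 0.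
Proof.
move=> SF Oq M; set f := fun q => rc (F q).
have T w : cre (along w (along w f) q) <= 0.
  have cs (s : R) : (fun s => (q.1, q.2 + rc s *: w) : S) @ s --> ((q.1, q.2 + rc s *: w) : S).
    apply: cvg_pair2; first exact: cvg_cst.
    apply: cvg_row => j.
    have -> : (fun x => (q.2 + rc x *: w) 0 j) = fun x => q.2 0 j + rc x * w 0 j by apply/funext => x; rewrite !mxE.
    have -> : (q.2 + rc s *: w) 0 j = q.2 0 j + rc s * w 0 j by rewrite !mxE.
    apply: cvgD; first exact: cvg_cst.
    by apply: cvgM; [apply: cvg_rc; exact: cvg_id|exact: cvg_cst].
  have c0 : (fun s => (q.1, q.2 + rc s *: w) : S) @ (0 : R) --> q.
    by have := cs 0; rewrite rc0 scale0r addr0; case: (q).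
  have AF := sm_along w SF.
  apply: (@second_derivative_test (fun s => F (q.1, q.2 + rc s *: w)) (fun s => cre (along w f (q.1, q.2 + rc s *: w)))).
  - apply: (near0S _ (near_cvg _ c0 (near_O oO Oq))) => s Os.
    suff : is_cder (fun r => f (q.1, q.2 + rc r *: w)) s (along w f (q.1, q.2 + rc s *: w)) by case.
    apply/is_cder_shift; have := is_cder_along w SF Os; apply: is_cder_ext => r /=.
    by rewrite rcD scalerDl addrA.
  - by have [] := is_cder_along w AF Oq.
  - apply: (near0S _ (near_cvg _ c0 M)) => s /(_ erefl).
    by rewrite rc0 scale0r addr0; case: (q).
have L1 k l : sm (dd (Some (k, l)) f) by exact: sm_dd.
have AA w : along w (along w f) q = \sum_k \sum_l (w 0 k * w 0 l * dd (Some (k, false)) (dd (Some (l, false)) f) q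
   + w 0 k * (w 0 l)^* * dd (Some (k, false)) (dd (Some (l, true)) f) q
   + (w 0 k)^* * w 0 l * dd (Some (k, true)) (dd (Some (l, false)) f) q
   + (w 0 k)^* * (w 0 l)^* * dd (Some (k, true)) (dd (Some (l, true)) f) q).
  rewrite {1}/along; apply: eq_bigr => k _.
  have E b : dd (Some (k, b)) (along w f) q = \sum_l (w 0 l * dd (Some (k, b)) (dd (Some (l, false)) f) q
     + (w 0 l)^* * dd (Some (k, b)) (dd (Some (l, true)) f) q).
    rewrite (dd_sum oO _ _ _ _ Oq); last by move=> l; apply: (smD oO); apply: (smZ oO); exact: L1.
    apply: eq_bigr => l _; rewrite (ddD _ (smZ oO _ (L1 _ _)) (smZ oO _ (L1 _ _)) Oq).
    by rewrite !(ddZ oO _ _ (L1 _ _) Oq).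
  rewrite !E !mulr_sumr -big_split /=; apply: eq_bigr => l _; ring.
have := T v; have := T ('i *: v); rewrite !AA.
set A := (X in cre X <= 0 -> _); set B := (X in _ -> cre X <= 0 -> _); set C := (X in _ -> _ -> cre X <= 0).
have : A + B = 4 * C.
  have ii : 'i * 'i = -1 :> Cx R by rewrite -expr2 sqrCi.
  have C2 : C = \sum_k \sum_l (v 0 k)^* * v 0 l * dd (Some (k, true)) (dd (Some (l, false)) f) q.
    rewrite /C exchange_big /=; apply: eq_bigr => k _; apply: eq_bigr => l _.
    by rewrite (ddC oO _ _ SF Oq); congr (_ * _); rewrite mulrC.
  have -> : 4 * C = 2 * C + 2 * C by ring.
  rewrite {2}C2 /A /B /C !mulr_sumr -!big_split /=; apply: eq_bigr => k _.
  rewrite !mulr_sumr -!big_split /=; apply: eq_bigr => l _.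
  rewrite !mxE !cjM conjCi.
  set x1 := dd _ _ q; set x2 := dd _ _ q; set x3 := dd _ _ q; set x4 := dd _ _ q.
  set vk := (v 0 k)^*; set vl := (v 0 l)^*.
  have -> : 'i * v 0 k * ('i * v 0 l) * x1 = ('i * 'i) * (v 0 k * v 0 l * x1) by ring.
  have -> : 'i * v 0 k * (- 'i * vl) * x2 = - ('i * 'i) * (v 0 k * vl * x2) by ring.
  have -> : - 'i * vk * ('i * v 0 l) * x3 = - ('i * 'i) * (vk * v 0 l * x3) by ring.
  have -> : - 'i * vk * (- 'i * vl) * x4 = ('i * 'i) * (vk * vl * x4) by ring.
  rewrite ii; ring.
move=> E a0 b0; have : cre (4 * C) <= 0 by rewrite -E creD; lra.
have -> : (4 : Cx R) = rc 4 by rewrite -rc_nat.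
by rewrite !cE mul0r subr0; lra.
Qed.
End Directional.

(** * Hermitian matrices *)

Section Hermitian.
Variables (R : realType) (n : nat).
Implicit Types (G b : 'M[Cx R]_n) (u v w : Cn R n) (x y : 'I_n -> Cx R).

Definition sqn u : R := \sum_k nm (u 0 k) ^+ 2.
(** The Hermitian pairing of (1,0)-covectors when [b] is the inverse metric; the first index of [b]
    is the conjugate one. *)
Definition bf b x y : Cx R := \sum_k \sum_l b l k * x k * (y l)^*.

Lemma sqn_ge0 u : 0 <= sqn u. Proof. by apply: sumr_ge0 => k _; rewrite sqr_ge0. Qed.
Lemma sqn_gt0 u : u != 0 -> 0 < sqn u.
Proof.
move=> u0; rewrite lt_neqAle sqn_ge0 andbT eq_sym; apply: contra u0 => /eqP.
move=> /psumr_eq0P H; apply/eqP/rowP => k; rewrite mxE; apply/eqP; rewrite -nm_eq0.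
by rewrite -sqrf_eq0 H // => i _; rewrite sqr_ge0.
Qed.
Lemma sesqE G u v : sesq G u v = (u *m G *m (map_mx Num.conj v^T)) 0 0.
Proof.
rewrite /sesq mxE exchange_big /=; apply: eq_bigr => l _; rewrite !mxE mulr_suml.
by apply: eq_bigr => k _; rewrite (mulrC (u 0 k)).
Qed.
Lemma sesqDl G u v w : sesq G (u + v) w = sesq G u w + sesq G v w.
Proof. by rewrite !sesqE !mulmxDl mxE. Qed.
Lemma sesqDr G u v w : sesq G w (u + v) = sesq G w u + sesq G w v.
Proof. by rewrite !sesqE linearD map_mxD mulmxDr mxE. Qed.
Lemma sesqZl G c u w : sesq G (c *: u) w = c * sesq G u w.
Proof. by rewrite !sesqE -!scalemxAl mxE. Qed.
Lemma sesqZr G c u w : sesq G w (c *: u) = c^* * sesq G w u.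
Proof. by rewrite !sesqE linearZ map_mxZ -scalemxAr mxE. Qed.
Lemma sesq0 G w : sesq G 0 w = 0.
Proof. by rewrite -(scale0r 0) sesqZl mul0r. Qed.
Lemma sesq_delta G i j : sesq G (delta_mx 0 i) (delta_mx 0 j) = G i j.
Proof.
rewrite /sesq (bigD1 i) //= (bigD1 j) //= !mxE !eqxx /= mulr1 (rmorph1 (Num.conj : {rmorphism _ -> _})) mulr1.
rewrite !big1 ?addr0 // => [k ki|l lj].
  by rewrite big1 // => l _; rewrite !mxE (negPf ki) andbF mulr0 mul0r.
by rewrite !mxE (negPf lj) andbF (rmorph0 (Num.conj : {rmorphism _ -> _})) mulr0.
Qed.

Lemma sesq_le G (L : R) u : 0 <= L -> (forall k l, nm (G k l) <= L) -> cre (sesq G u u) <= n%:R * L * sqn u.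
Proof.
move=> L0 H.
have B k l : nm (G k l * u 0 k * (u 0 l)^*) <= L / 2 * (nm (u 0 k) ^+ 2) + L / 2 * (nm (u 0 l) ^+ 2).
  rewrite !nmM nm_conj -mulrDr; apply: (@le_trans _ _ (L * (nm (u 0 k) * nm (u 0 l)))).
    by rewrite -mulrA ler_wpM2r // mulr_ge0 // nm_ge0.
  by rewrite -mulrA ler_wpM2l //; have := sqr_ge0 (nm (u 0 k) - nm (u 0 l)); rewrite sqrrB; lra.
apply: le_trans (ler_norm _) _; apply: le_trans (cre_le _) _.
apply: le_trans (nm_sum _ _ _) _.
apply: (@le_trans _ _ (\sum_(k < n) \sum_(l < n) (L / 2 * (nm (u 0 k) ^+ 2) + L / 2 * (nm (u 0 l) ^+ 2)))).
  by apply: ler_sum => k _; apply: le_trans (nm_sum _ _ _) _; apply: ler_sum => l _; exact: B.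
under eq_bigr do rewrite big_split /= sumr_const card_ord -mulr_sumr.
rewrite big_split /= sumr_const card_ord -/(sqn u).
have -> : \sum_i (L / 2 * nm (u 0 i) ^+ 2 *+ n) = n%:R * (L / 2) * sqn u.
  by rewrite mulr_sumr; apply: eq_bigr => i _; rewrite -[LHS]mulr_natl mulrA.
by rewrite -[X in _ + X]mulr_natl le_eqVlt; apply/orP; left; apply/eqP; field.
Qed.

Variable G : 'M[Cx R]_n.
Hypothesis hG : hermpos G.
Let b := invmx G.

Lemma herm_sesq u v : sesq G v u = (sesq G u v)^*.
Proof.
rewrite /sesq cj_sum exchange_big /=; apply: eq_bigr => l _; rewrite cj_sum.
by apply: eq_bigr => k _; rewrite !cjM cjK -hG.1; ring.
Qed.
Lemma sesq_gt0 u : u != 0 -> 0 < cre (sesq G u u).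
Proof. by move=> /(hG.2 u) H; rewrite -rc_lt -rc_ge0 // ltW. Qed.
Lemma sesq_ge0 u : 0 <= cre (sesq G u u).
Proof. by have [->|/sesq_gt0/ltW//] := eqVneq u 0; rewrite sesq0. Qed.
Lemma sesq_rc u : sesq G u u = rc (cre (sesq G u u)).
Proof. by have [->|/(hG.2 u)/ltW/rc_ge0//] := eqVneq u 0; rewrite sesq0. Qed.

Lemma hermpos_unit : G \in unitmx.
Proof.
rewrite -row_free_unit; apply/row_freeP.
have /row_freeP [B BE] : row_free G; last by exists B.
rewrite -kermx_eq0; apply/eqP/row_matrixP => i; rewrite row0.
have : row i (kermx G) *m G = 0 by rewrite -row_mul mulmx_ker row0.
set u := row i _ => u0; apply/eqP; apply: contraT => /hG.2.
by rewrite sesqE u0 mul0mx mxE ltxx.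
Qed.

Lemma spectral_form : let P := spectralmx G in let d := spectral_diag G in
  [/\ G = map_mx Num.conj P^T *m diag_mx d *m P, P *m map_mx Num.conj P^T = 1%:M,
      forall a, d 0 a = rc (cre (d 0 a)) & forall a, 0 < cre (d 0 a)].
Proof.
move=> P d; have uP := spectral_unitarymx G; have P1 := unitarymxP uP.
have nG : G \is normalmx.
  apply: hermitian_normalmx; apply/is_hermitianmxP; rewrite expr0 scale1r.
  by apply/matrixP => i j; rewrite !mxE; exact: hG.1.
have GE : G = map_mx Num.conj P^T *m diag_mx d *m P by have := orthomx_spectralP nG; rewrite invmx_unitary.
have dE a : d 0 a = sesq G (row a P) (row a P).
  rewrite sesqE [X in row a P *m X]GE !mulmxA.
  have -> : row a P *m map_mx Num.conj P^T = delta_mx 0 a.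
    by rewrite -row_mul P1 row1.
  have -> : map_mx Num.conj (row a P)^T = map_mx Num.conj P^T *m delta_mx a 0.
    by rewrite tr_row -colE map_col.
  rewrite -!mulmxA (mulmxA P) P1 mul1mx mulmxA -rowE -colE mxE mxE.
  by rewrite mxE eqxx mulr1n.
have r0 a : row a P != 0.
  apply: contraPneq (erefl ((P *m map_mx Num.conj P^T) a a)) => r0.
  have := congr1 (fun M : 'M[Cx R]_n => M a a) P1; rewrite !mxE eqxx => E.
  have /rowP r0' := r0.
  move: E; rewrite big1 => [/eqP|j _]; first by rewrite eq_sym oner_eq0.
  by have := r0' j; rewrite !mxE => ->; rewrite mul0r.
by split=> // a; rewrite dE; [exact: sesq_rc|exact: sesq_gt0].
Qed.

Lemma hermpos_det : \det G = rc (cre (\det G)) /\ 0 < cre (\det G).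
Proof.
have [GE P1 dr d0] := spectral_form.
have E : \det G = rc (\prod_a cre (spectral_diag G 0 a)).
  rewrite {1}GE !det_mulmx mulrC mulrA -det_mulmx P1 det1 mul1r det_diag rc_prod.
  by apply: eq_bigr => a _; exact: dr.
by rewrite E creK; split=> //; apply: prodr_gt0 => a _; exact: d0.
Qed.

(** The rows of a unitary diagonalization, divided by the square roots of the eigenvalues. The frame
    turns traces with the inverse metric into sums over unit vectors, to which the sign of a Levi
    form or a bound of the curvature on unit vectors can be applied. *)
Lemma hermpos_frame : exists f : 'I_n -> Cn R n, (forall a, sesq G (f a) (f a) = 1) /\
  forall k l, b l k = \sum_a f a 0 k * (f a 0 l)^*.
Proof.
have [GE P1 dr d0] := spectral_form; set P := spectralmx G in GE P1; set d := spectral_diag G in GE dr d0.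
pose c a : Cx R := rc (Num.sqrt (cre (d 0 a)))^-1.
have c0 a : Num.sqrt (cre (d 0 a)) != 0 by rewrite gt_eqF // sqrtr_gt0.
have cc a : c a * c a = (d 0 a)^-1.
  by rewrite /c [in RHS]dr -rcM -rcV -invfM -expr2 sqr_sqrtr // ltW.
have dn0 a : d 0 a != 0 by rewrite dr rc_eq0 gt_eqF.
have P2 : map_mx Num.conj P^T *m P = 1%:M by exact: mulmx1C.
have bE : b = map_mx Num.conj P^T *m diag_mx (\row_a (d 0 a)^-1) *m P.
  have bG : (map_mx Num.conj P^T *m diag_mx (\row_a (d 0 a)^-1) *m P) *m G = 1%:M.
    rewrite [X in _ *m X]GE -!mulmxA (mulmxA P) P1 mul1mx (mulmxA (diag_mx _)) mulmx_diag.
    rewrite (_ : diag_mx _ = 1%:M) ?mul1mx //; apply/matrixP => i j; rewrite !mxE.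
    by case: (i == j); rewrite ?mulr0n // mulr1n mulVf.
  by rewrite -[LHS]mul1mx -bG -[LHS]mulmxA /b (mulmxV hermpos_unit) mulmx1.
exists (fun a => c a *: row a P); split=> [a|k l].
  rewrite sesqZl sesqZr /c rc_conj sesqE GE mulrA !mulmxA.
  have -> : row a P *m map_mx Num.conj P^T = delta_mx 0 a by rewrite -row_mul P1 row1.
  have -> : map_mx Num.conj (row a P)^T = map_mx Num.conj P^T *m delta_mx a 0.
    by rewrite tr_row -colE map_col.
  rewrite -!mulmxA (mulmxA P) P1 mul1mx mulmxA -rowE -colE mxE mxE mxE eqxx mulr1n.
  by rewrite -/(c a) cc mulVf.
rewrite bE !mxE; apply: eq_bigr => a _; rewrite !mxE cjM rc_conj.
rewrite (bigD1 a) //= big1 ?addr0 => [|i ia]; last by rewrite !mxE (negPf ia) mulr0n mulr0.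
by rewrite !mxE eqxx mulr1n -cc -/(c a); ring.
Qed.

Lemma inv_herm k l : b l k = (b k l)^*.
Proof.
have [f [_ bE]] := hermpos_frame; rewrite !bE cj_sum; apply: eq_bigr => a _.
by rewrite cjM cjK mulrC.
Qed.

Let dual v : Cn R n := v *m b.
Lemma sesq_dual v w : sesq G (dual v) w = \sum_l v 0 l * (w 0 l)^*.
Proof.
rewrite sesqE /dual -(mulmxA v) mulVmx ?hermpos_unit // mulmx1 mxE.
by apply: eq_bigr => l _; rewrite !mxE.
Qed.

(** Expand G(u - v / L, u - v / L) >= 0, where v is the conjugate of x and u is the vector dual to
    v, and use G(v, v) <= L |v|^2. *)
Lemma bf_lower (L : R) x : 0 < L -> (forall u, cre (sesq G u u) <= L * sqn u) ->
  (\sum_k nm (x k) ^+ 2) / L <= cre (bf b x x).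
Proof.
move=> L0 H; pose v : Cn R n := \row_k (x k)^*; pose u := dual v.
have vv : \sum_l v 0 l * (v 0 l)^* = rc (sqn v).
  by rewrite rc_sum; apply: eq_bigr => l _; rewrite conjM_nm.
have sv : sqn v = \sum_k nm (x k) ^+ 2 by apply: eq_bigr => k _; rewrite mxE nm_conj.
have uu : sesq G u u = bf b x x.
  rewrite sesq_dual /bf exchange_big /=; apply: eq_bigr => l _.
  rewrite /u /dual !mxE cj_sum mulr_sumr; apply: eq_bigr => m _; rewrite !mxE cjM cjK -inv_herm.
  by ring.
have e0 : sesq G (u - rc L^-1 *: v) (u - rc L^-1 *: v) = bf b x x - 2 * rc L^-1 * rc (sqn v) + rc L^-1 * rc L^-1 * sesq G v v.
  rewrite -scaleNr sesqDl !sesqDr !sesqZl !sesqZr uu (herm_sesq u v) sesq_dual vv !cjN !rc_conj; ring.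
have := sesq_ge0 (u - rc L^-1 *: v); rewrite e0 -!rcM -sv.
have Hv := H v; have L1 : 0 < L^-1 by rewrite invr_gt0.
have -> : (2 : Cx R) = rc 2 by rewrite -rc_nat.
rewrite !cE !mul0r !mulr0 !subr0.
have : L^-1 * L^-1 * cre (sesq G v v) <= L^-1 * L^-1 * (L * sqn v) by rewrite ler_wpM2l // mulr_ge0 // ltW.
have -> : L^-1 * L^-1 * (L * sqn v) = L^-1 * sqn v by field; rewrite gt_eqF.
rewrite (mulrC (sqn v)); lra.
Qed.

(** For u the i-th row of the inverse, G(u, u) is the diagonal entry [b i i]. The lower bound of G
    thus controls this entry, and then all entries of the row. *)
Lemma inv_bound (c : R) i k : 0 < c -> (forall u, c * sqn u <= cre (sesq G u u)) -> nm (b i k) <= c^-1.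
Proof.
move=> c0 H; pose v : Cn R n := delta_mx 0 i.
have E j : dual v 0 j = b i j by rewrite /dual /v -rowE mxE.
have := H (dual v); rewrite sesq_dual (bigD1 i) //= big1 ?addr0 => [|l li]; last first.
  by rewrite mxE (negPf li) andbF mul0r.
rewrite mxE !eqxx mul1r E cre_conj => H1.
have s1 : cre (b i i) <= nm (b i i) by apply: le_trans (ler_norm _) (cre_le _).
have le_b j : nm (b i j) ^+ 2 <= sqn (dual v).
  rewrite /sqn (bigD1 j) //= E lerDl; apply: sumr_ge0 => m _; exact: sqr_ge0.
have ii : nm (b i i) <= c^-1.
  have [z|nz] := eqVneq (nm (b i i)) 0; first by rewrite z invr_ge0 ltW.
  have p : 0 < nm (b i i) by rewrite lt_neqAle eq_sym nz nm_ge0.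
  rewrite -[leRHS]mul1r ler_pdivlMr // -(ler_pM2r p) mul1r mulrAC -expr2 mulrC.
  by apply: le_trans s1; apply: le_trans H1; rewrite ler_wpM2l // ltW.
have h : nm (b i k) ^+ 2 <= c^-1 ^+ 2.
  rewrite expr2 ler_pdivlMr // mulrC; apply: le_trans ii; apply: le_trans s1; apply: le_trans H1.
  by rewrite -expr2 ler_wpM2l // ltW.
by rewrite -ler_sqr ?nnegrE ?nm_ge0 // invr_ge0 ltW.
Qed.
End Hermitian.

(** * Derivatives of the inverse metric *)

Section InverseMatrix.
Variables (R : realType) (n k : nat) (O : set (R * Cn R n)) (oO : open O).
Variable G : R * Cn R n -> 'M[Cx R]_k.
Hypotheses (sG : forall i j, smooth_st O (fun q => G q i j)) (uG : forall q, O q -> G q \in unitmx).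

Lemma det_neq0 q : O q -> \det (G q) != 0.
Proof. by move=> /uG; rewrite unitmxE unitfE. Qed.
Lemma sm_invmx i j : smooth_st O (fun q => invmx (G q) i j).
Proof.
have sc : smooth_st O (fun q => cofactor (G q) j i).
  apply: (smZ oO); apply: (sm_det oO) => a c; apply: (sm_eq oO _ (sG (lift j a) (lift i c))) => q _.
  by rewrite !mxE.
apply: (sm_eq oO _ (smM oO (smV oO det_neq0 (sm_det oO sG)) sc)) => q Oq.
by rewrite /invmx uG // !mxE.
Qed.
(** Differentiate b G = 1 and multiply by b on the right. *)
Lemma dd_invmx a i j q : O q ->
  dd a (fun q => invmx (G q) i j) q = - \sum_m \sum_l invmx (G q) i m * dd a (fun q => G q m l) q * invmx (G q) l j.
Proof.
move=> Oq.
have K i' l : \sum_m (dd a (fun q => invmx (G q) i' m) q * G q m l + invmx (G q) i' m * dd a (fun q => G q m l) q) = 0.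
  rewrite -[RHS](dd_cst (((i' == l)%:R : Cx R)) a q).
  have -> : dd a (fun=> (i' == l)%:R) q = dd a (fun q => \sum_m invmx (G q) i' m * G q m l) q.
    apply: (dd_eq oO) Oq => q' Oq'.
    by have := congr1 (fun M : 'M[Cx R]_k => M i' l) (mulVmx (uG Oq')); rewrite !mxE.
  rewrite (dd_sum oO _ _ _ _ Oq); last by move=> m; exact: (smM oO (sm_invmx _ _) (sG _ _)).
  by apply: eq_bigr => m _; rewrite (ddM _ (sm_invmx _ _) (sG _ _) Oq).
have E : dd a (fun q => invmx (G q) i j) q = \sum_l (\sum_m dd a (fun q => invmx (G q) i m) q * G q m l) * invmx (G q) l j.
  under eq_bigr do rewrite mulr_suml.
  rewrite exchange_big /= (bigD1 j) //= [X in _ + X]big1 ?addr0 => [|m mj].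
    under eq_bigr do rewrite -mulrA.
    rewrite -mulr_sumr; have := congr1 (fun M : 'M[Cx R]_k => M j j) (mulmxV (uG Oq)).
    by rewrite !mxE eqxx => ->; rewrite mulr1.
  under eq_bigr do rewrite -mulrA.
  rewrite -mulr_sumr; have := congr1 (fun M : 'M[Cx R]_k => M m j) (mulmxV (uG Oq)).
  by rewrite !mxE (negPf mj) => ->; rewrite mulr0.
rewrite E exchange_big /= -sumrN; apply: eq_bigr => l _.
have := K i l; rewrite big_split /= => /eqP; rewrite addr_eq0 => /eqP ->.
by rewrite mulNr mulr_suml.
Qed.
End InverseMatrix.

(** * Evolution of the derivatives of a flow *)

Section Words.
Variables (R : realType) (n : nat).
Notation S := (R * Cn R n)%type.
Notation W := (seq ('I_n * bool)).
Definition dds (s : W) (f : S -> Cx R) : S -> Cx R := foldr (fun a => dd (Some a)) f s.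
Variables (O : set S) (oO : open O).
Lemma sm_dds s f : smooth_st O f -> smooth_st O (dds s f).
Proof. by move=> F; elim: s => [|a s IH]; [exact: F|exact: (sm_dd oO _ IH)]. Qed.
Lemma dds_eq s f g q : (forall q, O q -> f q = g q) -> O q -> dds s f q = dds s g q.
Proof. by elim: s q => [|a s IH] q fg Oq /=; [exact: fg|apply: (dd_eq oO) Oq => q' Oq'; exact: IH]. Qed.
Lemma dd_ddsC a s f q : smooth_st O f -> O q -> dd a (dds s f) q = dds s (dd a f) q.
Proof.
elim: s q => [|c s IH] q F Oq //=; rewrite (ddC oO _ _ (sm_dds s F) Oq).
by apply: (dd_eq oO) Oq => q' Oq'; exact: IH.
Qed.
End Words.

Section Expressions.
Variables (R : realType) (n : nat).
Notation S := (R * Cn R n)%type.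
Notation W := (seq ('I_n * bool)).

(* Differential polynomials in the entries of the metric [EG] and of its inverse [EB]. *)
Inductive ex := EC of Cx R | EB of 'I_n & 'I_n | EG of W & 'I_n & 'I_n | EA of ex & ex | EM of ex & ex.

Definition esum (T : Type) (r : seq T) (F : T -> ex) : ex := foldr (fun i e => EA (F i) e) (EC 0) r.
Notation "\esum_ i F" := (esum (index_enum 'I_n) (fun i : 'I_n => F)) (at level 41, i at level 0).

Fixpoint ed (a : 'I_n * bool) (e : ex) : ex :=
  match e with
  | EC _ => EC 0
  | EB i j => EM (EC (-1)) (\esum_m \esum_l (EM (EM (EB i m) (EG [:: a] m l)) (EB l j)))
  | EG s i j => EG (a :: s) i j
  | EA e1 e2 => EA (ed a e1) (ed a e2)
  | EM e1 e2 => EA (EM (ed a e1) e2) (EM e1 (ed a e2))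
  end.
(** [ordx] is the highest order of a derivative that occurs, hence what must be bounded beforehand.
    [wtx] counts all the derivatives in a monomial; it is the weight under parabolic scaling and
    decides whether a term can be absorbed. *)
Fixpoint ordx (e : ex) : nat :=
  match e with EC _ | EB _ _ => 0 | EG s _ _ => size s | EA e1 e2 | EM e1 e2 => maxn (ordx e1) (ordx e2) end.
Fixpoint wtx (e : ex) : nat :=
  match e with EC _ | EB _ _ => 0 | EG s _ _ => size s | EA e1 e2 => maxn (wtx e1) (wtx e2)
  | EM e1 e2 => wtx e1 + wtx e2 end.
Fixpoint cb (L : R) (e : ex) : R :=
  match e with EC c => nm c | EB _ _ | EG _ _ _ => L | EA e1 e2 => cb L e1 + cb L e2
  | EM e1 e2 => cb L e1 * cb L e2 end.

Lemma ordx_esum T (r : seq T) F m : (forall i, ordx (F i) <= m)%N -> (ordx (esum r F) <= m)%N.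
Proof. by move=> H; elim: r => //= i r IH; rewrite geq_max H. Qed.
Lemma wtx_esum T (r : seq T) F m : (forall i, wtx (F i) <= m)%N -> (wtx (esum r F) <= m)%N.
Proof. by move=> H; elim: r => //= i r IH; rewrite geq_max H. Qed.
Lemma ordx_ed a e : (ordx (ed a e) <= (ordx e).+1)%N.
Proof.
elim: e => //= [i j|e1 I1 e2 I2|e1 I1 e2 I2]; last 2 first; try by lia.
by rewrite max0n; do 2! apply: ordx_esum => ?.
Qed.
Lemma wtx_ed a e : (wtx (ed a e) <= (wtx e).+1)%N.
Proof.
elim: e => //= [i j|e1 I1 e2 I2|e1 I1 e2 I2]; last 2 first; try by lia.
by rewrite add0n; do 2! apply: wtx_esum => ?.
Qed.

(* The quasilinear part [b_lk d_k dbar_l] is split off; [Rw s] is the remainder of the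
   equation differentiated along the word [s]. *)
Definition R0 (i j : 'I_n) : ex := EM (EC (-1)) (\esum_p \esum_m \esum_r \esum_s
  (EM (EM (EB p m) (EG [:: (i, false)] m r)) (EM (EB r s) (EG [:: (j, true)] s p)))).
Fixpoint Rw (s : W) (i j : 'I_n) : ex :=
  if s is a :: s' then
    EA (\esum_k \esum_l (EM (ed a (EB l k)) (EG [:: (k, false), (l, true) & s'] i j))) (ed a (Rw s' i j))
  else R0 i j.
(** A new letter either falls on [b], in front of two derivatives of a word shorter by one, or
    differentiates the previous remainder. So no derivative of order |s| + 2 occurs outside of
    [Lop]. *)
Lemma ordx_Rw s i j : (ordx (Rw s i j) <= (size s).+1)%N.
Proof.
elim: s => [|a s IH]; first by rewrite /= max0n; do 4! apply: ordx_esum => ?.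
rewrite [Rw _ _ _]/= [ordx _]/= geq_max; apply/andP; split; last by apply: leq_trans (ordx_ed _ _) _.
do 2! apply: ordx_esum => ?; rewrite [ordx _]/= geq_max leqnn andbT.
by apply: leq_trans (ordx_ed a (EB _ _)) _.
Qed.
Lemma wtx_Rw s i j : (wtx (Rw s i j) <= (size s).+2)%N.
Proof.
elim: s => [|a s IH]; first by rewrite /= add0n; do 4! apply: wtx_esum => ?.
rewrite [Rw _ _ _]/= [wtx _]/= geq_max; apply/andP; split; last by apply: leq_trans (wtx_ed _ _) _.
apply: wtx_esum => k; apply: wtx_esum => l; rewrite [wtx _]/= -[in leqRHS]addn1 addnC.
by have := wtx_ed a (EB l k); rewrite /=; lia.
Qed.

Variable G : S -> 'M[Cx R]_n.
Fixpoint ev (e : ex) (q : S) : Cx R :=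
  match e with
  | EC c => c
  | EB i j => invmx (G q) i j
  | EG s i j => dds s (fun q => G q i j) q
  | EA e1 e2 => ev e1 q + ev e2 q
  | EM e1 e2 => ev e1 q * ev e2 q
  end.
Lemma ev_esum T (r : seq T) F q : ev (esum r F) q = \sum_(i <- r) ev (F i) q.
Proof. by elim: r => [|i r IH] /=; rewrite ?big_nil // big_cons IH. Qed.

Lemma cb_ge0 L e : 0 <= L -> 0 <= cb L e.
Proof. by move=> L0; elim: e => //= *; rewrite ?nm_ge0 ?addr_ge0 ?mulr_ge0. Qed.

(** A factor differentiated along s counts as L th^|s|; in a sum the larger of the two weights may
    be taken because th >= 1. *)
Lemma ev_bound e q (L th : R) : 1 <= th -> 0 <= L -> (forall i j, nm (invmx (G q) i j) <= L) ->
  (forall s i j, (size s <= ordx e)%N -> nm (dds s (fun q => G q i j) q) <= L * th ^+ size s) ->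
  nm (ev e q) <= cb L e * th ^+ wtx e.
Proof.
move=> t1 L0 Hb; have t0 : 0 <= th by lra.
elim: e => [c|i j|s i j|e1 I1 e2 I2|e1 I1 e2 I2] H /=.
- by rewrite expr0 mulr1.
- by rewrite expr0 mulr1.
- by apply: H.
- have {}I1 := I1 (fun s i j h => H s i j (leq_trans h (leq_maxl _ _))).
  have {}I2 := I2 (fun s i j h => H s i j (leq_trans h (leq_maxr _ _))).
  apply: le_trans (nmD _ _) _; rewrite mulrDl; apply: lerD.
    by apply: le_trans I1 _; rewrite ler_wpM2l ?cb_ge0 // ler_weXn2l // leq_maxl.
  by apply: le_trans I2 _; rewrite ler_wpM2l ?cb_ge0 // ler_weXn2l // leq_maxr.
- have {}I1 := I1 (fun s i j h => H s i j (leq_trans h (leq_maxl _ _))).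
  have {}I2 := I2 (fun s i j h => H s i j (leq_trans h (leq_maxr _ _))).
  by rewrite nmM exprD mulrACA; apply: ler_pM; rewrite ?nm_ge0.
Qed.

Variables (O : set S) (oO : open O).
Hypotheses (sG : forall i j, smooth_st O (fun q => G q i j)) (uG : forall q, O q -> G q \in unitmx).

Lemma sm_ev e : smooth_st O (ev e).
Proof.
elim: e => [c|i j|s i j|e1 I1 e2 I2|e1 I1 e2 I2] /=.
- exact: (sm_cst oO).
- exact: (sm_invmx oO sG uG).
- exact: (sm_dds oO).
- exact: (smD oO).
- exact: (smM oO).
Qed.
Lemma ev_ed a e q : O q -> dd (Some a) (ev e) q = ev (ed a e) q.
Proof.
move=> Oq; elim: e => [c|i j|s i j|e1 I1 e2 I2|e1 I1 e2 I2] /=.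
- exact: dd_cst.
- rewrite (dd_invmx oO sG uG _ _ _ Oq) mulN1r ev_esum; congr (- _); apply: eq_bigr => m _.
  by rewrite ev_esum; apply: eq_bigr.
- by [].
- by rewrite (ddD _ (sm_ev e1) (sm_ev e2) Oq) I1 I2.
- by rewrite (ddM _ (sm_ev e1) (sm_ev e2) Oq) I1 I2.
Qed.

(** The complex Laplacian of the metric [G], that is the trace of d dbar f with respect to [G]. *)
Definition Lop (f : S -> Cx R) (q : S) : Cx R :=
  \sum_k \sum_l invmx (G q) l k * dd (Some (k, false)) (dd (Some (l, true)) f) q.

Variable kappa : R.
Hypothesis eqG : forall q i j, O q -> dd None (fun q => G q i j) q =
  rc kappa * (Lop (fun q => G q i j) q + ev (R0 i j) q).

(** Induction on the word: a new derivative either passes through to the second derivatives in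
    [Lop], or falls on [b], and the latter terms are those collected by [Rw]. *)
Lemma evolution s i j q : O q -> dd None (dds s (fun q => G q i j)) q =
  rc kappa * (Lop (dds s (fun q => G q i j)) q + ev (Rw s i j) q).
Proof.
elim: s q => [|a s IH] q Oq; first by rewrite /= eqG.
set f := dds s (fun q => G q i j).
have sf : smooth_st O f by exact: (sm_dds oO).
have sb l k : smooth_st O (fun q => invmx (G q) l k) by exact: (sm_invmx oO sG uG).
have sL : smooth_st O (Lop f).
  apply: (sm_sum oO) => k; apply: (sm_sum oO) => l; apply: (smM oO); first exact: sb.
  by do 2! apply: (sm_dd oO).
rewrite [dds _ _]/= -/f (ddC oO _ _ sf Oq) (dd_eq oO _ IH Oq) -/f.
rewrite (ddZ oO _ _ (smD oO sL (sm_ev _)) Oq) (ddD _ sL (sm_ev _) Oq) (ev_ed _ _ Oq); congr (_ * _).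
rewrite [Rw _ _ _]/= [ev (EA _ _) q]/= addrA; congr (_ + _).
rewrite ev_esum /Lop -big_split /=.
have sT k l : smooth_st O (fun q => invmx (G q) l k * dd (Some (k, false)) (dd (Some (l, true)) f) q).
  by apply: (smM oO); [exact: sb|do 2! apply: (sm_dd oO)].
rewrite (dd_sum oO _ _ _ _ Oq); last by move=> k; apply: (sm_sum oO) => l; exact: sT.
apply: eq_bigr => k _; rewrite (dd_sum oO _ _ _ _ Oq); last by move=> l; exact: sT.
rewrite ev_esum -big_split /=; apply: eq_bigr => l _.
have s2 : smooth_st O (dd (Some (l, true)) f) by exact: (sm_dd oO).
rewrite (ddM _ (sb l k) (sm_dd oO _ s2) Oq) addrC; congr (_ + _); [by have := ev_ed a (EB l k) Oq => /= ->|].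
congr (_ * _); rewrite (ddC oO _ _ s2 Oq); apply: (dd_eq oO) Oq => q' Oq'.
exact: (ddC oO _ _ sf Oq').
Qed.
End Expressions.

(** * Bernstein estimates *)

(** Lagrange's identity. *)
Lemma sum_CS (R : realType) (I : finType) (x y : I -> R) :
  (\sum_i x i * y i) ^+ 2 <= (\sum_i x i ^+ 2) * (\sum_i y i ^+ 2).
Proof.
have : 0 <= \sum_i \sum_j (x i * y j - x j * y i) ^+ 2.
  by apply: sumr_ge0 => i _; apply: sumr_ge0 => j _; exact: sqr_ge0.
have -> : \sum_i \sum_j (x i * y j - x j * y i) ^+ 2 =
    2 * ((\sum_i x i ^+ 2) * (\sum_i y i ^+ 2)) - 2 * (\sum_i x i * y i) ^+ 2.
  have E1 : (\sum_i x i ^+ 2) * (\sum_i y i ^+ 2) = \sum_i \sum_j x i ^+ 2 * y j ^+ 2.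
    by rewrite mulr_suml; apply: eq_bigr => i _; rewrite mulr_sumr.
  have E2 : (\sum_i x i ^+ 2) * (\sum_i y i ^+ 2) = \sum_i \sum_j x j ^+ 2 * y i ^+ 2.
    by rewrite E1 exchange_big.
  have E3 : (\sum_i x i * y i) ^+ 2 = \sum_i \sum_j x i * y i * (x j * y j).
    by rewrite expr2 mulr_suml; apply: eq_bigr => i _; rewrite mulr_sumr.
  have -> : 2 * ((\sum_i x i ^+ 2) * \sum_i y i ^+ 2) =
      (\sum_i x i ^+ 2) * (\sum_i y i ^+ 2) + (\sum_i x i ^+ 2) * (\sum_i y i ^+ 2) by ring.
  rewrite {1}E1 E2 E3 mulr_sumr -sumrN -!big_split /=; apply: eq_bigr => i _.
  by rewrite mulr_sumr -sumrN -!big_split /=; apply: eq_bigr => j _; ring.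
lra.
Qed.

Section Bernstein.
Variables (R : realType) (n : nat).
Notation S := (R * Cn R n)%type.
Variables (O : set S) (oO : open O) (G : S -> 'M[Cx R]_n).
Hypotheses (sG : forall i j, smooth_st O (fun q => G q i j)) (pG : forall q, O q -> hermpos (G q)).
Variables (kappa : R) (q : S).
Hypotheses (k0 : 0 < kappa) (Oq : O q).
Notation sm := (smooth_st O).
Notation b := (invmx (G q)).
Notation L := (Lop G).
Implicit Types (f g : S -> Cx R) (X Y : S -> R).

Definition gr f (k : 'I_n) : Cx R := dd (Some (k, false)) f q.
Definition grb f (k : 'I_n) : Cx R := dd (Some (k, true)) f q.
Definition g1 (x : 'I_n -> Cx R) : R := \sum_k nm (x k) ^+ 2.
Definition gsq f : R := g1 (gr f) + g1 (grb f).
Definition heat f : Cx R := dd None f q - rc kappa * L f q.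

Lemma Lop_M f g : sm f -> sm g -> L (fun q => f q * g q) q = f q * L g q + g q * L f q +
  (bf b (gr f) (fun l => (grb g l)^*) + bf b (gr g) (fun l => (grb f l)^*)).
Proof.
move=> sf sg; rewrite /Lop /bf !mulr_sumr -!big_split /=; apply: eq_bigr => k _.
rewrite !mulr_sumr -!big_split /=; apply: eq_bigr => l _; rewrite !cjK.
have -> : dd (Some (k, false)) (dd (Some (l, true)) (fun q0 => f q0 * g q0)) q =
    dd (Some (k, false)) (fun q0 => dd (Some (l, true)) f q0 * g q0 + f q0 * dd (Some (l, true)) g q0) q.
  by apply: (dd_eq oO) Oq => q' Oq'; exact: (ddM _ sf sg Oq').
have s1 := sm_dd oO (Some (l, true)) sf; have s2 := sm_dd oO (Some (l, true)) sg.
rewrite (ddD _ (smM oO s1 sg) (smM oO sf s2) Oq) (ddM _ s1 sg Oq) (ddM _ sf s2 Oq) /gr /grb; ring.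
Qed.

Lemma Lop_D f g : sm f -> sm g -> L (fun q => f q + g q) q = L f q + L g q.
Proof.
move=> sf sg; rewrite /Lop -big_split /=; apply: eq_bigr => k _.
rewrite -big_split /=; apply: eq_bigr => l _.
have s1 := sm_dd oO (Some (l, true)) sf; have s2 := sm_dd oO (Some (l, true)) sg.
rewrite (dd_eq oO (g := fun q => dd (Some (l, true)) f q + dd (Some (l, true)) g q) _ _ Oq).
  by rewrite (ddD _ s1 s2 Oq); ring.
by move=> q' Oq'; exact: (ddD _ sf sg Oq').
Qed.
Lemma Lop_cst c : L (fun=> c) q = 0.
Proof.
apply: big1 => k _; apply: big1 => l _.
have -> : dd (Some (l, true)) (fun=> c) = fun=> 0 :> Cx R by apply/funext => x; exact: dd_cst.
by rewrite dd_cst mulr0.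
Qed.
Lemma Lop_conj f : sm f -> L (fun q => (f q)^*) q = (L f q)^*.
Proof.
move=> sf; rewrite /Lop cj_sum.
under [RHS]eq_bigr do rewrite cj_sum.
rewrite exchange_big; apply: eq_bigr => l _; apply: eq_bigr => k _; rewrite cjM.
rewrite (inv_herm (pG Oq) k l); congr (_ * _).
rewrite (dd_eq oO (g := fun q => (dd (Some (l, false)) f q)^*) _ _ Oq); last first.
  by move=> q' Oq'; rewrite (dd_conj _ sf Oq').
by rewrite (dd_conj _ (sm_dd oO _ sf) Oq) /= (ddC oO _ _ sf Oq).
Qed.

Lemma heat_M f g : sm f -> sm g -> heat (fun q => f q * g q) = f q * heat g + g q * heat f -
  rc kappa * (bf b (gr f) (fun l => (grb g l)^*) + bf b (gr g) (fun l => (grb f l)^*)).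
Proof. by move=> sf sg; rewrite /heat (Lop_M sf sg) (ddM _ sf sg Oq); ring. Qed.
Lemma heat_D f g : sm f -> sm g -> heat (fun q => f q + g q) = heat f + heat g.
Proof. by move=> sf sg; rewrite /heat (Lop_D sf sg) (ddD _ sf sg Oq); ring. Qed.
Lemma heat_cst c : heat (fun=> c) = 0.
Proof. by rewrite /heat Lop_cst dd_cst mulr0 subr0. Qed.
Lemma heat_sum (I : Type) (r : seq I) (f : I -> S -> Cx R) : (forall i, sm (f i)) ->
  heat (fun q => \sum_(i <- r) f i q) = \sum_(i <- r) heat (f i).
Proof.
move=> sf; elim: r => [|i r IH].
  rewrite big_nil (_ : (fun _ => _) = fun=> 0) ?heat_cst //.
  by apply/funext => x; rewrite big_nil.
rewrite big_cons -IH -(heat_D (sf i) (sm_sum oO _ _ sf)); congr heat.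
by apply/funext => x; rewrite big_cons.
Qed.

Lemma grb_real X : sm (fun q => rc (X q)) -> grb (fun q => rc (X q)) = fun k => (gr (fun q => rc (X q)) k)^*.
Proof.
move=> sX; apply/funext => k; rewrite /gr /grb -[Some (k, false)]/(flip (Some (k, true))).
rewrite -(dd_conj _ sX Oq); apply: (dd_eq oO) Oq => q' _; by rewrite rc_conj.
Qed.
Lemma grbK X : sm (fun q => rc (X q)) ->
  (fun l => (grb (fun q => rc (X q)) l)^*) = gr (fun q => rc (X q)).
Proof. by move=> sX; rewrite (grb_real sX); apply/funext => l; rewrite cjK. Qed.

Variables (Lam Lb : R).
Hypotheses (Lam0 : 0 < Lam) (upG : forall u, cre (sesq (G q) u u) <= Lam * sqn u)
  (Lb0 : 0 <= Lb) (upb : forall i j, nm (b i j) <= Lb).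

(** In the product rule for f times its conjugate, the cross terms are the squared lengths of the
    holomorphic and of the conjugate gradient for the inverse metric. Since G <= Lam, they are at
    least the Euclidean ones divided by Lam. *)
Lemma heat_normsq f (rho : Cx R) : sm f -> dd None f q = rc kappa * (L f q + rho) ->
  cre (heat (fun q => f q * (f q)^*)) <= kappa * (2 * nm rho * nm (f q) - gsq f / Lam).
Proof.
move=> sf Ef; have sc := sm_conj oO sf.
have hf : heat f = rc kappa * rho by rewrite /heat Ef; ring.
have hc : heat (fun q => (f q)^*) = rc kappa * rho^*.
  rewrite /heat (Lop_conj sf) (dd_conj _ sf Oq) /= Ef cjM cjD rc_conj; ring.
rewrite (heat_M sf sc) hf hc.
have -> : (fun l => (grb (fun q => (f q)^*) l)^*) = gr f.
  by apply/funext => l; rewrite /grb /gr (dd_conj _ sf Oq) cjK.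
have G1 := bf_lower (pG Oq) (gr f) Lam0 upG.
have := bf_lower (pG Oq) (gr (fun q => (f q)^*)) Lam0 upG.
have -> : (fun l => (grb f l)^*) = gr (fun q => (f q)^*).
  by apply/funext => l; rewrite /grb /gr (dd_conj _ sf Oq).
have -> : \sum_k nm (gr (fun q => (f q)^*) k) ^+ 2 = g1 (grb f).
  by apply: eq_bigr => k _; rewrite /gr (dd_conj _ sf Oq) nm_conj.
rewrite -/(g1 (gr f)) in G1; move=> G2.
have -> : f q * (rc kappa * rho^*) + (f q)^* * (rc kappa * rho) = rc kappa * (f q * rho^* + (f q)^* * rho) by ring.
rewrite -mulrBr !cE mul0r subr0 ler_pM2l //.
have B : cre (f q) * cre rho + cim (f q) * cim rho <= nm rho * nm (f q).
  have := le_trans (ler_norm _) (cre_le (f q * rho^*)); rewrite !cE nmM nm_conj; nra.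
rewrite /gsq mulrDl; lra.
Qed.

Section Family.
Variables (I : finType) (f : I -> S -> Cx R).
Hypothesis sf : forall i, sm (f i).
Definition sqs (q : S) : R := \sum_i nm (f i q) ^+ 2.
Definition gsqs : R := \sum_i gsq (f i).

Lemma sqsE : (fun q => rc (sqs q)) = fun q => \sum_i f i q * (f i q)^*.
Proof. by apply/funext => x; rewrite rc_sum; apply: eq_bigr => i _; rewrite conjM_nm. Qed.
Lemma sm_sqs : sm (fun q => rc (sqs q)).
Proof. by rewrite sqsE; apply: (sm_sum oO) => i; apply: (smM oO); [|apply: (sm_conj oO)]; exact: sf. Qed.

Lemma sqs_heat (rho : I -> Cx R) : (forall i, dd None (f i) q = rc kappa * (L (f i) q + rho i)) ->
  cre (heat (fun q => rc (sqs q))) <= kappa * (2 * (\sum_i nm (rho i) * nm (f i q)) - gsqs / Lam).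
Proof.
move=> H; rewrite sqsE heat_sum; last by move=> i; apply: (smM oO); [|apply: (sm_conj oO)]; exact: sf.
rewrite cre_sum; apply: le_trans (ler_sum _ (fun i _ => heat_normsq (sf i) (H i))) _.
rewrite -mulr_sumr sumrB -mulr_suml -/gsqs le_eqVlt; apply/orP; left; apply/eqP; congr (_ * (_ - _)).
by rewrite mulr_sumr; apply: eq_bigr => i _; rewrite mulrA.
Qed.

(** Cauchy-Schwarz over the family; the factor 2 comes from (x + y)^2 <= 2 x^2 + 2 y^2, where x and
    y are the moduli of the two Wirtinger derivatives in the same variable. *)
Lemma sqs_grad : g1 (gr (fun q => rc (sqs q))) <= 2 * sqs q * gsqs.
Proof.
have D k : nm (gr (fun q => rc (sqs q)) k) <= \sum_i nm (f i q) * (nm (gr (f i) k) + nm (grb (f i) k)).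
  rewrite sqsE /gr (dd_sum oO _ _ _ _ Oq); last by move=> i; apply: (smM oO); [|apply: (sm_conj oO)]; exact: sf.
  apply: le_trans (nm_sum _ _ _) _; apply: ler_sum => i _.
  rewrite (ddM _ (sf i) (sm_conj oO (sf i)) Oq) (dd_conj _ (sf i) Oq) /=.
  by apply: le_trans (nmD _ _) _; rewrite !nmM !nm_conj mulrDr mulrC.
rewrite /g1; apply: le_trans (_ : \sum_k sqs q * \sum_i (nm (gr (f i) k) + nm (grb (f i) k)) ^+ 2 <= _).
  apply: ler_sum => k _; apply: le_trans (sum_CS _ _).
  by rewrite ler_sqr ?nnegrE ?nm_ge0 // sumr_ge0 // => i _; rewrite mulr_ge0 ?addr_ge0 ?nm_ge0.
rewrite -mulr_sumr (mulrC 2) -mulrA ler_wpM2l //; first by apply: sumr_ge0 => i _; exact: sqr_ge0.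
rewrite exchange_big /= mulr_sumr; apply: ler_sum => i _.
rewrite /gsq /g1 -big_split /= mulr_sumr; apply: ler_sum => k _.
by have := sqr_ge0 (nm (gr (f i) k) - nm (grb (f i) k)); rewrite sqrrB sqrrD; lra.
Qed.
End Family.

Lemma bf_young (x y : 'I_n -> Cx R) (e : R) : 0 < e ->
  nm (bf b x y) <= n%:R * Lb * (e * g1 x + g1 y / e).
Proof.
move=> e0.
have B k l : nm (b l k * x k * (y l)^*) <= Lb * (e * nm (x k) ^+ 2) + Lb * (nm (y l) ^+ 2 / e).
  rewrite !nmM nm_conj -mulrA -mulrDr; apply: le_trans (_ : Lb * (nm (x k) * nm (y l)) <= _).
    by rewrite ler_wpM2r // mulr_ge0 ?nm_ge0.
  rewrite ler_wpM2l //.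
  have : 0 <= (e * nm (x k) - nm (y l)) ^+ 2 / e by rewrite divr_ge0 ?sqr_ge0 // ltW.
  have -> : (e * nm (x k) - nm (y l)) ^+ 2 / e = e * nm (x k) ^+ 2 + nm (y l) ^+ 2 / e - 2 * (nm (x k) * nm (y l)).
    by field; rewrite gt_eqF.
  have : 0 <= nm (x k) * nm (y l) by rewrite mulr_ge0 ?nm_ge0.
  lra.
apply: le_trans (nm_sum _ _ _) _.
apply: le_trans (_ : \sum_(k < n) \sum_(l < n) (Lb * (e * nm (x k) ^+ 2) + Lb * (nm (y l) ^+ 2 / e)) <= _).
  by apply: ler_sum => k _; apply: le_trans (nm_sum _ _ _) _; apply: ler_sum => l _; exact: B.
under eq_bigr do rewrite big_split /= sumr_const card_ord -mulr_sumr -mulr_suml -/(g1 y).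
rewrite big_split /= sumr_const card_ord.
have -> : \sum_(k < n) Lb * (e * nm (x k) ^+ 2) *+ n = n%:R * Lb * (e * g1 x).
  by rewrite /g1 !mulr_sumr; apply: eq_bigr => i _; rewrite -[LHS]mulr_natl !mulrA.
by rewrite -[X in _ + X]mulr_natl (mulrA n%:R) -mulrDr.
Qed.

(** The terms in z X^2 carry the coefficient - lam. The quadratic source and the gradient of E give
    back at most lam / 4 each, so lam / 2 times z X^2 is bounded by terms linear in X, and division
    by X bounds z X. *)
Lemma bernstein_numeric (lam M A B B' C2 Z0 z X Y2 N K1 : R) : 0 < lam -> 0 <= K1 -> 0 <= M -> 0 <= B -> 0 <= B' -> 0 <= C2 ->
  0 <= z -> z <= Z0 -> 1 <= X -> 0 <= Y2 -> 0 <= N -> N <= 2 * M -> 8 * M * A <= lam -> 0 <= A ->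
  0 <= N * (z * (- lam * Y2 / 2 + A * X ^+ 2 + B) + C2 * X) + z * X * (- lam * X + B') + lam / 4 * (z * X * (X + K1)) ->
  z * X <= 2 / lam * ((2 * M * B + B' + lam * K1) * Z0 + 2 * M * C2).
Proof.
move=> l0 K0 M0 B0 B'0 C20 z0 zZ X1 Y0 N0 NM MA A0 H.
have X0 : 0 < X by lra.
have h1 : N * (z * (- lam * Y2 / 2 + A * X ^+ 2 + B) + C2 * X) <= lam / 4 * (z * X ^+ 2) + 2 * M * B * z * X + 2 * M * C2 * X.
  have P : z * (- lam * Y2 / 2 + A * X ^+ 2 + B) + C2 * X <= z * (A * X ^+ 2 + B) + C2 * X.
    by rewrite lerD2r ler_wpM2l // -addrA gerDr !mulNr oppr_le0 divr_ge0 ?mulr_ge0 // ltW.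
  have Q : 0 <= z * (A * X ^+ 2 + B) + C2 * X.
    by rewrite addr_ge0 ?mulr_ge0 ?addr_ge0 ?mulr_ge0 ?sqr_ge0 // ltW.
  apply: le_trans (ler_wpM2l N0 P) _; apply: le_trans (ler_wpM2r Q NM) _.
  have : 2 * M * A * (z * X ^+ 2) <= lam / 4 * (z * X ^+ 2).
    by apply: ler_wpM2r; [rewrite mulr_ge0 ?sqr_ge0|lra].
  have : 2 * M * B * z <= 2 * M * B * z * X by rewrite ler_peMr // !mulr_ge0.
  lra.
have h2 : lam / 4 * (z * X * (X + K1)) = lam / 4 * (z * X ^+ 2) + lam / 4 * K1 * (z * X) by ring.
have lK : 0 <= lam * K1 by rewrite mulr_ge0 // ltW.
have h3 : z * X * (- lam * X + B') = - lam * (z * X ^+ 2) + B' * z * X by ring.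
have h4 : lam / 2 * (z * X ^+ 2) <= ((2 * M * B + B' + lam * K1 / 4) * z + 2 * M * C2) * X by lra.
have h5 : lam / 2 * (z * X) <= (2 * M * B + B' + lam * K1 / 4) * z + 2 * M * C2.
  by rewrite -(ler_pM2r X0); apply: le_trans h4; rewrite expr2 !mulrA.
have h6 : (2 * M * B + B' + lam * K1 / 4) * z <= (2 * M * B + B' + lam * K1) * Z0.
  apply: ler_pM => //; last by lra.
  have : 0 <= 2 * M * B by rewrite !mulr_ge0.
  lra.
have -> : 2 / lam * ((2 * M * B + B' + lam * K1) * Z0 + 2 * M * C2) = ((2 * M * B + B' + lam * K1) * Z0 + 2 * M * C2) / (lam / 2).
  by field; rewrite gt_eqF.
rewrite ler_pdivlMr ?divr_gt0 //; lra.
Qed.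

(** The heat inequality of E contributes - lam X, which the product with zeta^2 X turns into - lam
    zeta^2 X^2. This beats the source A X^2, multiplied by M + E <= 2 M, as soon as 8 M A <= lam,
    and the cross term with the gradient of E as soon as E is small compared with M. *)
Lemma bernstein_point (X E zt : S -> R) (lam M A B B' C1 K1 Cz Z0 Y2 : R) :
  sm (fun q => rc (X q)) -> sm (fun q => rc (E q)) -> sm (fun q => rc (zt q)) ->
  0 < lam -> 0 < M -> 0 <= A -> 0 <= B -> 0 <= B' -> 0 <= C1 -> 0 <= K1 -> 0 <= Cz -> 0 <= Y2 ->
  cre (heat (fun q => rc (X q))) <= kappa * (- lam * Y2 + A * X q ^+ 2 + B) ->
  g1 (gr (fun q => rc (X q))) <= 2 * X q * Y2 ->
  cre (heat (fun q => rc (E q))) <= kappa * (- lam * X q + B') ->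
  g1 (gr (fun q => rc (E q))) <= C1 * E q * (X q + K1) ->
  0 <= E q -> E q <= M -> 8 * M * A <= lam -> 16 * n%:R * Lb * C1 * E q <= lam * M ->
  dd None (fun q => rc (zt q)) q = 0 -> nm (L (fun q => rc (zt q ^+ 2)) q) <= Cz ->
  g1 (gr (fun q => rc (zt q))) <= Cz -> 0 < zt q -> zt q ^+ 2 <= Z0 -> 1 <= X q ->
  (forall k, gr (fun q => rc (zt q ^+ 2 * X q * (M + E q))) k = 0) ->
  0 <= cre (dd None (fun q => rc (zt q ^+ 2 * X q * (M + E q))) q) ->
  cre (L (fun q => rc (zt q ^+ 2 * X q * (M + E q))) q) <= 0 ->
  zt q ^+ 2 * X q <= 2 / lam * ((2 * M * B + B' + lam * K1) * Z0 +
     2 * M * (Cz + 4 * n%:R * Lb * (16 * n%:R * Lb / lam + 1) * Cz)).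
Proof.
move=> sX sE sz l0 M0 A0 B0 B'0 C10 K10 Cz0 Y0 hX gX hE gE E0 EM MA ME tz Lz gz z0 zZ X1 g0 t0' L0.
have X0 : 0 < X q by lra.
pose fX q := rc (X q); pose fE q := rc (E q); pose fz q := rc (zt q).
pose fZ q := rc (zt q ^+ 2); pose fP q := rc (zt q ^+ 2 * X q); pose fN q := rc (M + E q).
have sZ : sm fZ by apply: (sm_eq oO _ (smM oO sz sz)) => x _; rewrite /fZ expr2 rcM.
have sP : sm fP by apply: (sm_eq oO _ (smM oO sZ sX)) => x _; rewrite /fP /fZ rcM.
have sN : sm fN by apply: (sm_eq oO _ (smD oO (sm_cst oO (rc M)) sE)) => x _; rewrite /fN rcD.
have hPN : heat (fun q => rc (zt q ^+ 2 * X q * (M + E q))) = fP q * heat fN + fN q * heat fP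
    - rc kappa * (bf b (gr fP) (gr fN) + bf b (gr fN) (gr fP)).
  have -> : (fun q => rc (zt q ^+ 2 * X q * (M + E q))) = fun q => fP q * fN q by apply/funext => x; rewrite rcM.
  by rewrite (heat_M sP sN) (grbK sN) (grbK sP).
have hN : heat fN = heat fE.
  have -> : fN = fun q => rc M + rc (E q) by apply/funext => x; rewrite /fN rcD.
  by rewrite (heat_D (sm_cst oO _) sE) heat_cst add0r.
have gN : gr fN = gr fE.
  have -> : fN = fun q => rc M + rc (E q) by apply/funext => x; rewrite /fN rcD.
  by apply/funext => k; rewrite /gr (ddD _ (sm_cst oO _) sE Oq) dd_cst add0r.
have hP : heat fP = fZ q * heat fX + fX q * heat fZ - rc kappa * (bf b (gr fZ) (gr fX) + bf b (gr fX) (gr fZ)).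
  have -> : fP = fun q => fZ q * fX q by apply/funext => x; rewrite /fP rcM.
  by rewrite (heat_M sZ sX) (grbK sX) (grbK sZ).
have gZ k : gr fZ k = rc (2 * zt q) * gr fz k.
  have -> : fZ = fun q => fz q * fz q by apply/funext => x; rewrite /fZ expr2 rcM.
  by rewrite /gr (ddM _ sz sz Oq) rcM rc_nat /fz; ring.
have hZ : heat fZ = - rc kappa * L fZ q.
  rewrite /heat; have -> : dd None fZ q = 0.
    have -> : fZ = fun q => fz q * fz q by apply/funext => x; rewrite /fZ expr2 rcM.
    by rewrite (ddM _ sz sz Oq) tz mul0r mulr0 addr0.
  by rewrite sub0r mulNr.
set N := M + E q; set P := zt q ^+ 2 * X q.
have N0 : 0 < N by rewrite /N; lra.
have P0 : 0 < P by rewrite mulr_gt0 // exprn_gt0.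
(* The gradient of the whole product vanishes, so that of zeta^2 X is a multiple of the gradient of
   E, and the cross term between the two factors becomes a multiple of |dE|^2. *)
have gPN k : gr fP k = - rc (P / N) * gr fE k.
  have := g0 k; have -> : (fun q => rc (zt q ^+ 2 * X q * (M + E q))) = fun q => fP q * fN q by apply/funext => x; rewrite rcM.
  rewrite /gr (ddM _ sP sN Oq) -/(gr fP k) -/(gr fN k) gN -/N => /eqP; rewrite addr_eq0 => /eqP H.
  apply: (@mulIf _ (rc N)); first by rewrite rc_eq0 gt_eqF.
  rewrite -[fN q]/(rc N) in H; rewrite H rcM rcV.
  have N1 : rc N != 0 by rewrite rc_eq0 gt_eqF.
  by rewrite -[fP q]/(rc P) -/(gr fE k); field.
have bZ c x y : bf b (fun k => c * x k) y = c * bf b x y.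
  by rewrite /bf mulr_sumr; apply: eq_bigr => k _; rewrite mulr_sumr; apply: eq_bigr => l _; ring.
have bZr (c : R) x y : bf b x (fun k => rc c * y k) = rc c * bf b x y.
  by rewrite /bf mulr_sumr; apply: eq_bigr => k _; rewrite mulr_sumr; apply: eq_bigr => l _; rewrite cjM rc_conj; ring.
have cross1 : bf b (gr fP) (gr fN) + bf b (gr fN) (gr fP) = - rc (2 * (P / N)) * bf b (gr fE) (gr fE).
  rewrite gN; have -> : gr fP = fun k => rc (- (P / N)) * gr fE k by apply/funext => k; rewrite gPN rcN.
  by rewrite bZ bZr rcN (rcM 2 (P / N)) rc_nat; ring.
have cross2 : bf b (gr fZ) (gr fX) + bf b (gr fX) (gr fZ) = rc (2 * zt q) * (bf b (gr fz) (gr fX) + bf b (gr fX) (gr fz)).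
  have -> : gr fZ = fun k => rc (2 * zt q) * gr fz k by apply/funext => k; rewrite gZ.
  by rewrite bZ bZr mulrDr.
(* The weight in Young's inequality: for c >= 16 n Lb / lam the cross term between the cutoff and X
   costs at most half of the good term lam Y2. *)
pose c := 16 * n%:R * Lb / lam + 1.
have n0 : 0 <= n%:R :> R by exact: ler0n.
have c1 : 1 <= c by rewrite /c lerDr divr_ge0 ?mulr_ge0 // ltW.
have c0 : 0 < c by lra.
have cl : 8 * n%:R * Lb / c <= lam / 2.
  rewrite ler_pdivrMr // /c mulrDr mulr1.
  have -> : lam / 2 * (16 * n%:R * Lb / lam) = 8 * n%:R * Lb by field; rewrite gt_eqF.
  by rewrite lerDl; lra.
have crossB : zt q * 2 * nm (bf b (gr fz) (gr fX) + bf b (gr fX) (gr fz)) <=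
    4 * n%:R * Lb * c * Cz * X q + lam / 2 * (zt q ^+ 2 * Y2).
  have e0 : 0 < c * X q / zt q by rewrite divr_gt0 // mulr_gt0.
  have e0' : 0 < (c * X q / zt q)^-1 by rewrite invr_gt0.
  have Y1 := bf_young (gr fz) (gr fX) e0.
  have := bf_young (gr fX) (gr fz) e0'; rewrite invrK => Y3.
  have nL : 0 <= n%:R * Lb by rewrite mulr_ge0.
  have Y4 : nm (bf b (gr fz) (gr fX) + bf b (gr fX) (gr fz)) <= 2 * (n%:R * Lb * (c * X q / zt q * Cz + 2 * X q * Y2 / (c * X q / zt q))).
    have T : c * X q / zt q * g1 (gr fz) + g1 (gr fX) / (c * X q / zt q) <= c * X q / zt q * Cz + 2 * X q * Y2 / (c * X q / zt q).
      by apply: lerD; [rewrite ler_wpM2l // ltW|rewrite ler_wpM2r // ltW].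
    have {}T := ler_wpM2l nL T.
    rewrite (mulrC (c * X q / zt q)^-1) (mulrC (g1 (gr fz))) (addrC (g1 _ / _)) in Y3.
    apply: le_trans (nmD _ _) _; lra.
  apply: le_trans (ler_wpM2l (_ : 0 <= zt q * 2) Y4) _; first by lra.
  have -> : zt q * 2 * (2 * (n%:R * Lb * (c * X q / zt q * Cz + 2 * X q * Y2 / (c * X q / zt q)))) =
     4 * n%:R * Lb * c * Cz * X q + 8 * n%:R * Lb / c * (zt q ^+ 2 * Y2).
    by field; rewrite !gt_eqF.
  by rewrite lerD2l; apply: ler_wpM2r => //; rewrite mulr_ge0 ?sqr_ge0.
have gEB : 2 * (P / N) * nm (bf b (gr fE) (gr fE)) <= lam / 4 * (zt q ^+ 2 * X q * (X q + K1)).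
  have := bf_young (gr fE) (gr fE) ltr01; rewrite mul1r divr1 => Y1.
  have Y5 : nm (bf b (gr fE) (gr fE)) <= 2 * n%:R * Lb * (C1 * E q * (X q + K1)).
    apply: le_trans Y1 _; have : n%:R * Lb * g1 (gr fE) <= n%:R * Lb * (C1 * E q * (X q + K1)) by rewrite ler_wpM2l // mulr_ge0.
    by lra.
  have PN : 0 <= 2 * (P / N) by rewrite mulr_ge0 // divr_ge0 // ltW.
  apply: le_trans (ler_wpM2l PN Y5) _.
  have -> : 2 * (P / N) * (2 * n%:R * Lb * (C1 * E q * (X q + K1))) = (16 * n%:R * Lb * C1 * E q) / (4 * N) * (P * (X q + K1)).
    by field; rewrite gt_eqF.
  rewrite -/P; apply: ler_wpM2r; first by rewrite mulr_ge0 ?(ltW P0) //; lra.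
  rewrite ler_pdivrMr; last by lra.
  by apply: le_trans ME _; rewrite /N; nra.
have main : 0 <= cre (heat (fun q => rc (zt q ^+ 2 * X q * (M + E q)))).
  rewrite /heat !cE mul0r subr0; have : kappa * cre (L (fun q => rc (zt q ^+ 2 * X q * (M + E q))) q) <= 0 by rewrite pmulr_rle0.
  lra.
have hX' : cre (heat fX) <= kappa * (- lam * Y2 + A * X q ^+ 2 + B) := hX.
have hE' : cre (heat fE) <= kappa * (- lam * X q + B') := hE.
rewrite hPN hN cross1 hP cross2 hZ in main; move: main; clear hPN hN hP hZ.
move: (heat fX) (heat fE) hX' hE' => wX wE hX' hE'.
rewrite -[fP q]/(rc P) -[fN q]/(rc N) -[fZ q]/(rc (zt q ^+ 2)) -[fX q]/(rc (X q)).
have creZ (a : R) (w : Cx R) : cre (rc a * w) = a * cre w by rewrite !cE mul0r subr0.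
rewrite !(creD, creN, creZ, mulNr, mulrN, opprK).
set hh := cre wX; set he := cre wE; set lz := cre (L fZ q).
set x1 := cre (bf b (gr fz) (gr fX)); set x2 := cre (bf b (gr fX) (gr fz)); set x3 := cre (bf b (gr fE) (gr fE)).
have lzB : - lz <= Cz.
  by apply: le_trans Lz; apply: le_trans (cre_le _); rewrite -normrN; exact: ler_norm.
have x12 : - (2 * zt q * (x1 + x2)) <= 4 * n%:R * Lb * c * Cz * X q + lam / 2 * (zt q ^+ 2 * Y2).
  apply: le_trans crossB; rewrite -creD -mulrN -(mulrC 2); apply: ler_wpM2l; first by lra.
  by apply: le_trans (cre_le _); rewrite -normrN; exact: ler_norm.
have x3B : 2 * (P / N) * x3 <= lam / 4 * (zt q ^+ 2 * X q * (X q + K1)).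
  apply: le_trans gEB; apply: ler_wpM2l; first by rewrite mulr_ge0 // divr_ge0 // ltW.
  exact: le_trans (ler_norm _) (cre_le _).
move=> H.
have C20 : 0 <= Cz + 4 * n%:R * Lb * c * Cz by rewrite addr_ge0 // !mulr_ge0 // ltW.
have NM : N <= 2 * M by rewrite /N; lra.
apply: (@bernstein_numeric lam M A B B' _ Z0 (zt q ^+ 2) (X q) Y2 N K1 l0 K10 (ltW M0) B0 B'0 C20 (sqr_ge0 _) zZ X1 Y0 (ltW N0) NM MA A0).
(* Every term at the maximum point carries the factor kappa; once it is divided out, the resulting
   bound is independent of kappa. *)
rewrite -(pmulr_rge0 _ k0); apply: le_trans H _; rewrite -/P.
have z20 : 0 <= zt q ^+ 2 by exact: sqr_ge0.
have i1 : P * he <= P * (kappa * (- lam * X q + B')) by rewrite ler_wpM2l // ltW.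
have i2 : zt q ^+ 2 * hh <= zt q ^+ 2 * (kappa * (- lam * Y2 + A * X q ^+ 2 + B)) by rewrite ler_wpM2l.
have i3 : X q * (kappa * - lz) <= X q * (kappa * Cz) by rewrite !ler_wpM2l // ltW.
have i4 : kappa * - (2 * zt q * (x1 + x2)) <= kappa * (4 * n%:R * Lb * c * Cz * X q + lam / 2 * (zt q ^+ 2 * Y2)) by rewrite ler_wpM2l // ltW.
have i5 : kappa * (2 * (P / N) * x3) <= kappa * (lam / 4 * (P * (X q + K1))) by rewrite ler_wpM2l // ltW.
have i6 : N * (zt q ^+ 2 * hh + X q * (kappa * - lz) + kappa * - (2 * zt q * (x1 + x2))) <=
  N * (zt q ^+ 2 * (kappa * (- lam * Y2 + A * X q ^+ 2 + B)) + X q * (kappa * Cz) + kappa * (4 * n%:R * Lb * c * Cz * X q + lam / 2 * (zt q ^+ 2 * Y2))).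
  by apply: (ler_wpM2l (ltW N0)); lra.
apply: le_trans (_ : P * (kappa * (- lam * X q + B')) + N * (zt q ^+ 2 * (kappa * (- lam * Y2 + A * X q ^+ 2 + B)) + X q * (kappa * Cz) + kappa * (4 * n%:R * Lb * c * Cz * X q + lam / 2 * (zt q ^+ 2 * Y2))) + kappa * (lam / 4 * (P * (X q + K1))) <= _); first by lra.
by rewrite le_eqVlt; apply/orP; left; apply/eqP; rewrite /P; field.
Qed.
End Bernstein.

(** * First and second order conditions at a maximum point *)

Section MaximumPoint.
Variables (R : realType) (n : nat).
Notation S := (R * Cn R n)%type.

Lemma derive_ge0_left (g : R -> R) (l : R) : is_derive (0 : R) 1 g l ->
  (\forall s \near (0 : R), s < 0 -> g s <= g 0) -> 0 <= l.
Proof.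
move=> [dg E] M; rewrite leNgt; apply/negP => l0.
have C : (fun h : R => h^-1 *: ((g \o shift (0 : R)) (h *: (1 : R)) - g 0)) @ (0 : R)^' --> l by rewrite -E; exact: dg.
have nl : 0 < - l by lra.
move/cvgrPdist_lt: C => /(_ _ nl); rewrite /dnbhs /within /= => H0.
have H : \forall t \near (0 : R), t != 0 -> `|l - t^-1 *: (g (t *: (1 : R) + 0) - g 0)| < - l := H0.
have [e /= e0 He] := (@nbhs_ballP _ _ (0 : R) _).1 (filterI H M).
have [|A Bd] := He (- (e / 2)); first by rewrite /ball /= sub0r opprK ger0_norm; lra.
have e2 : - (e / 2) < 0 by lra.
have := A (ltr0_neq0 e2); rewrite /= addr0 /GRing.scale /= mulr1 ltr_norml => /andP[A1 _].
have : 0 <= (- (e / 2))^-1 * (g (- (e / 2)) - g 0).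
  by rewrite nmulr_rge0 ?subr_le0 ?Bd // invr_lt0.
lra.
Qed.
Lemma derive_max (g : R -> R) (l : R) : is_derive (0 : R) 1 g l ->
  (\forall s \near (0 : R), g s <= g 0) -> l = 0.
Proof.
move=> D M; apply/eqP; rewrite eq_le; apply/andP; split; last first.
  by apply: (derive_ge0_left D); apply: (near0S _ M).
rewrite -oppr_ge0.
have oD : is_derive (0 : R) 1 (fun s : R => - s) (-1).
  by have := is_deriveN (is_derive_id (0 : R) 1).
have D0 : is_derive (- 0 : R) 1 g l by rewrite oppr0.
have := is_derive_1comp oD D0; rewrite mulrN1 => /derive_ge0_left; apply.
have [e /= e0 He] := (@nbhs_ballP _ _ (0 : R) _).1 M; exists e => // s.
by rewrite /ball_ /= sub0r normrN oppr0 => se _; apply: He; rewrite /ball /= sub0r opprK.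
Qed.

Variables (O : set S) (oO : open O) (G : S -> 'M[Cx R]_n) (q : S).
Hypotheses (Oq : O q) (pG : hermpos (G q)).
Variable F : S -> R.
Hypothesis sF : smooth_st O (fun q => rc (F q)).

(** In the frame of [hermpos_frame] the Laplacian is a sum of Levi forms in the directions of the
    frame. *)
Lemma Lop_max : (\forall q' \near q, q'.1 = q.1 -> F q' <= F q) -> cre (Lop G (fun q => rc (F q)) q) <= 0.
Proof.
move=> M; have [f [_ bE]] := hermpos_frame pG.
have -> : Lop G (fun q => rc (F q)) q = \sum_a \sum_k \sum_l f a 0 k * (f a 0 l)^* * dd (Some (k, false)) (dd (Some (l, true)) (fun q => rc (F q))) q.
  rewrite /Lop exchange_big /=; rewrite [RHS]exchange_big /= exchange_big /=; apply: eq_bigr => k _.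
  rewrite [RHS]exchange_big /=; apply: eq_bigr => l _.
  by rewrite bE mulr_suml.
by rewrite cre_sum; apply: sumr_le0 => a _; exact: (levi_max oO (f a) sF Oq M).
Qed.
Lemma grad_max : (\forall q' \near q, q'.1 = q.1 -> F q' <= F q) ->
  forall k c, dd (Some (k, c)) (fun q => rc (F q)) q = 0.
Proof.
move=> M k c.
have P b : pd (Some (k, b)) (fun q => rc (F q)) q = 0.
  have [D1 D2] := sm_der (Some (k, b)) sF Oq.
  apply: complexP; rewrite !cE; last by have /is_derive1E[_ <-] := D2; rewrite derive1_cst.
  apply: (derive_max D1); apply: (near0S _ (near_sh (Some (k, b)) M)) => s /(_ erefl) /=.
  by rewrite rc0 mul0r scale0r addr0; case: (q).
by rewrite ddE !P mulr0 addr0 mul0r.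
Qed.
(** Only earlier times are compared, because the maximum over a closed time interval may lie on its
    final slice. *)
Lemma time_max : (\forall s \near (0 : R), s < 0 -> F (q.1 + s, q.2) <= F q) ->
  0 <= cre (dd None (fun q => rc (F q)) q).
Proof.
move=> M; have [D1 _] := sm_der None sF Oq; rewrite ddE.
apply: (derive_ge0_left D1); apply: (near0S _ M) => s Ms s0 /=.
by rewrite addr0; have := Ms s0; case: (q).
Qed.
End MaximumPoint.

(** Continuity of the restriction to A; it is the form in which the behaviour up to the initial time
    is recorded, where two-sided limits in time have no meaning. *)
Definition cw (T : topologicalType) (V : topologicalType) (A : set T) (f : T -> V) : Prop :=
  forall x, A x -> f @ within A (nbhs x) --> f x.

(** * The maximum principle on a closed cylinder in space-time *)

Section Region.
Variables (R : realType) (n : nat).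
Notation S := (R * Cn R n)%type.

Definition dist2 (p0 p : Cn R n) : R := \sum_j nm (p 0 j - p0 0 j) ^+ 2.
(** A quadratic cutoff in the space variables; c is the square of the radius. *)
Definition zeta (p0 : Cn R n) (c : R) (q : S) : R := c - dist2 p0 q.2.
Definition slab (p0 : Cn R n) (c t0 T : R) : set S := [set q | t0 <= q.1 <= T /\ dist2 p0 q.2 <= c].

Lemma cvg_sumR (T I : Type) (F : set_system T) (FF : Filter F) (r : seq I) (f : I -> T -> R) (l : I -> R) :
  (forall i, f i @ F --> l i) -> (fun x => \sum_(i <- r) f i x) @ F --> \sum_(i <- r) l i.
Proof.
move=> H; elim: r => [|i r IH].
  by rewrite big_nil (_ : (fun _ => _) = fun=> 0); [exact: cvg_cst|apply/funext => x; rewrite big_nil].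
rewrite big_cons (_ : (fun _ => _) = fun x => f i x + \sum_(j <- r) f j x); first exact: cvgD.
by apply/funext => x; rewrite big_cons.
Qed.

Lemma cvg_dist2 p0 (p : Cn R n) : (fun p => dist2 p0 p) @ p --> dist2 p0 p.
Proof.
apply: (@cvg_sumR _ _ (nbhs p) (nbhs_filter p)) => j.
have H : (fun p' : Cn R n => nm (p' 0 j - p0 0 j)) @ p --> nm (p 0 j - p0 0 j).
  have H' : (fun p' : Cn R n => p' 0 j - p0 0 j) @ p --> p 0 j - p0 0 j.
    by have h1 := @cvg_coord R n p j; exact: (cvgB h1 (cvg_cst _)).
  exact: cvg_nmf H'.
by rewrite expr2; apply: cvgM.
Qed.

Lemma compact_disc (c : R) : compact [set z : Cx R | nm z <= c].
Proof.
have K : compact ((fun xy : R * R => rc xy.1 + 'i * rc xy.2) @` (`[- c, c]%classic `*` `[- c, c]%classic)).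
  apply: continuous_compact; last by apply: compact_setX; exact: segment_compact.
  apply: continuous_subspaceT => xy.
  apply: cvgD; first by apply: cvg_rc; exact: cvg_fst.
  by apply: cvgM; [exact: cvg_cst|apply: cvg_rc; exact: cvg_snd].
apply: (subclosed_compact _ K).
  have -> : [set z : Cx R | nm z <= c] = (@nm R : Cx R -> R) @^-1` [set x : R | x <= c] by [].
  apply: closed_comp; last exact: closed_le.
  by move=> z _; have := @cvg_nmf R _ (nbhs z) _ id z; apply; exact: cvg_id.
move=> z zc; exists (cre z, cim z); last by apply: complexP; rewrite !cE /=; ring.
split; rewrite /= in_itv /=; rewrite -ler_norml.
  exact: le_trans (cre_le z) zc.
exact: le_trans (cim_le z) zc.
Qed.

Lemma compact_ball p0 c : compact [set p : Cn R n | dist2 p0 p <= c].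
Proof.
pose r := \sum_j nm (p0 0 j) + Num.sqrt c.
have K : compact [set v : Cn R n | forall j, nm (v 0 j) <= r].
  by apply: (rV_compact (A := fun _ => [set z : Cx R | nm z <= r])) => j; exact: compact_disc.
apply: (subclosed_compact _ K).
  have -> : [set p : Cn R n | dist2 p0 p <= c] = dist2 p0 @^-1` [set x : R | x <= c] by [].
  by apply: closed_comp; [move=> z _; exact: cvg_dist2|exact: closed_le].
move=> p /= pc j.
have h : nm (p 0 j - p0 0 j) <= Num.sqrt c.
  rewrite -(ger0_norm (nm_ge0 _)) -sqrtr_sqr ler_wsqrtr //; apply: le_trans pc.
  by rewrite /dist2 (bigD1 j) //= lerDl sumr_ge0 // => i _; exact: sqr_ge0.
have := nmD (p 0 j - p0 0 j) (p0 0 j); rewrite subrK => h2.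
have : nm (p0 0 j) <= \sum_i nm (p0 0 i) by rewrite (bigD1 j) //= lerDl sumr_ge0 // => i _; exact: nm_ge0.
by rewrite /r; lra.
Qed.
Lemma compact_slab p0 c t0 T : compact (slab p0 c t0 T).
Proof.
have := compact_setX (@segment_compact R t0 T) (@compact_ball p0 c).
by rewrite (_ : _ `*` _ = slab p0 c t0 T) //; apply/seteqP; split=> q; rewrite /slab /= in_itv.
Qed.

Lemma slab_bound p0 c t0 T (F : S -> R) (Bd : R) : cw (slab p0 c t0 T) F ->
  (forall q, slab p0 c t0 T q -> (forall q', slab p0 c t0 T q' -> F q' <= F q) -> F q <= Bd) ->
  forall q, slab p0 c t0 T q -> F q <= Bd.
Proof.
move=> cF H q Kq.
have [||x Kx Mx] := @compact_EVT_max _ R F (slab p0 c t0 T) _ (@compact_slab p0 c t0 T) _.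
- by exists q.
- exact/subspace_continuousP.
rewrite inE in Kx.
apply: le_trans (Mx q _) _; first by rewrite inE.
by apply: H => // q' Kq'; apply: Mx; rewrite inE.
Qed.

Section Cutoff.
Variables (O : set S) (oO : open O) (p0 : Cn R n) (c : R).
Notation zt := (zeta p0 c).
Let y j (q : S) : Cx R := q.2 0 j - p0 0 j.
Lemma zetaE : (fun q => rc (zt q)) = fun q => rc c - \sum_j y j q * (y j q)^*.
Proof.
apply/funext => q; rewrite rcB rc_sum; congr (_ - _); apply: eq_bigr => j _.
by rewrite conjM_nm.
Qed.
Let sy j : smooth_st O (y j).
Proof. exact: (smB oO (sm_coord oO j) (sm_cst oO _)). Qed.
Let syy j : smooth_st O (fun q => y j q * (y j q)^*).
Proof. exact: (smM oO (sy j) (sm_conj oO (sy j))). Qed.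
Lemma sm_zeta : smooth_st O (fun q => rc (zt q)).
Proof. by rewrite zetaE; apply: (smB oO (sm_cst oO _)); apply: (sm_sum oO) => j; exact: syy. Qed.
Let dy a j q : O q -> dd a (y j) q = (a == Some (j, false))%:R.
Proof. by move=> Oq; rewrite (ddB oO _ (sm_coord oO j) (sm_cst oO _) Oq) dd_cst subr0 dd_coord. Qed.
Lemma dd_zeta a q : O q -> dd a (fun q => rc (zt q)) q =
  - \sum_j ((a == Some (j, false))%:R * (y j q)^* + y j q * (flip a == Some (j, false))%:R).
Proof.
move=> Oq; rewrite zetaE (ddB oO _ (sm_cst oO _) (sm_sum oO _ _ syy) Oq) dd_cst sub0r; congr (- _).
rewrite (dd_sum oO _ _ _ syy Oq); apply: eq_bigr => j _.
rewrite (ddM _ (sy j) (sm_conj oO (sy j)) Oq) (dd_conj _ (sy j) Oq) !dy //.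
by rewrite (rmorph_nat (Num.conj : {rmorphism _ -> _})).
Qed.
Lemma zeta_t q : O q -> dd None (fun q => rc (zt q)) q = 0.
Proof. by move=> Oq; rewrite dd_zeta // big1 ?oppr0 // => j _; rewrite mul0r mulr0 addr0. Qed.
Lemma zeta_z k q : O q -> dd (Some (k, false)) (fun q => rc (zt q)) q = - (y k q)^*.
Proof.
move=> Oq; rewrite dd_zeta //; congr (- _); rewrite (bigD1 k) //= big1 ?addr0 => [|j jk].
  rewrite eqxx mul1r (_ : (Some (k, true) == Some (k, false)) = false) ?mulr0 ?addr0 //.
  by apply/eqP => -[].
rewrite (_ : (Some (k, false) == Some (j, false)) = false) ?mul0r ?add0r.
  by rewrite (_ : (Some (k, true) == Some (j, false)) = false) ?mulr0 //; apply/eqP => -[].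
by apply/eqP => -[/eqP]; rewrite eq_sym (negPf jk).
Qed.
Lemma zeta_zb k q : O q -> dd (Some (k, true)) (fun q => rc (zt q)) q = - y k q.
Proof.
move=> Oq; have E : (fun q => (rc (zt q))^*) = fun q => rc (zt q) by apply/funext => x; rewrite rc_conj.
by rewrite -E (dd_conj _ sm_zeta Oq) /= zeta_z // cjN cjK.
Qed.
Lemma zeta_g1 q : O q -> g1 (gr q (fun q => rc (zt q))) = dist2 p0 q.2.
Proof. by move=> Oq; apply: eq_bigr => k _; rewrite /gr zeta_z // nmN nm_conj. Qed.

Variables (G : S -> 'M[Cx R]_n) (pG : forall q, O q -> hermpos (G q)) (Lb : R).
Hypothesis Lb0 : 0 <= Lb.
(** The constant is 6 = 2 + 4: twice zeta times its Laplacian, the latter being minus the trace of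
    the inverse metric, and two gradient terms of size at most 2 c n Lb. *)
Lemma zeta_Lop q : O q -> (forall i j, nm (invmx (G q) i j) <= Lb) -> 0 <= zt q -> dist2 p0 q.2 <= c ->
  nm (Lop G (fun q => rc (zt q ^+ 2)) q) <= 6 * c * n%:R * Lb.
Proof.
move=> Oq Hb z0 dc.
have -> : (fun q => rc (zt q ^+ 2)) = fun q => rc (zt q) * rc (zt q) by apply/funext => x; rewrite expr2 rcM.
rewrite (Lop_M oO G Oq sm_zeta sm_zeta) (grbK oO Oq sm_zeta).
have Lz : nm (Lop G (fun q => rc (zt q)) q) <= n%:R * Lb.
  have -> : Lop G (fun q => rc (zt q)) q = - \sum_k invmx (G q) k k.
    rewrite /Lop -sumrN; apply: eq_bigr => k _.
    have E l : dd (Some (k, false)) (dd (Some (l, true)) (fun q => rc (zt q))) q = - (k == l)%:R.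
      rewrite (dd_eq oO (g := fun q => - y l q) _ _ Oq); last by move=> q' Oq'; rewrite zeta_zb.
      rewrite (ddN oO _ (sy l) Oq) dy //; congr (- _%:R).
      by rewrite (_ : (Some (k, false) == Some (l, false)) = (k == l)) //; apply/eqP/eqP => [[]|->].
    rewrite (bigD1 k) //= E eqxx mulrN1 big1 ?addr0 // => l lk.
    by rewrite E eq_sym (negPf lk) oppr0 mulr0.
  rewrite nmN; apply: le_trans (nm_sum _ _ _) _.
  by apply: le_trans (ler_sum _ (fun k _ => Hb k k)) _; rewrite sumr_const card_ord -[X in X <= _]mulr_natl.
have := bf_young Lb0 Hb (gr q (fun q => rc (zt q))) (gr q (fun q => rc (zt q))) ltr01.
rewrite mul1r divr1 zeta_g1 // => Y.
have n0 : 0 <= n%:R * Lb by rewrite mulr_ge0.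
have zc : zt q <= c by rewrite /zeta gerBl sumr_ge0 // => j _; exact: sqr_ge0.
apply: le_trans (nmD _ _) _; apply: le_trans (lerD (nmD _ _) (nmD _ _)) _.
rewrite !nmM !nm_rc (ger0_norm z0).
have : zt q * nm (Lop G (fun q => rc (zt q)) q) <= c * (n%:R * Lb).
  by apply: ler_pM => //; exact: nm_ge0.
have : n%:R * Lb * (dist2 p0 q.2 + dist2 p0 q.2) <= n%:R * Lb * (c + c) by rewrite ler_wpM2l // lerD.
lra.
Qed.
End Cutoff.

Section Estimate.
Variables (tA tB : R) (U : set (Cn R n)) (oU : open U).
Let O : set S := [set q | tA < q.1 < tB /\ U q.2].
Variable G : S -> 'M[Cx R]_n.
Hypotheses (sG : forall i j, smooth_st O (fun q => G q i j)) (pG : forall q, O q -> hermpos (G q)).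

Lemma open_slab : open O.
Proof.
have -> : O = [set q : S | tA < q.1] `&` ([set q : S | q.1 < tB] `&` [set q : S | U q.2]).
  by apply/seteqP; split=> q /=; [move=> [/andP[? ?] ?]|move=> [? [? ?]]; split=> //; apply/andP].
apply: openI; [|apply: openI].
- have -> : [set q : S | tA < q.1] = (@fst R (Cn R n)) @^-1` [set x | tA < x] by [].
  by apply: open_comp; [move=> q _; exact: cvg_fst|exact: open_gt].
- have -> : [set q : S | q.1 < tB] = (@fst R (Cn R n)) @^-1` [set x | x < tB] by [].
  by apply: open_comp; [move=> q _; exact: cvg_fst|exact: open_lt].
- have -> : [set q : S | U q.2] = (@snd R (Cn R n)) @^-1` U by [].
  by apply: open_comp; [move=> q _; exact: cvg_snd|exact: oU].
Qed.

Variables (kappa t0 T : R) (p0 : Cn R n) (c Lam Lb : R).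
Hypotheses (k0 : 0 < kappa) (tA0 : tA <= t0) (TB : T < tB) (c0 : 0 <= c)
  (cU : forall p, dist2 p0 p <= c -> U p) (Lam0 : 0 < Lam) (Lb0 : 0 <= Lb).
Notation K := (slab p0 c t0 T).
Hypotheses (upG : forall q, K q -> forall u, cre (sesq (G q) u u) <= Lam * sqn u)
  (upb : forall q, K q -> forall i j, nm (invmx (G q) i j) <= Lb).

(** At a maximum point of zeta^2 X (M + E) over the compact cylinder, either X <= 1, or the time is
    initial, or the cutoff vanishes, or [bernstein_point] applies; the bound adds up what these
    cases give. The factor 2 in front comes from M <= M + E <= 2 M. *)
Lemma bernstein_region (X E Y2 : S -> R) (lam M A B B' C1 K1 X0 : R) :
  smooth_st O (fun q => rc (X q)) -> smooth_st O (fun q => rc (E q)) -> cw K X -> cw K E ->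
  0 < lam -> 0 < M -> 0 <= A -> 0 <= B -> 0 <= B' -> 0 <= C1 -> 0 <= K1 -> 0 <= X0 -> (forall q, 0 <= X q) ->
  (forall q, O q -> K q -> [/\ 0 <= Y2 q,
     cre (heat G kappa q (fun q => rc (X q))) <= kappa * (- lam * Y2 q + A * X q ^+ 2 + B),
     g1 (gr q (fun q => rc (X q))) <= 2 * X q * Y2 q,
     cre (heat G kappa q (fun q => rc (E q))) <= kappa * (- lam * X q + B') &
     g1 (gr q (fun q => rc (E q))) <= C1 * E q * (X q + K1)]) ->
  (forall q, K q -> [/\ 0 <= E q, E q <= M & 16 * n%:R * Lb * C1 * E q <= lam * M]) ->
  8 * M * A <= lam ->
  (forall p, dist2 p0 p <= c -> X (t0, p) <= X0) ->
  forall q, K q -> zeta p0 c q ^+ 2 * X q <= 2 * (c ^+ 2 * X0 + c ^+ 2 +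
    2 / lam * ((2 * M * B + B' + lam * K1) * c ^+ 2 + 2 * M * ((6 * c * n%:R * Lb + c) +
      4 * n%:R * Lb * (16 * n%:R * Lb / lam + 1) * (6 * c * n%:R * Lb + c)))).
Proof.
move=> sX sE cX cE l0 M0 A0 B0 B'0 C10 K10 X00 Xp Hq HE MA Hi.
set C := 2 / lam * _; have oO := open_slab.
have n0 : 0 <= n%:R :> R by exact: ler0n.
have Cz0 : 0 <= 6 * c * n%:R * Lb + c by rewrite addr_ge0 // !mulr_ge0.
have C0 : 0 <= C.
  rewrite /C mulr_ge0 ?divr_ge0 ?(ltW l0) //.
  have h1 : 0 <= 2 * M * B by rewrite !mulr_ge0 // ltW.
  have h2 : 0 <= 16 * n%:R * Lb / lam + 1 by rewrite addr_ge0 // divr_ge0 ?(ltW l0) // !mulr_ge0.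
  have h3 : 0 <= (2 * M * B + B' + lam * K1) * c ^+ 2 by apply: mulr_ge0; [have : 0 <= lam * K1 by rewrite mulr_ge0 // ltW|exact: sqr_ge0]; lra.
  have h4 : 0 <= 4 * n%:R * Lb * (16 * n%:R * Lb / lam + 1) * (6 * c * n%:R * Lb + c) by rewrite !mulr_ge0.
  by rewrite addr_ge0 // !mulr_ge0 ?(ltW M0) // addr_ge0.
pose F q := zeta p0 c q ^+ 2 * X q * (M + E q).
have zB q : K q -> 0 <= zeta p0 c q /\ zeta p0 c q ^+ 2 <= c ^+ 2.
  move=> [_ dq]; rewrite /zeta subr_ge0 dq; split=> //.
  rewrite ler_sqr ?nnegrE ?subr_ge0 // gerBl sumr_ge0 // => j _; exact: sqr_ge0.
have FX q : K q -> 0 <= zeta p0 c q ^+ 2 * X q.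
  by move=> Kq; rewrite mulr_ge0 ?sqr_ge0.
have FM q : K q -> M * (zeta p0 c q ^+ 2 * X q) <= F q <= 2 * M * (zeta p0 c q ^+ 2 * X q).
  move=> Kq; have [E0 EM _] := HE q Kq; rewrite /F mulrC (mulrC (2 * M)).
  by apply/andP; split; rewrite ler_wpM2l ?FX //; lra.
pose Bd := 2 * M * (c ^+ 2 * X0 + c ^+ 2 + C).
have c20 : 0 <= c ^+ 2 by exact: sqr_ge0.
have cX0 : 0 <= c ^+ 2 * X0 by rewrite mulr_ge0.
suff FB : forall q, K q -> F q <= Bd.
  move=> q Kq; have /andP[F1 _] := FM q Kq; have F2 := le_trans F1 (FB q Kq).
  by rewrite -(ler_pM2l M0); apply: le_trans F2 _; rewrite /Bd; lra.
have M20 : 0 <= 2 * M by lra.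
apply: slab_bound.
  move=> q Kq; apply: cvgM; last by apply: cvgD; [exact: cvg_cst|exact: cE].
  apply: cvgM; last exact: cX.
  have H : (fun q => zeta p0 c q) @ within K (nbhs q) --> zeta p0 c q.
    apply: cvg_within_filter; apply: cvgB; first exact: cvg_cst.
    exact: (cvg_comp _ _ (@cvg_snd _ _ (nbhs q.1) (nbhs q.2) _) (@cvg_dist2 p0 q.2)).
  by rewrite expr2; apply: cvgM.
move=> q Kq Mq.
have [z0 zc] := zB q Kq; have /andP[_ F2] := FM q Kq.
have Ff (x : R) : zeta p0 c q ^+ 2 * X q <= x -> x <= c ^+ 2 * X0 + c ^+ 2 + C -> F q <= Bd.
  by move=> h1 h2; apply: le_trans F2 _; rewrite /Bd ler_wpM2l //; exact: le_trans h1 h2.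
have [X1|X1] := leP (X q) 1.
  apply: (Ff (c ^+ 2)); last by lra.
  by rewrite -[leRHS]mulr1; apply: ler_pM => //; exact: sqr_ge0.
have [q1|q1] := leP q.1 t0.
  have qt : q.1 = t0 by apply/eqP; rewrite eq_le q1; case: Kq => /andP[].
  apply: (Ff (c ^+ 2 * X0)); last by lra.
  apply: ler_pM => //; first exact: sqr_ge0.
  by have := Hi q.2; rewrite -qt -surjective_pairing; apply; case: Kq.
have [z1|z1] := leP (zeta p0 c q) 0.
  apply: (Ff 0); last by rewrite !addr_ge0.
  by rewrite (_ : zeta p0 c q = 0) ?expr0n ?mul0r //; apply/eqP; rewrite eq_le z1.
have [/andP[_ qT] dq] := Kq.
have Oq : O q by split; [rewrite (le_lt_trans tA0 q1) (le_lt_trans qT TB)|exact: cU].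
have sz := sm_zeta oO p0 c.
have sF : smooth_st O (fun q => rc (F q)).
  apply: (sm_eq oO _ (smM oO (smM oO (smM oO sz sz) sX) (smD oO (sm_cst oO (rc M)) sE))) => x _.
  by rewrite /F expr2 !rcM rcD.
have Ms : \forall q' \near q, q'.1 = q.1 -> F q' <= F q.
  have : \forall q' \near q, dist2 p0 q'.2 < c.
    have H : (fun q' : S => dist2 p0 q'.2) @ q --> dist2 p0 q.2.
      exact: (cvg_comp _ _ (@cvg_snd _ _ (nbhs q.1) (nbhs q.2) _) (@cvg_dist2 p0 q.2)).
    by move/cvgr_lt: H; apply; move: z1; rewrite /zeta subr_gt0.
  apply: filterS => q' dq' E1; apply: Mq; split; last exact: ltW.
  by rewrite E1; apply/andP; split; lra.
have Mt : \forall s \near (0 : R), s < 0 -> F (q.1 + s, q.2) <= F q.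
  apply: (near0S _ (near0_lt (_ : 0 < q.1 - t0))) => [s|]; last by lra.
  rewrite ltr_norml => /andP[s1 _] s0; apply: Mq; split => //=.
  by apply/andP; split; lra.
have [E0 EM E1] := HE q Kq.
have [Y0 hX gX hE gE] := Hq q Oq Kq.
apply: (Ff C); last by lra.
have b1 := zeta_t oO p0 c Oq.
have b2 : nm (Lop G (fun q => rc (zeta p0 c q ^+ 2)) q) <= 6 * c * n%:R * Lb + c.
  by apply: le_trans (zeta_Lop oO Lb0 Oq (upb Kq) (ltW z1) dq) _; rewrite lerDl.
have b3 : g1 (gr q (fun q => rc (zeta p0 c q))) <= 6 * c * n%:R * Lb + c.
  by rewrite (zeta_g1 oO) //; apply: le_trans dq _; rewrite lerDr !mulr_ge0.
have b4 k : gr q (fun q => rc (F q)) k = 0 by exact: (grad_max Oq sF Ms).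
have b5 := time_max Oq sF Mt.
have b6 := Lop_max oO Oq (pG Oq) sF Ms.
exact: (bernstein_point oO k0 Oq Lb0 (upb Kq) sX sE sz l0 M0 A0 B0 B'0 C10 K10 Cz0 Y0 hX gX hE gE E0 EM MA E1 b1 b2 b3 z1 zc (ltW X1) b4 b5 b6).
Qed.
End Estimate.
End Region.

Ltac forget := repeat match goal with H : ?P |- _ => match type of P with Prop => clear H end end.

(** * Absorption inequalities *)

Section Numerics.
Variable R : realType.
Implicit Types (C e x Y th : R).

(** Beyond x = 1 + C / e the higher power dominates, and below it the left side is at most B. *)
Lemma pow_absorb (a b : nat) C e : (a < b)%N -> 0 <= C -> 0 < e ->
  exists2 B, 0 <= B & forall x, 0 <= x -> C * x ^+ a <= e * x ^+ b + B.
Proof.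
move=> ab C0 e0; have Ce : 0 <= C / e by rewrite divr_ge0 // ltW.
exists (C * (1 + C / e) ^+ a) => [|x x0]; first by rewrite mulr_ge0 // exprn_ge0 // addr_ge0.
have [h|h] := leP x (1 + C / e).
  apply: (@le_trans _ _ (C * (1 + C / e) ^+ a)); first by rewrite ler_wpM2l // lerXn2r // nnegrE // addr_ge0.
  by rewrite lerDr mulr_ge0 ?exprn_ge0 // ltW.
have x1 : 1 <= x by lra.
apply: (@le_trans _ _ (e * x ^+ b)); last by rewrite lerDl mulr_ge0 // exprn_ge0 // addr_ge0.
apply: (@le_trans _ _ (e * x ^+ a.+1)); last by rewrite ler_wpM2l ?ler_weXn2l // ltW.
rewrite exprS mulrA ler_wpM2r ?exprn_ge0 // -ler_pdivrMl // mulrC; lra.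
Qed.

Lemma root_exists (k : nat) x : 0 <= x -> exists2 y, 0 <= y & y ^+ k.+1 = x.
Proof.
move=> x0; exists (powR x (k.+1%:R^-1)); first exact: powR_ge0.
by rewrite -powR_mulrn ?powR_ge0 // -powRrM mulVf ?powRr1 // pnatr_eq0.
Qed.

(* Parabolic scaling: [th] has weight one, so a differential monomial of weight [w] is [O(th ^ w)]. *)
Lemma scale_exists (k : nat) x Y : 0 <= x -> 0 <= Y -> exists th, [/\ 1 <= th, x <= th ^+ k.+1, Y <= th ^+ k.+2 &
  [\/ th = 1, x = th ^+ k.+1 | Y = th ^+ k.+2]].
Proof.
move=> x0 Y0; have [y y0 yE] := root_exists k x0; have [z z0 zE] := root_exists k.+1 Y0.
pose th := Num.max 1 (Num.max y z).
have t1 : 1 <= th by rewrite le_max lexx.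
have ty : y <= th by rewrite !le_max lexx orbT.
have tz : z <= th by rewrite !le_max lexx !orbT.
exists th; split=> //.
- by rewrite -yE lerXn2r // nnegrE; lra.
- by rewrite -zE lerXn2r // nnegrE; lra.
rewrite /th; have [h|h] := leP 1 (Num.max y z); last by apply: Or31.
by have [h2|h2] := leP y z; [apply: Or33|apply: Or32].
Qed.

(** Here x has weight one and Y weight two, so th^3 x has the same weight as x^4 and as Y^2. In the
    case x = th the term C x^4 appears with its given constant, and A cannot be made small. *)
Lemma source_first C e : 0 <= C -> 0 < e -> exists A B, [/\ 0 <= A, 0 <= B & forall x Y th, 0 <= x -> 0 <= Y ->
  1 <= th -> x <= th -> [\/ th = 1, x = th ^+ 1 | Y = th ^+ 2] ->
  C * th ^+ 3 * x <= e * Y ^+ 2 + A * x ^+ 4 + B].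
Proof.
move=> C0 e0; have Ce : 0 <= C / e by rewrite divr_ge0 // ltW.
have [B B0 HB] := @pow_absorb 1 4 C 1 isT C0 ltr01.
exists (1 + C + C * (C / e) ^+ 3), B; split=> //.
  by rewrite !addr_ge0 // mulr_ge0 // exprn_ge0.
move=> x Y th x0 Y0 t1 xt H.
have x4 : 0 <= x ^+ 4 by rewrite exprn_ge0.
have eY : 0 <= e * Y ^+ 2 by rewrite mulr_ge0 ?sqr_ge0 // ltW.
have P3 : 0 <= C * (C / e) ^+ 3 * x ^+ 4 by apply: mulr_ge0 => //; rewrite mulr_ge0 // exprn_ge0.
have Cx4 : 0 <= C * x ^+ 4 by rewrite mulr_ge0.
case: H => [E|E|E].
- by have := HB x x0; rewrite E expr1n mulr1 expr1 mul1r; lra.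
- rewrite expr1 in E; rewrite -E; have -> : C * x ^+ 3 * x = C * x ^+ 4 by ring.
  lra.
have [h|h] := leP (C * x) (e * th).
  have : th ^+ 3 * (C * x) <= th ^+ 3 * (e * th) by rewrite ler_wpM2l // exprn_ge0 //; lra.
  rewrite E; have -> : th ^+ 3 * (e * th) = e * (th ^+ 2) ^+ 2 by ring.
  lra.
have h' : th <= C / e * x by rewrite mulrAC ler_pdivlMr // mulrC ltW.
have : C * th ^+ 3 * x <= C * (C / e * x) ^+ 3 * x.
  have t0 : 0 <= th by lra.
  by rewrite ler_wpM2r // ler_wpM2l // lerXn2r // nnegrE mulr_ge0.
have -> : C * (C / e * x) ^+ 3 * x = C * (C / e) ^+ 3 * x ^+ 4 by ring.
lra.
Qed.

(** Now x has weight k + 2 >= 2, so x^4 outweighs th^(k+4) x and any eta > 0 will do. Only Y^2 has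
    the same weight as the left side; when Y is the dominant quantity, the comparison depends on
    whether C x <= e th^(k+2). *)
Lemma source_high (k : nat) C e eta : 0 <= C -> 0 < e -> 0 < eta -> exists2 B, 0 <= B & forall x Y th, 0 <= x -> 0 <= Y ->
  1 <= th -> x <= th ^+ k.+2 -> [\/ th = 1, x = th ^+ k.+2 | Y = th ^+ k.+3] ->
  C * th ^+ k.+4 * x <= e * Y ^+ 2 + eta * x ^+ 4 + B.
Proof.
have e1 : (k.+4 + k.+2 = k.+3 * 2)%N by lia.
have e2 : (k.+4 + k.+2 < k.+2 * 4)%N by lia.
have e3 : (k.+4 <= k.+2 * 2)%N by lia.
move=> C0 e0 n0; have Ce : 0 <= C / e by rewrite divr_ge0 // ltW.
have [B1 B10 H1] := @pow_absorb 1 4 C eta isT C0 n0.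
have [B2 B20 H2] := @pow_absorb (k.+4 + k.+2) (k.+2 * 4) C eta e2 C0 n0.
have C30 : 0 <= C * (C / e) ^+ 2 by rewrite mulr_ge0 // exprn_ge0.
have [B3 B30 H3] := @pow_absorb 3 4 (C * (C / e) ^+ 2) eta isT C30 n0.
exists (B1 + B2 + B3) => [|x Y th x0 Y0 t1 xt H]; first by rewrite !addr_ge0.
have x4 : 0 <= eta * x ^+ 4 by rewrite mulr_ge0 ?exprn_ge0 // ltW.
have eY : 0 <= e * Y ^+ 2 by rewrite mulr_ge0 ?sqr_ge0 // ltW.
have t0 : 0 <= th by lra.
case: H => [E|E|E].
- by have := H1 x x0; rewrite E expr1n mulr1 expr1; lra.
- by have := H2 th t0; rewrite exprD exprM -E mulrA; lra.
have [h|h] := leP (C * x) (e * th ^+ k.+2).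
  have : th ^+ k.+4 * (C * x) <= th ^+ k.+4 * (e * th ^+ k.+2) by rewrite ler_wpM2l // exprn_ge0.
  have -> : th ^+ k.+4 * (e * th ^+ k.+2) = e * Y ^+ 2.
    by rewrite E -exprM mulrCA -exprD e1.
  lra.
have h' : th ^+ k.+2 <= C / e * x by rewrite mulrAC ler_pdivlMr // mulrC ltW.
have : C * th ^+ k.+4 * x <= C * (C / e * x) ^+ 2 * x.
  rewrite ler_wpM2r // ler_wpM2l //; apply: (@le_trans _ _ ((th ^+ k.+2) ^+ 2)).
    by rewrite -exprM ler_weXn2l.
  by rewrite lerXn2r // nnegrE ?exprn_ge0 // mulr_ge0.
have -> : C * (C / e * x) ^+ 2 * x = C * (C / e) ^+ 2 * x ^+ 3 by ring.
have := H3 x x0; lra.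
Qed.
Lemma sq_triangle (w v u : R) : 0 <= w -> 0 <= v -> 0 <= u -> w <= u + v -> u <= w + v ->
  u ^+ 2 / 2 - v ^+ 2 <= w ^+ 2 /\ w ^+ 2 <= 2 * u ^+ 2 + 2 * v ^+ 2.
Proof.
move=> w0 v0 u0 h1 h2; have q1 := sqr_ge0 (u - v); have q2 := sqr_ge0 (w - v).
have a1 : w ^+ 2 <= (u + v) ^+ 2 by rewrite ler_sqr ?nnegrE // addr_ge0.
have a2 : u ^+ 2 <= (w + v) ^+ 2 by rewrite ler_sqr ?nnegrE // addr_ge0.
rewrite sqrrD in a1; rewrite sqrrD in a2; rewrite sqrrB in q1; rewrite sqrrB in q2; split; lra.
Qed.
End Numerics.

(** * Spatial derivatives on a time slice *)

Section Slices.
Variables (R : realType) (n : nat).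
Notation S := (R * Cn R n)%type.
Implicit Types (f g : S -> Cx R).
(** A spatial derivative sees one time slice only, so f may be exchanged for any function with the
    same slice, even one at another time. This allows freezing the time variable and computing at
    the initial time. *)
Lemma dd_slice a f g t t' p : (forall p, f (t, p) = g (t', p)) -> dd (Some a) f (t, p) = dd (Some a) g (t', p).
Proof.
move=> fg; case: a => j b; rewrite !ddE !pdE /pder /=.
have E (c : Cx R) : (fun s : R => f (t, p + (rc s * c) *: delta_mx 0 j)) =
  (fun s : R => g (t', p + (rc s * c) *: delta_mx 0 j)) by apply/funext => s; exact: fg.
have H (c : Cx R) : cderiv (fun s : R => f (t, p + (rc s * c) *: delta_mx 0 j)) 0 =
  cderiv (fun s : R => g (t', p + (rc s * c) *: delta_mx 0 j)) 0 by rewrite E.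
by congr ((_ + _ * _) / _); [exact: (H 1)|exact: (H 'i)].
Qed.
Lemma dd_static f q : (forall t t' p, f (t, p) = f (t', p)) -> dd None f q = 0.
Proof.
move=> H; rewrite ddE; apply: pd_cder => /=.
have -> : (fun s : R => f (Defs.shift None q s)) = fun=> f q by apply/funext => s; rewrite /= (H _ q.1); case: q.
exact: is_cderC.
Qed.
Lemma dds_slice s f g t t' p : (forall p, f (t, p) = g (t', p)) -> dds s f (t, p) = dds s g (t', p).
Proof. by elim: s p => [|a s IH] p fg //=; apply: dd_slice => p'; exact: IH. Qed.
End Slices.

(** * Derivative estimates of a fixed order *)

Section Flow.
Variables (R : realType) (n : nat).
Notation S := (R * Cn R n)%type.
Notation W := (seq ('I_n * bool)).

(** One chart of a rescaled flow, continuous up to time 0 together with its spatial derivatives. The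
    single constant [L] stands for ellipticity, for the size of the entries and for the Lipschitz
    constant in time. The estimates below depend on it and not on [kappa], [U] or [G], which makes
    them uniform in r. *)
Record flow (tB kappa L : R) (U : set (Cn R n)) (G : S -> 'M[Cx R]_n) : Prop := Flow {
  fl_k : 0 < kappa;
  fl_U : open U;
  fl_s : forall i j, smooth_st [set q | 0 < q.1 < tB /\ U q.2] (fun q => G q i j);
  fl_t : forall t i j, 0 <= t < tB -> smooth_st (setT `*` U) (fun q => G (t, q.2) i j);
  fl_c : forall s i j, cw [set q | 0 <= q.1 < tB /\ U q.2] (dds s (fun q => G q i j));
  fl_p : forall q, 0 <= q.1 < tB -> U q.2 -> hermpos (G q);
  fl_e : forall q i j, 0 < q.1 < tB -> U q.2 -> dd None (fun q => G q i j) q =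
    rc kappa * (Lop G (fun q => G q i j) q + ev G (R0 R i j) q);
  fl_L : 1 <= L;
  fl_up : forall q, 0 <= q.1 < tB -> U q.2 -> forall u, cre (sesq (G q) u u) <= L * sqn u;
  fl_b : forall q, 0 <= q.1 < tB -> U q.2 -> forall i j, nm (invmx (G q) i j) <= L;
  fl_G : forall q, 0 <= q.1 < tB -> U q.2 -> forall i j, nm (G q i j) <= L;
  fl_lip : forall t t' p i j, 0 <= t < tB -> 0 <= t' < tB -> U p -> nm (G (t, p) i j - G (t', p) i j) <= L * `|t - t'|
}.

Definition fam (G : S -> 'M[Cx R]_n) (k : nat) (x : k.-tuple ('I_n * bool) * ('I_n * 'I_n)) : S -> Cx R :=
  dds (tval x.1) (fun q => G q x.2.1 x.2.2).
Definition Nk G k : S -> R := sqs (@fam G k).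
Definition cnt (k : nat) : R := #|{: k.-tuple ('I_n * bool) * ('I_n * 'I_n)}|%:R.

Lemma word_le (G : S -> 'M[Cx R]_n) (s : W) i j q : nm (dds s (fun q => G q i j) q) ^+ 2 <= Nk G (size s) q.
Proof.
rewrite /Nk /sqs (bigD1 (in_tuple s, (i, j))) //= /fam /= lerDl.
by apply: sumr_ge0 => x _; exact: sqr_ge0.
Qed.
Lemma Nk_ge0 G k q : 0 <= Nk G k q.
Proof. by apply: sumr_ge0 => x _; exact: sqr_ge0. Qed.
Lemma Nk_le (G : S -> 'M[Cx R]_n) k q (C : R) : (forall s i j, size s = k -> nm (dds s (fun q => G q i j) q) <= C) -> Nk G k q <= cnt k * C ^+ 2.
Proof.
move=> H; rewrite /cnt mulr_natl -sumr_const; apply: ler_sum => x _.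
have h := H (tval x.1) x.2.1 x.2.2 (size_tuple _).
by rewrite ler_sqr ?nnegrE ?nm_ge0 // (le_trans (nm_ge0 _) h).
Qed.
Lemma gsqE (q : S) f : gsq q f = \sum_(a : 'I_n * bool) nm (dd (Some a) f q) ^+ 2.
Proof.
transitivity (\sum_(k < n) \sum_(c : bool) nm (dd (Some (k, c)) f q) ^+ 2).
  by rewrite /gsq /g1 -big_split /=; apply: eq_bigr => k _; rewrite big_bool /= addrC.
by rewrite pair_bigA /=; apply: eq_bigr => -[k c].
Qed.
(** Words are ordered, so prefixing a letter is a bijection onto the words of length k + 1, and the
    gradient of the k-th family is exactly the next family. *)
Lemma gsqs_fam G k q : gsqs q (@fam G k) = Nk G k.+1 q.
Proof.
rewrite /gsqs; under eq_bigr do rewrite gsqE.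
rewrite exchange_big /= (pair_bigA _ (fun (a : 'I_n * bool) (x : k.-tuple ('I_n * bool) * ('I_n * 'I_n)) => nm (dd (Some a) (@fam G k x) q) ^+ 2)) /=.
rewrite /Nk /sqs.
rewrite (reindex (fun ax : ('I_n * bool) * (k.-tuple ('I_n * bool) * ('I_n * 'I_n)) => ([tuple of ax.1 :: ax.2.1], ax.2.2))) //=.
exists (fun y : k.+1.-tuple ('I_n * bool) * ('I_n * 'I_n) => (thead y.1, ([tuple of behead y.1], y.2))).
  by move=> [a [w ij]] _ /=; rewrite theadE; congr (_, (_, _)); apply: val_inj.
by move=> [w ij] _ /=; congr (_, _); rewrite [RHS]tuple_eta.
Qed.

Lemma gsqs_base (G : S -> 'M[Cx R]_n) q : gsqs q (fun (x : 'I_n * 'I_n) q => G q x.1 x.2) = Nk G 1 q.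
Proof.
rewrite -gsqs_fam /gsqs (reindex (fun x : 0.-tuple ('I_n * bool) * ('I_n * 'I_n) => x.2)) /=.
  by apply: eq_bigr => -[w x] _; congr (gsq q _); rewrite /fam /=; case: w => -[].
by exists (fun x => ([tuple], x)) => [[w x] _|x _] //=; congr (_, _); case: w => -[] // p; apply: val_inj.
Qed.

Definition Crho (m : nat) (D : R) : R :=
  \sum_(x : m.-tuple ('I_n * bool) * ('I_n * 'I_n)) cb D (Rw R (tval x.1) x.2.1 x.2.2).
Lemma Crho_ge0 m D : 0 <= D -> 0 <= Crho m D.
Proof. by move=> D0; apply: sumr_ge0 => x _; exact: cb_ge0. Qed.

Lemma ev_Rw_bound (G : S -> 'M[Cx R]_n) m q (D th : R) (s : W) i j : 0 <= D -> 1 <= th -> size s = m ->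
  (forall i j, nm (invmx (G q) i j) <= D) ->
  (forall s i j, (size s <= m.+1)%N -> nm (dds s (fun q => G q i j) q) <= D * th ^+ size s) ->
  nm (ev G (Rw R s i j) q) <= cb D (Rw R s i j) * th ^+ m.+2.
Proof.
move=> D0 t1 sm Hb H; apply: (@le_trans _ _ (cb D (Rw R s i j) * th ^+ wtx (Rw R s i j))).
  apply: ev_bound => // s' i' j' h; apply: H; apply: leq_trans h _.
  by apply: leq_trans (ordx_Rw _ _ _ _) _; rewrite sm.
rewrite ler_wpM2l ?cb_ge0 // ler_weXn2l // -sm; exact: wtx_Rw.
Qed.

Lemma source_sum (G : S -> 'M[Cx R]_n) m q (D th y : R) : 0 <= D -> 1 <= th ->
  (forall i j, nm (invmx (G q) i j) <= D) ->
  (forall s i j, (size s <= m.+1)%N -> nm (dds s (fun q => G q i j) q) <= D * th ^+ size s) ->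
  (forall x, nm (@fam G m x q) <= y) ->
  \sum_x nm (ev G (Rw R (tval x.1) x.2.1 x.2.2) q) * nm (@fam G m x q) <= Crho m D * th ^+ m.+2 * y.
Proof.
move=> D0 t1 Hb H Hy; rewrite /Crho -mulrA mulr_suml; apply: ler_sum => x _; rewrite mulrA.
by apply: ler_pM; rewrite ?nm_ge0 //; apply: ev_Rw_bound => //; rewrite size_tuple.
Qed.

Lemma fam_le G k x q : nm (@fam G k x q) <= Num.sqrt (Nk G k q).
Proof.
rewrite -(ger0_norm (nm_ge0 _)) -sqrtr_sqr ler_wsqrtr // /Nk /sqs (bigD1 x) //= lerDl.
by apply: sumr_ge0 => y _; exact: sqr_ge0.
Qed.
Lemma word_le_sqrt (G : S -> 'M[Cx R]_n) (s : W) i j q : nm (dds s (fun q => G q i j) q) <= Num.sqrt (Nk G (size s) q).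
Proof. by rewrite -(ger0_norm (nm_ge0 _)) -sqrtr_sqr ler_wsqrtr // word_le. Qed.

Section FlowFacts.
Variables (tB kappa L : R) (U : set (Cn R n)) (G : S -> 'M[Cx R]_n).
Hypothesis fl : flow tB kappa L U G.
Variables (p0 : Cn R n) (c t0 T : R).
Hypotheses (t00 : 0 <= t0) (TB : T < tB) (cU : forall p, dist2 p0 p <= c -> U p).
Let O : set S := [set q | 0 < q.1 < tB /\ U q.2].
Notation K := (slab p0 c t0 T).

Lemma slab_dom q : K q -> 0 <= q.1 < tB /\ U q.2.
Proof. by move=> [/andP[a b] d]; split; [rewrite (le_trans t00 a) (le_lt_trans b TB)|exact: cU]. Qed.
Lemma flow_open : open O. Proof. exact: open_slab (fl_U fl). Qed.
Lemma flow_unit q : O q -> G q \in unitmx.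
Proof. by move=> [/andP[a b] u]; apply: hermpos_unit; apply: (fl_p fl) => //; rewrite (ltW a) b. Qed.
Lemma flow_pos q : O q -> hermpos (G q).
Proof. by move=> [/andP[a b] u]; apply: (fl_p fl) => //; rewrite (ltW a) b. Qed.
Lemma sm_fam k x : smooth_st O (@fam G k x).
Proof. exact: (sm_dds flow_open _ (fl_s fl _ _)). Qed.
Lemma cw_sqs (I : finType) (f : I -> S -> Cx R) : (forall i, cw K (f i)) -> cw K (sqs f).
Proof.
move=> H q Kq; apply: cvg_sumR => i; have h : (fun x => nm (f i x)) @ within K (nbhs q) --> nm (f i q) by exact: (cvg_nmf _ (H i q Kq)).
by rewrite expr2; apply: (cvgM h h).
Qed.
Lemma cw_word s i j : cw K (dds s (fun q => G q i j)).
Proof.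
move=> q Kq; apply: cvg_trans (fl_c fl (slab_dom Kq)); apply: cvg_app.
by apply: within_subset => x; exact: slab_dom.
Qed.
Lemma Nk_evol k x q : O q -> dd None (@fam G k x) q =
  rc kappa * (Lop G (@fam G k x) q + ev G (Rw R (tval x.1) x.2.1 x.2.2) q).
Proof.
move=> Oq.
have EQ q' i j : O q' -> dd None (fun q => G q i j) q' = rc kappa * (Lop G (fun q => G q i j) q' + ev G (R0 R i j) q').
  by move=> [a b]; exact: (fl_e fl).
exact: (evolution flow_open (fl_s fl) flow_unit EQ (tval x.1) x.2.1 x.2.2 Oq).
Qed.
Lemma Nk_heat k q : O q -> cre (heat G kappa q (fun q => rc (Nk G k q))) <=
  kappa * (2 * (\sum_x nm (ev G (Rw R (tval x.1) x.2.1 x.2.2) q) * nm (@fam G k x q)) - Nk G k.+1 q / L).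
Proof.
move=> Oq; have L0 : 0 < L by have := fl_L fl; lra.
have [/andP[a b] u] := Oq.
have a' : 0 <= q.1 < tB by rewrite (ltW a) b.
rewrite -gsqs_fam; apply: (sqs_heat flow_open flow_pos (fl_k fl) Oq L0 (fl_up fl a' u)) => x.
  exact: sm_fam.
exact: Nk_evol.
Qed.
Lemma Nk_grad k q : O q -> g1 (gr q (fun q => rc (Nk G k q))) <= 2 * Nk G k q * Nk G k.+1 q.
Proof. by move=> Oq; rewrite -gsqs_fam; apply: (sqs_grad flow_open Oq) => x; exact: sm_fam. Qed.
Lemma sm_Nk k : smooth_st O (fun q => rc (Nk G k q)).
Proof. by apply: (sm_sqs flow_open) => x; exact: sm_fam. Qed.
Lemma cw_Nk k : cw K (Nk G k).
Proof. by apply: cw_sqs => x; exact: cw_word. Qed.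
End FlowFacts.

Lemma slab_le p0 (c c' t0 T : R) (q : S) : c' <= c -> slab p0 c' t0 T q -> slab p0 c t0 T q.
Proof. by move=> cc [a b]; split=> //; exact: le_trans cc. Qed.
(** On the smaller cylinder the cutoff is at least c - c'; the inequality x <= 1 + x^2 spares a
    square root. *)
Lemma cutoff_bound p0 (c c' t0 T N Bd x : R) (q : S) : c' < c -> slab p0 c' t0 T q ->
  zeta p0 c q ^+ 2 * N <= Bd -> 0 <= x -> x ^+ 2 <= N -> x <= 1 + `|Bd| / (c - c') ^+ 2.
Proof.
move=> cc [_ b] h x0 xN; have zq : c - c' <= zeta p0 c q by rewrite /zeta; lra.
have h2 : (c - c') ^+ 2 * x ^+ 2 <= `|Bd|.
  apply: le_trans (ler_norm Bd); apply: le_trans h; apply: ler_pM; rewrite ?sqr_ge0 //.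
  by rewrite ler_sqr ?nnegrE //; lra.
have d0 : 0 < (c - c') ^+ 2 by rewrite exprn_gt0 //; lra.
have : x ^+ 2 <= `|Bd| / (c - c') ^+ 2 by rewrite ler_pdivlMr // mulrC.
move: (_ / _) => y; nra.
Qed.

(** X, E and Y2 are the squared norms of the derivatives of orders k + 2, k + 1 and k + 3. By
    [source_high] the nonlinear source costs an arbitrarily small multiple of X^2, so that a bound
    for E, small or not, is enough. *)
Lemma order_high (k : nat) (L C c c' : R) : 1 <= L -> 0 <= C -> 0 <= c' -> c' < c -> exists2 B : R, 0 <= B &
  forall tB kappa U G p0 t0 T, flow tB kappa L U G -> 0 <= t0 -> T < tB ->
  (forall p, dist2 p0 p <= c -> U p) ->
  (forall s i j q, slab p0 c t0 T q -> (size s < k.+2)%N -> nm (dds s (fun q => G q i j) q) <= C) ->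
  (forall s i j p, dist2 p0 p <= c -> size s = k.+2 -> nm (dds s (fun q => G q i j) (t0, p)) <= C) ->
  forall s i j q, slab p0 c' t0 T q -> size s = k.+2 -> nm (dds s (fun q => G q i j) q) <= B.
Proof.
have e1 : (k.+3 < k.+2 * 2)%N by lia.
move=> L1 C0 c'0 cc; have L0 : 0 < L by lra.
pose D := C + L; have D1 : 1 <= D by rewrite /D; lra.
have D0 : 0 <= D by lra.
(* The good terms in [Nk_heat] carry the coefficient 1 / L. Half of it absorbs the sources, and a
   quarter is what is kept. *)
pose lam := (4 * L)^-1; have l0 : 0 < lam by rewrite invr_gt0; lra.
have lE : lam = L^-1 / 4 by rewrite /lam invfM mulrC.
have Li : 0 < L^-1 by rewrite invr_gt0.
pose E0 := cnt k.+1 * D ^+ 2.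
have E00 : 0 <= E0 by rewrite mulr_ge0 ?ler0n // sqr_ge0.
have nL : 0 <= n%:R * L * E0 by rewrite !mulr_ge0 ?ler0n // ltW.
(* M is taken large compared with the bound E0 of E, as the gradient term |dE|^2 <= 2 E X demands.
   Only afterwards is the coefficient [eta] of X^2 fixed, as lam / (8 M). *)
pose M := E0 + 32 * (n%:R * L * E0) / lam + 1.
have M0 : 0 < M by rewrite /M ltr_wpDl // addr_ge0 // divr_ge0 ?(ltW l0) // mulr_ge0.
have ME : E0 <= M by rewrite /M -addrA lerDl addr_ge0 // divr_ge0 ?(ltW l0) // mulr_ge0.
have ME2 : 32 * (n%:R * L * E0) <= lam * M.
  rewrite /M !mulrDr (mulrC lam (_ / lam)) divfK ?gt_eqF // mulr1.
  have : 0 <= lam * E0 by rewrite mulr_ge0 // ltW.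
  lra.
pose eta := lam / (8 * M); have eta0 : 0 < eta by rewrite divr_gt0 //; lra.
have C20 : 0 <= 2 * Crho k.+2 D by rewrite mulr_ge0 // Crho_ge0.
have L20 : 0 < L^-1 / 2 by lra.
have [B1 B10 H1] := source_high k C20 L20 eta0.
have C30 : 0 <= 2 * Crho k.+1 D * D by rewrite !mulr_ge0 // Crho_ge0.
have [B2 B20 H2] := @pow_absorb R k.+3 (k.+2 * 2) (2 * Crho k.+1 D * D) (L^-1 / 2) e1 C30 L20.
pose X0 := cnt k.+2 * D ^+ 2.
have X00 : 0 <= X0 by rewrite mulr_ge0 ?ler0n // sqr_ge0.
pose Bd := 2 * (c ^+ 2 * X0 + c ^+ 2 + 2 / lam * ((2 * M * B1 + (B2 + L^-1) + lam * 0) * c ^+ 2 + 2 * M * ((6 * c * n%:R * L + c) +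
      4 * n%:R * L * (16 * n%:R * L / lam + 1) * (6 * c * n%:R * L + c)))).
exists (1 + `|Bd| / (c - c') ^+ 2).
  by rewrite addr_ge0 // divr_ge0 // sqr_ge0.
move=> tB kappa U G p0 t0 T fl t00 TB cU Hlow Hinit s i j q Kq sk.
have upb q' : slab p0 c t0 T q' -> forall i j, nm (invmx (G q') i j) <= L.
  by move=> /(slab_dom t00 TB cU)[a b]; exact: fl_b fl _ a b.
have HR := bernstein_region (fl_U fl) (flow_pos fl) (fl_k fl) t00 TB (ltW (le_lt_trans c'0 cc)) cU (ltW L0) upb
  (X := Nk G k.+2) (E := Nk G k.+1) (Y2 := Nk G k.+3) (lam := lam) (M := M) (A := eta) (B := B1) (B' := B2 + L^-1) (C1 := 2) (K1 := 0) (X0 := X0).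
have Hlow' s' i' j' q' : slab p0 c t0 T q' -> (size s' < k.+2)%N -> nm (dds s' (fun q => G q i' j') q') <= D.
  by move=> K' h; apply: le_trans (Hlow _ _ _ _ K' h) _; rewrite /D lerDl; exact: ltW.
have bD q' i' j' : slab p0 c t0 T q' -> nm (invmx (G q') i' j') <= D.
  move=> K'; have [a b] := slab_dom t00 TB cU K'; apply: le_trans (fl_b fl a b i' j') _; rewrite /D lerDr; exact: C0.
have Dpow th (m : nat) (y : R) : 1 <= th -> y <= D -> y <= D * th ^+ m.
  by move=> h1 h2; apply: le_trans h2 _; rewrite ler_peMr // exprn_ege1.
have Dpow2 th (m : nat) (y : R) : 1 <= th -> y <= th ^+ m -> y <= D * th ^+ m.
  by move=> h1 h2; apply: le_trans h2 _; rewrite ler_peMl // exprn_ge0 // (le_trans ler01 h1).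
have EB q' : slab p0 c t0 T q' -> Nk G k.+1 q' <= E0.
  by move=> K'; apply: Nk_le => s' i' j' h; apply: Hlow' => //; rewrite h.
have {}HR : forall q, slab p0 c t0 T q -> zeta p0 c q ^+ 2 * Nk G k.+2 q <= Bd.
  apply: HR => //.
  - exact: (sm_Nk fl).
  - exact: (sm_Nk fl).
  - exact: (cw_Nk fl).
  - exact: (cw_Nk fl).
  - exact: ltW.
  - by rewrite addr_ge0 // ltW.
  - by move=> x; exact: Nk_ge0.
  - move=> q' Oq K'; split; first exact: Nk_ge0.
    + apply: le_trans (Nk_heat fl k.+2 Oq) _; rewrite ler_pM2l ?(fl_k fl) //.
      have [th [t1 tx tY tE]] := scale_exists k.+1 (sqrtr_ge0 (Nk G k.+2 q')) (sqrtr_ge0 (Nk G k.+3 q')).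
      have S1 : \sum_x nm (ev G (Rw R (tval x.1) x.2.1 x.2.2) q') * nm (@fam G k.+2 x q') <=
        Crho k.+2 D * th ^+ k.+4 * Num.sqrt (Nk G k.+2 q').
        apply: source_sum => //.
        - by move=> i' j'; exact: bD.
        - move=> s' i' j' h; rewrite leq_eqVlt in h; case/orP: h => [/eqP h|h].
            by apply: Dpow2 => //; apply: le_trans (word_le_sqrt _ _ _ _ _) _; rewrite h.
          rewrite ltnS leq_eqVlt in h; case/orP: h => [/eqP h|h].
            by apply: Dpow2 => //; apply: le_trans (word_le_sqrt _ _ _ _ _) _; rewrite h.
          by apply: Dpow => //; exact: Hlow'.
        - by move=> x; exact: fam_le.
      have := H1 _ _ _ (sqrtr_ge0 (Nk G k.+2 q')) (sqrtr_ge0 (Nk G k.+3 q')) t1 tx tE.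
      rewrite sqr_sqrtr ?Nk_ge0 // (_ : Num.sqrt (Nk G k.+2 q') ^+ 4 = Nk G k.+2 q' ^+ 2); last first.
        by rewrite (_ : 4 = 2 * 2)%N // exprM sqr_sqrtr ?Nk_ge0.
      have := Nk_ge0 G k.+3 q'; rewrite lE => N3 h; have h5 : 0 <= Nk G k.+3 q' * L^-1 by rewrite mulr_ge0 // ltW.
      move: S1 N3 h h5; forget; lra.
    + exact: (Nk_grad fl).
    + apply: le_trans (Nk_heat fl k.+1 Oq) _; rewrite ler_pM2l ?(fl_k fl) //.
      have [th [t1 tx _ tE]] := scale_exists k.+1 (sqrtr_ge0 (Nk G k.+2 q')) (lexx (0 : R)).
      have S1 : \sum_x nm (ev G (Rw R (tval x.1) x.2.1 x.2.2) q') * nm (@fam G k.+1 x q') <=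
        Crho k.+1 D * th ^+ k.+3 * D.
        apply: source_sum => //.
        - by move=> i' j'; exact: bD.
        - move=> s' i' j' h; rewrite leq_eqVlt in h; case/orP: h => [/eqP h|h].
            by apply: Dpow2 => //; apply: le_trans (word_le_sqrt _ _ _ _ _) _; rewrite h.
          by apply: Dpow => //; exact: Hlow'.
        - by move=> x; apply: Hlow' => //; rewrite size_tuple.
      have := H2 th (le_trans ler01 t1).
      have : th ^+ (k.+2 * 2) <= Nk G k.+2 q' + 1.
        case: tE => [->|E|E]; first by rewrite expr1n lerDr Nk_ge0.
          by rewrite exprM -E sqr_sqrtr ?Nk_ge0 // lerDl.
        have : 1 <= th ^+ k.+3 by rewrite exprn_ege1.
        by rewrite -E; forget; lra.
      move=> h1 h2; have h3 : L^-1 / 2 * th ^+ (k.+2 * 2) <= L^-1 / 2 * (Nk G k.+2 q' + 1) by rewrite ler_wpM2l // ltW.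
      have : 0 <= Nk G k.+2 q' * L^-1 by rewrite mulr_ge0 ?Nk_ge0 // ltW.
      rewrite lE; move: S1 h1 h2 h3 B20 Li; forget; lra.
    + by rewrite addr0; exact: (Nk_grad fl).
  - move=> q' K'; split; first exact: Nk_ge0.
      exact: le_trans (EB _ K') ME.
    apply: le_trans ME2; have h0 : 0 <= 32 * (n%:R * L) by rewrite !mulr_ge0 ?ler0n // ltW.
    have := ler_wpM2l h0 (EB _ K'); forget; lra.
  - by rewrite /eta mulrC divfK // gt_eqF // mulr_gt0.
  - move=> p dp; apply: Nk_le => s' i' j' h; apply: le_trans (Hinit _ _ _ _ dp h) _; rewrite /D lerDl; exact: ltW.
have w := word_le G s i j q; rewrite sk in w.
exact: (cutoff_bound cc Kq (HR q (slab_le (ltW cc) Kq)) (nm_ge0 _) w).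
Qed.

(* At order one the source is as large as the good term, so the gradient bound uses that the
   metric moves little on a time interval whose length depends only on [L]. *)
Lemma order_first (L : R) : 1 <= L -> exists2 delta : R, 0 < delta &
  forall C c c' : R, 0 <= C -> 0 <= c' -> c' < c -> exists2 B : R, 0 <= B &
  forall tB kappa U G p0 t0 T, flow tB kappa L U G -> 0 <= t0 -> t0 <= T -> T < tB -> T <= t0 + delta ->
  (forall p, dist2 p0 p <= c -> U p) ->
  (forall s i j p, dist2 p0 p <= c -> (size s <= 2)%N -> nm (dds s (fun q => G q i j) (t0, p)) <= C) ->
  forall s i j q, slab p0 c' t0 T q -> size s = 1%N -> nm (dds s (fun q => G q i j) q) <= B.
Proof.
move=> L1; have L0 : 0 < L by lra.
pose lam := (4 * L)^-1; have l0 : 0 < lam by rewrite invr_gt0; lra.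
have lE : lam = L^-1 / 4 by rewrite /lam invfM mulrC.
have Li : 0 < L^-1 by rewrite invr_gt0.
have L20 : 0 < L^-1 / 2 by lra.
have C20 : 0 <= 2 * Crho 1 L by rewrite mulr_ge0 // Crho_ge0 // ltW.
have [A0 [B1 [A00 B10 H1]]] := source_first C20 L20.
(* The coefficient A of X^2 is imposed by the critical source, so 8 M A <= lam forces M to be small,
   and with it E <= M. *)
pose A := A0 + 1; pose M := lam / (8 * A).
have A1 : 0 < A by rewrite /A; lra.
have M0 : 0 < M by rewrite divr_gt0 //; lra.
pose n2 : R := #|{: 'I_n * 'I_n}|%:R.
have n20 : 0 <= n2 by exact: ler0n.
have nn0 : 0 <= n%:R :> R by exact: ler0n.
pose Cb := \sum_(x : 'I_n * 'I_n) cb L (R0 R x.1 x.2).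
have Cb0 : 0 <= Cb by apply: sumr_ge0 => x _; apply: cb_ge0; lra.
pose Q := n2 + 64 * (n%:R * L * n2) / lam + 1.
have Q1 : 1 <= Q by rewrite /Q lerDr addr_ge0 // divr_ge0 ?(ltW l0) // !mulr_ge0 // ltW.
(* [sg] will bound the entries of G - G(t0). The bound M / Q keeps E below M and the gradient term
   of E below lam M; the last bound ensures that the source, quadratic in dG and multiplied by |G -
   G(t0)|, uses up at most half of the good term. *)
pose sg := Num.min 1 (Num.min (M / Q) (16 * L * (Cb + 1))^-1).
have sg0 : 0 < sg.
  have q0 : 0 < M / Q by apply: divr_gt0 => //; lra.
  have c0 : 0 < Cb + 1 by lra.
  have r0 : 0 < (16 * L * (Cb + 1))^-1 by rewrite invr_gt0 !mulr_gt0.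
  by rewrite !lt_min ltr01 q0 r0.
have sg1 : sg <= 1 by rewrite ge_min lexx.
have sgM : sg * Q <= M.
  by rewrite -ler_pdivlMr ?ge_min ?lexx ?orbT //; lra.
have sgC : 4 * sg * Cb <= lam.
  have : sg <= (16 * L * (Cb + 1))^-1 by rewrite !ge_min lexx !orbT.
  move=> h; have : sg * Cb <= (16 * L * (Cb + 1))^-1 * (Cb + 1) by apply: ler_pM => //; lra.
  have -> : (16 * L * (Cb + 1))^-1 * (Cb + 1) = lam / 4.
    by rewrite /lam; field; rewrite !gt_eqF //; lra.
  lra.
have sq1 : sg ^+ 2 <= sg by rewrite expr2 ler_piMr // ltW.
have E1 : n2 * sg ^+ 2 <= M.
  apply: le_trans sgM; rewrite mulrC; apply: ler_pM => //; first exact: sqr_ge0.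
  by rewrite /Q -addrA lerDl addr_ge0 // divr_ge0 ?(ltW l0) // !mulr_ge0 // ltW.
have E2 : 64 * (n%:R * L * n2) * sg ^+ 2 <= lam * M.
  apply: (@le_trans _ _ (lam * (sg * Q))); last by rewrite ler_wpM2l // ltW.
  have h : 64 * (n%:R * L * n2) <= lam * Q.
    rewrite /Q !mulrDr (mulrC lam (_ / lam)) divfK ?gt_eqF // mulr1.
    have : 0 <= lam * n2 by rewrite mulr_ge0 // ltW.
    lra.
  rewrite (mulrCA lam) mulrC; apply: ler_pM => //; first exact: sqr_ge0.
  by rewrite !mulr_ge0 // ltW.
exists (sg / L); first by rewrite divr_gt0.
move=> C c c' C0 c'0 cc.
pose K1 := cnt 1 * C ^+ 2; have K10 : 0 <= K1 by rewrite mulr_ge0 ?ler0n ?sqr_ge0.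
pose LK := n2 * (L * C); have LK0 : 0 <= LK by rewrite !mulr_ge0 // ltW.
pose B' := 4 * Cb + 2 * (n2 * LK) + K1 * L^-1.
have B'0 : 0 <= B' by rewrite !addr_ge0 ?mulr_ge0 // ltW.
pose X0 := cnt 1 * C ^+ 2.
pose Bd := 2 * (c ^+ 2 * X0 + c ^+ 2 + 2 / lam * ((2 * M * B1 + B' + lam * K1) * c ^+ 2 + 2 * M * ((6 * c * n%:R * L + c) +
      4 * n%:R * L * (16 * n%:R * L / lam + 1) * (6 * c * n%:R * L + c)))).
exists (1 + `|Bd| / (c - c') ^+ 2).
  by rewrite addr_ge0 // divr_ge0 // sqr_ge0.
move=> tB kappa U G p0 t0 T fl t00 t0T TB Td cU Hinit s i j q Kq sk.
have t0B : 0 <= t0 < tB by rewrite t00 (le_lt_trans t0T TB).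
have oO := flow_open fl.
pose kf (x : 'I_n * 'I_n) (q : S) := G (t0, q.2) x.1 x.2.
pose e (x : 'I_n * 'I_n) (q : S) := G q x.1 x.2 - kf x q.
have skf x : smooth_st [set q | 0 < q.1 < tB /\ U q.2] (kf x).
  have /smooth_stP H := fl_t fl x.1 x.2 t0B; apply/smooth_stP => k.
  by apply: Ck_sub (H k) => q' [_ ?].
have se x : smooth_st [set q | 0 < q.1 < tB /\ U q.2] (e x) by exact: (smB oO (fl_s fl _ _) (skf x)).
have dkf s' x q' : dds s' (kf x) q' = dds s' (fun q => G q x.1 x.2) (t0, q'.2).
  by case: q' => t p; apply: dds_slice.
have upb q' : slab p0 c t0 T q' -> forall i j, nm (invmx (G q') i j) <= L.
  by move=> /(slab_dom t00 TB cU)[a b]; exact: fl_b fl _ a b.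
have sB x q' : slab p0 c t0 T q' -> nm (e x q') <= sg.
  move=> K'; have [a b] := slab_dom t00 TB cU K'.
  apply: le_trans (_ : L * `|q'.1 - t0| <= _).
    by rewrite /e /kf {1}(surjective_pairing q'); exact: (fl_lip fl).
  have [/andP[q1 q2] _] := K'; rewrite ger0_norm ?subr_ge0 // mulrC -ler_pdivlMr // lerBlDl.
  exact: le_trans q2 Td.
have EB q' : slab p0 c t0 T q' -> sqs e q' <= n2 * sg ^+ 2.
  move=> K'; rewrite /n2 mulr_natl -sumr_const; apply: ler_sum => x _.
  by rewrite ler_sqr ?nnegrE ?nm_ge0 ?sB // ltW.
have Kin q' s' i' j' : slab p0 c t0 T q' -> (size s' <= 2)%N -> nm (dds s' (fun q => G q i' j') (t0, q'.2)) <= C.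
  by move=> [_ d] h; exact: Hinit.
(* Up to the initial gradient, whose square is at most K1, the gradient of G - G(t0) is that of G.
   This lets the good term in the heat inequality of E be expressed by X. *)
have gK q' : slab p0 c t0 T q' -> [set q | 0 < q.1 < tB /\ U q.2] q' ->
    Nk G 1 q' / 2 - K1 <= gsqs q' e /\ gsqs q' e <= 2 * Nk G 1 q' + 2 * K1.
  move=> K' Oq.
  have kN : gsqs q' kf <= K1.
    rewrite /K1 /cnt mulr_natl -sumr_const.
    rewrite (gsqs_base (fun q => G (t0, q.2))).
    apply: ler_sum => x _; rewrite ler_sqr ?nnegrE ?nm_ge0 //.
    rewrite /fam (dkf _ x.2); apply: Kin => //; by rewrite size_tuple.
  have gG := gsqs_base G q'.
  have T1 x a : nm (dd (Some a) (fun q => G q x.1 x.2) q') ^+ 2 / 2 - nm (dd (Some a) (kf x) q') ^+ 2 <= nm (dd (Some a) (e x) q') ^+ 2 /\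
      nm (dd (Some a) (e x) q') ^+ 2 <= 2 * nm (dd (Some a) (fun q => G q x.1 x.2) q') ^+ 2 + 2 * nm (dd (Some a) (kf x) q') ^+ 2.
    rewrite (ddB oO _ (fl_s fl x.1 x.2) (skf x) Oq).
    set u := dd _ _ q'; set v := dd _ _ q'.
    have h1 := nmB u v; have h2 := nmD (u - v) v; rewrite subrK in h2.
    have := nm_ge0 u; have := nm_ge0 v; have := nm_ge0 (u - v) => w0 v0 u0.
    exact: sq_triangle.
  have T2 x : gsq q' (fun q => G q x.1 x.2) / 2 - gsq q' (kf x) <= gsq q' (e x) /\ gsq q' (e x) <= 2 * gsq q' (fun q => G q x.1 x.2) + 2 * gsq q' (kf x).
    rewrite !gsqE !mulr_sumr mulr_suml -sumrB -big_split /=; split; apply: ler_sum => a _; by case: (T1 x a).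
  rewrite -gG; split.
    apply: (@le_trans _ _ (gsqs q' (fun (x : 'I_n * 'I_n) q => G q x.1 x.2) / 2 - gsqs q' kf)); first by rewrite lerD2l lerN2.
    by rewrite /gsqs mulr_suml -sumrB; apply: ler_sum => x _; case: (T2 x).
  apply: (@le_trans _ _ (2 * gsqs q' (fun (x : 'I_n * 'I_n) q => G q x.1 x.2) + 2 * gsqs q' kf)); last by rewrite lerD2l ler_pM2l.
  by rewrite /gsqs !mulr_sumr -big_split /=; apply: ler_sum => x _; case: (T2 x).
have HR := bernstein_region (fl_U fl) (flow_pos fl) (fl_k fl) t00 TB (ltW (le_lt_trans c'0 cc)) cU (ltW L0) upb
  (X := Nk G 1) (E := sqs e) (Y2 := Nk G 2) (lam := lam) (M := M) (A := A) (B := B1) (B' := B') (C1 := 4) (K1 := K1) (X0 := X0).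
have {}HR : forall q, slab p0 c t0 T q -> zeta p0 c q ^+ 2 * Nk G 1 q <= Bd.
  apply: HR => //.
  - exact: (sm_Nk fl).
  - exact: (sm_sqs oO se).
  - exact: (cw_Nk fl).
  - apply: cw_sqs => x q' K'; apply: cvgB; first exact: (cw_word fl t00 TB cU (s := [::])).
    have h : (fun y : S => (t0, y.2)) @ within (slab p0 c t0 T) (nbhs q') --> ((t0, q'.2) : S).
      apply: cvg_pair2; first exact: cvg_cst.
      by apply: cvg_within_filter; exact: cvg_snd.
    have [a b] := slab_dom t00 TB cU K'.
    have /(_ (t0, q'.2)) := @sm_cts _ _ _ (fun q => G (t0, q.2) x.1 x.2) _ (fl_t fl x.1 x.2 t0B).
    move=> /(_ (conj I b)) h2.
    have h3 : (fun y : S => y) @ within (slab p0 c t0 T) (nbhs q') --> q' by apply: cvg_within_filter; exact: cvg_id.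
    have h4 : {for q', continuous (kf x)} by apply: (sm_cts (fl_t fl x.1 x.2 t0B)).
    exact: (cvg_comp _ _ h3 h4).
  - exact: ltW.
  - by move=> x; exact: Nk_ge0.
  - move=> q' Oq K'; split; first exact: Nk_ge0.
    + apply: le_trans (Nk_heat fl 1 Oq) _; rewrite ler_pM2l ?(fl_k fl) //.
      have [th [t1 tx tY tE]] := scale_exists 0 (sqrtr_ge0 (Nk G 1 q')) (sqrtr_ge0 (Nk G 2 q')).
      have S1 : \sum_x nm (ev G (Rw R (tval x.1) x.2.1 x.2.2) q') * nm (@fam G 1 x q') <=
        Crho 1 L * th ^+ 3 * Num.sqrt (Nk G 1 q').
        apply: source_sum => //; first exact: ltW.
        - by move=> i' j'; exact: upb.
        - have P m (y : R) : y <= th ^+ m -> y <= L * th ^+ m.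
            by move=> h2; apply: le_trans h2 _; rewrite ler_peMl // exprn_ge0 // (le_trans ler01 t1).
          move=> s' i' j'; case: s' => [|a [|a' [|? ?]]] // _.
          + by rewrite /= expr0 mulr1; have [u v] := slab_dom t00 TB cU K'; exact: (fl_G fl).
          + by apply: P; apply: le_trans (word_le_sqrt _ _ _ _ _) _.
          + by apply: P; apply: le_trans (word_le_sqrt _ _ _ _ _) _.
        - by move=> x; exact: fam_le.
      rewrite expr1 in tx.
      have := H1 _ _ _ (sqrtr_ge0 (Nk G 1 q')) (sqrtr_ge0 (Nk G 2 q')) t1 tx tE.
      rewrite sqr_sqrtr ?Nk_ge0 // (_ : Num.sqrt (Nk G 1 q') ^+ 4 = Nk G 1 q' ^+ 2); last first.
        by rewrite (_ : 4 = 2 * 2)%N // exprM sqr_sqrtr ?Nk_ge0.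
      have := sqr_ge0 (Nk G 1 q').
      have := Nk_ge0 G 2 q'; rewrite lE /A => N3 h0 h; have h5 : 0 <= Nk G 2 q' * L^-1 by rewrite mulr_ge0 // ltW.
      move: S1 N3 h0 h h5; forget; lra.
    + exact: (Nk_grad fl).
    + have [a b] := slab_dom t00 TB cU K'.
      pose rho x := Lop G (kf x) q' + ev G (R0 R x.1 x.2) q'.
      have Ee x : dd None (e x) q' = rc kappa * (Lop G (e x) q' + rho x).
        have kt : dd None (kf x) q' = 0.
          exact: dd_static.
        rewrite (ddB oO _ (fl_s fl x.1 x.2) (skf x) Oq) kt subr0.
        have [u v] := Oq; rewrite (fl_e fl x.1 x.2 u v) /rho; congr (_ * _); rewrite addrA; congr (_ + _).
        have -> : Lop G (fun q => G q x.1 x.2) q' = Lop G (fun q => e x q + kf x q) q'.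
          by congr (Lop G _ q'); apply/funext => y; rewrite /e subrK.
        exact: (Lop_D oO _ Oq (se x) (skf x)).
      apply: le_trans (sqs_heat oO (flow_pos fl) (fl_k fl) Oq L0 (fl_up fl a b) se Ee) _.
      rewrite ler_pM2l ?(fl_k fl) //.
      have [g1' _] := gK q' K' Oq.
      have rB x : nm (rho x) <= LK + cb L (R0 R x.1 x.2) * (2 + 2 * Nk G 1 q').
        apply: le_trans (nmD _ _) _; apply: lerD.
          rewrite /Lop (pair_bigA _ (fun k l => invmx (G q') l k * dd (Some (k, false)) (dd (Some (l, true)) (kf x)) q')) /=.
          apply: le_trans (nm_sum _ _ _) _; rewrite /LK /n2 mulr_natl -sumr_const; apply: ler_sum => -[k l] _ /=.
          rewrite nmM; apply: ler_pM; rewrite ?nm_ge0 ?upb //.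
          by rewrite -[dd _ _ q']/(dds [:: (k, false); (l, true)] (kf x) q') dkf; exact: Kin.
        have x0 := sqrtr_ge0 (Nk G 1 q').
        apply: (@le_trans _ _ (cb L (R0 R x.1 x.2) * (1 + Num.sqrt (Nk G 1 q')) ^+ 2)).
          apply: (@ev_Rw_bound G 0 q' L _ [::] x.1 x.2) => //; [exact: ltW|by rewrite lerDl|exact: upb|].
          move=> s' i' j'; case: s' => [|a' [|? ?]] // _.
            by rewrite /= expr0 mulr1; exact: (fl_G fl).
          apply: le_trans (word_le_sqrt _ _ _ _ _) _ => /=; rewrite expr1.
          apply: (@le_trans _ _ (1 + Num.sqrt (Nk G 1 q'))); first by rewrite lerDr.
          by rewrite ler_peMl // addr_ge0.
        apply: ler_wpM2l; first by apply: cb_ge0; exact: ltW.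
        have := sqr_sqrtr (Nk_ge0 G 1 q'); have := sqr_ge0 (Num.sqrt (Nk G 1 q') - 1); rewrite sqrrB sqrrD expr1n mulr1 mul1r; move: x0; forget; lra.
      have N0 := Nk_ge0 G 1 q'.
      have S1 : \sum_x nm (rho x) * nm (e x q') <= n2 * LK + sg * (Cb * (2 + 2 * Nk G 1 q')).
        apply: (@le_trans _ _ (\sum_(x : 'I_n * 'I_n) (LK + cb L (R0 R x.1 x.2) * (2 + 2 * Nk G 1 q')) * sg)).
          by apply: ler_sum => x _; apply: ler_pM; rewrite ?nm_ge0 ?sB ?rB.
        rewrite -mulr_suml big_split /= sumr_const -mulr_suml -/Cb mulrDl (mulrC sg); apply: lerD => //.
        by rewrite -mulr_natl -/n2 ler_piMr // mulr_ge0.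
      have h1 : sg * (Cb * (2 + 2 * Nk G 1 q')) <= 2 * Cb + lam / 2 * Nk G 1 q'.
        have : sg * Cb <= Cb by rewrite ler_piMl.
        have : 4 * sg * Cb * Nk G 1 q' <= lam * Nk G 1 q' by rewrite ler_wpM2r.
        forget; lra.
      have h2 : (Nk G 1 q' / 2 - K1) * L^-1 <= gsqs q' e * L^-1 by rewrite ler_wpM2r // ltW.
      rewrite /B'; have : lam * Nk G 1 q' = L^-1 / 4 * Nk G 1 q' by rewrite lE.
      move: S1 h1 h2; forget; lra.
    + have [_ g2'] := gK q' K' Oq.
      apply: le_trans (sqs_grad oO Oq se) _.
      have E0 : 0 <= sqs e q' by apply: sumr_ge0 => x _; exact: sqr_ge0.
      have := ler_wpM2l (_ : 0 <= 2 * sqs e q') g2'; move=> /(_ (mulr_ge0 _ E0)) h; have {}h := h (ler0n _ 2); move: h; forget; lra.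
  - move=> q' K'; split; first by apply: sumr_ge0 => x _; exact: sqr_ge0.
      exact: le_trans (EB _ K') E1.
    apply: le_trans E2; have h0 : 0 <= 64 * (n%:R * L) by rewrite !mulr_ge0 // ltW.
    have := ler_wpM2l h0 (EB _ K'); forget; lra.
  - by rewrite /M mulrAC mulrC divfK // gt_eqF // mulr_gt0.
  - by move=> p dp; apply: Nk_le => s' i' j' h; apply: Hinit => //; rewrite h.
have w := word_le G s i j q; rewrite sk in w.
exact: (cutoff_bound cc Kq (HR q (slab_le (ltW cc) Kq)) (nm_ge0 _) w).
Qed.
End Flow.

(** * Derivative estimates on a bounded time interval *)

Section Uniform.
Variables (R : realType) (n : nat).
Notation S := (R * Cn R n)%type.
Notation W := (seq ('I_n * bool)).

(** Induction on the order, each order being bounded on a smaller concentric ball. The length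
    [delta] comes from order one alone and is the same for all orders, which allows the steps to be
    iterated. *)
Lemma time_step_order (L : R) : 1 <= L -> exists2 delta : R, 0 < delta &
  forall N (C c c' : R), 0 <= C -> 0 <= c' -> c' < c -> exists2 B : R, 0 <= B &
  forall tB kappa U (G : S -> 'M[Cx R]_n) (p0 : Cn R n) t0 T, flow tB kappa L U G -> 0 <= t0 -> t0 <= T -> T < tB -> T <= t0 + delta ->
  (forall p, dist2 p0 p <= c -> U p) ->
  (forall s i j p, dist2 p0 p <= c -> (size s <= N.+2)%N -> nm (dds s (fun q => G q i j) (t0, p)) <= C) ->
  forall s i j q, slab p0 c' t0 T q -> (size s <= N.+1)%N -> nm (dds s (fun q => G q i j) q) <= B.
Proof.
move=> L1; have [delta d0 H1] := order_first n L1; exists delta => //.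
elim=> [|N IH] C c c' C0 c'0 cc.
  have [B B0 HB] := H1 C c c' C0 c'0 cc.
  exists (B + L); first by apply: addr_ge0 => //; lra.
  move=> tB kappa U G p0 t0 T fl t00 t0T TB Td cU Hi s i j q Kq.
  case: s => [|a [|? ?]] // _.
    have c'U p : dist2 p0 p <= c' -> U p by move=> h; apply: cU; exact: le_trans h (ltW cc).
    have [a b] := slab_dom t00 TB c'U Kq.
    by apply: le_trans (fl_G fl a b i j) _; rewrite lerDr.
  have := HB _ _ _ _ _ _ _ fl t00 t0T TB Td cU Hi [:: a] i j q Kq erefl; lra.
pose c2 := (c + c') / 2.
have c2c : c2 < c by rewrite /c2; lra.
have c2c' : c' < c2 by rewrite /c2; lra.
have c20 : 0 <= c2 by lra.
have [B B0 HB] := IH C c c2 C0 c20 c2c.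
have [B' B'0 HB'] := @order_high R n N L (B + C) c2 c' L1 (addr_ge0 B0 C0) c'0 c2c'.
exists (B + B'); first exact: addr_ge0.
move=> tB kappa U G p0 t0 T fl t00 t0T TB Td cU Hi s i j q Kq sN.
have Hlow : forall s i j q, slab p0 c2 t0 T q -> (size s < N.+2)%N -> nm (dds s (fun q => G q i j) q) <= B + C.
  move=> s' i' j' q' K' h; apply: (@le_trans _ _ B); last by rewrite lerDl.
  apply: (HB _ _ _ _ _ _ _ fl t00 t0T TB Td cU _ s' i' j' q' K' h) => s2 i2 j2 p2 d2 h2.
  by apply: Hi => //; exact: leqW.
have c2U p : dist2 p0 p <= c2 -> U p by move=> h; apply: cU; exact: le_trans h (ltW c2c).
have Kq2 : slab p0 c2 t0 T q by case: Kq => a b; split=> //; exact: le_trans b (ltW c2c').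
rewrite leq_eqVlt in sN; case/orP: sN => [/eqP sN|sN].
  apply: (@le_trans _ _ B'); last by rewrite lerDr.
  apply: (HB' _ _ _ _ _ _ _ fl t00 TB c2U Hlow _ s i j q Kq sN) => s2 i2 j2 p2 d2 h2.
  apply: (@le_trans _ _ C); last by rewrite lerDr.
  by apply: Hi; [exact: le_trans d2 (ltW c2c)|rewrite h2].
apply: (@le_trans _ _ B); last by rewrite lerDl.
apply: (HB _ _ _ _ _ _ _ fl t00 t0T TB Td cU _ s i j q Kq2 sN) => s2 i2 j2 p2 d2 h2.
by apply: Hi => //; exact: leqW.
Qed.

(* Each time step costs one derivative, and their number depends only on [L] and [T1]. *)
Lemma uniform_bounds (L T1 : R) (N : nat) (c c' : R) : 1 <= L -> 0 <= c' -> c' < c -> exists M : nat, forall C : R, 0 <= C ->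
  exists2 B : R, 0 <= B & forall tB kappa U (G : S -> 'M[Cx R]_n) (p0 : Cn R n), flow tB kappa L U G -> tB <= T1 ->
  (forall p, dist2 p0 p <= c -> U p) ->
  (forall s i j p, dist2 p0 p <= c -> (size s <= M)%N -> nm (dds s (fun q => G q i j) (0, p)) <= C) ->
  forall s i j q, 0 <= q.1 < tB -> dist2 p0 q.2 <= c' -> (size s <= N.+1)%N -> nm (dds s (fun q => G q i j) q) <= B.
Proof.
move=> L1; have [delta d0 H] := time_step_order L1.
have step : forall k N (C c c' : R), 0 <= C -> 0 <= c' -> c' < c -> exists2 B : R, 0 <= B &
  forall tB kappa U (G : S -> 'M[Cx R]_n) (p0 : Cn R n), flow tB kappa L U G ->
  (forall p, dist2 p0 p <= c -> U p) ->
  (forall s i j p, dist2 p0 p <= c -> (size s <= k + N.+1)%N -> nm (dds s (fun q => G q i j) (0, p)) <= C) ->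
  forall s i j q, 0 <= q.1 < tB -> q.1 <= k%:R * delta -> dist2 p0 q.2 <= c' -> (size s <= N.+1)%N -> nm (dds s (fun q => G q i j) q) <= B.
  elim=> [|k IH] {}N C {}c {}c' C0 c'0 cc.
    exists C => // tB kappa U G p0 fl cU Hi s i j [t p] /= /andP[t0 _]; rewrite mul0r => t1 d sN.
    have -> : t = 0 by apply/eqP; rewrite eq_le t1 t0.
    by apply: Hi => //; exact: le_trans d (ltW cc).
  pose c2 := (c + c') / 2.
  have c2c : c2 < c by rewrite /c2; lra.
  have c2c' : c' < c2 by rewrite /c2; lra.
  have c20 : 0 <= c2 by lra.
  have [B B0 HB] := IH N.+1 C c c2 C0 c20 c2c.
  have [B' B'0 HB'] := H N B c2 c' B0 c'0 c2c'.
  exists (B + B') => [|tB kappa U G p0 fl cU Hi s i j [t p] /= /andP[t0 tt] t1 d sN]; first exact: addr_ge0.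
  have Hi2 : forall s i j p, dist2 p0 p <= c -> (size s <= k + N.+2)%N -> nm (dds s (fun q => G q i j) (0, p)) <= C.
    by move=> s' i' j' p' d' h; apply: Hi => //; rewrite addSnnS.
  have [h|h] := leP t (k%:R * delta).
    apply: (@le_trans _ _ B); last by rewrite lerDl.
    apply: (HB _ _ _ _ _ fl cU Hi2 s i j (t, p)) => //=; first by rewrite t0.
      exact: le_trans d (ltW c2c').
    exact: leqW.
  have k0 : 0 <= k%:R * delta by rewrite mulr_ge0 // ltW.
  have kd : k.+1%:R * delta = k%:R * delta + delta by rewrite -addn1 natrD mulrDl mul1r.
  have c2U p' : dist2 p0 p' <= c2 -> U p' by move=> h'; apply: cU; exact: le_trans h' (ltW c2c).
  rewrite kd in t1; apply: (@le_trans _ _ B'); last by rewrite lerDr.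
  apply: (HB' _ _ _ _ _ _ _ fl k0 (ltW h) tt t1 c2U _ s i j (t, p)) => //.
    move=> s' i' j' p' d' h'; apply: (HB _ _ _ _ _ fl cU Hi2) => //=.
    by rewrite k0 (lt_trans h tt).
  by split=> //=; rewrite (ltW h) lexx.
(* The order of the quantifiers matters: [k] is fixed before C, since a bound for the initial
   derivatives becomes available only once their number is known. *)
move=> c'0 cc; pose k := (Num.trunc (T1 / delta)).+1; exists (k + N.+1)%N => C C0.
have [B B0 HB] := step k N C c c' C0 c'0 cc.
exists B => // tB kappa U G p0 fl tT cU Hi s i j q h d; apply: (HB _ _ _ _ _ fl cU Hi) => //.
rewrite -ler_pdivrMr //; apply: le_trans (_ : T1 / delta <= _); last exact: ltW (truncnS_gt _).
rewrite ler_pM2r ?invr_gt0 //; case/andP: h => _ h; exact: le_trans (ltW h) tT.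
Qed.

(** Mean value theorem for the real and for the imaginary part, hence the factor 2. At the left end
    only continuity is asked, because that is all a flow has at its initial time. *)
Lemma time_increment (f : R -> Cx R) (df : R -> Cx R) (a T M : R) : a < T ->
  (forall t, a < t <= T -> is_cder f t (df t) /\ nm (df t) <= M) -> f @ a^'+ --> f a ->
  nm (f T - f a) <= 2 * M * (T - a).
Proof.
move=> T0 H f0; have T1 : 0 < T - a by rewrite subr_gt0.
have re (h : Cx R -> R) (hN : forall z, `|h z| <= nm z) : (forall x y, h (x - y) = h x - h y) ->
    (forall t, a < t <= T -> is_derive t 1 (fun s => h (f s)) (h (df t))) ->
    (fun s => h (f s)) @ a^'+ --> h (f a) -> `|h (f T - f a)| <= M * (T - a).
  move=> hB hd h0; have [||c] := @MVT R (fun s => h (f s)) (fun t => h (df t)) a T T0.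
  - by move=> x; rewrite in_itv /= => /andP[a1 b]; apply: hd; rewrite a1 ltW.
  - apply/continuous_within_itvP => //; split=> [x|//|].
      rewrite in_itv /= => /andP[a1 b].
      have [dx _] := hd x (andb_true_intro (conj a1 (ltW b))).
      exact: differentiable_continuous ((derivable1_diffP _ _).1 dx).
    have [dx _] := hd T (andb_true_intro (conj T0 (lexx _))).
    apply: cvg_at_left_filter; exact: differentiable_continuous ((derivable1_diffP _ _).1 dx).
  rewrite in_itv /= => /andP[a1 b] E; rewrite hB E normrM (gtr0_norm T1) ler_pM2r //.
  by apply: le_trans (hN _) _; have [] := H c; rewrite ?a1 ?(ltW b).
have h1 : `|cre (f T - f a)| <= M * (T - a).
  apply: re; [exact: cre_le|by move=> x y; rewrite !cE|by move=> t /H[[]]|exact: cvg_cre].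
have h2 : `|cim (f T - f a)| <= M * (T - a).
  apply: re; [exact: cim_le|by move=> x y; rewrite !cE|by move=> t /H[[]]|exact: cvg_cim].
by apply: le_trans (nm_le _) _; lra.
Qed.

Lemma cw_time (tB a : R) (U : set (Cn R n)) (f : S -> Cx R) p : 0 <= a < tB -> U p ->
  cw [set q | 0 <= q.1 < tB /\ U q.2] f -> (fun t => f (t, p)) @ a^'+ --> f (a, p).
Proof.
move=> /andP[a0 aB] Up cf.
have qa : [set q | 0 <= q.1 < tB /\ U q.2] ((a, p) : S) by split=> //=; rewrite a0.
have h : (fun t : R => ((t, p) : S)) @ a^'+ --> within [set q | 0 <= q.1 < tB /\ U q.2] (nbhs ((a, p) : S)).
  move=> A /= [[V1 V2] /= [V10 V20] HV].
  have n1 : \forall x \near a^'+, V1 x by exact: (@cvg_at_right_filter _ _ id a _ cvg_id).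
  have p2 : V2 p by exact: nbhs_singleton.
  have : \forall x \near a^'+, [/\ V1 x, a < x & x < tB].
    near=> x; split; [by near: x| |]; near: x; [exact: nbhs_right_gt|exact: nbhs_right_lt].
  by apply: filterS => x [v1 x0 xB]; apply: HV => //=; split=> //=; rewrite (le_trans a0 (ltW x0)).
exact: (cvg_comp _ _ h (cf _ qa)).
Unshelve. all: by end_near.
Qed.

(** Here the factor [kappa] of the equation is gained: the time derivative of a word s is kappa
    times an expression in derivatives of order at most |s| + 2, all of them bounded by B. *)
Lemma word_increment (L B : R) (s : W) i j : 1 <= L -> 0 <= B -> exists2 C : R, 0 <= C &
  forall tB kappa U (G : S -> 'M[Cx R]_n) p, flow tB kappa L U G -> U p ->
  (forall s' i j t, (size s' <= (size s).+2)%N -> 0 <= t < tB -> nm (dds s' (fun q => G q i j) (t, p)) <= B) ->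
  forall t, 0 < t < tB -> nm (dds s (fun q => G q i j) (t, p) - dds s (fun q => G q i j) (0, p)) <= kappa * C * t.
Proof.
move=> L1 B0; pose D := L + B.
have D0 : 0 <= D by rewrite /D; lra.
have L0 : 0 <= L by lra.
have BD : B <= D by rewrite /D lerDr.
pose C1 := n%:R * (n%:R * (L * D)) + cb D (Rw R s i j).
exists (2 * C1) => [|tB kappa U G p fl Up HB t /andP[t0 tB1]].
  by rewrite mulr_ge0 // addr_ge0 ?cb_ge0 // !mulr_ge0 ?ler0n.
pose f t := dds s (fun q => G q i j) (t, p).
have oO := flow_open fl.
have k0 := fl_k fl.
rewrite (_ : kappa * (2 * C1) * t = 2 * (kappa * C1) * (t - 0)); last by ring.
apply: (@time_increment f (fun t => dd None (dds s (fun q => G q i j)) (t, p))) => //.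
  move=> t' /andP[t'0 t't].
  have Oq : [set q | 0 < q.1 < tB /\ U q.2] ((t', p) : S) by split=> //=; rewrite t'0 (le_lt_trans t't tB1).
  have t'B : 0 <= t' < tB by rewrite ltW //= (le_lt_trans t't tB1).
  have sf := sm_dds oO s (fl_s fl i j).
  split.
    rewrite ddE; apply/is_cder_shift; exact: (sm_der None sf Oq).
  have EQ q' i' j' : [set q | 0 < q.1 < tB /\ U q.2] q' -> dd None (fun q => G q i' j') q' = rc kappa * (Lop G (fun q => G q i' j') q' + ev G (R0 R i' j') q').
    by move=> [a b]; exact: (fl_e fl).
  rewrite (evolution oO (fl_s fl) (flow_unit fl) EQ s i j Oq) nmM nm_rc (gtr0_norm k0) ler_pM2l //.
  apply: le_trans (nmD _ _) _; apply: lerD.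
    apply: le_trans (nm_sum _ _ _) _; rewrite -[X in X%:R * _](card_ord n) mulr_natl -sumr_const; apply: ler_sum => k _.
    apply: le_trans (nm_sum _ _ _) _; rewrite -[X in X%:R * _](card_ord n) mulr_natl -sumr_const; apply: ler_sum => l _.
    rewrite nmM; apply: ler_pM; rewrite ?nm_ge0 //; first exact: (fl_b fl).
    exact: le_trans (HB [:: (k, false), (l, true) & s] i j t' (leqnn _) t'B) BD.
  rewrite -[cb _ _]mulr1 -(expr1n R (size s).+2); apply: ev_Rw_bound => //.
    by move=> i' j'; apply: (@le_trans _ _ L); [exact: (fl_b fl)|rewrite /D lerDl].
  move=> s' i' j' h; rewrite expr1n mulr1; apply: le_trans (HB s' i' j' t' _ t'B) BD; exact: leqW.
have tB0 : 0 < tB by exact: lt_trans t0 tB1.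
by apply: (cw_time _ Up (fl_c fl (s := s) (i := i) (j := j))); rewrite lexx.
Qed.
End Uniform.

(** * Ricci curvature *)

Section Jacobi.
Variables (R : realType) (n : nat).
Notation S := (R * Cn R n)%type.
Variables (O : set S) (oO : open O).
Notation sm := (smooth_st O).

Lemma dd_prod (k : nat) (F : 'I_k -> S -> Cx R) a q : (forall i, sm (F i)) -> O q ->
  dd a (fun q => \prod_i F i q) q = \sum_i \prod_j (if j == i then dd a (F j) q else F j q).
Proof.
elim: k F => [|k IH] F sF Oq.
  rewrite big_ord0; rewrite (_ : (fun _ => _) = fun=> 1) ?dd_cst //.
  by apply/funext => q'; rewrite big_ord0.
have sP : sm (fun q => \prod_(i < k) F (lift ord0 i) q) by apply: (sm_prod oO) => i; exact: sF.
transitivity (dd a (fun q => F ord0 q * \prod_(i < k) F (lift ord0 i) q) q).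
  by congr (dd a _ q); apply/funext => q'; rewrite big_ord_recl.
rewrite (ddM _ (sF ord0) sP Oq) IH // [RHS]big_ord_recl; congr (_ + _).
  by rewrite big_ord_recl eqxx; congr (_ * _); apply: eq_bigr => i _; rewrite (negbTE (neq_lift _ _)) // eq_sym.
rewrite mulr_sumr; apply: eq_bigr => i _; rewrite [RHS]big_ord_recl /=; congr (_ * _).
Qed.

Variables (k : nat) (G : S -> 'M[Cx R]_k).
Hypothesis sG : forall i j, sm (fun q => G q i j).

(** Jacobi's formula: the derivative is a sum of determinants with one row differentiated, each of
    which is expanded along that row. *)
Lemma dd_det a q : O q ->
  dd a (fun q => \det (G q)) q = \sum_i \sum_j dd a (fun q => G q i j) q * cofactor (G q) i j.
Proof.
move=> Oq; rewrite (dd_sum oO (index_enum _) xpredT (F := fun (s : 'S_k) q => (-1) ^+ s * \prod_i G q i (s i))) //; last first.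
  by move=> s; apply: (smZ oO); apply: (sm_prod oO) => i; exact: sG.
transitivity (\sum_(s : 'S_k) \sum_i (-1) ^+ s * \prod_j (if j == i then dd a (fun q => G q j (s j)) q else G q j (s j))).
  apply: eq_bigr => s _; rewrite (ddZ oO) //; last by apply: (sm_prod oO) => i; exact: sG.
  by rewrite (dd_prod _ _ Oq) ?mulr_sumr // => i; exact: sG.
rewrite exchange_big /=; apply: eq_bigr => i _.
pose B := \matrix_(l, j) (if l == i then dd a (fun q => G q l j) q else G q l j).
transitivity (\det B).
  by apply: eq_bigr => s _; congr (_ * _); apply: eq_bigr => j _; rewrite mxE.
rewrite (expand_det_row B i); apply: eq_bigr => j _; rewrite mxE eqxx; congr (_ * _).
congr (_ * \det _); apply/matrixP => u v; rewrite !mxE.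
by rewrite eq_sym (negbTE (neq_lift _ _)).
Qed.

Hypothesis pG : forall q, O q -> hermpos (G q).

Lemma sm_lndet : sm (fun q => rc (ln (cre (\det (G q))))).
Proof.
apply: (sm_ln oO) => [q Oq|]; first by have [] := hermpos_det (pG Oq).
by apply: (sm_eq oO _ (sm_det oO sG)) => q Oq; have [] := hermpos_det (pG Oq).
Qed.

Lemma dd_lndet a q : O q -> dd a (fun q => rc (ln (cre (\det (G q))))) q =
  \sum_i \sum_j invmx (G q) j i * dd a (fun q => G q i j) q.
Proof.
move=> Oq; have dE q' : O q' -> rc (cre (\det (G q'))) = \det (G q').
  by move=> O'; have [<-] := hermpos_det (pG O').
rewrite (@dd_ln _ _ O (fun q => cre (\det (G q)))) //; first last.
- by apply: (sm_eq oO _ (sm_det oO sG)) => q' O'; rewrite dE.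
- by move=> q' O'; have [] := hermpos_det (pG O').
rewrite dE // (dd_eq oO _ dE Oq) dd_det // mulr_suml; apply: eq_bigr => i _.
rewrite mulr_suml; apply: eq_bigr => j _; rewrite /invmx (hermpos_unit (pG Oq)) !mxE.
by rewrite mulrAC -mulrA mulrC.
Qed.
End Jacobi.

Lemma trace_sum (F : fieldType) (n : nat) (X Y : 'M[F]_n) : \sum_k \sum_l X l k * Y k l = \tr (X *m Y).
Proof. by rewrite exchange_big /=; apply: eq_bigr => l _; rewrite mxE. Qed.

Lemma mxtraceN (F : fieldType) (n : nat) (X : 'M[F]_n) : \tr (- X) = - \tr X.
Proof. by rewrite -scaleN1r mxtraceZ mulN1r. Qed.

Lemma sesqr0 (R : realType) (n : nat) (G : 'M[Cx R]_n) w : sesq G w 0 = 0.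
Proof. by rewrite -(scale0r (0 : Cn R n)) sesqZr (rmorph0 (Num.conj : {rmorphism _ -> _})) mul0r. Qed.

(** * Ricci curvature of a Kaehler metric in coordinates *)

Section Kahler.
Variables (R : realType) (n : nat).
Notation S := (R * Cn R n)%type.
Variables (O : set S) (oO : open O) (G : S -> 'M[Cx R]_n).
Notation sm := (smooth_st O).
Hypothesis sG : forall i j, sm (fun q => G q i j).
Hypothesis pG : forall q, O q -> hermpos (G q).
Let uG q : O q -> G q \in unitmx. Proof. by move=> /pG; exact: hermpos_unit. Qed.

Lemma dz_slice t j (f : S -> Cx R) p : dz j (fun p => f (t, p)) p = dd (Some (j, false)) f (t, p).
Proof. by rewrite /dz wirtE; apply: dd_slice. Qed.
Lemma dzb_slice t j (f : S -> Cx R) p : dzb j (fun p => f (t, p)) p = dd (Some (j, true)) f (t, p).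
Proof. by rewrite /dzb wirtE; apply: dd_slice. Qed.
Lemma dz_dzb_slice t i j (f : S -> Cx R) p : dz i (dzb j (fun p => f (t, p))) p =
  dd (Some (i, false)) (dd (Some (j, true)) f) (t, p).
Proof.
rewrite -dz_slice; congr (dz i _ p); apply/funext => p'; exact: dzb_slice.
Qed.

(** The curvature with its last pair of indices fixed at (i, j), as a matrix in the first pair, and
    with derivatives taken on space-time so that the calculus of [dd] applies. *)
Definition curvmx (i j : 'I_n) (q : S) : 'M[Cx R]_n :=
  - (\matrix_(k, l) dd (Some (i, false)) (dd (Some (j, true)) (fun q => G q k l)) q)
  + (\matrix_(k, l) dd (Some (i, false)) (fun q => G q k l) q) *m invmx (G q)
    *m (\matrix_(k, l) dd (Some (j, true)) (fun q => G q k l) q).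

Lemma ricci_curvmx t p i j : O (t, p) ->
  Ric (fun p => G (t, p)) p i j = \sum_k \sum_l invmx (G (t, p)) l k * curvmx i j (t, p) k l.
Proof.
move=> Oq; set q := (t, p).
have sM k l : sm (fun q => invmx (G q) l k * dd (Some (j, true)) (fun q => G q k l) q).
  by apply: (smM oO); [exact: (sm_invmx oO sG uG)|exact: (sm_dd oO)].
rewrite !mxE (dz_dzb_slice t i j (fun q => rc (ln (cre (\det (G q)))))).
rewrite (dd_eq oO _ (fun q' => @dd_lndet R n O oO n G sG pG (Some (j, true)) q') Oq).
pose A := \matrix_(k, l) dd (Some (i, false)) (fun q => G q k l) q.
pose B := \matrix_(k, l) dd (Some (j, true)) (fun q => G q k l) q.
pose C := \matrix_(k, l) dd (Some (i, false)) (dd (Some (j, true)) (fun q => G q k l)) q.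
pose b := invmx (G q).
rewrite [RHS](trace_sum b (- C + A *m b *m B)).
transitivity (- (- \tr (b *m A *m b *m B) + \tr (b *m C))); last first.
  by rewrite mulmxDr mulmxN mxtraceD mxtraceN !mulmxA opprD opprK addrC.
congr (- _); rewrite -!trace_sum -sumrN -big_split /= (dd_sum oO) //; last by move=> k; apply: (sm_sum oO) => l; exact: sM.
apply: eq_bigr => k _; rewrite -sumrN -big_split /= (dd_sum oO) //.
apply: eq_bigr => l _; rewrite (ddM _ (sm_invmx oO sG uG l k) (sm_dd oO _ (sG k l)) Oq) (dd_invmx oO sG uG _ _ _ Oq).
rewrite ![in RHS]mxE; congr (_ + _); rewrite mulNr; congr (- (_ * _)).
rewrite exchange_big /=; apply: eq_bigr => r _; rewrite !mxE mulr_suml; apply: eq_bigr => s _.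
by rewrite mxE.
Qed.

(** Closedness, used in the holomorphic and in the conjugate indices, gives d_i dbar_j g_kl = d_k
    dbar_l g_ij. The trace of second derivatives in - Ric is therefore the Laplacian of g_ij, and
    the flow is a quasilinear parabolic system in any holomorphic coordinates. *)
Lemma kahler_flow_rhs t p i j : O (t, p) -> (forall q, O q -> forall i j k, dd (Some (k, false)) (fun q => G q i j) q = dd (Some (i, false)) (fun q => G q k j) q) ->
  - Ric (fun p => G (t, p)) p i j = Lop G (fun q => G q i j) (t, p) + ev G (R0 R i j) (t, p).
Proof.
move=> Oq cl; rewrite ricci_curvmx //; set q := (t, p).
have hG k l q' : O q' -> G q' k l = (G q' l k)^* by move=> O'; exact: (pG O').1.
have clb q' : O q' -> forall i j k, dd (Some (k, true)) (fun q => G q i j) q' = dd (Some (j, true)) (fun q => G q i k) q'.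
  move=> O' i' j' k'.
  rewrite (dd_eq oO _ (hG i' j') O') (dd_eq oO _ (hG i' k') O') !(dd_conj _ _ O') //=; congr (_^*); exact: cl.
pose A := \matrix_(k, l) dd (Some (i, false)) (fun q => G q k l) q.
pose B := \matrix_(k, l) dd (Some (j, true)) (fun q => G q k l) q.
pose C := \matrix_(k, l) dd (Some (i, false)) (dd (Some (j, true)) (fun q => G q k l)) q.
pose b := invmx (G q).
rewrite [X in - X](trace_sum b (- C + A *m b *m B)) mulmxDr mulmxN mxtraceD mxtraceN opprD opprK; congr (_ + _).
  rewrite -trace_sum; apply: eq_bigr => k _; apply: eq_bigr => l _; congr (_ * _); rewrite mxE.
  rewrite (ddC oO) //.
  rewrite (dd_eq oO (Some (j, true)) (g := dd (Some (k, false)) (fun q => G q i l)) (fun q' (O' : O q') => cl q' O' k l i) Oq).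
  rewrite (ddC oO) //; apply: (dd_eq oO) Oq => q' O'; exact: clb.
rewrite /= mulN1r; congr (- _).
rewrite ev_esum /mxtrace; apply: eq_bigr => a _; rewrite ev_esum mxE; apply: eq_bigr => c _; rewrite ev_esum.
rewrite mxE; under [RHS]eq_bigr do rewrite ev_esum.
rewrite mulr_sumr exchange_big /=; apply: eq_bigr => d _; rewrite !mxE mulr_suml mulr_sumr; apply: eq_bigr => e _.
by rewrite !mxE !mulrA.
Qed.

Lemma ricci_curv t p : O (t, p) -> exists f : 'I_n -> Cn R n, (forall a, sesq (G (t, p)) (f a) (f a) = 1) /\
  forall c d, sesq (Ric (fun p => G (t, p)) p) c d = \sum_a curv (fun p => G (t, p)) p (f a) (f a) c d.
Proof.
move=> Oq; have [f [f1 fb]] := hermpos_frame (pG Oq); exists f; split=> // c d.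
have E k l : - (\matrix_(i, j) dz k (dzb l (fun q => G (t, q) i j)) p) + (\matrix_(i, j) dz k (fun q => G (t, q) i j) p)
    *m invmx (G (t, p)) *m (\matrix_(i, j) dzb l (fun q => G (t, q) i j) p) = curvmx k l (t, p).
  have e1 : \matrix_(i, j) dz k (dzb l (fun q => G (t, q) i j)) p = \matrix_(x, y) dd (Some (k, false)) (dd (Some (l, true)) (fun q => G q x y)) (t, p).
    by apply/matrixP => x y; rewrite !mxE; exact: (dz_dzb_slice t k l (fun q => G q x y)).
  have e2 : \matrix_(i, j) dz k (fun q => G (t, q) i j) p = \matrix_(x, y) dd (Some (k, false)) (fun q => G q x y) (t, p).
    by apply/matrixP => x y; rewrite !mxE; exact: (dz_slice t k (fun q => G q x y)).
  have e3 : \matrix_(i, j) dzb l (fun q => G (t, q) i j) p = \matrix_(x, y) dd (Some (l, true)) (fun q => G q x y) (t, p).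
    by apply/matrixP => x y; rewrite !mxE; exact: (dzb_slice t l (fun q => G q x y)).
  have gen (A A' B B' C C' : 'M[Cx R]_n) b : A = A' -> B = B' -> C = C' -> - A + B *m b *m C = - A' + B' *m b *m C'.
    by move=> -> -> ->.
  exact: (gen _ _ _ _ _ _ _ e1 e2 e3).
have cE a : curv (fun p => G (t, p)) p (f a) (f a) c d = \sum_k \sum_l sesq (curvmx k l (t, p)) (f a) (f a) * c 0 k * (d 0 l)^*.
  by rewrite /curv; apply: eq_bigr => k _; apply: eq_bigr => l _; rewrite E.
under eq_bigr do rewrite cE.
rewrite exchange_big /=; apply: eq_bigr => k _; rewrite exchange_big /=; apply: eq_bigr => l _.
rewrite -!mulr_suml; congr (_ * _ * _); rewrite ricci_curvmx //.
rewrite exchange_big /=; under [RHS]eq_bigr do rewrite /sesq.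
rewrite [LHS]exchange_big /= [RHS]exchange_big /=; apply: eq_bigr => x _; rewrite exchange_big /=; apply: eq_bigr => y _.
by rewrite fb mulr_suml; apply: eq_bigr => a _; rewrite mulrC mulrA.
Qed.

(** After u and v are normalized, Ric(u, v) is a sum of n curvature values on unit vectors, taken
    over a unitary frame. *)
Lemma ricci_bound t p (K : R) : O (t, p) -> (forall a b c d, sesq (G (t, p)) a a = 1 -> sesq (G (t, p)) b b = 1 ->
    sesq (G (t, p)) c c = 1 -> sesq (G (t, p)) d d = 1 -> `|curv (fun p => G (t, p)) p a b c d| <= rc K) ->
  forall u v, nm (sesq (Ric (fun p => G (t, p)) p) u v) <=
    n%:R * K * (Num.sqrt (cre (sesq (G (t, p)) u u)) * Num.sqrt (cre (sesq (G (t, p)) v v))).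
Proof.
move=> Oq HK u v; have [f [f1 fE]] := ricci_curv Oq; have hG := pG Oq.
have unit w : w != 0 -> exists2 w', sesq (G (t, p)) w' w' = 1 & w = rc (Num.sqrt (cre (sesq (G (t, p)) w w))) *: w'.
  move=> w0; have s0 := sesq_gt0 hG w0; set s := Num.sqrt _.
  have s1 : 0 < s by rewrite sqrtr_gt0.
  exists (rc s^-1 *: w); last by rewrite scalerA -rcM mulfV ?gt_eqF // scale1r.
  rewrite sesqZl sesqZr rc_conj sesq_rc // -!rcM mulrA -expr2 exprVn sqr_sqrtr ?ltW // mulVf ?gt_eqF //.
have [->|u0] := eqVneq u 0; first by rewrite !sesq0 nm0 sqrtr0 mul0r mulr0.
have [->|v0] := eqVneq v 0; first by rewrite !sesqr0 nm0 sqrtr0 !mulr0.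
have [u' u1 uE] := unit u u0; have [v' v1 vE] := unit v v0.
rewrite {1}uE {1}vE sesqZl sesqZr rc_conj !nmM !nm_rc !ger0_norm ?sqrtr_ge0 // mulrA [leRHS]mulrC ler_wpM2l ?mulr_ge0 ?sqrtr_ge0 //.
rewrite fE; apply: le_trans (nm_sum _ _ _) _; rewrite -[X in X%:R](card_ord n) mulr_natl -sumr_const; apply: ler_sum => a _.
by rewrite -norm_le; apply: HK.
Qed.
End Kahler.

Lemma is_derive_scale (R : realType) (c t : R) : is_derive t (1 : R) (fun s : R => c * s) c.
Proof. by have := is_deriveZ c (is_derive_id t (1 : R)); rewrite /GRing.scale /= mulr1. Qed.

(** Mean value theorem for exp(- A t) f and for exp(A t) f, whose derivatives have opposite signs.
    Both inequalities are needed, as an upper and a lower bound for the metric. *)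
Lemma gronwall (R : realType) (f df : R -> R) (T A : R) : 0 < T ->
  (forall t, 0 < t <= T -> is_derive t 1 f (df t) /\ `|df t| <= A * f t) -> f @ 0^'+ --> f 0 ->
  f T <= expR (A * T) * f 0 /\ f 0 <= expR (A * T) * f T.
Proof.
move=> T0 H f0.
have expc (c t : R) : is_derive t (1 : R) (fun s : R => expR (c * s)) (expR (c * t) * c).
  exact: (@is_derive_1comp R expR (fun s => c * s) t c (expR (c * t)) (is_derive_scale c t) (is_derive_expR (c * t))).
have K (c : R) : exists2 x, 0 < x < T & expR (c * T) * f T - f 0 = expR (c * x) * (c * f x + df x) * T.
  pose h s := expR (c * s) * f s.
  have hd t : 0 < t <= T -> is_derive t 1 h (expR (c * t) * (c * f t + df t)).
    move=> /H[d _]; have e : is_derive t 1 (fun s => expR (c * s)) (expR (c * t) * c).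
      exact: expc.
    have := is_deriveM e d; rewrite /GRing.scale /= => h'; apply: is_derive_eq h' _; ring.
  have [||x xT E] := @MVT R h (fun t => expR (c * t) * (c * f t + df t)) 0 T T0.
  - by move=> x; rewrite in_itv /= => /andP[a b]; apply: hd; rewrite a ltW.
  - apply/continuous_within_itvP => //; split=> [x||].
    + rewrite in_itv /= => /andP[a b].
      have [dx _] := hd x (andb_true_intro (conj a (ltW b))).
      exact: differentiable_continuous ((derivable1_diffP _ _).1 dx).
    + rewrite /h; apply: cvgM => //; apply: cvg_at_right_filter.
      have [dx _] := expc c 0; exact: differentiable_continuous ((derivable1_diffP _ _).1 dx).
    + have [dx _] := hd T (andb_true_intro (conj T0 (lexx _))).
      apply: cvg_at_left_filter; exact: differentiable_continuous ((derivable1_diffP _ _).1 dx).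
  exists x; first by move: xT; rewrite in_itv.
  by move: E; rewrite /h mulr0 expR0 mul1r subr0.
have eT := expR_gt0 (A * T); split.
  have [x /andP[x0 xT] E] := K (- A).
  have [_] := H x (andb_true_intro (conj x0 (ltW xT))); rewrite ler_norml => /andP[_ h].
  have : expR (- A * T) * f T - f 0 <= 0.
    by rewrite E; apply: mulr_le0_ge0; [apply: mulr_ge0_le0; [exact: expR_ge0|lra]|exact: ltW].
  rewrite mulNr expRN subr_le0 mulrC ler_pdivrMr // mulrC; exact.
have [x /andP[x0 xT] E] := K A.
have [_] := H x (andb_true_intro (conj x0 (ltW xT))); rewrite ler_norml => /andP[h _].
rewrite -subr_ge0 E; apply: mulr_ge0; last exact: ltW.
by apply: mulr_ge0; [exact: expR_ge0|lra].
Qed.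

(** * Diagonal scalings of the coordinates *)

Section Scaling.
Variables (R : realType) (n : nat).
Notation S := (R * Cn R n)%type.
Implicit Types (f : S -> Cx R) (rho : 'I_n -> R).

Definition scp rho (p : Cn R n) : Cn R n := \row_j (rc (rho j) * p 0 j).
Definition sc rho (q : S) : S := (q.1, scp rho q.2).
Definition sca rho (a : option ('I_n * bool)) : R := if a is Some (j, _) then rho j else 1.

Lemma sc_shift rho a q s : sc rho (Defs.shift a q s) = Defs.shift a (sc rho q) (sca rho a * s).
Proof.
case: a => [[j b]|] /=; last by rewrite /sc /= mul1r.
congr (_, _); apply/rowP => k; rewrite !mxE /=.
have [->|kj] := eqVneq k j; last by rewrite !mulr0 !addr0.
by rewrite !mulr1 mulrDr rcM !mulrA.
Qed.
Lemma cvg_sc rho q : sc rho @ q --> sc rho q.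
Proof.
apply: cvg_pair2; first exact: cvg_fst.
apply: cvg_row => j; rewrite (_ : (fun _ => _) = fun q' : S => rc (rho j) * q'.2 0 j); last by apply/funext => q'; rewrite mxE.
rewrite mxE; apply: cvgM; first exact: cvg_cst.
by apply: (cvg_comp _ _ (@cvg_snd _ _ _ _ _) (@cvg_coord R n q.2 j)).
Qed.

Lemma is_cder_scale (c : R -> Cx R) (k : R) l : is_cder c 0 l -> is_cder (fun s => c (k * s)) 0 (rc k * l).
Proof.
have H (f : R -> R) (d : R) : is_derive (0 : R) (1 : R) f d -> is_derive (0 : R) (1 : R) (fun s : R => f (k * s)) (k * d).
  move=> h; rewrite mulrC.
  by apply: (@is_derive_1comp R f (fun s => k * s) 0 k d (is_derive_scale k 0)); rewrite mulr0.
by move=> [a b]; split; rewrite !cE ?mul0r ?subr0 ?addr0; apply: H.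
Qed.

Variables (O : set S) (oO : open O) (rho : 'I_n -> R).
Let O' : set S := [set q | O (sc rho q)].
Lemma open_sc : open O'.
Proof.
rewrite openE => q Oq; apply: (@cvg_sc rho q O); exact: open_nbhs_nbhs.
Qed.
Lemma Ck_sc k f : Ck k O f -> Ck k O' (fun q => f (sc rho q)).
Proof.
have C f' j : Ck j O f' -> forall q, O' q -> {for q, continuous (fun q => f' (sc rho q))}.
  by move=> F q Oq; apply: (cvg_comp _ _ (@cvg_sc rho q)); exact: (Ck_cts F Oq).
elim: k f => [|k IH] f F; first by split=> // q Oq; exact: C F q Oq.
apply: (@Ck_intro R n O' open_sc k _ (fun a q => rc (sca rho a) * pd a f (sc rho q))) => [q Oq||a].
- exact: C F q Oq.
- move=> a q Oq; have := is_cder_scale (sca rho a) (Ck_der a F Oq).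
  by apply: is_cder_ext => s; rewrite sc_shift.
- by apply: (CkM open_sc); [exact: (Ck_cst open_sc)|apply: IH; exact: Ck_pd F].
Qed.
Lemma sm_sc f : smooth_st O f -> smooth_st O' (fun q => f (sc rho q)).
Proof. by move=> /smooth_stP F; apply/smooth_stP => k; exact: Ck_sc. Qed.
Lemma pd_sc f a q : smooth_st O f -> O (sc rho q) -> pd a (fun q => f (sc rho q)) q = rc (sca rho a) * pd a f (sc rho q).
Proof.
move=> F Oq; apply: pd_cder; have := is_cder_scale (sca rho a) (sm_der a F Oq).
by apply: is_cder_ext => s; rewrite sc_shift.
Qed.
Lemma dd_sc f a q : smooth_st O f -> O (sc rho q) -> dd a (fun q => f (sc rho q)) q = rc (sca rho a) * dd a f (sc rho q).
Proof.
move=> F Oq; rewrite !ddE; case: a => [[j b]|]; last exact: pd_sc.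
by rewrite !(pd_sc _ F Oq) /=; ring.
Qed.
Lemma dds_sc f s q : smooth_st O f -> O (sc rho q) ->
  dds s (fun q => f (sc rho q)) q = rc (\prod_(a <- s) rho a.1) * dds s f (sc rho q).
Proof.
move=> F; elim: s q => [|[j b] s IH] q Oq; first by rewrite big_nil rc1 mul1r.
rewrite /= (dd_eq open_sc _ IH Oq) (ddZ open_sc) //; last by apply: sm_sc; exact: (sm_dds oO).
by rewrite (dd_sc _ (sm_dds oO _ F) Oq) big_cons rcM /= mulrCA mulrA.
Qed.
End Scaling.

(** * Smoothness up to the ends of a time interval *)

Section Upto.
Variables (R : realType) (n : nat).
Notation S := (R * Cn R n)%type.
Implicit Types (f : S -> Cx R) (A O : set S).

Lemma upto_smooth A O f : open O -> O `<=` A -> smooth_upto A f -> smooth_st O f.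
Proof.
move=> oO OA H; move=> s q Oq; have [ O2 [f1 [oO2 O2q F' E]]] := H q (OA q Oq).
have oI := openI oO oO2.
have /smooth_stP F2 := F'.
have F3 : smooth_st (O `&` O2) f1 by apply/smooth_stP => k; apply: Ck_sub (F2 k) => x [].
have F : smooth_st (O `&` O2) f by apply: (sm_eq oI _ F3) => x [x1 x2]; rewrite E //; exact: OA.
by apply: F.
Qed.

(** At an end time A is not open, but its time slices are. Spatial derivatives use the slice only,
    so they agree with those of the local smooth extension. *)
Lemma upto_dds A (V : R -> set (Cn R n)) f O f' s q : (forall t, open (V t)) -> A = [set q | V q.1 q.2] -> open O -> smooth_st O f' ->
  (forall q', O q' -> A q' -> f q' = f' q') -> O q -> A q -> dds s f q = dds s f' q.
Proof.
move=> oV AE oO F' E Oq Aq; case: q Oq Aq => t p Oq Aq.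
pose Ot : set S := [set q | O (t, q.2) /\ V t q.2].
have oOt : open Ot.
  have -> : Ot = (fun q : S => (t, q.2)) @^-1` O `&` (fun q : S => q.2) @^-1` V t by [].
  apply: openI; apply: open_comp => //; move=> x _; last exact: cvg_snd.
  by apply: cvg_pair2; [exact: cvg_cst|exact: cvg_snd].
rewrite (@dds_slice R n s f (fun q => f (t, q.2)) t t p) // (@dds_slice R n s f' (fun q => f' (t, q.2)) t t p) //.
apply: (dds_eq oOt) => [x [x1 x2]|]; first by apply: E => //; rewrite AE.
by split=> //=; move: Aq; rewrite AE.
Qed.

Lemma upto_cw A (V : R -> set (Cn R n)) f s : (forall t, open (V t)) -> A = [set q | V q.1 q.2] -> smooth_upto A f -> cw A (dds s f).
Proof.
move=> oV AE H q Aq; have [ O [f1 [oO Oq F' E]]] := H q Aq.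
rewrite (upto_dds s oV AE oO F' E Oq Aq).
have c := sm_cts (sm_dds oO s F') Oq.
have c' : dds s f1 @ within A (nbhs q) --> dds s f1 q by apply: cvg_within_filter.
apply: cvg_trans c'; apply: near_eq_cvg.
have := near_O oO Oq; rewrite near_withinE; apply: filterS => x Ox Ax.
by rewrite (upto_dds s oV AE oO F' E Ox Ax).
Qed.
End Upto.

(** * Rescaled flows *)

(** Positivity on e_i - w e_j, with w the phase of [G i j], gives 2 |G i j| <= G i i + G j j, and
    the diagonal entries are values of the form on unit vectors. *)
Lemma hermpos_entry (R : realType) (n : nat) (G : 'M[Cx R]_n) (L : R) i j : hermpos G ->
  (forall u, cre (sesq G u u) <= L * sqn u) -> nm (G i j) <= L.
Proof.
move=> hG H; have sqd k : sqn (delta_mx 0 k : Cn R n) = 1.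
  rewrite /sqn (bigD1 k) //= mxE !eqxx nm1 expr1n big1 ?addr0 // => l lk.
  by rewrite mxE (negbTE lk) nm0 expr0n.
have D k : cre (G k k) <= L by have := H (delta_mx 0 k); rewrite sesq_delta sqd mulr1.
have [z0|z0] := eqVneq (G i j) 0.
  by rewrite z0 nm0; apply: le_trans (D i); have := sesq_ge0 hG (delta_mx 0 i); rewrite sesq_delta.
have n0 : 0 < nm (G i j) by rewrite lt_neqAle nm_ge0 eq_sym nm_eq0 z0.
set w := rc (nm (G i j))^-1 * G i j.
have ww : w * w^* = 1.
  by rewrite conjM_nm /w nmM nm_rc ger0_norm ?invr_ge0 ?nm_ge0 // mulVf ?gt_eqF // expr1n.
have wg : w^* * G i j = rc (nm (G i j)).
  rewrite /w cjM rc_conj -mulrA (mulrC (_^*)) conjM_nm -rcM; congr rc; by rewrite expr2 mulrA mulVf ?gt_eqF // mul1r.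
have := sesq_ge0 hG (delta_mx 0 i + (- w) *: delta_mx 0 j).
rewrite sesqDl !sesqDr !sesqZl !sesqZr !sesq_delta (hG.1 i j).
have -> : G i i + (- w)^* * G i j + (- w * (G i j)^* + - w * ((- w)^* * G j j)) =
  G i i - w^* * G i j - (w^* * G i j)^* + (w * w^*) * G j j.
  by rewrite cjN cjM cjK; ring.
rewrite wg ww rc_conj !cE mul1r; have := D i; have := D j; lra.
Qed.

Lemma open_cylinder (R : realType) (n : nat) (V : set (Cn R n)) : open V -> open (setT `*` V : set (R * Cn R n)).
Proof.
move=> oV; rewrite (_ : _ `*` _ = (fun q : R * Cn R n => q.2) @^-1` V).
  by apply: open_comp => // q _; exact: cvg_snd.
by apply/seteqP; split=> [q []|q].
Qed.

Section ScaledFlow.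
Variables (R : realType) (n : nat).
Notation S := (R * Cn R n)%type.
Notation W := (seq ('I_n * bool)).
Variables (dom : set (Cn R n)) (t1 K : R) (g : S -> 'M[Cx R]_n).
Hypotheses (odom : open dom) (t10 : 0 < t1) (K0 : 0 <= K).
Let A : set S := [set q | 0 <= q.1 <= t1 /\ dom q.2].
Let Oi : set S := [set q | 0 < q.1 < t1 /\ dom q.2].
Hypothesis gs : forall i j, smooth_upto A (fun q => g q i j).
Hypothesis gt : forall t i j, 0 <= t <= t1 -> smooth_st (setT `*` dom) (fun q => g (t, q.2) i j).
Hypothesis gp : forall q, A q -> hermpos (g q).
Hypothesis gcl : forall q, Oi q -> forall i j k,
  dd (Some (k, false)) (fun q => g q i j) q = dd (Some (i, false)) (fun q => g q k j) q.
Hypothesis ge : forall t p i j, Oi (t, p) -> dd None (fun q => g q i j) (t, p) = - Ric (fun p => g (t, p)) p i j.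
Hypothesis gK : forall t p, A (t, p) -> forall a b c d, sesq (g (t, p)) a a = 1 -> sesq (g (t, p)) b b = 1 ->
    sesq (g (t, p)) c c = 1 -> sesq (g (t, p)) d d = 1 -> `|curv (fun p => g (t, p)) p a b c d| <= rc K.

Let oOi : open Oi. Proof. exact: open_slab. Qed.
Let OiA : Oi `<=` A.
Proof. by move=> q [/andP[a b] d]; split=> //; rewrite (ltW a) (ltW b). Qed.
Let sg i j : smooth_st Oi (fun q => g q i j). Proof. exact: upto_smooth oOi OiA (gs i j). Qed.
Let pg q : Oi q -> hermpos (g q). Proof. by move=> /OiA; exact: gp. Qed.

Lemma metric_cw s i j : cw A (dds s (fun q => g q i j)).
Proof.
apply: (@upto_cw R n A (fun t => [set p | 0 <= t <= t1 /\ dom p])) => // t.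
have [h|h] := boolP (0 <= t <= t1).
  by rewrite (_ : [set p | _] = dom) //; apply/seteqP; split=> [p []//|p dp]; split.
by rewrite (_ : [set p | _] = set0); [exact: open0|apply/seteqP; split=> [p []//|p]].
Qed.

Lemma metric_cw_sub B s i j : B `<=` A -> cw B (dds s (fun q => g q i j)).
Proof.
move=> BA q Bq; apply: cvg_trans (@metric_cw s i j q (BA q Bq)); apply: cvg_app.
exact: within_subset.
Qed.

Let Am := n%:R * K.
Lemma metric_rate t p u v : Oi (t, p) ->
  is_cder (fun t => sesq (g (t, p)) u v) t (- sesq (Ric (fun p => g (t, p)) p) u v) /\
  nm (sesq (Ric (fun p => g (t, p)) p) u v) <= Am * (Num.sqrt (cre (sesq (g (t, p)) u u)) * Num.sqrt (cre (sesq (g (t, p)) v v))).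
Proof.
move=> Oq; split; last first.
  by apply: (ricci_bound oOi sg pg Oq); exact: (gK (OiA Oq)).
have H k l : is_cder (fun t => g (t, p) k l) t (- Ric (fun p => g (t, p)) p k l).
  rewrite -ge // ddE; apply/is_cder_shift; exact: (sm_der None (sg k l) Oq).
have S1 (T : Type) (r : seq T) (c : T -> R -> Cx R) (d : T -> Cx R) : (forall i, is_cder (c i) t (d i)) ->
    is_cder (fun t => \sum_(i <- r) c i t) t (\sum_(i <- r) d i).
  move=> hc; elim: r => [|x r IH].
    by rewrite big_nil; apply: is_cder_ext (is_cderC 0 t) => s; rewrite big_nil.
  by rewrite big_cons; apply: is_cder_ext (is_cderD (hc x) IH) => s; rewrite big_cons.
rewrite /sesq -sumrN; apply: (S1) => k; rewrite -sumrN; apply: (S1) => l.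
have := is_cderM (is_cderM (H k l) (is_cderC (u 0 k) t)) (is_cderC (v 0 l)^* t).
by apply: is_cder_eq; rewrite !mulr0 !addr0 !mulNr.
Qed.

Lemma cvg_sesq (T : Type) (F : set_system T) (FF : Filter F) (M : T -> 'M[Cx R]_n) (M0 : 'M[Cx R]_n) u v :
  (forall i j, (fun x => M x i j) @ F --> M0 i j) -> (fun x => sesq (M x) u v) @ F --> sesq M0 u v.
Proof.
move=> H; have S1 (I : Type) (r : seq I) (c : I -> T -> Cx R) (d : I -> Cx R) : (forall i, c i @ F --> d i) ->
    (fun t => \sum_(i <- r) c i t) @ F --> \sum_(i <- r) d i.
  move=> hc; elim: r => [|x r IH].
    by rewrite big_nil (_ : (fun _ => _) = fun=> 0); [exact: cvg_cst|apply/funext => s; rewrite big_nil].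
  rewrite big_cons (_ : (fun _ => _) = fun t => c x t + \sum_(j <- r) c j t); first exact: (cvgD (hc x) IH).
  by apply/funext => s; rewrite big_cons.
apply: (S1) => k; apply: (S1) => l; apply: cvgM; last exact: cvg_cst.
by apply: cvgM; [exact: H|exact: cvg_cst].
Qed.

Let E := expR (Am * t1).
(** Since |Ric(u, u)| <= n K g(u, u), the function g(t)(u, u) satisfies a two-sided Gronwall
    inequality, and the metrics at all times are uniformly equivalent to the initial one. *)
Lemma metric_comparison t p u : 0 <= t < t1 -> dom p ->
  cre (sesq (g (t, p)) u u) <= E * cre (sesq (g (0, p)) u u) /\ cre (sesq (g (0, p)) u u) <= E * cre (sesq (g (t, p)) u u).
Proof.
move=> /andP[t0 tt] dp.
have A0 : 0 <= Am by rewrite mulr_ge0 // ler0n.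
have P s : 0 <= s < t1 -> 0 <= cre (sesq (g (s, p)) u u).
  by move=> /andP[a b]; apply: sesq_ge0; apply: gp; split=> //=; rewrite a ltW.
have E1 : 1 <= E by rewrite -expR0 ler_expR mulr_ge0 // ltW.
have EE : expR (Am * t) <= E by rewrite ler_expR ler_wpM2l // ltW.
have P0 : 0 <= cre (sesq (g (0, p)) u u) by apply: P; rewrite lexx.
have Pt : 0 <= cre (sesq (g (t, p)) u u) by apply: P; rewrite t0.
move: t0; rewrite le_eqVlt => /orP[/eqP t0|t0].
  by rewrite -t0 in Pt *; split; rewrite ler_peMl.
have [||h1 h2] := @gronwall R (fun s => cre (sesq (g (s, p)) u u)) (fun s => - cre (sesq (Ric (fun p => g (s, p)) p) u u)) t Am t0.
- move=> s /andP[s0 st]; have st1 := le_lt_trans st tt.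
  have Os : Oi (s, p) by split=> //=; rewrite s0 st1.
  have [[d _] b] := metric_rate u u Os.
  split; first by rewrite -creN.
  rewrite normrN; apply: le_trans (cre_le _) _; apply: le_trans b _.
  by rewrite -expr2 sqr_sqrtr // P // ltW.
- apply: cvg_cre; apply: cvg_sesq => i j.
  apply: (@cw_time R n t1 0 dom (fun q => g q i j)) => //; first by rewrite lexx.
  apply: (@metric_cw_sub _ [::] i j) => q [/andP[a b] d]; split=> //; by rewrite a ltW.
split.
  by apply: le_trans h1 _; rewrite ler_wpM2r.
by apply: le_trans h2 _; rewrite ler_wpM2r.
Qed.

Variables (r : R) (rho : 'I_n -> R) (U : set (Cn R n)) (lam Lam : R).
Hypotheses (r0 : 0 < r) (rho0 : forall j, 0 < rho j) (oU : open U) (Udom : forall p, U p -> dom (scp rho p)).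
Definition scaled (q : S) : 'M[Cx R]_n := \matrix_(i, j) (rc (r ^+ 2 * rho i * rho j) * g (sc rho q) i j).

Lemma scaled_sesq q u v : sesq (scaled q) u v = rc (r ^+ 2) * sesq (g (sc rho q)) (scp rho u) (scp rho v).
Proof.
rewrite /sesq mulr_sumr; apply: eq_bigr => k _; rewrite mulr_sumr; apply: eq_bigr => l _.
by rewrite !mxE cjM rc_conj !rcM; ring.
Qed.
Let scpA t p : 0 <= t <= t1 -> U p -> A (sc rho (t, p)).
Proof. by move=> h Up; split=> //=; exact: Udom. Qed.
Lemma scp_neq0 u : u != 0 -> scp rho u != 0.
Proof.
move=> H; apply: contra H => /eqP u0; apply/eqP/rowP => j; move/rowP/(_ j): u0; rewrite !mxE => /eqP.
by rewrite mulf_eq0 rc_eq0 (gt_eqF (rho0 j)) /= => /eqP.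
Qed.
Lemma scaled_pos q : 0 <= q.1 <= t1 -> U q.2 -> hermpos (scaled q).
Proof.
case: q => t p /= h Up; have [h1 h2] := gp (scpA h Up); split=> [k l|u u0].
  by rewrite !mxE h1 cjM rc_conj mulrAC; congr (rc _ * _); ring.
rewrite scaled_sesq mulr_gt0 ?h2 ?scp_neq0 // -rc0 rc_lt exprn_gt0 //.
Qed.

Lemma scaled_slice_smooth t i j : 0 <= t <= t1 -> smooth_st (setT `*` U) (fun q => scaled (t, q.2) i j).
Proof.
move=> h; have oT : open (setT `*` dom : set S) by exact: open_cylinder.
have oU' : open (setT `*` U : set S) by exact: open_cylinder.
have /smooth_stP F := sm_sc (rho := rho) oT (gt i j h).
have F' : smooth_st (setT `*` U) (fun q : S => g (t, scp rho q.2) i j).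
  by apply/smooth_stP => k; apply: Ck_sub (F k) => q [_ Uq]; split=> //=; exact: Udom.
by apply: (sm_eq oU' _ (smZ oU' (rc (r ^+ 2 * rho i * rho j)) F')) => q _; rewrite mxE.
Qed.

Lemma scaled_dds s i j t p : 0 <= t <= t1 -> U p -> dds s (fun q => scaled q i j) (t, p) =
  rc (r ^+ 2 * rho i * rho j * \prod_(a <- s) rho a.1) * dds s (fun q => g q i j) (t, scp rho p).
Proof.
move=> h Up; have oT : open (setT `*` dom : set S) by exact: open_cylinder.
have oO' := open_sc (rho := rho) oT.
have Oq : (setT `*` dom : set S) (sc rho (t, p)) by split=> //=; exact: Udom.
have sF := sm_sc (rho := rho) oT (gt i j h).
pose cc := rc (r ^+ 2 * rho i * rho j).
rewrite (@dds_slice R n s (fun q => scaled q i j) (fun q => cc * g (t, scp rho q.2) i j) t t p); last first.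
  by move=> p'; rewrite mxE.
have Z : forall s q, (setT `*` dom : set S) (sc rho q) -> dds s (fun q => cc * g (t, scp rho q.2) i j) q = cc * dds s (fun q : S => g (t, scp rho q.2) i j) q.
  elim=> [|a s' IH] q' O'; first exact: erefl.
  rewrite /= (dd_eq oO' _ IH O'); exact: (ddZ oO' _ _ (sm_dds oO' s' sF) O').
rewrite Z // (dds_sc oT s (gt i j h) Oq) mulrA -rcM; congr (_ * _).
exact: dds_slice.
Qed.

Lemma scaled_inv q k l : 0 <= q.1 <= t1 -> U q.2 ->
  invmx (scaled q) l k = rc (r ^+ 2 * rho l * rho k)^-1 * invmx (g (sc rho q)) l k.
Proof.
move=> h Uq; have hq := hermpos_unit (scaled_pos h Uq).
have hg : g (sc rho q) \in unitmx by apply: hermpos_unit; case: q h Uq {hq} => t p /= h Up; apply: gp; exact: scpA.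
pose B : 'M[Cx R]_n := \matrix_(l, k) (rc (r ^+ 2 * rho l * rho k)^-1 * invmx (g (sc rho q)) l k).
suff BE : B = invmx (scaled q) by rewrite -BE mxE.
rewrite -[B]mulmx1 -(mulmxV hq) mulmxA -[RHS]mul1mx; congr (_ *m _).
apply/matrixP => a b; rewrite mxE.
transitivity (rc (rho b / rho a) * \sum_j invmx (g (sc rho q)) a j * g (sc rho q) j b).
  rewrite mulr_sumr; apply: eq_bigr => j _; rewrite !mxE.
  rewrite mulrACA -rcM; congr (rc _ * _); move: (rho0 a) (rho0 b) (rho0 j) => a0 b0 j0.
  by field; rewrite !gt_eqF.
have := mulVmx hg => /matrixP/(_ a b); rewrite !mxE => ->.
by have [->|_] := eqVneq a b; rewrite ?mulr0 // mulr1 mulfV ?gt_eqF.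
Qed.

(** Both parts of the right-hand side are covariant under linear changes of coordinates, and the
    Ricci form is unchanged when the metric is multiplied by r^2; the left-hand side is not, which
    leaves the factor r^2. *)
Lemma scaled_evolution q i j : 0 < q.1 < t1 -> U q.2 -> dd None (fun q => scaled q i j) q =
    rc (r ^+ 2) * (Lop scaled (fun q => scaled q i j) q + ev scaled (R0 R i j) q).
Proof.
case: q => t p h Up; have {}h : 0 < t < t1 by []. have {}Up : U p by [].
have h' : 0 <= t <= t1 by case/andP: h => a b; rewrite (ltW a) (ltW b).
have Os : Oi (sc rho (t, p)) by split=> //=; exact: Udom.
have oO' := open_sc (rho := rho) oOi.
have tE : dd None (fun q => scaled q i j) (t, p) = rc (r ^+ 2 * rho i * rho j) * dd None (fun q => g q i j) (sc rho (t, p)).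
  rewrite (_ : (fun q => scaled q i j) = fun q => rc (r ^+ 2 * rho i * rho j) * g (sc rho q) i j); last by apply/funext => q'; rewrite mxE.
  rewrite (ddZ oO' _ _ (sm_sc (rho := rho) oOi (sg i j)) Os) (dd_sc _ (sg i j) Os) /= rc1 mul1r //.
have eE := kahler_flow_rhs oOi sg pg i j Os gcl.
rewrite tE ge // eE.
have ring4 (c1 c2 c3 c4 c5 b1 X b2 Y : Cx R) : c1 * c2 * (c3 * c4) = c5 ->
    c1 * b1 * (c2 * X) * (c3 * b2 * (c4 * Y)) = c5 * (b1 * X * (b2 * Y)) by move=> <-; ring.
have -> : Lop scaled (fun q => scaled q i j) (t, p) = rc (rho i * rho j) * Lop g (fun q => g q i j) (sc rho (t, p)).
  rewrite /Lop mulr_sumr; apply: eq_bigr => k _; rewrite mulr_sumr; apply: eq_bigr => l _.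
  rewrite scaled_inv // -[dd _ _ (t, p)]/(dds [:: (k, false); (l, true)] (fun q => scaled q i j) (t, p)) scaled_dds //.
  rewrite mulrACA -rcM; congr (rc _ * _); rewrite !big_cons big_nil /=.
  move: (rho0 k) (rho0 l) => k0 l0; by field; rewrite !gt_eqF.
have -> : ev scaled (R0 R i j) (t, p) = rc (rho i * rho j) * ev g (R0 R i j) (sc rho (t, p)).
  rewrite /= !mulN1r mulrN; congr (- _).
  rewrite !ev_esum mulr_sumr; apply: eq_bigr => a _; rewrite !ev_esum mulr_sumr; apply: eq_bigr => b _.
  rewrite !ev_esum mulr_sumr; apply: eq_bigr => c _; rewrite !ev_esum mulr_sumr; apply: eq_bigr => d _.
  rewrite [ev _ _ (t, p)]/= [ev _ _ (sc _ _)]/= !scaled_inv //.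
  rewrite -[dd _ _ (t, p)]/(dds [:: (i, false)] (fun q => scaled q b c) (t, p)) scaled_dds //.
  rewrite -[dd _ _ (t, p)]/(dds [:: (j, true)] (fun q => scaled q d a) (t, p)) scaled_dds //.
  apply: ring4; rewrite -!rcM; congr rc; rewrite !big_cons big_nil /=.
  move: (rho0 a) (rho0 b) (rho0 c) (rho0 d) => a0 b0 c0 d0; by field; rewrite !gt_eqF.
by rewrite -mulrDr mulrA -rcM; congr (rc _ * _); rewrite mulrA.
Qed.

Hypotheses (lam0 : 0 < lam) (Lam0 : 0 <= Lam).
Hypothesis lower0 : forall p u, U p -> lam * sqn u <= cre (sesq (scaled (0, p)) u u).
Hypothesis upper0 : forall p u, U p -> cre (sesq (scaled (0, p)) u u) <= Lam * sqn u.

(** The summands provide in turn for 1 <= L, for the upper bound and the entries of the metric, for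
    the entries of its inverse, and for the Lipschitz constant in time. *)
Let Lb := 1 + E * Lam + E / lam + 2 * (Am * (E * Lam)).
Lemma scaled_flow : flow t1 (r ^+ 2) Lb U scaled.
Proof.
have A0 : 0 <= Am by rewrite mulr_ge0 // ler0n.
have E0 : 0 < E by exact: expR_gt0.
have EL : 0 <= E * Lam by rewrite mulr_ge0 // ltW.
have El : 0 <= E / lam by rewrite divr_ge0 // ltW.
have AEL : 0 <= 2 * (Am * (E * Lam)) by rewrite !mulr_ge0 // ltW.
have L1 : 1 <= Lb by rewrite /Lb -!addrA lerDl !addr_ge0.
have LEL : E * Lam <= Lb by rewrite /Lb; lra.
have LEl : E / lam <= Lb by rewrite /Lb; lra.
have LA : 2 * (Am * (E * Lam)) <= Lb by rewrite /Lb; lra.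
have ltle t : 0 <= t < t1 -> 0 <= t <= t1 by case/andP=> a b; rewrite a ltW.
have cmp t p u : 0 <= t < t1 -> U p -> cre (sesq (scaled (t, p)) u u) <= E * cre (sesq (scaled (0, p)) u u) /\
    cre (sesq (scaled (0, p)) u u) <= E * cre (sesq (scaled (t, p)) u u).
  move=> h Up; rewrite !scaled_sesq !cE !mul0r !subr0.
  have [h1 h2] := metric_comparison (scp rho u) h (Udom Up).
  by split; rewrite mulrCA ler_pM2l ?exprn_gt0.
have up t p u : 0 <= t < t1 -> U p -> cre (sesq (scaled (t, p)) u u) <= E * Lam * sqn u.
  move=> h Up; apply: le_trans (cmp t p u h Up).1 _; rewrite -mulrA ler_pM2l //; exact: upper0.
have cwG s i j : cw [set q | 0 <= q.1 < t1 /\ U q.2] (dds s (fun q => scaled q i j)).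
  move=> [t p] [h Up]; have h' := ltle _ h.
  pose cc := rc (r ^+ 2 * rho i * rho j * \prod_(a <- s) rho a.1).
  have c1 : (fun q => cc * dds s (fun q => g q i j) (sc rho q)) @ within [set q | 0 <= q.1 < t1 /\ U q.2] (nbhs ((t, p) : S)) -->
      cc * dds s (fun q => g q i j) (sc rho (t, p)).
    apply: cvgM; first exact: cvg_cst.
    have c2 : sc rho @ within [set q | 0 <= q.1 < t1 /\ U q.2] (nbhs ((t, p) : S)) --> within A (nbhs (sc rho (t, p))).
      move=> B HB; have H2 : nbhs ((t, p) : S) (sc rho @^-1` [set x | A x -> B x]) by exact: (@cvg_sc R n rho (t, p) _ HB).
      have H3 : nbhs ((t, p) : S) [set q : S | [set q | 0 <= q.1 < t1 /\ U q.2] q -> B (sc rho q)].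
        by apply: filterS H2 => q HB' [hq Uq]; apply: HB'; split; [exact: ltle|exact: Udom].
      exact: H3.
    apply: (cvg_comp _ _ c2); apply: metric_cw; exact: scpA.
  rewrite [X in _ --> X](scaled_dds s i j h' Up).
  apply: cvg_trans c1; apply: near_eq_cvg.
  rewrite near_withinE; apply: filterE => -[t' p'] [hq Uq] /=.
  by rewrite (scaled_dds s i j (ltle _ hq) Uq).
split.
- by rewrite exprn_gt0.
- exact: oU.
- move=> i j.
  have oO' : open [set q : S | 0 < q.1 < t1 /\ U q.2] by exact: open_slab.
  have /smooth_stP F := sm_sc (rho := rho) oOi (sg i j).
  have F' : smooth_st [set q : S | 0 < q.1 < t1 /\ U q.2] (fun q : S => g (sc rho q) i j).
    by apply/smooth_stP => k; apply: Ck_sub (F k) => q [h Uq]; split=> //=; exact: Udom.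
  by apply: (sm_eq oO' _ (smZ oO' (rc (r ^+ 2 * rho i * rho j)) F')) => q _; rewrite mxE.
- by move=> t i j h; apply: scaled_slice_smooth; exact: ltle.
- exact: cwG.
- by move=> q h Uq; apply: scaled_pos => //; exact: ltle.
- exact: scaled_evolution.
- exact: L1.
- move=> [t p] h Up u; apply: le_trans (up t p u h Up) _; rewrite ler_wpM2r // sqn_ge0 //.
- move=> [t p] h Up i j; apply: le_trans LEl.
  have -> : E / lam = (lam / E)^-1 by rewrite invfM invrK mulrC.
  apply: (inv_bound (scaled_pos (ltle _ h) Up)) => [|u]; first by rewrite divr_gt0.
  rewrite mulrAC ler_pdivrMr // mulrC (mulrC _ E); apply: le_trans (cmp t p u h Up).2.
  by rewrite mulrC; exact: lower0.
- move=> [t p] h Up i j; apply: le_trans LEL.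
  by apply: (hermpos_entry _ _ (scaled_pos (ltle _ h) Up)) => u; exact: up.
(* As |Ric| <= Am g, the product r^2 Ric is at most Am times the rescaled metric. The Lipschitz
   constant is thus independent of r, but does not become small with r. *)
have lip t t' p i j : 0 <= t' -> t' < t -> t < t1 -> U p -> nm (scaled (t, p) i j - scaled (t', p) i j) <= Lb * (t - t').
  move=> t'0 tt tt1 Up; apply: (@le_trans _ _ (2 * (Am * (E * Lam)) * (t - t'))); last by rewrite ler_wpM2r // subr_ge0 ltW.
  pose ei := scp rho (delta_mx 0 i); pose ej := scp rho (delta_mx 0 j).
  have GE s k l : scaled (s, p) k l = rc (r ^+ 2) * sesq (g (s, scp rho p)) (scp rho (delta_mx 0 k)) (scp rho (delta_mx 0 l)).
    by rewrite -(scaled_sesq (s, p)) sesq_delta.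
  apply: (@time_increment R (fun s => scaled (s, p) i j) (fun s => rc (r ^+ 2) * - sesq (Ric (fun p => g (s, p)) (scp rho p)) ei ej)) => //.
    move=> s /andP[s0 st]; have sI : 0 < s < t1 by rewrite (le_lt_trans t'0 s0) (le_lt_trans st tt1).
    have sI' : 0 <= s < t1 by case/andP: sI => a b; rewrite ltW.
    have Os : Oi (s, scp rho p) by split=> //=; exact: Udom.
    have [d b] := metric_rate ei ej Os; split.
      have := is_cderM (is_cderC (rc (r ^+ 2)) s) d; rewrite mul0r add0r.
      by apply: is_cder_ext => s'; rewrite GE.
    rewrite nmM nmN nm_rc ger0_norm ?sqr_ge0 //.
    have dg k : r ^+ 2 * cre (sesq (g (s, scp rho p)) (scp rho (delta_mx 0 k)) (scp rho (delta_mx 0 k))) <= E * Lam.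
      have -> : r ^+ 2 * cre (sesq (g (s, scp rho p)) (scp rho (delta_mx 0 k)) (scp rho (delta_mx 0 k))) = cre (scaled (s, p) k k).
        by rewrite GE !cE mul0r subr0.
      apply: le_trans (ler_norm _) _; apply: le_trans (cre_le _) _.
      have hp : hermpos (scaled (s, p)) by apply: scaled_pos => //=; exact: ltle.
      by apply: (hermpos_entry k k hp) => u; exact: up.
    have hs := gp (scpA (ltle _ sI') Up).
    apply: le_trans (ler_wpM2l (sqr_ge0 r) b) _; rewrite mulrCA ler_wpM2l //.
    have x0 := sesq_ge0 hs ei; have y0 := sesq_ge0 hs ej; have := dg i; have := dg j; rewrite -/ei -/ej.
    set x := cre (sesq _ ei ei) in x0 *; set y := cre (sesq _ ej ej) in y0 *; move=> h1 h2.
    have sx := sqr_sqrtr x0; have sy := sqr_sqrtr y0.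
    have : Num.sqrt x * Num.sqrt y <= (x + y) / 2.
      by have := sqr_ge0 (Num.sqrt x - Num.sqrt y); rewrite sqrrB sx sy; lra.
    move=> h3; apply: le_trans (ler_wpM2l (sqr_ge0 r) h3) _; lra.
  apply: (@cw_time R n t1 t' U (fun q => scaled q i j)) => //; first by rewrite t'0 (lt_trans tt tt1).
  exact: (cwG [::] i j).
move=> t t' p i j /andP[a b] /andP[a' b'] Up.
have [h|h|->] := ltgtP t t'.
- by rewrite nmBC distrC ger0_norm ?subr_ge0 ?(ltW h) // lip.
- by rewrite ger0_norm ?subr_ge0 ?(ltW h) // lip.
- by rewrite !subrr nm0 normr0 mulr0.
Qed.
End ScaledFlow.

(** * Rescaled flows as r tends to 0 *)

Section Stability.
Variables (R : realType) (n : nat).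
Notation S := (R * Cn R n)%type.
Notation W := (seq ('I_n * bool)).

(** What a single chart sees of the flow on the closed interval [0, t1]: smoothness up to both end
    times, and the evolution equation in the interior only. *)
Record metric_flow (dom : set (Cn R n)) (t1 K : R) (g : S -> 'M[Cx R]_n) : Prop := MetricFlow {
  mf_dom : open dom;
  mf_t : 0 < t1;
  mf_K : 0 <= K;
  mf_s : forall i j, smooth_upto [set q | 0 <= q.1 <= t1 /\ dom q.2] (fun q => g q i j);
  mf_slice : forall t i j, 0 <= t <= t1 -> smooth_st (setT `*` dom) (fun q => g (t, q.2) i j);
  mf_p : forall q, [set q | 0 <= q.1 <= t1 /\ dom q.2] q -> hermpos (g q);
  mf_cl : forall q, [set q | 0 < q.1 < t1 /\ dom q.2] q -> forall i j k,
    dd (Some (k, false)) (fun q => g q i j) q = dd (Some (i, false)) (fun q => g q k j) q;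
  mf_e : forall t p i j, [set q | 0 < q.1 < t1 /\ dom q.2] (t, p) ->
    dd None (fun q => g q i j) (t, p) = - Ric (fun p => g (t, p)) p i j;
  mf_curv : forall t p, [set q | 0 <= q.1 <= t1 /\ dom q.2] (t, p) -> forall a b c d,
    sesq (g (t, p)) a a = 1 -> sesq (g (t, p)) b b = 1 ->
    sesq (g (t, p)) c c = 1 -> sesq (g (t, p)) d d = 1 -> `|curv (fun p => g (t, p)) p a b c d| <= rc K
}.

Variables (dom : set (Cn R n)) (t1 K : R) (g : S -> 'M[Cx R]_n).
Hypothesis mf : metric_flow dom t1 K g.
Variables (rho : R -> 'I_n -> R) (K1 U : set (Cn R n)) (c lam Lam r1 : R).
Hypotheses (c0 : 0 < c) (r10 : 0 < r1) (lam0 : 0 < lam) (Lam0 : 0 <= Lam) (oU : open U).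
Hypothesis K1U : forall p0, K1 p0 -> forall p, dist2 p0 p <= c -> U p.
Let G r := scaled g r (rho r).
Hypothesis rho0 : forall r, 0 < r < r1 -> forall j, 0 < rho r j.
Hypothesis Udom : forall r, 0 < r < r1 -> forall p, U p -> dom (scp (rho r) p).
Hypothesis lower0 : forall r, 0 < r < r1 -> forall p u, U p -> lam * sqn u <= cre (sesq (G r (0, p)) u u).
Hypothesis upper0 : forall r, 0 < r < r1 -> forall p u, U p -> cre (sesq (G r (0, p)) u u) <= Lam * sqn u.
Hypothesis init0 : forall M : nat, exists C r2 : R, [/\ 0 <= C, 0 < r2 & forall r, 0 < r < r2 -> forall (s : W) i j p,
  (size s <= M)%N -> U p -> nm (dds s (fun q => G r q i j) (0, p)) <= C].

(** The uniform bounds are invoked for the orders up to |s| + 2, because the evolution equation of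
    the word s costs two derivatives. *)
Lemma stability s i j : exists C r2 : R, [/\ 0 <= C, 0 < r2 & forall r p, 0 < r < r2 -> K1 p ->
  nm (dds s (fun q => G r q i j) (t1, p) - dds s (fun q => G r q i j) (0, p)) <= r ^+ 2 * C].
Proof.
have [odom t10 K0 gs gt gp gcl ge gK] := mf.
have [L [L1 flowG]] : exists L : R, 1 <= L /\ forall r, 0 < r < r1 -> flow t1 (r ^+ 2) L U (G r).
  pose E := expR (n%:R * K * t1).
  have H r : 0 < r < r1 -> flow t1 (r ^+ 2) (1 + E * Lam + E / lam + 2 * (n%:R * K * (E * Lam))) U (G r).
    move=> hr; have r0 : 0 < r by case/andP: hr.
    exact: (scaled_flow odom t10 K0 gs gt gp gcl ge gK r0 (rho0 hr) oU (Udom hr) lam0 Lam0 (lower0 hr) (upper0 hr)).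
  exists (1 + E * Lam + E / lam + 2 * (n%:R * K * (E * Lam))); split=> //.
  have hr : 0 < r1 / 2 < r1 by rewrite divr_gt0 //= ltr_pdivrMr // ltr_pMr // ltr1n.
  exact: fl_L (H _ hr).
have c20 : 0 <= c / 2 by rewrite divr_ge0 // ltW.
have c2c : c / 2 < c by rewrite ltr_pdivrMr // ltr_pMr // ltr1n.
have [M HM] := uniform_bounds n t1 (size s).+1 L1 c20 c2c.
have [C [r2 [C0 r20 HC]]] := init0 M.
have [B B0 HB] := HM C C0.
have [C' C'0 HC'] := word_increment s i j L1 B0.
exists (C' * t1), (Num.min r1 r2); split.
- by rewrite mulr_ge0 // ltW.
- by rewrite lt_min r10.
move=> r p /andP[r0]; rewrite lt_min => /andP[rr1 rr2] Kp.
have hr1 : 0 < r < r1 by rewrite r0.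
have hr2 : 0 < r < r2 by rewrite r0.
have fl := flowG r hr1.
have d0 : dist2 p p = 0 by rewrite /dist2 big1 // => k _; rewrite subrr nm0 expr0n.
have Up : U p by apply: (K1U Kp); rewrite d0 ltW.
have bd s' i' j' t : (size s' <= (size s).+2)%N -> 0 <= t < t1 -> nm (dds s' (fun q => G r q i' j') (t, p)) <= B.
  move=> hs ht; apply: (HB _ _ _ _ _ fl (lexx _) (K1U Kp)) => //=; last by rewrite d0.
  by move=> s2 i2 j2 p2 d2 h2; apply: HC => //; exact: (K1U Kp).
have inc t : 0 < t < t1 -> nm (dds s (fun q => G r q i j) (t, p) - dds s (fun q => G r q i j) (0, p)) <= r ^+ 2 * (C' * t1).
  move=> ht; apply: le_trans (HC' _ _ _ _ _ fl Up bd t ht) _; rewrite -mulrA ler_wpM2l ?sqr_ge0 // ler_wpM2l //.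
  by case/andP: ht => _ /ltW.
have t1t : 0 <= t1 <= t1 by rewrite lexx andbT ltW.
(* [flow] lives on the half-open interval [0, t1), so the value at t1 is reached as a limit from the
   left, by smoothness up to t1. *)
have cl : (fun t => dds s (fun q => G r q i j) (t, p)) @ t1^'- --> dds s (fun q => G r q i j) (t1, p).
  have dp := Udom hr1 Up.
  have q1 : [set q | 0 <= q.1 <= t1 /\ dom q.2] ((t1, scp (rho r) p) : S) by split.
  have h : (fun t : R => ((t, scp (rho r) p) : S)) @ t1^'- --> within [set q | 0 <= q.1 <= t1 /\ dom q.2] (nbhs ((t1, scp (rho r) p) : S)).
    move=> A /= [[V1 V2] /= [V10 V20] HV].
    have n1 : \forall x \near t1^'-, V1 x by exact: (@cvg_at_left_filter _ _ id t1 _ cvg_id).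
    have p2 : V2 (scp (rho r) p) by exact: nbhs_singleton.
    have : \forall x \near t1^'-, [/\ V1 x, 0 < x & x < t1].
      near=> x; split; [by near: x| |]; near: x; [exact: nbhs_left_gt|exact: nbhs_left_lt].
    by apply: filterS => x [v1 x0 xB]; apply: HV => //=; split=> //=; rewrite (ltW x0) (ltW xB).
  have cg := cvg_comp _ _ h (metric_cw odom gs (s := s) (i := i) (j := j) q1).
  rewrite (scaled_dds odom gt r (Udom hr1) s i j t1t Up).
  pose cc := rc (r ^+ 2 * rho r i * rho r j * \prod_(a <- s) rho r a.1).
  have c2 : (fun t => cc * dds s (fun q => g q i j) (t, scp (rho r) p)) @ t1^'- --> cc * dds s (fun q => g q i j) (t1, scp (rho r) p).
    by apply: cvgM; [exact: cvg_cst|exact: cg].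
  apply: cvg_trans c2; apply: near_eq_cvg.
  have : \forall x \near t1^'-, 0 < x < t1.
    near=> x; apply/andP; split; near: x; [exact: nbhs_left_gt|exact: nbhs_left_lt].
  apply: filterS => x /andP[x0 xt]; have hx : 0 <= x <= t1 by rewrite (ltW x0) (ltW xt).
  by rewrite /G (scaled_dds odom gt r (Udom hr1) s i j hx Up).
have cl2 : (fun t => dds s (fun q => G r q i j) (t, p) - dds s (fun q => G r q i j) (0, p)) @ t1^'- -->
    dds s (fun q => G r q i j) (t1, p) - dds s (fun q => G r q i j) (0, p) by apply: cvgB; [exact: cl|exact: cvg_cst].
have cl3 : (fun t => nm (dds s (fun q => G r q i j) (t, p) - dds s (fun q => G r q i j) (0, p))) @ t1^'- -->
   nm (dds s (fun q => G r q i j) (t1, p) - dds s (fun q => G r q i j) (0, p)) by exact: (cvg_nmf _ cl2).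
apply: (cvgr_to_le cl3); near=> t; apply: inc; apply/andP; split; near: t; [exact: nbhs_left_gt|exact: nbhs_left_lt].
Unshelve. all: by end_near.
Qed.
End Stability.

(** * Real derivatives against Wirtinger derivatives *)

Section RealDerivatives.
Variables (R : realType) (n : nat).
Notation S := (R * Cn R n)%type.
Variables (O : set S) (oO : open O).
Implicit Types (f h : S -> Cx R).

Lemma sm_pders s f : smooth_st O f -> smooth_st O (foldr (@pd R n) f s).
Proof. by move=> F; elim: s => [|a s IH]; [exact: F|exact: sm_pd]. Qed.
Lemma pd_ddC a b f q : smooth_st O f -> O q -> dd b (pd a f) q = pd a (dd b f) q.
Proof.
move=> F Oq; case: a => [[j c]|].
  rewrite (pd_ddE _ _ (sm_dd oO b F) Oq) (dd_eq oO b (fun q' O' => pd_ddE j c F O') Oq).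
  case: c.
    have s1 := sm_dd oO (Some (j, false)) F; have s2 := sm_dd oO (Some (j, true)) F.
    by rewrite (ddZ oO _ b (smB oO s1 s2) Oq) (ddB oO b s1 s2 Oq) !(ddC oO b _ F Oq).
  by rewrite (ddD _ (sm_dd oO (Some (j, false)) F) (sm_dd oO (Some (j, true)) F) Oq) !(ddC oO b).
have E q' : O q' -> pd None f q' = dd None f q' by rewrite ddE.
by rewrite (dd_eq oO b E Oq) (ddC oO) // ddE.
Qed.
Lemma dd_pdersC s b f q : smooth_st O f -> O q -> dd b (foldr (@pd R n) f s) q = foldr (@pd R n) (dd b f) s q.
Proof.
move=> F; elim: s q => [//|a s IH] q Oq /=.
rewrite (pd_ddC _ _ (sm_pders s F) Oq).
exact: (pd_eq oO) Oq.
Qed.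

(** [smooth_cvg] speaks of real derivatives and of the time derivative, the estimates of Wirtinger
    words. A real derivative is, up to a unit, a sum or difference of two Wirtinger derivatives,
    whence a factor 2 for each letter; a time letter gives 0. *)
Lemma pders_bound (s : seq (option ('I_n * bool))) f q (M : R) : 0 <= M -> smooth_st O f -> O q ->
  (forall q, O q -> pd None f q = 0) ->
  (forall w, size w = size s -> nm (dds w f q) <= M) -> nm (foldr (@pd R n) f s q) <= 2 ^+ size s * M.
Proof.
move=> M0; elim: s f => [|a s IH] f F Oq f0 H; first by rewrite expr0 mul1r; exact: (H [::]).
have step j b : nm (dd (Some (j, b)) (foldr (@pd R n) f s) q) <= 2 ^+ size s * M.
  rewrite (dd_pdersC _ _ F Oq); apply: (IH _ (sm_dd oO (Some (j, b)) F) Oq).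
    move=> q' O'; have := ddC oO None (Some (j, b)) F O'; rewrite ddE => ->.
    by rewrite (dd_eq oO (g := fun=> 0) _ _ O') ?dd_cst // => q2 O2; rewrite ddE f0.
  by move=> w hw; rewrite -(dd_ddsC oO) // ; apply: (H ((j, b) :: w)); rewrite /= hw.
have M2 : 0 <= 2 ^+ size s * M by rewrite mulr_ge0 // exprn_ge0.
have SF := sm_pders s F.
rewrite /= exprS -mulrA; case: a H => [[j c]|] H; last first.
  have -> : pd None (foldr (@pd R n) f s) q = 0; last by rewrite nm0 mulr_ge0.
  have -> : pd None (foldr (@pd R n) f s) q = dd None (foldr (@pd R n) f s) q by rewrite ddE.
  rewrite dd_pdersC //.
  have E : forall q', O q' -> dd None f q' = 0 by move=> q' O'; rewrite ddE f0.
  have Z : forall s q', O q' -> foldr (@pd R n) (dd None f) s q' = 0.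
    elim=> [|b s' IH'] q' O' /=; first exact: E.
    by rewrite (pd_eq oO b (g := fun=> 0) IH' O'); apply: pd_cder; exact: is_cderC.
  exact: Z.
rewrite (pd_ddE _ _ SF Oq); have h1 := step j false; have h2 := step j true.
case: c {H}; last by apply: le_trans (nmD _ _) _; lra.
by rewrite nmM nm_i mul1r; apply: le_trans (nmB _ _) _; lra.
Qed.
End RealDerivatives.

(** * Uniform bounds on compact sets *)

Section CompactFamilies.
Variables (R : realType) (n : nat).
Notation S := (R * Cn R n)%type.

(** A uniform limit of continuous functions is continuous; the continuity of the model metric will
    come from the convergence in this way. *)
Lemma uniform_cw (T : topologicalType) (K : set T) (h : T -> Cx R) :
  (forall e : R, 0 < e -> exists2 f : T -> Cx R, cw K f & forall p, K p -> nm (f p - h p) <= e) -> cw K h.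
Proof.
move=> H p Kp; apply/cvg_nm => e e0.
have [|f cf fh] := H (e / 4); first by rewrite divr_gt0.
have /cvg_nm/(_ (e / 4)) := cf p Kp; rewrite divr_gt0 // => /(_ isT).
rewrite !near_withinE; apply: filterS => x Hx Kx; have h1 := Hx Kx.
have := fh x Kx; have := fh p Kp => h2 h3.
have -> : h x - h p = - (f x - h x) + (f x - f p) + (f p - h p) by ring.
apply: le_lt_trans (nmD _ _) _; have := nmD (- (f x - h x)) (f x - f p); rewrite nmN => h4.
lra.
Qed.

Lemma compact_bound (T : topologicalType) (K : set T) (f : T -> Cx R) : compact K -> cw K f ->
  exists B : R, forall p, K p -> nm (f p) <= B.
Proof.
move=> cK cf; have [K0|/set0P[x0 Kx0]] := eqVneq K set0; first by exists 0; rewrite K0.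
have [||x Kx Mx] := @compact_EVT_max _ R (fun p => nm (f p)) K _ cK _.
- by exists x0.
- by apply/subspace_continuousP => x Kx; exact: (cvg_nmf _ (cf x Kx)).
by exists (nm (f x)) => p Kp; apply: Mx; rewrite inE.
Qed.

Lemma sqnZ (k : Cx R) (u : Cn R n) : sqn (k *: u) = nm k ^+ 2 * sqn u.
Proof. by rewrite /sqn mulr_sumr; apply: eq_bigr => j _; rewrite mxE nmM exprMn. Qed.

(** Minimum of the form over the product of K with the unit sphere, extended by homogeneity. *)
Lemma uniform_ellipticity (K : set (Cn R n)) (M : Cn R n -> 'M[Cx R]_n) : compact K ->
  (forall i j, cw K (fun p => M p i j)) -> (forall p, K p -> hermpos (M p)) ->
  exists2 lam : R, 0 < lam & forall p u, K p -> lam * sqn u <= cre (sesq (M p) u u).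
Proof.
move=> cK cM hM; pose Sp : set (Cn R n) := [set u | sqn u = 1].
have d2 (u : Cn R n) : dist2 0 u = sqn u by apply: eq_bigr => j _; rewrite mxE subr0.
have cS : compact Sp.
  apply: (subclosed_compact _ (@compact_ball R n 0 1)); last by move=> u /= u1; rewrite d2 u1.
  have -> : Sp = dist2 0 @^-1` [set 1] by apply/seteqP; split=> u /=; rewrite d2.
  by apply: closed_comp; [move=> z _; exact: cvg_dist2|exact: closed_eq].
have red lam : 0 < lam -> (forall p u, K p -> Sp u -> lam <= cre (sesq (M p) u u)) ->
    forall p u, K p -> lam * sqn u <= cre (sesq (M p) u u).
  move=> l0 H p u Kp; have [->|u0] := eqVneq u 0.
    by rewrite sesq0 /sqn big1 ?mulr0 // => j _; rewrite mxE nm0 expr0n.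
  have s0 := sqn_gt0 u0; set s := Num.sqrt (sqn u).
  have sp : 0 < s by rewrite sqrtr_gt0.
  have ss : s ^+ 2 = sqn u by rewrite sqr_sqrtr // ltW.
  have := H p (rc s^-1 *: u) Kp; rewrite sesqZl sesqZr rc_conj /Sp /= sqnZ nm_rc ger0_norm ?invr_ge0 ?(ltW sp) //.
  rewrite -ss -exprMn mulVf ?gt_eqF // expr1n => /(_ erefl).
  rewrite mulrA -rcM !cE mul0r subr0 -expr2 exprVn mulrC ler_pdivlMr ?exprn_gt0 //.
have [E|/set0P[[p1 u1] [/= Kp1 Su1]]] := eqVneq (K `*` Sp) set0.
  exists 1 => //; apply: red => // p u Kp Su; exfalso.
  have : (K `*` Sp) (p, u) by split.
  by rewrite E.
pose Phi (x : Cn R n * Cn R n) := cre (sesq (M x.1) x.2 x.2).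
have cP : cw (K `*` Sp) Phi.
  move=> [p u] [Kp Su]; apply: cvg_cre.
  have c1 : (fun x : Cn R n * Cn R n => x.1) @ within (K `*` Sp) (nbhs (p, u)) --> within K (nbhs p).
    move=> A HA; have cf : (fun x : Cn R n * Cn R n => x.1) @ nbhs ((p, u) : Cn R n * Cn R n) --> p by exact: cvg_fst.
    have H2 : nbhs ((p, u) : Cn R n * Cn R n) [set x : Cn R n * Cn R n | K x.1 -> A x.1] by exact: (cf _ HA).
    by have H3 : nbhs (p, u) [set x | (K `*` Sp) x -> A x.1] by apply: filterS H2 => x h [/h].
  have c2 k : (fun x : Cn R n * Cn R n => x.2 0 k) @ within (K `*` Sp) (nbhs (p, u)) --> u 0 k.
    by apply: cvg_within_filter; apply: (cvg_comp _ _ (@cvg_snd _ _ _ _ _) (@cvg_coord R n u k)).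
  have S1 (I : Type) (r : seq I) (c : I -> Cn R n * Cn R n -> Cx R) (d : I -> Cx R) : (forall i, c i @ within (K `*` Sp) (nbhs (p, u)) --> d i) ->
    (fun t => \sum_(i <- r) c i t) @ within (K `*` Sp) (nbhs (p, u)) --> \sum_(i <- r) d i.
    move=> hc; elim: r => [|x r IH].
      by rewrite big_nil (_ : (fun _ => _) = fun=> 0); [exact: cvg_cst|apply/funext => s; rewrite big_nil].
    rewrite big_cons (_ : (fun _ => _) = fun t => c x t + \sum_(j <- r) c j t); first exact: (cvgD (hc x) IH).
    by apply/funext => s; rewrite big_cons.
  apply: (S1) => k; apply: (S1) => l; apply: cvgM; last by apply: cvg_conj; exact: c2.
  by apply: cvgM; [exact: (cvg_comp _ _ c1 (cM k l p Kp))|exact: c2].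
have [||[p0 u0] Kx Mx] := @compact_EVT_min _ R Phi (K `*` Sp) _ (compact_setX cK cS) _.
- by exists (p1, u1).
- exact/subspace_continuousP.
rewrite inE in Kx; case: Kx => /= Kp0 Su0.
have P0 : 0 < Phi (p0, u0).
  apply: (sesq_gt0 (hM p0 Kp0)); apply/eqP => /= u00; move: Su0.
  by rewrite /Sp /= u00 /sqn big1 => [/eqP|j _]; [rewrite eq_sym oner_eq0|rewrite mxE nm0 expr0n].
exists (Phi (p0, u0)) => //; apply: red => // p u Kp Su.
by apply: (Mx (p, u)); rewrite inE; split.
Qed.

Variables (O : set S) (oO : open O).
Lemma pdersB s f h q : smooth_st O f -> smooth_st O h -> O q ->
  foldr (@pd R n) (fun q => f q - h q) s q = foldr (@pd R n) f s q - foldr (@pd R n) h s q.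
Proof.
move=> F H; elim: s q => [//|a s IH] q Oq /=; rewrite (pd_eq oO a IH Oq).
apply: pd_cder; apply: is_cderD; first exact: (sm_der a (sm_pders s F) Oq).
by apply: is_cderN; exact: (sm_der a (sm_pders s H) Oq).
Qed.
Lemma ddsB s f h q : smooth_st O f -> smooth_st O h -> O q ->
  dds s (fun q => f q - h q) q = dds s f q - dds s h q.
Proof.
move=> F H; elim: s q => [//|a s IH] q Oq /=; rewrite (dd_eq oO _ IH Oq).
by rewrite (ddB oO _ (sm_dds oO s F) (sm_dds oO s H) Oq).
Qed.
(** Converse to [pders_bound]: a Wirtinger derivative is half of a sum of two real derivatives up to
    units, so no constant is lost. *)
Lemma dds_bound (w : seq ('I_n * bool)) f q (M : R) : smooth_st O f -> O q ->
  (forall s, size s = size w -> nm (foldr (@pd R n) f s q) <= M) -> nm (dds w f q) <= M.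
Proof.
elim: w f => [|[j b] w IH] f F Oq H; first exact: (H [::]).
have step c : nm (pd (Some (j, c)) (dds w f) q) <= M.
  have -> : pd (Some (j, c)) (dds w f) q = dds w (pd (Some (j, c)) f) q.
    elim: w q Oq {IH H} => [//|a w IH] q Oq /=.
    by rewrite -(pd_ddC oO _ _ (sm_dds oO w F) Oq); exact: (dd_eq oO) Oq.
  apply: (IH _ (sm_pd (Some (j, c)) F) Oq) => s hs.
  have -> : foldr (@pd R n) (pd (Some (j, c)) f) s q = foldr (@pd R n) f (rcons s (Some (j, c))) q by rewrite foldr_rcons.
  by apply: H; rewrite size_rcons hs.
rewrite /= ddE nmM nmV (_ : nm 2 = 2); last by rewrite -(rc_nat R 2) nm_rc normr_nat.
rewrite ler_pdivrMr //; apply: le_trans (nmD _ _) _; rewrite nmM (_ : nm (if b then _ else _) = 1); last first.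
  by case: b {H}; rewrite ?nmN nm_i.
have := step false; have := step true; lra.
Qed.
End CompactFamilies.

(** * Conical asymptotics *)

Section Pieces.
Variables (R : realType) (m : nat).
Notation n := m.+1.
Notation S := (R * Cn R n)%type.

Definition ray (r : R) (j : 'I_n) : R := if j == ord0 then r else 1.

Lemma zc_zw (z : Cx R) (w : Cn R m) : zc (zw z w) = z.
Proof. by rewrite /zc /zw mxE unlift_none. Qed.
Lemma wc_zw (z : Cx R) (w : Cn R m) : wc (zw z w) = w.
Proof. by apply/rowP => k; rewrite !mxE liftK. Qed.
Lemma zw_eta (p : Cn R n) : zw (zc p) (wc p) = p.
Proof. by apply/rowP => j; rewrite mxE; case: unliftP => [k ->|->] /=; rewrite ?mxE. Qed.

Lemma alpha_scp r (p : Cn R n) : alpha r p = scp (ray r) p.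
Proof.
apply/rowP => j; rewrite /alpha /ray !mxE; case: unliftP => [k ->|->] /=.
  by rewrite mxE rc1 mul1r.
by [].
Qed.

Lemma dz_alpha r i a (p : Cn R n) : dz i (fun q => alpha r q 0 a) p = rc (ray r a) * (a == i)%:R.
Proof.
rewrite /dz wirtE (_ : (fun q : S => _) = fun q : S => rc (ray r a) * q.2 0 a); last first.
  by apply/funext => q; rewrite alpha_scp mxE.
have oT : open (setT : set S) by exact: openT.
by rewrite (ddZ oT _ _ (sm_coord oT a)) // dd_coord; congr (_ * _%:R); rewrite -[RHS]/(nat_of_bool _) eq_sym; congr nat_of_bool; apply/eqP/eqP => [[]|->].
Qed.

Lemma pull_alpha r (g : Cn R n -> 'M[Cx R]_n) p i j : pull (alpha r) g p i j = rc (ray r i * ray r j) * g (scp (ray r) p) i j.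
Proof.
rewrite /pull; set J := \matrix_(a, i) _.
have JE a b : J a b = rc (ray r a) * (a == b)%:R by rewrite mxE dz_alpha.
rewrite mxE (bigD1 j) //= [X in _ + X]big1 ?addr0; last first.
  by move=> k kj; rewrite [map_mx _ _ _ _]mxE JE (negbTE kj) mulr0 (rmorph0 (Num.conj : {rmorphism _ -> _})) mulr0.
rewrite mxE (bigD1 i) //= [X in _ + X]big1 ?addr0; last first.
  by move=> k ki; rewrite [_^T _ _]mxE JE (negbTE ki) mulr0 mul0r.
rewrite [_^T _ _]mxE [map_mx _ _ _ _]mxE !JE !eqxx !mulr1 rc_conj rcM -alpha_scp; ring.
Qed.

Lemma scaled_pull (g : S -> 'M[Cx R]_n) r t p i j :
  rc (r ^+ 2) * pull (alpha r) (fun p => g (t, p)) p i j = scaled g r (ray r) (t, p) i j.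
Proof. by rewrite pull_alpha mxE mulrA -rcM mulrA. Qed.

(** If the w-part of u is not zero, positivity comes from [gD]; otherwise theta evaluated on u is
    u_0 / z, which is not zero. *)
Lemma cone_model_pos (hh : Cn R m -> R) (gD : Cn R m -> 'M[Cx R]_m) p :
  0 < hh (wc p) -> zc p != 0 -> hermpos (gD (wc p)) -> hermpos (cone_model hh gD p).
Proof.
move=> h0 z0 [gh gp]; rewrite /cone_model; set z := zc p in z0 *; set w := wc p in h0 gh gp *; cbv zeta.
set th := zw _ _; set k := (_ * _)^-1; set B := \matrix_(i, j) _.
have kE : k = rc (hh w * nm z ^+ 2)^-1 by rewrite /k normE -rcX -rcM rcV.
have nz : 0 < nm z by rewrite lt_neqAle nm_ge0 eq_sym nm_eq0 z0.
have k0 : 0 < (hh w * nm z ^+ 2)^-1 by rewrite invr_gt0 mulr_gt0 // exprn_gt0.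
have E i j : (k *: (th^T *m map_mx Num.conj th + B)) i j = k * (th 0 i * (th 0 j)^* + B i j).
  by rewrite !mxE big_ord1 !mxE.
have SE u v : sesq (k *: (th^T *m map_mx Num.conj th + B)) u v =
    k * ((\sum_i th 0 i * u 0 i) * (\sum_j th 0 j * v 0 j)^* + sesq (gD w) (wc u) (wc v)).
  rewrite /sesq mulrDr; transitivity (k * (\sum_i \sum_j th 0 i * u 0 i * (th 0 j * v 0 j)^*) + k * (\sum_i \sum_j B i j * u 0 i * (v 0 j)^*)).
    rewrite !mulr_sumr -big_split /=; apply: eq_bigr => i _; rewrite !mulr_sumr -big_split /=; apply: eq_bigr => j _.
    by rewrite E cjM; ring.
  congr (k * _ + k * _).
    by rewrite cj_sum mulr_suml; apply: eq_bigr => i _; rewrite mulr_sumr.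
  rewrite big_ord_recl [X in X + _]big1 ?add0r; last by move=> j _; rewrite mxE unlift_none !mul0r.
  apply: eq_bigr => i _; rewrite big_ord_recl mxE unlift_none; case: unliftP => [a _|//]; rewrite !mul0r add0r.
  by apply: eq_bigr => j _; rewrite !mxE !liftK.
split=> [i j|u u0].
  rewrite !E cjM kE rc_conj; congr (_ * _); rewrite cjD cjM cjK mulrC; congr (_ + _); rewrite !mxE.
  by case: (unlift _ i) (unlift _ j) => [a|] [b|]; rewrite ?(rmorph0 (Num.conj : {rmorphism _ -> _})) //; exact: gh.
rewrite SE conjM_nm kE.
have hw : hermpos (gD w) by split.
rewrite (sesq_rc hw) -rcD -rcM -rc0 rc_lt mulr_gt0 //.
have [w0|w0] := eqVneq (wc u) 0; last by rewrite ltr_wpDl ?sqr_ge0 // sesq_gt0.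
have uz : zc u != 0.
  apply: contraNneq u0 => uz; rewrite -(zw_eta u) uz w0; apply/eqP/rowP => j; rewrite !mxE.
  by case: (unlift _ j) => [a|] //=; rewrite mxE.
rewrite w0 sesq0 addr0 exprn_gt0 // lt_neqAle nm_ge0 andbT eq_sym nm_eq0.
rewrite big_ord_recl [X in _ + X]big1 ?addr0; last first.
  by move=> j _; move/rowP/(_ j): w0; rewrite !mxE => ->; rewrite mulr0.
by rewrite mulf_neq0 // /th mxE unlift_none /= invr_eq0.
Qed.
End Pieces.

Lemma near_gt (R : realType) (T : topologicalType) (f : T -> R) x (c : R) : f @ x --> f x -> c < f x -> \forall y \near x, c < f y.
Proof. by move=> /cvgr_gt H h; apply: H. Qed.
Lemma near_lt (R : realType) (T : topologicalType) (f : T -> R) x (c : R) : f @ x --> f x -> f x < c -> \forall y \near x, f y < c.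
Proof. by move=> /cvgr_lt H h; apply: H. Qed.

(** * Annular regions around the divisor *)

Section PolarRegion.
Variables (R : realType) (m : nat).
Notation n := m.+1.
Notation S := (R * Cn R n)%type.
Implicit Types (a b d : R) (p : Cn R n).

Definition polar (a b d : R) : set (Cn R n) := [set p | a < nm (zc p) < b /\ forall k, nm (wc p 0 k) < d].
Definition cpolar (a b d : R) : set (Cn R n) := [set p | a <= nm (zc p) <= b /\ forall k, nm (wc p 0 k) <= d].

Lemma cvg_nm_coord (j : 'I_n) p : (fun p : Cn R n => nm (p 0 j)) @ p --> nm (p 0 j).
Proof. exact: (cvg_nmf _ (@cvg_coord R n p j)). Qed.
Lemma polar_near a b d p : polar a b d p -> \forall p' \near p, polar a b d p'.
Proof.
move=> [/andP[h1 h2] h3].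
have n1 : \forall p' \near p, a < nm (zc p') by exact: (near_gt (@cvg_nm_coord ord0 p)).
have n2 : \forall p' \near p, nm (zc p') < b by exact: (near_lt (@cvg_nm_coord ord0 p)).
have n3 : \forall p' \near p, forall k : 'I_m, nm (wc p' 0 k) < d.
  apply: (@filter_forall _ 'I_m (fun k p' => nm (wc p' 0 k) < d) (nbhs p) (nbhs_filter p)) => k; have hk := h3 k; rewrite mxE in hk.
  have := near_lt (@cvg_nm_coord (lift ord0 k) p) hk.
  by apply: filterS => x; rewrite mxE.
near=> x; split; last by near: x.
by apply/andP; split; near: x.
Unshelve. all: by end_near.
Qed.
Lemma open_polar a b d : open (polar a b d).
Proof. by rewrite openE => p; exact: polar_near. Qed.

Lemma compact_cpolar a b d : compact (cpolar a b d).
Proof.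
pose A (j : 'I_n) : set (Cx R) := [set z | if j == ord0 then a <= nm z <= b else nm z <= d].
have cA j : compact (A j).
  rewrite /A; case: (j == ord0); last exact: compact_disc.
  apply: (subclosed_compact _ (@compact_disc R b)); last by move=> z /= /andP[].
  have -> : [set z : Cx R | a <= nm z <= b] = (@nm R : Cx R -> R) @^-1` [set x | a <= x] `&` (@nm R : Cx R -> R) @^-1` [set x | x <= b].
    by apply/seteqP; split=> z /=; [move=> /andP[]|move=> [-> ->]].
  have cn : forall z : Cx R, {for z, continuous (@nm R : Cx R -> R)}.
    by move=> z; have := @cvg_nmf R _ (nbhs z) _ id z; apply; exact: cvg_id.
  by apply: closedI; apply: closed_comp; [move=> z _; exact: cn|exact: closed_ge|move=> z _; exact: cn|exact: closed_le].
have := rV_compact cA; congr compact; apply/seteqP; split=> p.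
  move=> H; split; first by have := H ord0.
  by move=> k; have := H (lift ord0 k); rewrite /A /= mxE.
move=> [h1 h2] j; rewrite /A /=; case: eqP => [->//|/eqP jn].
have [|k jE _] := @unlift_some _ ord0 j; first by rewrite eq_sym.
by have := h2 k; rewrite mxE -jE.
Qed.

Lemma polar_ball a b d a' b' d' (c : R) p0 p : 0 <= c -> a' + Num.sqrt c <= a -> b + Num.sqrt c <= b' -> d + Num.sqrt c < d' ->
  a < nm (zc p0) < b -> (forall k, nm (wc p0 0 k) <= d) -> dist2 p0 p <= c -> polar a' b' d' p.
Proof.
move=> c0 h1 h2 h3 /andP[h4 h5] h6 hd.
have H j : nm (p 0 j - p0 0 j) <= Num.sqrt c.
  rewrite -(ger0_norm (nm_ge0 _)) -sqrtr_sqr ler_wsqrtr //; apply: le_trans hd.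
  by rewrite /dist2 (bigD1 j) //= lerDl sumr_ge0 // => i _; exact: sqr_ge0.
have H1 j : nm (p 0 j) <= nm (p0 0 j) + Num.sqrt c.
  by have := nmD (p 0 j - p0 0 j) (p0 0 j); rewrite subrK; have := H j; lra.
have H2 j : nm (p0 0 j) <= nm (p 0 j) + Num.sqrt c.
  by have := nmD (p0 0 j - p 0 j) (p 0 j); rewrite subrK nmBC; have := H j; lra.
have := H1 ord0; have := H2 ord0; rewrite -/(zc p) -/(zc p0) => g1 g2.
split; first by apply/andP; split; lra.
by move=> k; have := h6 k; rewrite !mxE; have := H1 (lift ord0 k); lra.
Qed.

Lemma polar_dom (a b d r : R) p : 0 < r <= 1 -> 0 <= a -> b <= 1 -> d <= 1 -> polar a b d p ->
  polydisc m.+1 (scp (ray r) p) /\ zc (scp (ray r) p) != 0.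
Proof.
move=> /andP[r0 r1] a0 b1 d1 [/andP[h1 h2] h3]; split=> [j|].
  rewrite -(rc1 R) norm_lt /ray mxE nmM nm_rc.
  have [->|jn] := eqVneq j ord0.
    rewrite (gtr0_norm r0); apply: (@le_lt_trans _ _ (nm (zc p))); last exact: lt_le_trans h2 b1.
    by rewrite /zc ler_piMl ?nm_ge0.
  have [|k jE _] := @unlift_some _ ord0 j; first by rewrite eq_sym.
  by rewrite normr1 mul1r; have := h3 k; rewrite mxE -jE; lra.
rewrite /zc mxE /ray eqxx mulf_neq0 //; first by rewrite rc_eq0 gt_eqF.
by rewrite -nm_eq0 gt_eqF // (le_lt_trans a0 h1).
Qed.
End PolarRegion.

(** * Charts of the complement of the divisor *)

Section Charts.
Variables (R : realType) (m : nat) (M : complexManifold R m.+1) (D : set M).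
Notation n := m.+1.
Notation S := (R * Cn R n)%type.

Lemma holo_map_sub (k l : nat) (A B : set (Cn R k)) (c : Cn R k -> Cn R l) : B `<=` A -> holo_map A c -> holo_map B c.
Proof.
move=> BA H j; have [/smooth_stP s d] := H j; split.
  by apply/smooth_stP => i; apply: Ck_sub (s i) => q [? ?]; split=> //; exact: BA.
by move=> p i Bp; apply: d; exact: BA.
Qed.
Lemma holo_map_cts (k l : nat) (A : set (Cn R k)) (c : Cn R k -> Cn R l) j p : holo_map A c -> A p ->
  (fun p => c p 0 j) @ p --> c p 0 j.
Proof.
move=> H Ap; have [s _] := H j.
have h : {for ((0, p) : R * Cn R k), continuous (fun q : R * Cn R k => c q.2 0 j)} by apply: (sm_cts s).
have e : (fun p' : Cn R k => ((0, p') : R * Cn R k)) @ p --> ((0, p) : R * Cn R k).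
  apply: (@cvg_pair2 R k _ (nbhs p) 0 p (fun=> 0) id (nbhs_filter p)); [exact: cvg_cst|exact: cvg_id].
exact: (cvg_comp _ _ e h).
Qed.
Lemma open_neq0 : open [set p : Cn R n | zc p != 0].
Proof.
rewrite openE => p /= p0; have h : 0 < nm (zc p) by rewrite lt_neqAle nm_ge0 eq_sym nm_eq0 p0.
have := near_gt (@cvg_nm_coord R m ord0 p) h; apply: filterS => x /= x0.
by rewrite -nm_eq0 gt_eqF.
Qed.
Lemma open_pdisc (k : nat) : open (polydisc k : set (Cn R k)).
Proof.
rewrite openE => p Hp.
change (nbhs p [set p' : Cn R k | forall j : 'I_k, `|p' 0 j| < 1]).
apply: (@filter_forall _ 'I_k (fun j (p' : Cn R k) => `|p' 0 j| < 1) (nbhs p) (nbhs_filter p)) => j; have := Hp j; rewrite -(rc1 R) norm_lt => h.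
have c : (fun p : Cn R k => nm (p 0 j)) @ p --> nm (p 0 j) by exact: (cvg_nmf _ (@cvg_coord R k p j)).
by have := near_lt c h; apply: filterS => x /= x0; rewrite norm_lt.
Qed.

(** The flow is given in holomorphic charts that avoid D; this makes F, deprived of z = 0, one of
    them. *)
Lemma X_params_Xpart x F : local_param D x F -> X_params D (Xpart F).
Proof.
move=> [[[oF iF pF imF] cF] dF Fx FD].
have oD : open (pdom (Xpart F)) by apply: openI; [exact: open_pdisc|exact: open_neq0].
have sub : pdom (Xpart F) `<=` pdom F by rewrite dF => p [].
split; last first.
  move=> p Dp; have : (F @` [set p | polydisc m.+1 p /\ zc p != 0]) (F p) by exists p.
  by rewrite FD => -[].
split; first split=> //.
- by move=> p p' h h'; apply: iF; exact: sub.
- move=> U oU; have := openI (pF U oU) oD; congr open; apply/seteqP; split=> p.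
    by move=> [[_ ?] ?]; split.
  by move=> [h1 h2]; split=> //; split=> //; exact: sub.
- by move=> V oV VD; apply: imF => // p /VD /sub.
move=> chi cchi; have [c1 c2] := cF chi cchi; split.
- move=> p p' h h' e; have [V [tau [Vp [oV VF Vc re] ht]]] := c1 p p' (sub _ h) h' e.
  exists (V `&` pdom (Xpart F)), tau; split=> //; last by apply: holo_map_sub ht => ? [].
  by split=> [|q []|q [Vq _]|q [Vq _]] //; [exact: openI|exact: Vc|exact: re].
move=> p p' h h' e; have [V [tau [Vp [oV VF Vc re] ht]]] := c2 p p' h (sub _ h') e.
have tp : tau p = p' by apply: iF; [exact: Vc|exact: sub|rewrite -e re].
(* The transition map has to land in z <> 0. It does so at p, hence near p, and V is shrunk
   accordingly. *)
exists (V `&` [set q | V q /\ zc (tau q) != 0]), tau; split.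
- by split=> //; split=> //; rewrite tp; case: h'.
- split=> [|q []|q [Vq [_ zq]]|q [Vq _]].
  + rewrite openE => q [Vq [_ zq]].
    have h0 : 0 < nm (zc (tau q)) by rewrite lt_neqAle nm_ge0 eq_sym nm_eq0 zq.
    have c := @cvg_nmf R _ (nbhs q) (nbhs_filter q) (fun p => tau p 0 ord0) (tau q 0 ord0) (holo_map_cts (j := ord0) ht Vq).
    have nV : \forall q' \near q, V q' by exact: open_nbhs_nbhs.
    have n2 := near_gt c h0; near=> q'; have Vq' : V q' by near: q'.
    split=> //; split=> //; rewrite -nm_eq0 gt_eqF //; near: q'; exact: n2.
  + by move=> Vq _; exact: VF.
  + by split=> //; have := Vc q Vq; rewrite dF.
  + exact: re.
by apply: holo_map_sub ht => ? [].
Unshelve. all: by end_near.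
Qed.
End Charts.

Lemma pdersE (R : realType) (n : nat) s (f : R * Cn R n -> Cx R) : pders s f = foldr (@pd R n) f s.
Proof. by rewrite /pders pdE. Qed.

Lemma near_right0 (R : realType) (P : R -> Prop) : (\forall r \near (0 : R)^'+, P r) <-> exists2 r1 : R, 0 < r1 & forall r, 0 < r < r1 -> P r.
Proof.
split=> [|[r1 r10 H]].
  rewrite /at_right near_withinE => /nbhs_ballP[r1 /= r10 H]; exists r1 => // r /andP[r0 rr].
  by apply: H => //; rewrite /ball /= sub0r normrN gtr0_norm.
near=> r; apply: H; apply/andP; split; near: r; [exact: nbhs_right_gt|exact: nbhs_right_lt].
Unshelve. all: by end_near.
Qed.

Lemma near_right_ex (R : realType) (P : R -> Prop) : (\forall r \near (0 : R)^'+, P r) -> exists r, P r.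
Proof.
move=> /near_right0[r1 r10 H]; exists (r1 / 2); apply: H.
by rewrite divr_gt0 //= ltr_pdivrMr // ltr_pMr // ltr1n.
Qed.

Lemma sesqB (R : realType) (n : nat) (A B : 'M[Cx R]_n) u v : sesq (A - B) u v = sesq A u v - sesq B u v.
Proof. by rewrite !sesqE mulmxBr mulmxBl !mxE. Qed.

(** * Preservation of the conical limit *)

Section ConicalStability.
Variables (R : realType) (m : nat).
Notation n := m.+1.
Notation S := (R * Cn R n)%type.
Let dom : set (Cn R n) := [set p | polydisc n p /\ zc p != 0].
Variables (t1 K : R) (g : S -> 'M[Cx R]_n) (mm : Cn R n -> 'M[Cx R]_n).
Hypothesis mf : metric_flow dom t1 K g.
Let Kset (a b d : R) : set S := [set q | rc a < `|zc q.2| < rc b /\ forall k, `|wc q.2 0 k| <= rc d].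
Let f t r i j (q : S) := scaled g r (ray r) (t, q.2) i j.
Hypothesis conv : forall a b d : R, 0 < a -> a < b -> b < 1 -> d < 1 -> forall i j,
  smooth_cvg (0^'+) (Kset a b d) (fun r q => f 0 r i j q) (fun q => mm q.2 i j).
Hypothesis mmpos : forall p, zc p != 0 -> polydisc m (wc p) -> hermpos (mm p).

Section Radii.
Variables (R1 R2 rh : R).
Hypotheses (R10 : 0 < R1) (R12 : R1 < R2) (R21 : R2 < 1) (rh1 : rh < 1).
(** Nested regions: the target given by R1, R2 and rh lies in the open set [U], on which the
    estimates run; the closed region [Kc] contains [U] and is compact; the open set [U'] contains
    [Kc] and is where the rescaled metrics are known to be smooth. *)
Let a := R1 / 2. Let b := (1 + R2) / 2. Let d := (1 + rh) / 2.
Let a' := R1 / 4. Let b' := (3 + R2) / 4. Let d' := (3 + rh) / 4.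
Let U := polar a b d : set (Cn R n).
Let U' := polar a' b' d' : set (Cn R n).
Let Kc := cpolar a b d : set (Cn R n).
Let radii : [/\ 0 < a', a' < b', b' < 1, d < 1 & a' < a] /\ [/\ b < b', d < d', d' < 1 & 0 < a].
Proof. by move: R10 R12 R21 rh1; rewrite /a /b /d /a' /b' /d' => *; split; split; lra. Qed.
Let UKc : U `<=` Kc.
Proof. by move=> p [/andP[h1 h2] h3]; split=> [|k]; [rewrite !ltW|rewrite ltW]. Qed.
Let KcU' : Kc `<=` U'.
Proof.
move=> p [/andP[h1 h2] h3]; have [[_ _ _ _ aa] [bb dd' _ _]] := radii.
split=> [|k]; first by rewrite (lt_le_trans aa h1) (le_lt_trans h2 bb).
exact: le_lt_trans (h3 k) dd'.
Qed.
Let KcK t p : Kc p -> Kset a' b' d (t, p).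
Proof.
move=> [/andP[h1 h2] h3]; have [[_ _ _ _ aa] [bb _ _ _]] := radii.
split=> [|k] /=; last by rewrite norm_le.
by rewrite normE !rc_lt (lt_le_trans aa h1) (le_lt_trans h2 bb).
Qed.
Let U'dom r : 0 < r <= 1 -> forall p, U' p -> dom (scp (ray r) p).
Proof. by move=> hr p Up; have [[x1 _ x2 _ _] [_ _ x3 _]] := radii; exact: (polar_dom hr (ltW x1) (ltW x2) (ltW x3) Up). Qed.
Let oU' : open U'. Proof. exact: open_polar. Qed.
Let oO' : open (setT `*` U' : set S). Proof. exact: open_cylinder. Qed.
Let odom := mf_dom mf.
Let smf t r i j : 0 <= t <= t1 -> 0 < r <= 1 -> smooth_st (setT `*` U') (f t r i j).
Proof. by move=> ht hr; exact: (scaled_slice_smooth odom (mf_slice mf) r oU' (U'dom hr) i j ht). Qed.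
Let t10 := mf_t mf.
Let h0t : 0 <= (0 : R) <= t1. Proof. by rewrite lexx ltW. Qed.

Let conv' i j s (e : R) : 0 < e -> \forall r \near (0 : R)^'+, forall p, Kc p ->
  nm (foldr (@pd R n) (f 0 r i j) s (0, p) - foldr (@pd R n) (fun q : S => mm q.2 i j) s (0, p)) <= e.
Proof.
move=> e0; have := @conv a' b' d _ _ _ _ i j s e e0.
have [[c1 c2 c3 c4 _] _] := radii.
move=> /(_ c1 c2 c3 c4); apply: filterS => r H p Kp.
by have := H (0, p) (KcK 0 Kp); rewrite !pdersE norm_le.
Qed.
Let small : \forall r \near (0 : R)^'+, 0 < r <= 1.
Proof. by apply/near_right0; exists 1 => // r /andP[-> /ltW]. Qed.

(** Derivatives of the limit are bounded through one fixed rescaled metric, with parameter r0, which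
    is smooth near the compact [Kc] and differs from the limit by at most 1 in the derivatives
    concerned. All small r then follow by the triangle inequality. *)
Lemma initial_words k : exists2 B : R, 0 <= B & \forall r \near (0 : R)^'+, forall (w : seq ('I_n * bool)) i j p, size w = k -> Kc p ->
  nm (dds w (fun q => scaled g r (ray r) q i j) (0, p)) <= B.
Proof.
pose X := (k.-tuple (option ('I_n * bool)) * ('I_n * 'I_n))%type.
have N1 : \forall r \near (0 : R)^'+, forall x : X, forall p, Kc p ->
  nm (foldr (@pd R n) (f 0 r x.2.1 x.2.2) x.1 (0, p) - foldr (@pd R n) (fun q : S => mm q.2 x.2.1 x.2.2) x.1 (0, p)) <= 1.
  by apply: filter_forall => x; exact: conv'.
have [r0 [H0 hr0]] := near_right_ex (filterI N1 small).
have bx (x : X) : exists B, forall p, Kc p -> nm (foldr (@pd R n) (f 0 r0 x.2.1 x.2.2) x.1 (0, p)) <= B.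
  apply: compact_bound; first exact: compact_cpolar.
  move=> p Kp; apply: cvg_within_filter.
  have e : (fun p' : Cn R n => ((0, p') : S)) @ p --> ((0, p) : S).
    by apply: (@cvg_pair2 R n _ (nbhs p) 0 p (fun=> 0) id (nbhs_filter p)); [exact: cvg_cst|exact: cvg_id].
  apply: (cvg_comp _ _ e); apply: (sm_cts (sm_pders _ (smf _ _ h0t hr0))); by split=> //; exact: KcU'.
have /choice[Bx HBx] := bx.
exists (2 + \sum_x `|Bx x|); first by rewrite addr_ge0 // sumr_ge0.
apply: filterS (filterI N1 small) => r [H1 hr] w i j p wk Kp.
rewrite (@dds_slice R n w _ (f 0 r i j) 0 0 p) //.
apply: (dds_bound oO' (smf _ _ h0t hr)); first by split=> //; exact: KcU'.
move=> s sw; have sk : size s == k by rewrite sw wk.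
pose x : X := (Tuple sk, (i, j)).
have := H1 x p Kp; have := H0 x p Kp; have := HBx x p Kp => /=.
set u := foldr _ (f 0 r i j) _ _; set v := foldr _ (f 0 r0 i j) _ _; set z := foldr _ _ _ _ => e1 e2 e3.
have -> : u = (u - z) + (- (v - z) + v) by ring.
apply: le_trans (nmD _ _) _; have := nmD (- (v - z)) v; rewrite nmN => e4.
have : Bx x <= \sum_x `|Bx x|.
  by apply: le_trans (ler_norm _) _; rewrite (bigD1 x) //= lerDl sumr_ge0.
lra.
Qed.

Lemma initial_words_le k : exists2 B : R, 0 <= B & \forall r \near (0 : R)^'+, forall (w : seq ('I_n * bool)) i j p, (size w <= k)%N -> Kc p ->
  nm (dds w (fun q => scaled g r (ray r) q i j) (0, p)) <= B.
Proof.
elim: k => [|k [B B0 IH]].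
  have [B B0 H] := initial_words 0; exists B => //; apply: filterS H => r H w i j p.
  by rewrite leqn0 => /eqP; exact: H.
have [B' B'0 H] := initial_words k.+1; exists (B + B'); first exact: addr_ge0.
apply: filterS (filterI IH H) => r [H1 H2] w i j p; rewrite leq_eqVlt => /orP[/eqP hw|hw] Kp.
  by apply: le_trans (H2 w i j p hw Kp) _; rewrite lerDr.
by apply: le_trans (H1 w i j p hw Kp) _; rewrite lerDl.
Qed.

(** The limit is continuous as a uniform limit, hence uniformly elliptic on [Kc] with some constant.
    Entries within lam / (2 n) of those of the limit change the form by at most lam / 2. *)
Lemma initial_lower : exists2 lam : R, 0 < lam & \forall r \near (0 : R)^'+, forall p u, Kc p ->
  lam * sqn u <= cre (sesq (scaled g r (ray r) (0, p)) u u).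
Proof.
have cK : compact Kc by exact: compact_cpolar.
have cm i j : cw Kc (fun p => mm p i j).
  apply: uniform_cw => e e0.
  have [r [H hr]] := near_right_ex (filterI (conv' i j [::] e0) small).
  exists (fun p => f 0 r i j (0, p)) => [p Kp|p Kp]; last exact: (H p Kp).
  apply: cvg_within_filter.
  have e' : (fun p' : Cn R n => ((0, p') : S)) @ p --> ((0, p) : S).
    by apply: (@cvg_pair2 R n _ (nbhs p) 0 p (fun=> 0) id (nbhs_filter p)); [exact: cvg_cst|exact: cvg_id].
  apply: (cvg_comp _ _ e'); apply: (sm_cts (smf i j h0t hr)); by split=> //; exact: KcU'.
have hm p : Kc p -> hermpos (mm p).
  move=> [/andP[h1 h2] h3]; apply: mmpos.
    by have [_ [_ _ _ a0]] := radii; rewrite -nm_eq0 gt_eqF // (lt_le_trans a0 h1).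
  by have [[_ _ _ d1 _] _] := radii; move=> k; rewrite -(rc1 R) norm_lt; exact: le_lt_trans (h3 k) d1.
have [lam l0 Hl] := uniform_ellipticity cK cm hm.
pose ep := lam / (2 * n%:R).
have n0 : 0 < n%:R :> R by rewrite ltr0n.
have ep0 : 0 < ep by rewrite divr_gt0 // mulr_gt0.
exists (lam / 2); first by rewrite divr_gt0.
have N1 : \forall r \near (0 : R)^'+, forall x : 'I_n * 'I_n, forall p, Kc p -> nm (f 0 r x.1 x.2 (0, p) - mm p x.1 x.2) <= ep.
  by apply: filter_forall => x; exact: (conv' x.1 x.2 [::] ep0).
apply: filterS N1 => r H p u Kp.
have h1 := @sesq_le R n (mm p - scaled g r (ray r) (0, p)) ep u (ltW ep0).
have {}h1 : cre (sesq (mm p - scaled g r (ray r) (0, p)) u u) <= n%:R * ep * sqn u.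
  apply: h1 => k l; have E : (mm p - scaled g r (ray r) (0, p)) k l = mm p k l - f 0 r k l (0, p) by rewrite /f !mxE.
  by rewrite E nmBC; exact: (H (k, l) p Kp).
have ne : n%:R * ep = lam / 2 by rewrite /ep; field; rewrite gt_eqF.
rewrite sesqB !cE ne in h1; have := Hl p u Kp; lra.
Qed.

Lemma conical_limit_stable i j : smooth_cvg (0^'+) (Kset R1 R2 rh) (fun r q => f t1 r i j q) (fun q => mm q.2 i j).
Proof.
move=> s e e0.
have [lam l0 /near_right0[r1 r10 Hlow]] := initial_lower.
have [B0 B00 /near_right0[r2 r20 Hup]] := initial_words 0.
(* Half of the smallest of the gaps between the radii of the target and those of [U], so that balls
   of radius eta around points of the target stay in [U]. *)
pose eta := Num.min (R1 / 2) (Num.min ((1 - R2) / 2) ((1 - rh) / 2)) / 2.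
have [eta0 [e1 [e2 e3]]] : 0 < eta /\ eta <= R1 / 4 /\ eta <= (1 - R2) / 4 /\ eta <= (1 - rh) / 4.
  have q1 : Num.min (R1 / 2) (Num.min ((1 - R2) / 2) ((1 - rh) / 2)) <= R1 / 2 by rewrite ge_min lexx.
  have q2 : Num.min (R1 / 2) (Num.min ((1 - R2) / 2) ((1 - rh) / 2)) <= (1 - R2) / 2 by rewrite !ge_min lexx !orbT.
  have q3 : Num.min (R1 / 2) (Num.min ((1 - R2) / 2) ((1 - rh) / 2)) <= (1 - rh) / 2 by rewrite !ge_min lexx !orbT.
  have q4 : 0 < Num.min (R1 / 2) (Num.min ((1 - R2) / 2) ((1 - rh) / 2)) by rewrite !lt_min !divr_gt0 ?subr_gt0.
  rewrite /eta; split; first by rewrite divr_gt0.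
  by split; [lra|split; lra].
pose rr := Num.min 1 (Num.min r1 r2).
have rr0 : 0 < rr by rewrite !lt_min ltr01 r10 r20.
pose K1 : set (Cn R n) := [set p | R1 < nm (zc p) < R2 /\ forall k, nm (wc p 0 k) <= rh].
have K1U p0 : K1 p0 -> forall p, dist2 p0 p <= eta ^+ 2 -> U p.
  move=> [h1 h2] p; have se : Num.sqrt (eta ^+ 2) = eta by rewrite sqrtr_sqr gtr0_norm.
  move: R10 R12 R21 rh1 => *.
  apply: (@polar_ball R m R1 R2 rh a b d (eta ^+ 2) p0 p) => //; rewrite ?se; first exact: sqr_ge0.
  - by rewrite /a; lra.
  - by rewrite /b; lra.
  - by rewrite /d; lra.
have hrr r : 0 < r < rr -> [/\ 0 < r <= 1, 0 < r < r1 & 0 < r < r2].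
  by move=> /andP[h0]; rewrite !lt_min => /and3P[h1 h2 h3]; rewrite h0 h2 h3 ltW.
have Udom r : 0 < r < rr -> forall p, U p -> dom (scp (ray r) p).
  by move=> /hrr[h1 _ _] p Up; apply: (U'dom h1); apply: KcU'; exact: UKc.
have ray0 r : 0 < r < rr -> forall l : 'I_n, 0 < ray r l.
  by move=> /andP[h0 _] l; rewrite /ray; case: eqP.
have low r : 0 < r < rr -> forall p u, U p -> lam * sqn u <= cre (sesq (scaled g r (ray r) (0, p)) u u).
  by move=> /hrr[_ h1 _] p u Up; apply: Hlow => //; exact: UKc.
have up r : 0 < r < rr -> forall p u, U p -> cre (sesq (scaled g r (ray r) (0, p)) u u) <= n%:R * B0 * sqn u.
  move=> /hrr[_ _ h2] p u Up; apply: sesq_le => // k l.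
  by apply: (Hup r h2 [::] k l p) => //; exact: UKc.
have init k : exists C r3 : R, [/\ 0 <= C, 0 < r3 & forall r, 0 < r < r3 -> forall (w : seq ('I_n * bool)) i j p,
  (size w <= k)%N -> U p -> nm (dds w (fun q => scaled g r (ray r) q i j) (0, p)) <= C].
  have [B BB /near_right0[r3 r30 H]] := initial_words_le k; exists B, r3; split=> // r hr w i' j' p hw Up.
  by apply: (H r hr w i' j' p hw); exact: UKc.
have nB : 0 <= n%:R * B0 by rewrite mulr_ge0.
have eta2 : 0 < eta ^+ 2 by rewrite exprn_gt0.
have stab w i' j' := stability mf eta2 rr0 l0 nB (@open_polar R m a b d) K1U ray0 Udom low up init w i' j'.
(* Half of e is spent on the motion in time and half on the convergence at time 0; the power of 2 is
   the price of [pders_bound]. *)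
pose de := e / 2 / 2 ^+ size s.
have de0 : 0 < de by rewrite !divr_gt0 // exprn_gt0.
have N1 : \forall r \near (0 : R)^'+, forall w : (size s).-tuple ('I_n * bool), forall p, K1 p ->
    nm (dds w (fun q => scaled g r (ray r) q i j) (t1, p) - dds w (fun q => scaled g r (ray r) q i j) (0, p)) <= de.
  apply: filter_forall => w; have [C [r3 [C0 r30 H]]] := stab w i j; apply/near_right0.
  exists (Num.min 1 (Num.min r3 (de / (C + 1)))); first by rewrite !lt_min ltr01 r30 divr_gt0 // ltr_wpDl.
  move=> r /andP[h0]; rewrite !lt_min => /and3P[h1 h2 h3] p Kp.
  apply: le_trans (H r p _ Kp) _; first by rewrite h0.
  have C1 : 0 < C + 1 by rewrite ltr_wpDl.
  rewrite ltr_pdivlMr // in h3; apply: le_trans (ltW h3); rewrite expr2 -mulrA ler_pM2l //.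
  by rewrite mulrC; apply: (@le_trans _ _ C); [rewrite ler_piMr // ltW|rewrite lerDl].
have e20 : 0 < e / 2 by rewrite divr_gt0.
have N2 := @conv R1 R2 rh R10 R12 R21 rh1 i j s (e / 2) e20.
apply: filterS (filterI (filterI N1 N2) small) => r [[H1 H2] hr] q Kq.
have K1q : K1 q.2.
  case: Kq => [/andP[z1 z2] w1]; rewrite normE !rc_lt in z1 z2; split; first by rewrite z1 z2.
  by move=> k; rewrite -norm_le; exact: w1.
have U'q : (setT `*` U' : set S) q.
  split=> //; apply: KcU'; apply: UKc; apply: (K1U _ K1q).
  by rewrite /dist2 big1 ?sqr_ge0 // => k _; rewrite subrr nm0 expr0n.
have ht1 : 0 <= t1 <= t1 by rewrite lexx andbT ltW.
have s1 := smf i j ht1 hr; have s0 := smf i j h0t hr.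
have := H2 q Kq; rewrite !pdersE norm_le => h2; rewrite norm_le.
set u := foldr _ _ _ _; set z := foldr _ (fun q => mm q.2 i j) _ _ in h2 *.
set v := foldr _ _ _ _ in h2.
have uv : nm (u - v) <= 2 ^+ size s * de.
  rewrite /u /v -(pdersB oO' s s1 s0 U'q); apply: (pders_bound oO'); [exact: ltW|exact: (smB oO' s1 s0)|exact: U'q| |].
  - move=> q' _; have -> : pd None (fun q0 : S => f t1 r i j q0 - f 0 r i j q0) q' = dd None (fun q0 : S => f t1 r i j q0 - f 0 r i j q0) q' by rewrite ddE.
    exact: dd_static.
  move=> w sw; rewrite (ddsB oO' w s1 s0 U'q); case: q {Kq U'q h2 u z v} K1q => t' p K1q.
  rewrite (@dds_slice R n w (f t1 r i j) (fun q => scaled g r (ray r) q i j) t' t1 p) //.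
  rewrite (@dds_slice R n w (f 0 r i j) (fun q => scaled g r (ray r) q i j) t' 0 p) //.
  have sw' : size w == size s by rewrite sw.
  exact: (H1 (Tuple sw') p K1q).
have de2 : 2 ^+ size s * de = e / 2 by rewrite /de mulrC divfK // gt_eqF // exprn_gt0.
have -> : u - z = (u - v) + (v - z) by ring.
apply: le_trans (nmD _ _) _; lra.
Qed.
End Radii.
End ConicalStability.

(** * Conical asymptotics along the flow *)

Section PartA.
Variables (R : realType) (m : nat) (M : complexManifold R m.+1) (D : set M).
Notation n := m.+1.
Notation S := (R * Cn R n)%type.
Variables (I : set R) (g : R -> tensor R M n).
Hypothesis hflow : complete_kr_flow (X_params D) (~` D) I g.

Lemma flow_metric x F t1 : local_param D x F -> I t1 -> 0 < t1 ->
  exists K, metric_flow (pdom (Xpart F)) t1 K (fun q => g q.1 (Xpart F) q.2).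
Proof.
move=> lF It t10; have [[Ii [I0 Ige]] hK [hflow1 _] _ hcurv] := hflow.
have XF := X_params_Xpart lF; set psi := Xpart F in XF *.
have [K0 HK0] := hcurv t1 It; pose K := `|K0|; exists K.
have It' t : 0 <= t <= t1 -> I t by move=> ht; exact: (Ii 0 t1 I0 It).
have [sW pW eW] := hflow1 psi XF.
have odom : open (pdom psi) by have [[[]]] := XF.
have AW : [set q : S | 0 <= q.1 <= t1 /\ pdom psi q.2] `<=` [set q : S | pdom psi q.2 /\ [set q | I q.1 /\ (~` D) q.2] (q.1, psi q.2)].
  move=> q [ht dq]; split=> //; split=> /=; first exact: It'.
  exact: XF.2.
have OW q : [set q : S | 0 < q.1 < t1 /\ pdom psi q.2] q -> ([set q : S | pdom psi q.2 /\ [set q | I q.1 /\ (~` D) q.2] (q.1, psi q.2)])° q.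
  move=> Oq; have oO : open [set q : S | 0 < q.1 < t1 /\ pdom psi q.2] by exact: open_slab.
  have := near_O oO Oq; apply: filterS => q' [/andP[a b] d]; apply: AW; split=> //.
  by rewrite (ltW a) (ltW b).
split=> //.
- exact: normr_ge0.
- move=> i j q Aq; have [ V [f1 [oV Vq F1 E]]] := sW i j q (AW q Aq).
  by exists V, f1; split=> // q' Vq' Aq'; apply: E => //; exact: AW.
- by move=> t i j ht; have [h _] := hK t (It' t ht); have [h' _] := h psi XF; exact: (h' i j).
- by move=> q Aq; apply: pW; exact: AW.
- move=> [t p] Oq i j k; have [cl _] := eW _ (OW _ Oq).
  rewrite -(dz_slice t k (fun q => g q.1 psi q.2 i j)) -(dz_slice t i (fun q => g q.1 psi q.2 k j)).
  exact: (cl i j k).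
- by move=> t p i j Oq; have [_ e] := eW _ (OW _ Oq); rewrite -pderNE; exact: (e i j).
move=> t p [ht dp] a b c d a1 b1 c1 d1.
apply: le_trans (HK0 t ht psi p XF dp a b c d a1 b1 c1 d1) _; rewrite rc_le; exact: ler_norm.
Qed.

Variables (L : lineBundle M) (sigma : forall x, L x) (h : forall x, L x -> R) (gD : tensor R M m).
Hypotheses (hh : hermitian_metric h) (hgD : kahler (D_params D) gD).

Lemma model_pos x F (e : forall x, L x) c p : D x -> local_param D x F -> c != 0 ->
  (forall p, polydisc n p -> e (F p) != 0) -> zc p != 0 -> polydisc m (wc p) ->
  hermpos (cone_model (fun w => h (c *: e (F (zw 0 w)))) (gD (Gof F)) p).
Proof.
move=> Dx lF c0 e0 z0 pw; apply: cone_model_pos => //.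
  have [_ hp _] := hh; apply: hp.
  have Pz : polydisc n (zw 0 (wc p)).
    move=> j; rewrite mxE; case: unliftP => [k _|_] /=; first exact: pw.
    by rewrite normr0 ltr01.
  rewrite scaler_eq0 negb_or c0; exact: e0.
have [hD _] := hgD; have DG : D_params D (Gof F) by exists x, F.
by have [_ H] := hD _ DG; case: (H (wc p) pw).
Qed.

(** The section e and the constant c in the asymptotics do not involve the metric, so only the
    convergence has to be carried from time 0 to time t. *)
Lemma conical_stable x F c t : D x -> local_param D x F -> c != 0 -> I t ->
  conical_at sigma h gD (g 0) F c -> conical_at sigma h gD (g t) F c.
Proof.
move=> Dx lF c0 It [e [e1 e2 e3 e4]].
have [[Ii [I0 Ige]] _ _ _ _] := hflow.
have := Ige t It; rewrite le_eqVlt => /orP[/eqP <-|t0]; first by exists e.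
have [K mf] := flow_metric lF It t0.
exists e; split; [exact: e1|exact: e2|exact: e3|].
move=> R1 R2 rh R10 R12 R21 rh1 i j.
pose mm := cone_model (fun w => h (c *: e (F (zw 0 w)))) (gD (Gof F)).
have fE s r i' j' : (fun q : S => rc (r ^+ 2) * pull (alpha r) (g s (Xpart F)) q.2 i' j') =
    (fun q : S => scaled (fun q => g q.1 (Xpart F) q.2) r (ray r) (s, q.2) i' j').
  by apply/funext => q; rewrite -scaled_pull.
have cv : forall a b d : R, 0 < a -> a < b -> b < 1 -> d < 1 -> forall i j,
    smooth_cvg (0^'+) [set q : S | rc a < `|zc q.2| < rc b /\ forall k, `|wc q.2 0 k| <= rc d]
      (fun r q => scaled (fun q => g q.1 (Xpart F) q.2) r (ray r) (0, q.2) i j) (fun q => mm q.2 i j).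
  move=> a b d a0 ab b1 d1 i' j'; have := e4 a b d a0 ab b1 d1 i' j'.
  by congr smooth_cvg; apply/funext => r; exact: fE.
have mp p : zc p != 0 -> polydisc m (wc p) -> hermpos (mm p) by move=> z0 pw; exact: (model_pos Dx lF c0 e2).
have := conical_limit_stable mf cv mp R10 R12 R21 rh1 i j.
by congr smooth_cvg; apply/funext => r; rewrite -fE.
Qed.
End PartA.

(** * Scaling without differentiability *)

Section Junk.
Variable R : realType.
(* A divergent difference quotient has the junk limit [0], so these scaling rules hold without
   differentiability. *)
Lemma lim_scale (f : R -> R) (F : set_system R) (FF : ProperFilter F) (c : R) : c != 0 ->
  lim ((fun h => c * f h) @ F) = c * lim (f @ F) :> R.
Proof.
move=> c0; have [cf|df] := pselect (cvg (f @ F)).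
  apply/cvg_lim; first exact: norm_hausdorff.
  by apply: cvgM; [exact: cvg_cst|exact: cf].
rewrite (dvgP df) dvgP ?mulr0 // => cf; apply: df.
have H : (fun h => c^-1 * (c * f h)) @ F --> c^-1 * lim ((fun h => c * f h) @ F).
  by apply: cvgM; [exact: cvg_cst|exact: cf].
apply/cvg_ex; exists (c^-1 * lim ((fun h => c * f h) @ F)).
by apply: cvg_trans H; apply: near_eq_cvg; apply: nearW => h; rewrite mulrA mulVf // mul1r.
Qed.
Lemma derive1_scale (f : R -> R) (c t : R) : c != 0 -> derive1 (fun s => c * f s) t = c * derive1 f t.
Proof.
move=> c0; rewrite /derive1 -(@lim_scale (fun h : R => h^-1 *: (f (h + t) - f t)) (0^') _ c c0).
have E : (fun h : R => h^-1 *: (c * f (h + t) - c * f t)) = fun h : R => c * (h^-1 *: (f (h + t) - f t)).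
  by apply/funext => h; rewrite /GRing.scale /=; ring.
by rewrite E.
Qed.
Lemma dnbhs_scale (k : R) (B : set R) : k != 0 -> (0 : R)^' B -> (0 : R)^' [set h | B (k * h)].
Proof.
move=> k0; rewrite /dnbhs /within /= => /nbhs_ballP[e /= e0 H]; apply/nbhs_ballP.
have nk : 0 < `|k| by rewrite normr_gt0.
exists (e / `|k|); first by rewrite /= divr_gt0.
move=> x; rewrite /ball /= sub0r normrN => hx x0; apply: H; last by rewrite mulf_neq0.
by rewrite /ball /= sub0r normrN normrM mulrC -ltr_pdivlMr.
Qed.
Lemma derive1_rescale (f : R -> R) (k : R) : k != 0 -> derive1 (fun s => f (k * s)) 0 = k * derive1 f 0.
Proof.
move=> k0; rewrite -(@derive1_scale f k 0 k0) /derive1.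
pose F (h : R) : R := h^-1 *: (k * f (h + 0) - k * f 0).
have E : (fun h : R => h^-1 *: (f (k * (h + 0)) - f (k * 0))) = fun h => F (k * h).
  apply/funext => h; rewrite /F /GRing.scale /= !addr0 mulr0 invfM -mulrBr mulrA; congr (_ * _).
  by rewrite mulrAC mulVf // mul1r.
have im : (fun h : R => F (k * h)) @ 0^' = F @ 0^'.
  apply/seteqP; split=> A /=; last exact: (@dnbhs_scale k (F @^-1` A) k0).
  have ki : k^-1 != 0 by rewrite invr_eq0.
  move=> /(dnbhs_scale ki); rewrite /nbhs /=; congr (_ _); apply/funext => h /=.
  by rewrite mulrA mulfV // mul1r.
by rewrite E im.
Qed.

Lemma cderiv_scale (h : R -> Cx R) (c t : R) : c != 0 -> cderiv (fun s => rc c * h s) t = rc c * cderiv h t.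
Proof.
move=> c0; apply: complexP; rewrite !cE /= mul0r ?subr0 ?addr0.
  by rewrite -derive1_scale //; congr (derive1 _ t); apply/funext => s; rewrite !cE mul0r subr0.
by rewrite -derive1_scale //; congr (derive1 _ t); apply/funext => s; rewrite !cE mul0r addr0.
Qed.
Lemma cderiv_rescale (h : R -> Cx R) (k : R) : k != 0 -> cderiv (fun s => h (k * s)) 0 = rc k * cderiv h 0.
Proof.
move=> k0; apply: complexP; rewrite !cE /= mul0r ?subr0 ?addr0.
  by rewrite -(derive1_rescale (fun s => cre (h s))).
by rewrite -(derive1_rescale (fun s => cim (h s))).
Qed.

Variable n : nat.
Notation S := (R * Cn R n)%type.
Lemma dd_scale_any a (f : S -> Cx R) (c : R) q : c != 0 -> dd a (fun q => rc c * f q) q = rc c * dd a f q.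
Proof.
move=> c0; have P b : pd b (fun q => rc c * f q) q = rc c * pd b f q by rewrite pdE /pder cderiv_scale.
by rewrite !ddE; case: a => [[j b]|]; rewrite !P //; ring.
Qed.
Lemma dd_sc_any a (f : S -> Cx R) rho q : (forall j, rho j != 0) ->
  dd a (fun q => f (sc rho q)) q = rc (sca rho a) * dd a f (sc rho q).
Proof.
move=> r0; have P b : pd b (fun q => f (sc rho q)) q = rc (sca rho b) * pd b f (sc rho q).
  rewrite pdE /pder; have b0 : sca rho b != 0 by case: b => [[]|] //=; exact: oner_neq0.
  rewrite -cderiv_rescale //; congr (cderiv _ 0); apply/funext => s; by rewrite sc_shift.
by rewrite !ddE; case: a => [[j b]|]; rewrite !P //=; ring.
Qed.
End Junk.

Section Slice.
Variables (R : realType) (n : nat).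
Notation S := (R * Cn R n)%type.
Variables (O : set S) (oO : open O) (t : R).
Let Ot : set S := [set q | O (t, q.2)].
Lemma open_slice : open Ot.
Proof.
rewrite (_ : Ot = (fun q : S => ((t, q.2) : S)) @^-1` O) //; apply: open_comp => // x _.
by apply: cvg_pair2; [exact: cvg_cst|exact: cvg_snd].
Qed.
Lemma sm_slice f : smooth_st O f -> smooth_st Ot (fun q => f (t, q.2)).
Proof.
have C f' k : Ck k O f' -> forall q, Ot q -> {for q, continuous (fun q : S => f' (t, q.2))}.
  move=> F q Oq; have e : (fun q' : S => ((t, q'.2) : S)) @ q --> ((t, q.2) : S).
    by apply: cvg_pair2; [exact: cvg_cst|exact: cvg_snd].
  exact: (cvg_comp _ _ e (Ck_cts F Oq)).
move=> /smooth_stP F; apply/smooth_stP => k; elim: k f {F}(F k) => [|k IH] f F.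
  by split=> // q Oq; exact: C F q Oq.
apply: (@Ck_intro R n Ot open_slice k _ (fun a q => if a is Some _ then pd a f (t, q.2) else 0)) => [q Oq|[a|] q Oq|[a|]].
- exact: C F q Oq.
- have := Ck_der (Some a) F Oq; apply: is_cder_ext => s; by case: a.
- exact: (is_cder_ext _ (is_cderC (f (t, q.2)) 0)).
- by apply: IH; exact: Ck_pd F.
- exact: (Ck_cst open_slice).
Qed.
End Slice.

(** * Smooth families of polynomials *)

Section PolynomialFamilies.
Variables (R : realType) (n : nat).
Notation S := (R * Cn R n)%type.
Variables (O : set S) (oO : open O).
Notation sm := (smooth_st O).

(** The uniform bound on the degree turns evaluation into a sum over a fixed finite range, which can
    be differentiated term by term. *)
Definition smp (P : S -> {poly Cx R}) : Prop :=
  (exists N, forall q, (size (P q) <= N)%N) /\ forall i, sm (fun q => (P q)`_i).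

Lemma smp_cst c : smp (fun=> c).
Proof. by split=> [|i]; [exists (size c)|exact: (sm_cst oO)]. Qed.
Lemma smp_C f : sm f -> smp (fun q => (f q)%:P).
Proof.
move=> F; split=> [|i]; first by exists 1%N => q; exact: size_polyC_leq1.
case: i => [|i].
  by apply: (sm_eq oO _ F) => q _; rewrite coefC eqxx.
by apply: (sm_eq oO _ (sm_cst oO 0)) => q _; rewrite coefC.
Qed.
Lemma smpD P Q : smp P -> smp Q -> smp (fun q => P q + Q q).
Proof.
move=> [[N1 H1] s1] [[N2 H2] s2]; split=> [|i].
  exists (N1 + N2)%N => q; apply: leq_trans (size_polyD _ _) _.
  by rewrite geq_max (leq_trans (H1 q) (leq_addr _ _)) (leq_trans (H2 q) (leq_addl _ _)).
by apply: (sm_eq oO _ (smD oO (s1 i) (s2 i))) => q _; rewrite coefD.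
Qed.
Lemma smpM P Q : smp P -> smp Q -> smp (fun q => P q * Q q).
Proof.
move=> [[N1 H1] s1] [[N2 H2] s2]; split=> [|i].
  exists (N1 + N2)%N => q; apply: leq_trans (size_polyMleq _ _) _.
  by apply: leq_trans (leq_pred _) _; exact: leq_add.
have H := @sm_sum R n O oO _ (index_enum 'I_i.+1) xpredT (fun (j : 'I_i.+1) q => (P q)`_j * (Q q)`_(i - j)) (fun j => smM oO (s1 j) (s2 (i - j)%N)).
by apply: (sm_eq oO _ H) => q _; rewrite coefM.
Qed.
Lemma smp_ext P Q : P =1 Q -> smp P -> smp Q.
Proof. by move=> /funext ->. Qed.
Lemma smp_sum (T : Type) (r : seq T) (P : T -> S -> {poly Cx R}) : (forall i, smp (P i)) ->
  smp (fun q => \sum_(i <- r) P i q).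
Proof.
move=> H; elim: r => [|x r IH]; first by apply: smp_ext (smp_cst 0) => q; rewrite big_nil.
by apply: smp_ext (smpD (H x) IH) => q; rewrite big_cons.
Qed.
Lemma smp_prod (T : Type) (r : seq T) (P : T -> S -> {poly Cx R}) : (forall i, smp (P i)) ->
  smp (fun q => \prod_(i <- r) P i q).
Proof.
move=> H; elim: r => [|x r IH]; first by apply: smp_ext (smp_cst 1) => q; rewrite big_nil.
by apply: smp_ext (smpM (H x) IH) => q; rewrite big_cons.
Qed.
Lemma smpX P k : smp P -> smp (fun q => P q ^+ k).
Proof.
move=> H; elim: k => [|k IH]; first by apply: smp_ext (smp_cst 1) => q; rewrite expr0.
by apply: smp_ext (smpM H IH) => q; rewrite exprS.
Qed.
Lemma smp_det (k : nat) (A : S -> 'M[{poly Cx R}]_k) : (forall i j, smp (fun q => A q i j)) -> smp (fun q => \det (A q)).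
Proof.
move=> H; apply: smp_sum => s; apply: smpM; first exact: smp_cst.
by apply: smp_prod => i; exact: H.
Qed.

Lemma sm_horner P x : smp P -> sm (fun q => (P q).[x]).
Proof.
move=> [[N H] s].
have H2 := @sm_sum R n O oO _ (index_enum 'I_N) xpredT (fun (i : 'I_N) q => (P q)`_i * x ^+ i) (fun i => smM oO (s i) (sm_cst oO _)).
by apply: (sm_eq oO _ H2) => q _; rewrite (horner_coef_wide _ (H q)).
Qed.
Lemma dd2_horner P N x a b q : smp P -> (forall q, (size (P q) <= N)%N) -> O q ->
  dd a (dd b (fun q => (P q).[x])) q = \sum_(i < N) dd a (dd b (fun q => (P q)`_i)) q * x ^+ i.
Proof.
move=> [_ s] H Oq.
have e1 q' : O q' -> dd b (fun q => (P q).[x]) q' = \sum_(i < N) x ^+ i * dd b (fun q => (P q)`_i) q'.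
  move=> O'; rewrite (_ : (fun q => (P q).[x]) = fun q => \sum_(i < N) x ^+ i * (P q)`_i); last first.
    by apply/funext => z; rewrite (horner_coef_wide _ (H z)); apply: eq_bigr => i _; rewrite mulrC.
  rewrite (dd_sum oO) //; last by move=> i; exact: (smZ oO).
  by apply: eq_bigr => i _; rewrite (ddZ oO).
rewrite (dd_eq oO _ e1 Oq) (dd_sum oO) //; last by move=> i; apply: (smZ oO); exact: (sm_dd oO).
by apply: eq_bigr => i _; rewrite (ddZ oO _ _ (sm_dd oO b (s i)) Oq) mulrC.
Qed.
End PolynomialFamilies.

Lemma cvg_sumC (R : realType) (T I : Type) (F : set_system T) (FF : Filter F) (r : seq I) (c : I -> T -> Cx R) (d : I -> Cx R) :
  (forall i, c i @ F --> d i) -> (fun t => \sum_(i <- r) c i t) @ F --> \sum_(i <- r) d i.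
Proof.
move=> hc; elim: r => [|x r IH].
  by rewrite big_nil (_ : (fun _ => _) = fun=> 0); [exact: cvg_cst|apply/funext => s; rewrite big_nil].
rewrite big_cons (_ : (fun _ => _) = fun t => c x t + \sum_(j <- r) c j t); first exact: (cvgD (hc x) IH).
by apply/funext => s; rewrite big_cons.
Qed.

(** This is the comparison of coefficients in l. The constant coefficient is the limit at 0 and
    vanishes; division by X lowers k by one. *)
Lemma small_poly (R : realType) (k : nat) (p : {poly Cx R}) :
  (forall e : R, 0 < e -> \forall x \near (0 : R)^'+, nm (p.[rc x]) <= e * x ^+ k) -> forall i, (i <= k)%N -> p`_i = 0.
Proof.
elim: k p => [|k IH] p H i ik.
  move: ik; rewrite leqn0 => /eqP ->; rewrite -horner_coef0; apply/eqP; rewrite -nm_eq0 eq_le nm_ge0 andbT.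
  apply/ler_addgt0Pr => e e0; rewrite add0r.
  have c : (fun x : R => nm (p.[rc x])) @ 0^'+ --> nm (p.[0]).
    apply: cvg_at_right_filter; rewrite -(rc0 R); apply: cvg_nmf.
    rewrite (_ : (fun x => _) = fun x : R => \sum_(i < size p) p`_i * rc x ^+ i); last by apply/funext => x; rewrite horner_coef.
    rewrite horner_coef; apply: cvg_sumC => j; apply: cvgM; first exact: cvg_cst.
    have c1 : (fun x : R => rc x) @ (0 : R) --> rc (0 : R) by apply: cvg_rc; exact: cvg_id.
    elim: (j : nat) => [|l IHl].
      by rewrite expr0 (_ : (fun _ => _) = fun=> 1); [exact: cvg_cst|apply/funext => x; rewrite expr0].
    rewrite exprS (_ : (fun _ => _) = fun x : R => rc x * rc x ^+ l); last by apply/funext => x; rewrite exprS.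
    exact: (cvgM c1 IHl).
  apply: (cvgr_to_le c); apply: filterS (H e e0) => x; by rewrite expr0 mulr1.
have p0 : p`_0 = 0.
  apply: (IH p _ 0%N) => // e e0; have := H e e0.
  have s1 : \forall x \near (0 : R)^'+, 0 < x < 1 by apply/near_right0; exists 1.
  move=> /(filterI s1); apply: filterS => x [/andP[x0 x1] h]; apply: le_trans h _.
  by rewrite ler_pM2l // exprS ler_piMl ?exprn_ge0 ?(ltW x0) ?(ltW x1).
case: i ik => [//|i] ik; rewrite ltnS in ik.
pose r := \poly_(i < (size p).-1) p`_i.+1.
have pE : p = r * 'X.
  apply/polyP => j; rewrite coefMX /r; case: j => [|j] /=; first by rewrite p0.
  rewrite coef_poly; case: ltnP => // h; rewrite nth_default //; exact: leq_trans (leqSpred _) _.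
rewrite pE coefMX /=; apply: IH ik => e e0.
have s1 : \forall x \near (0 : R)^'+, 0 < x < 1 by apply/near_right0; exists 1.
apply: filterS (filterI s1 (H e e0)) => x [/andP[x0 x1]].
by rewrite {1}pE hornerMX nmM nm_rc (gtr0_norm x0) exprSr mulrA ler_pM2r.
Qed.

(** * Jets of families *)

Section TruncatedLog.
Variables (R : realType) (n : nat).
Notation S := (R * Cn R n)%type.
Variables (O : set S) (oO : open O) (f : S -> Cx R).
Notation sm := (smooth_st O).
Hypothesis F : sm f.

Definition logk (k : nat) (x : Cx R) : Cx R := \sum_(1 <= l < k.+1) (-1) ^+ l.+1 / l%:R * (x - 1) ^+ l.

Lemma smX h k : sm h -> sm (fun q => h q ^+ k).
Proof.
move=> H; elim: k => [|k IH]; first by apply: (sm_eq oO _ (sm_cst oO 1)) => q _; rewrite expr0.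
by apply: (sm_eq oO _ (smM oO H IH)) => q _; rewrite exprS.
Qed.
Lemma ddX h k a q : sm h -> O q -> dd a (fun q => h q ^+ k) q = k%:R * h q ^+ k.-1 * dd a h q.
Proof.
move=> H Oq; elim: k => [|k IH]; first by rewrite (_ : (fun _ => _) = fun=> 1) ?dd_cst ?mul0r //; apply/funext => z; rewrite expr0.
rewrite (_ : (fun _ => _) = fun q => h q * h q ^+ k); last by apply/funext => z; rewrite exprS.
rewrite (ddM _ H (smX k H) Oq) IH /=; case: k {IH} => [|k] /=; first by rewrite expr0; ring.
rewrite exprS -(natr1 k.+1); ring.
Qed.
Lemma sm_logk k : sm (fun q => logk k (f q)).
Proof.
rewrite /logk; apply: (sm_sum oO) => l; apply: (smZ oO); apply: smX.
exact: (smB oO F (sm_cst oO 1)).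
Qed.
(** Term by term differentiation of the truncated series leaves a geometric sum, which is the
    truncation of 1 / f around f = 1. *)
Lemma dd_logk k b q : O q -> dd b (fun q => logk k (f q)) q = dd b f q * \sum_(l < k) (1 - f q) ^+ l.
Proof.
move=> Oq; have sf := smB oO F (sm_cst oO 1).
have df : dd b (fun q => f q - 1) q = dd b f q by rewrite (ddB oO _ F (sm_cst oO 1) Oq) dd_cst subr0.
elim: k => [|k IH].
  rewrite big_ord0 mulr0 (_ : (fun _ => _) = fun=> 0) ?dd_cst //.
  by apply/funext => z; rewrite /logk big_geq.
have E : (fun q => logk k.+1 (f q)) = fun q => logk k (f q) + (-1) ^+ k.+2 / k.+1%:R * (f q - 1) ^+ k.+1.
  by apply/funext => z; rewrite /logk big_nat_recr.
have A : (-1) ^+ k.+2 / k.+1%:R * (k.+1%:R * (f q - 1) ^+ k.+1.-1 * dd b f q) = dd b f q * (1 - f q) ^+ k.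
  have -> : 1 - f q = - (f q - 1) by ring.
  have e : (-1) ^+ k.+2 = (-1) ^+ k :> Cx R by rewrite !exprS mulrA mulrNN !mul1r.
  have k0 : k.+1%:R != 0 :> Cx R by rewrite pnatr_eq0.
  have gen (K E' X Y : Cx R) : K != 0 -> E' / K * (K * X * Y) = Y * (E' * X) by move=> K0; field.
  rewrite e [(- (f q - 1)) ^+ k]exprNn; exact: (gen _ _ _ _ k0).
rewrite E (ddD _ (sm_logk k) (smZ oO _ (smX _ sf)) Oq) IH (ddZ oO _ _ (smX k.+1 sf) Oq) (ddX _ _ sf Oq) df.
by rewrite big_ord_recr mulrDr; congr (_ + _); exact: A.
Qed.

(** The first two terms on the left are the second derivative of log f. The geometric sum in
    [dd_logk] is (1 - (1 - f)^k) / f, so the remainder is explicit: each of its terms has at least k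
    + 1 factors among y, y1, y2 and y3, which are all small when f is close to 1. *)
Lemma dd2_logk k a b q : O q -> f q != 0 ->
  let y := f q - 1 in let y1 := dd a f q in let y2 := dd b f q in let y3 := dd a (dd b f) q in
  y3 / f q - y1 * y2 / (f q * f q) - dd a (dd b (fun q => logk k (f q))) q =
  (y3 * (- y) ^+ k + (-1) ^+ k * k%:R * y ^+ k.-1 * (y1 * y2)) / f q - y1 * y2 * (- y) ^+ k / (f q * f q).
Proof.
move=> Oq f0 y y1 y2 y3; pose Sk q := \sum_(l < k) (1 - f q) ^+ l.
have s1 := smB oO (sm_cst oO 1) F.
have sS : sm Sk by apply: (sm_sum oO) => l; exact: smX.
have E q' : f q' * Sk q' = 1 - (1 - f q') ^+ k.
  have -> : f q' * Sk q' = - ((1 - f q' - 1) * Sk q') by ring.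
  by rewrite /Sk -subrX1 opprB.
have dE : y1 * Sk q + f q * dd a Sk q = k%:R * (1 - f q) ^+ k.-1 * y1.
  rewrite /y1 -(ddM _ F sS Oq) (_ : (fun q => f q * Sk q) = fun q => 1 - (1 - f q) ^+ k); last by apply/funext.
  rewrite (ddB oO _ (sm_cst oO 1) (smX k s1) Oq) dd_cst sub0r (ddX _ _ s1 Oq) (ddB oO _ (sm_cst oO 1) F Oq) dd_cst sub0r.
  by ring.
have -> : dd a (dd b (fun q => logk k (f q))) q = y3 * Sk q + y2 * dd a Sk q.
  by rewrite (dd_eq oO a (fun q' O' => dd_logk k b O') Oq) (ddM _ (sm_dd oO b F) sS Oq).
have yE : - y = 1 - f q by rewrite /y opprB.
have Ek : (-1) ^+ k * k%:R * y ^+ k.-1 = - (k%:R * (1 - f q) ^+ k.-1).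
  rewrite -yE [(- y) ^+ _]exprNn; case: (k) => [|l]; first by rewrite mulr0 !mul0r oppr0.
  have gen (E' K X : Cx R) : -1 * E' * K * X = - (K * (E' * X)) by ring.
  by rewrite exprS; exact: gen.
have -> : dd a Sk q = (k%:R * (1 - f q) ^+ k.-1 * y1 - y1 * Sk q) / f q.
  by rewrite -dE addrC addKr mulrC mulKf.
have SE : Sk q = (1 - (- y) ^+ k) / f q by rewrite yE -E mulrC mulKf.
rewrite Ek SE; set w := (- y) ^+ k; set z := k%:R * _; field; exact: f0.
Qed.
End TruncatedLog.

Section Jets.
Variables (R : realType) (n : nat).
Notation S := (R * Cn R n)%type.
Variables (q : S) (a b : option ('I_n * bool)) (Om : R -> set S).
Hypothesis oOm : forall l, open (Om l).
Hypothesis Omq : \forall l \near (0 : R)^'+, Om l q.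
Implicit Types (f g : S -> Cx R) (F G : R -> S -> Cx R).

(* [jle f M] bounds the derivatives of [f] at [q] that enter [dd a (dd b _)] of a product; [jb] and [jo k]
   say that they are O(1) and o(l^k) as l -> 0+. *)
Definition jle f (M : R) : Prop :=
  [/\ nm (f q) <= M, nm (dd a f q) <= M, nm (dd b f q) <= M & nm (dd a (dd b f) q) <= M].
Definition smf F := \forall l \near (0 : R)^'+, smooth_st (Om l) (F l).
Definition jb F := smf F /\ exists C : R, \forall l \near (0 : R)^'+, jle (F l) C.
Definition jo k F := smf F /\ forall e : R, 0 < e -> \forall l \near (0 : R)^'+, jle (F l) (e * l ^+ k).

Lemma jle_ge0 f M : jle f M -> 0 <= M. Proof. by case=> h _ _ _; exact: le_trans (nm_ge0 _) h. Qed.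
Lemma jle_le f M N : M <= N -> jle f M -> jle f N.
Proof. by move=> MN [h1 h2 h3 h4]; split; apply: le_trans MN. Qed.
Section At.
Variables (O : set S) (oO : open O) (Oq : O q).
Lemma jleD f g M N : smooth_st O f -> smooth_st O g -> jle f M -> jle g N -> jle (fun q => f q + g q) (M + N).
Proof.
move=> sf sg [f0 f1 f2 f3] [g0 g1 g2 g3].
have E q' : O q' -> dd b (fun q => f q + g q) q' = dd b f q' + dd b g q' by move=> O'; exact: (ddD _ sf sg O').
split; [|rewrite (ddD _ sf sg Oq)|rewrite E //|rewrite (dd_eq oO a E Oq) (ddD _ (sm_dd oO b sf) (sm_dd oO b sg) Oq)];
 by apply: le_trans (nmD _ _) _; exact: lerD.
Qed.
(** The factor 4 counts the terms in the mixed second derivative of a product. *)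
Lemma jleM f g M N : smooth_st O f -> smooth_st O g -> jle f M -> jle g N -> jle (fun q => f q * g q) (4 * (M * N)).
Proof.
move=> sf sg hf hg; have M0 := jle_ge0 hf; have N0 := jle_ge0 hg; have MN : 0 <= M * N by exact: mulr_ge0.
case: hf hg => [f0 f1 f2 f3] [g0 g1 g2 g3].
have P x y : nm x <= M -> nm y <= N -> nm (x * y) <= M * N by move=> hx hy; rewrite nmM; apply: ler_pM; rewrite ?nm_ge0.
have E q' : O q' -> dd b (fun q => f q * g q) q' = dd b f q' * g q' + f q' * dd b g q' by move=> O'; exact: (ddM _ sf sg O').
have sfb := sm_dd oO b sf; have sgb := sm_dd oO b sg.
split; [|rewrite (ddM _ sf sg Oq)|rewrite E //|rewrite (dd_eq oO a E Oq) (ddD _ (smM oO sfb sg) (smM oO sf sgb) Oq) (ddM _ sfb sg Oq) (ddM _ sf sgb Oq)].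
- by apply: le_trans (P _ _ f0 g0) _; lra.
- by apply: le_trans (nmD _ _) _; have := P _ _ f1 g0; have := P _ _ f0 g1; lra.
- by apply: le_trans (nmD _ _) _; have := P _ _ f2 g0; have := P _ _ f0 g2; lra.
apply: le_trans (nmD _ _) _.
have := nmD (dd a (dd b f) q * g q) (dd b f q * dd a g q); have := nmD (dd a f q * dd b g q) (f q * dd a (dd b g) q).
have := P _ _ f3 g0; have := P _ _ f2 g1; have := P _ _ f1 g2; have := P _ _ f0 g3; lra.
Qed.
Lemma jleZ (c : Cx R) f M : smooth_st O f -> jle f M -> jle (fun q => c * f q) (nm c * M).
Proof.
move=> sf [f0 f1 f2 f3].
have E q' : O q' -> dd b (fun q => c * f q) q' = c * dd b f q' by move=> O'; exact: (ddZ oO _ _ sf O').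
by split; [|rewrite (ddZ oO _ _ sf Oq)|rewrite E //|rewrite (dd_eq oO a E Oq) (ddZ oO _ _ (sm_dd oO b sf) Oq)];
 rewrite nmM ler_wpM2l ?nm_ge0.
Qed.
Lemma jle_eq f g M : (forall q', O q' -> f q' = g q') -> jle f M -> jle g M.
Proof.
move=> fg [f0 f1 f2 f3]; have E q' : O q' -> dd b f q' = dd b g q' by move=> O'; exact: (dd_eq oO b fg O').
by split; rewrite -?fg -?E -?(dd_eq oO a fg Oq) -?(dd_eq oO a E Oq).
Qed.
End At.

Lemma smfD F G : smf F -> smf G -> smf (fun l q => F l q + G l q).
Proof. by move=> sF sG; apply: filterS (filterI sF sG) => l [h1 h2]; exact: (smD (@oOm l) h1 h2). Qed.
Lemma smfM F G : smf F -> smf G -> smf (fun l q => F l q * G l q).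
Proof. by move=> sF sG; apply: filterS (filterI sF sG) => l [h1 h2]; exact: (smM (@oOm l) h1 h2). Qed.
Lemma jbD F G : jb F -> jb G -> jb (fun l q => F l q + G l q).
Proof.
move=> [sF [C HC]] [sG [D HD]]; split; first exact: smfD.
exists (C + D); apply: filterS (filterI (filterI HC HD) (filterI (filterI sF sG) Omq)) => l [[h1 h2] [[h3 h4] h5]].
exact: (jleD (@oOm l) h5 h3 h4 h1 h2).
Qed.
Lemma jbM F G : jb F -> jb G -> jb (fun l q => F l q * G l q).
Proof.
move=> [sF [C HC]] [sG [D HD]]; split; first exact: smfM.
exists (4 * (C * D)); apply: filterS (filterI (filterI HC HD) (filterI (filterI sF sG) Omq)) => l [[h1 h2] [[h3 h4] h5]].
exact: (jleM (@oOm l) h5 h3 h4 h1 h2).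
Qed.
Lemma pos1 : \forall l \near (0 : R)^'+, 0 < l < 1. Proof. by apply/near_right0; exists 1. Qed.
Lemma joD k F G : jo k F -> jo k G -> jo k (fun l q => F l q + G l q).
Proof.
move=> [sF HC] [sG HD]; split; first exact: smfD.
move=> e e0; have e20 : 0 < e / 2 by rewrite divr_gt0.
apply: filterS (filterI (filterI (HC _ e20) (HD _ e20)) (filterI (filterI sF sG) Omq)) => l [[h1 h2] [[h3 h4] h5]].
by have := jleD (@oOm l) h5 h3 h4 h1 h2; apply: jle_le; rewrite -mulrDl -splitr.
Qed.
Lemma joM k F G : jo k F -> jb G -> jo k (fun l q => F l q * G l q).
Proof.
move=> [sF HC] [sG [D HD]]; split; first exact: smfM.
move=> e e0; have D0 : 0 < 4 * (`|D| + 1) by rewrite mulr_gt0 // ltr_wpDl.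
have e20 : 0 < e / (4 * (`|D| + 1)) by rewrite divr_gt0.
apply: filterS (filterI pos1 (filterI (filterI (HC _ e20) HD) (filterI (filterI sF sG) Omq))) => l [/andP[l0 _] [[h1 h2] [[h3 h4] h5]]].
have D1 : D <= `|D| + 1 by have := ler_norm D; lra.
have := jleM (@oOm l) h5 h3 h4 h1 (jle_le D1 h2); apply: jle_le.
by rewrite (_ : 4 * _ = e / (4 * (`|D| + 1)) * (4 * (`|D| + 1)) * l ^+ k); [rewrite divfK // gt_eqF|ring].
Qed.
Lemma jb_ext F G : (forall l q, F l q = G l q) -> jb F -> jb G.
Proof. by move=> H; rewrite (_ : F = G) //; apply/funext => l; apply/funext => z. Qed.
Lemma jo_ext k F G : (forall l q, F l q = G l q) -> jo k F -> jo k G.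
Proof. by move=> H; rewrite (_ : F = G) //; apply/funext => l; apply/funext => z. Qed.
Lemma jb_fix f : (\forall l \near (0 : R)^'+, smooth_st (Om l) f) -> jb (fun=> f).
Proof.
move=> sf; split=> //; exists (nm (f q) + nm (dd a f q) + nm (dd b f q) + nm (dd a (dd b f) q)).
apply: nearW => l; have := nm_ge0 (f q); have := nm_ge0 (dd a f q); have := nm_ge0 (dd b f q); have := nm_ge0 (dd a (dd b f) q).
by move=> *; split; lra.
Qed.
Lemma jb_cst c : jb (fun _ _ => c).
Proof. by apply: jb_fix; apply: nearW => l; exact: (sm_cst (@oOm l)). Qed.
Lemma jo0 k : jo k (fun _ _ => 0).
Proof.
split; first by apply: nearW => l; exact: (sm_cst (@oOm l)).
move=> e e0; apply: filterS pos1 => l /andP[l0 _].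
have h : 0 <= e * l ^+ k by rewrite mulr_ge0 ?exprn_ge0 // ltW.
have z : dd b (fun _ : S => (0 : Cx R)) = (fun _ : S => (0 : Cx R)) by apply/funext => z; exact: dd_cst.
by split; rewrite ?z ?dd_cst nm0.
Qed.
Lemma jb_sum (T : Type) (r : seq T) (F : T -> R -> S -> Cx R) : (forall i, jb (F i)) -> jb (fun l q => \sum_(i <- r) F i l q).
Proof.
move=> H; elim: r => [|x r IH]; first by apply: jb_ext (jb_cst 0) => l z; rewrite big_nil.
by apply: jb_ext (jbD (H x) IH) => l z; rewrite big_cons.
Qed.
Lemma jb_prod (T : Type) (r : seq T) (F : T -> R -> S -> Cx R) : (forall i, jb (F i)) -> jb (fun l q => \prod_(i <- r) F i l q).
Proof.
move=> H; elim: r => [|x r IH]; first by apply: jb_ext (jb_cst 1) => l z; rewrite big_nil.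
by apply: jb_ext (jbM (H x) IH) => l z; rewrite big_cons.
Qed.
Lemma jo_sum k (T : Type) (r : seq T) (F : T -> R -> S -> Cx R) : (forall i, jo k (F i)) -> jo k (fun l q => \sum_(i <- r) F i l q).
Proof.
move=> H; elim: r => [|x r IH]; first by apply: jo_ext (jo0 k) => l z; rewrite big_nil.
by apply: jo_ext (joD (H x) IH) => l z; rewrite big_cons.
Qed.
(** Telescoping: the factors are exchanged one at a time while the others stay bounded. *)
Lemma jo_prod k (T : Type) (r : seq T) (F G : T -> R -> S -> Cx R) : (forall i, jb (F i)) -> (forall i, jb (G i)) ->
  (forall i, jo k (fun l q => F i l q - G i l q)) ->
  jo k (fun l q => \prod_(i <- r) F i l q - \prod_(i <- r) G i l q).
Proof.
move=> HF HG H; elim: r => [|x r IH]; first by apply: jo_ext (jo0 k) => l z; rewrite !big_nil subrr.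
by apply: jo_ext (joD (joM (H x) (jb_prod r HF)) (joM IH (HG x))) => l z; rewrite !big_cons; ring.
Qed.
Lemma jo_det k (N : nat) (A B : R -> S -> 'M[Cx R]_N) : (forall i j, jb (fun l q => A l q i j)) -> (forall i j, jb (fun l q => B l q i j)) ->
  (forall i j, jo k (fun l q => A l q i j - B l q i j)) -> jo k (fun l q => \det (A l q) - \det (B l q)).
Proof.
move=> HA HB H.
have P (s : {perm 'I_N}) : jo k (fun l q => (\prod_i A l q i (s i) - \prod_i B l q i (s i)) * (-1) ^+ s).
  apply: joM (jb_cst _); exact: (@jo_prod k _ (index_enum 'I_N) (fun i l q => A l q i (s i)) (fun i l q => B l q i (s i))).
apply: jo_ext (jo_sum (index_enum {perm 'I_N}) P) => l z.
by rewrite /determinant -sumrB; apply: eq_bigr => s _; rewrite -mulrBr mulrC.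
Qed.
Lemma jo_pow k j f : (k < j)%N -> (\forall l \near (0 : R)^'+, smooth_st (Om l) f) -> jo k (fun l q => rc (l ^+ j) * f q).
Proof.
move=> kj sf; have [_ [C HC]] := jb_fix sf; split.
  by apply: filterS sf => l h; exact: (smZ (@oOm l) _ h).
move=> e e0; have C0 : 0 < `|C| + 1 by rewrite ltr_wpDl.
have S1 : \forall l \near (0 : R)^'+, 0 < l < e / (`|C| + 1) by apply/near_right0; exists (e / (`|C| + 1)) => //; rewrite divr_gt0.
apply: filterS (filterI (filterI pos1 S1) (filterI (filterI sf HC) Omq)) => l [[/andP[l0 l1] /andP[_ le]] [[h1 h2] h3]].
have := jleZ (@oOm l) h3 (rc (l ^+ j)) h1 h2; apply: jle_le.
rewrite nm_rc ger0_norm ?exprn_ge0 ?(ltW l0) // -(subnKC kj) exprD exprS -mulrA.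
have le1 : l ^+ (j - k.+1) <= 1 by rewrite exprn_ile1 // ltW.
rewrite ltr_pdivlMr // in le.
have CC : C <= `|C| + 1 by have := ler_norm C; lra.
have l2 : l ^+ (j - k.+1) * C <= `|C| + 1.
  apply: (@le_trans _ _ (l ^+ (j - k.+1) * (`|C| + 1))); first by rewrite ler_wpM2l ?exprn_ge0 // ltW.
  by rewrite ler_piMl // ltW.
have gen (x y z w : R) : x * (y * z) * w = x * (z * w) * y by ring.
rewrite gen ler_wpM2r ?exprn_ge0 ?(ltW l0) //; apply: le_trans (ltW le); by rewrite ler_pM2l.
Qed.
End Jets.

Lemma remainder_sum (R : realType) (e x t k a b c d : R) :
  a <= b + c -> b <= (t + k * t) * 2 -> c <= t * 4 -> d <= e / 2 * x -> (2 * k + 6) * t <= e / 2 * x ->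
  a + d <= e * x.
Proof. by move=> *; lra. Qed.

(** * The logarithm and the formal logarithm *)

Section LogComparison.
Variables (R : realType) (n : nat).
Notation S := (R * Cn R n)%type.
Variables (q : S) (a b : option ('I_n * bool)) (Om : R -> set S) (O : set S).
Hypothesis oOm : forall l, open (Om l).
Hypothesis Omq : \forall l \near (0 : R)^'+, Om l q.
Hypothesis oO : open O.
Hypothesis Oq : O q.
Hypothesis OmO : forall l, Om l `<=` O.
Notation jb := (jb q a b Om).
Notation jo := (jo q a b Om).
Notation jle := (jle q a b).

Lemma sm_sub (A B : set S) f : A `<=` B -> smooth_st B f -> smooth_st A f.
Proof. by move=> AB /smooth_stP F; apply/smooth_stP => k; exact: Ck_sub (F k). Qed.
Lemma jb_rcX i : jb (fun l _ => rc l ^+ i).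
Proof.
split; first by apply: nearW => l; exact: (sm_cst (@oOm l)).
exists 1; apply: filterS (pos1 R) => l /andP[l0 l1].
have h : nm (rc l ^+ i) <= 1 by rewrite nmX nm_rc gtr0_norm // exprn_ile1 // ltW.
have z c : dd b (fun _ : S => (c : Cx R)) = (fun _ : S => (0 : Cx R)) by apply/funext => z; exact: dd_cst.
by split; rewrite ?z ?dd_cst ?nm0.
Qed.
Lemma jo_jb k F : jo k F -> jb F.
Proof.
move=> [sF H]; split=> //; exists 1; apply: filterS (filterI (pos1 R) (H 1 ltr01)) => l [/andP[l0 l1]].
by apply: jle_le; rewrite mul1r exprn_ile1 // ltW.
Qed.
Lemma jo_le i k F : (i <= k)%N -> jo k F -> jo i F.
Proof.
move=> ik [sF H]; split=> // e e0; apply: filterS (filterI (pos1 R) (H e e0)) => l [/andP[l0 l1]].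
by apply: jle_le; rewrite ler_pM2l // ler_wiXn2l // ltW.
Qed.
Lemma jo_exp k i F G : jb F -> jb G -> jo k (fun l q => F l q - G l q) -> jo k (fun l q => F l q ^+ i - G l q ^+ i).
Proof.
move=> bF bG H.
apply: jo_ext (@jo_prod _ _ q a b Om oOm Omq k _ (index_enum 'I_i) (fun=> F) (fun=> G) (fun=> bF) (fun=> bG) (fun=> H)) => l z.
by rewrite !prodr_const card_ord.
Qed.
Lemma jb_smooth f : smooth_st O f -> jb (fun=> f).
Proof. by move=> sf; apply: jb_fix; apply: nearW => l; exact: (sm_sub (@OmO l) sf). Qed.
Lemma jb_horner P : smp O P -> jb (fun l q => (P q).[rc l]).
Proof.
move=> [[N H] s].
apply: jb_ext (@jb_sum _ _ q a b Om oOm Omq _ (index_enum 'I_N) (fun (i : 'I_N) l q => (P q)`_i * rc l ^+ i) _) => [l z|i].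
  by rewrite (horner_coef_wide _ (H z)).
by apply: jbM => //; [exact: jb_smooth|exact: jb_rcX].
Qed.

Variables (k : nat) (F : R -> S -> Cx R) (P : S -> {poly Cx R}).
Hypothesis sP : smp O P.
Hypothesis P0 : forall q', O q' -> (P q')`_0 = 1.
Hypothesis FP : jo k (fun l q => F l q - (P q).[rc l]).

Let bP : jb (fun l q => (P q).[rc l]). Proof. exact: jb_horner. Qed.
Let bF : jb F.
Proof. by apply: jb_ext (jbD oOm Omq (jo_jb FP) bP) => l z; rewrite subrK. Qed.

(** P = 1 + X P1 with P1 again a smooth family, hence bounded together with its derivatives. *)
Lemma jet_horner1 : exists C : R, \forall l \near (0 : R)^'+, jle (fun q => (P q).[rc l] - 1) (C * l).
Proof.
pose P1 q := \poly_(i < (size (P q)).-1) (P q)`_i.+1.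
have cP1 q' i : (P1 q')`_i = (P q')`_i.+1.
  rewrite coef_poly; case: ltnP => // h; rewrite nth_default //; exact: leq_trans (leqSpred _) _.
have sP1 : smp O P1.
  have [[N H] s] := sP; split=> [|i].
    exists N => z; apply: leq_trans (size_poly _ _) _; exact: leq_trans (leq_pred _) (H z).
  by apply: (sm_eq oO _ (s i.+1)) => z _; rewrite cP1.
have [_ [C HC]] := jb_horner sP1; exists C.
apply: filterS (filterI (pos1 R) (filterI HC Omq)) => l [/andP[l0 l1] [h1 h2]].
have := jleZ (@oOm l) h2 (rc l) (sm_sub (@OmO l) (sm_horner oO (rc l) sP1)) h1.
rewrite nm_rc gtr0_norm // mulrC; apply: (jle_eq (@oOm l) h2) => z /(@OmO l) Oz.
have -> : P z = P1 z * 'X + 1.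
  apply/polyP => i; rewrite coefD coefMX coef1; case: i => [|i] /=; first by rewrite add0r P0.
  by rewrite addr0 cP1.
by rewrite hornerD hornerMX hornerC addrK mulrC.
Qed.
Lemma smF1 : smf Om F. Proof. by case: bF. Qed.
(** [eta] bounds F - 1 and its derivatives at once. The number 2 k + 6 is the factor of eta^(k+1) in
    the remainder of [dd2_logk] when |F| >= 1/2: the terms over F give (1 + k) 2, the term over F^2
    gives 4. *)
Lemma jet_small (e : R) : 0 < e -> \forall l \near (0 : R)^'+, exists eta,
  [/\ jle (fun q => F l q - 1) eta, eta <= 1 / 2 & (2 * k%:R + 6) * eta ^+ k.+1 <= e * l ^+ k].
Proof.
move=> e0; have [C HC] := jet_horner1.
pose A : R := `|C| + 1; have A0 : 0 < A by rewrite /A ltr_wpDl.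
have E : forall M N l, Om l q -> smooth_st (Om l) (F l) -> jle (fun q => F l q - (P q).[rc l]) M -> jle (fun q => (P q).[rc l] - 1) N ->
    jle (fun q => F l q - 1) (M + N).
  move=> M N l Ol sFl h1 h2; have sPl := sm_sub (@OmO l) (sm_horner oO (rc l) sP).
  have := jleD (@oOm l) Ol (smB (@oOm l) sFl sPl) (smB (@oOm l) sPl (sm_cst (@oOm l) 1)) h1 h2.
  by apply: (jle_eq (@oOm l) Ol) => z _; ring.
(* For k = 0 the error F - P is only o(1), so eta is a small constant; for k > 0 it can be taken
   proportional to l. *)
have [k0|kp] := posnP k.
  have [eta [t0 t1 t2]] : exists eta : R, [/\ 0 < eta, eta <= 1/2 & 6 * eta <= e].
    exists (Num.min (1/2) (e / 6)); have h : 0 < e / 6 by lra.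
    split; first by rewrite lt_min h andbT; lra.
      by rewrite ge_min lexx.
    have : Num.min (1/2) (e / 6) <= e / 6 by rewrite ge_min lexx orbT.
    lra.
  have eta2 : 0 < eta / 2 by lra.
  have S1 : \forall l \near (0 : R)^'+, 0 < l < eta / 2 / A by apply/near_right0; exists (eta / 2 / A) => //; rewrite divr_gt0.
  have [_ H] := FP; apply: filterS (filterI (filterI S1 (H _ eta2)) (filterI (filterI HC Omq) smF1)) => l [[/andP[l0 l1] h1] [[h2 h3] h4]].
  exists eta; split=> //; last by rewrite k0 mulr0 add0r expr1 expr0 mulr1.
  rewrite k0 expr0 mulr1 in h1; have := E _ _ _ h3 h4 h1 h2; apply: jle_le.
  move: l1; rewrite ltr_pdivlMr // => l1.
  have : C * l <= A * l by rewrite ler_pM2r // /A; have := ler_norm C; lra.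
  lra.
pose B := A + 1; have B0 : 0 < B by rewrite /B; lra.
pose c : R := (2 * k%:R + 6) * B ^+ k.+1.
have c0 : 0 < c by rewrite /c mulr_gt0 ?exprn_gt0 // ltr_wpDl // mulr_ge0.
have S1 : \forall l \near (0 : R)^'+, 0 < l < Num.min (1 / 2 / B) (e / c).
  apply/near_right0; exists (Num.min (1 / 2 / B) (e / c)) => //; rewrite lt_min !divr_gt0 //; lra.
have [_ H] := jo_le kp FP.
apply: filterS (filterI (filterI S1 (H _ ltr01)) (filterI (filterI HC Omq) smF1)) => l [[/andP[l0]]].
rewrite lt_min => /andP[l1 l2] h1 [[h2 h3] h4]; rewrite expr1 mul1r in h1.
exists (B * l); split.
- have := E _ _ _ h3 h4 h1 h2; apply: jle_le; rewrite /B mulrDl mul1r addrC lerD2r.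
  by rewrite ler_pM2r // /A; have := ler_norm C; lra.
- by rewrite mulrC -ler_pdivlMr // ltW.
rewrite exprMn mulrA -/c exprSr mulrCA mulrC ler_wpM2r ?exprn_ge0 ?(ltW l0) // mulrC.
by rewrite -ler_pdivlMr // ltW.
Qed.

Definition logpoly (p : {poly Cx R}) : {poly Cx R} := \sum_(1 <= l < k.+1) ((-1) ^+ l.+1 / l%:R) *: (p - 1) ^+ l.
Lemma horner_logpoly p x : (logpoly p).[x] = logk k p.[x].
Proof.
rewrite /logpoly horner_sum; apply: eq_bigr => l _.
by rewrite hornerZ horner_exp hornerD hornerN hornerC.
Qed.
Lemma smp_logpoly : smp O (fun q => logpoly (P q)).
Proof.
apply: (smp_sum oO) => l; apply: (smp_ext (P := fun q => ((-1) ^+ l.+1 / l%:R)%:P * (P q - 1) ^+ l)) => [z|].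
  by rewrite mul_polyC.
apply: (smpM oO); first exact: (smp_cst oO).
apply: (smpX oO); exact: (smpD oO sP (smp_cst oO (-1))).
Qed.
Lemma jo_logk : jo k (fun l q => logk k (F l q) - logk k ((P q).[rc l])).
Proof.
have b1 : jb (fun l q => F l q - 1) by apply: (jbD oOm Omq bF); exact: jb_cst.
have b2 : jb (fun l q => (P q).[rc l] - 1) by apply: (jbD oOm Omq bP); exact: jb_cst.
have d : jo k (fun l q => (F l q - 1) - ((P q).[rc l] - 1)) by apply: jo_ext FP => l z; ring.
have E i := joM oOm Omq (jo_exp i b1 b2 d) (jb_cst q a b oOm ((-1) ^+ i.+1 / i%:R)).
apply: jo_ext (jo_sum oOm Omq (index_iota 1 k.+1) E) => l z.
by rewrite /logk -sumrB; apply: eq_bigr => i _; rewrite -mulrBr mulrC.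
Qed.

(** The rational expression is the second derivative of log F. To replace log by its truncation
    costs a multiple of eta^(k+1), and to replace F by P at l costs o(l^k). The truncated logarithm
    of a polynomial is a polynomial, and its coefficient of index k is the formal one. *)
Lemma log_comparison : exists2 Z : {poly Cx R},
  Z`_k = dd a (dd b (fun q => formal_log_coef k (P q))) q &
  forall e : R, 0 < e -> \forall l \near (0 : R)^'+, F l q != 0 /\
    nm (dd a (dd b (F l)) q / F l q - dd a (F l) q * dd b (F l) q / (F l q * F l q) - Z.[rc l]) <= e * l ^+ k.
Proof.
have sQ := smp_logpoly; have [[N HN] _] := sQ.
pose Z := \poly_(i < N) dd a (dd b (fun q => (logpoly (P q))`_i)) q; exists Z.
  rewrite coef_poly; case: ltnP => // h.
  have z c : dd b (fun _ : S => (c : Cx R)) = (fun _ : S => (0 : Cx R)) by apply/funext => z; exact: dd_cst.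
  rewrite (_ : (fun q => formal_log_coef k (P q)) = fun=> 0) ?z ?dd_cst //; apply/funext => z0.
  by rewrite /formal_log_coef nth_default // (leq_trans (HN _)).
have ZE l : Z.[rc l] = dd a (dd b (fun q => logk k (P q).[rc l])) q.
  rewrite horner_poly (_ : (fun q => logk k (P q).[rc l]) = fun q => (logpoly (P q)).[rc l]).
    by rewrite (dd2_horner oO _ _ _ sQ HN Oq).
  by apply/funext => z; rewrite horner_logpoly.
move=> e e0; have e2 : 0 < e / 2 by lra.
have [_ H] := jo_logk.
apply: filterS (filterI (filterI (jet_small e2) (H _ e2)) (filterI (filterI Omq smF1) (pos1 R))).
move=> l [[[eta [J h1 h2]] HJ] [[Ol sFl] /andP[l0 l1]]].
have sP' := sm_sub (@OmO l) (sm_horner oO (rc l) sP).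
have [j0 j1 j2 j3] := J; have t0 := jle_ge0 J.
have D1 c z : Om l z -> dd c (fun q => F l q - 1) z = dd c (F l) z.
  by move=> Oz; rewrite (ddB (@oOm l) _ sFl (sm_cst (@oOm l) 1) Oz) dd_cst subr0.
rewrite (D1 _ _ Ol) in j1; rewrite (D1 _ _ Ol) in j2.
rewrite (dd_eq (@oOm l) a (fun z Oz => D1 b z Oz) Ol) in j3.
have nF : 1 / 2 <= nm (F l q).
  have := nmD (F l q) (- (F l q - 1)); rewrite (_ : F l q - (F l q - 1) = 1); last by ring.
  rewrite nm1 nmN; lra.
have F0 : F l q != 0 by rewrite -nm_eq0 gt_eqF //; lra.
split=> //; rewrite ZE.
have L1 := sm_logk (@oOm l) sFl k; have L2 := sm_logk (@oOm l) sP' k.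
have [_ _ _ q3] := HJ.
rewrite (dd_eq (@oOm l) a (fun z Oz => ddB (@oOm l) b L1 L2 Oz) Ol) in q3.
rewrite (ddB (@oOm l) a (sm_dd (@oOm l) b L1) (sm_dd (@oOm l) b L2) Ol) in q3.
set X := dd a (dd b (F l)) q in j3 *; set Y := dd a (F l) q in j1 *; set W := dd b (F l) q in j2 *.
have K := @dd2_logk R n _ (@oOm l) (F l) sFl k a b q Ol F0; cbv zeta in K; rewrite -/X -/Y -/W in K.
set U := dd a (dd b (fun q => logk k (F l q))) q in q3 K *; set V := dd a (dd b (fun q => logk k (P q).[rc l])) q in q3 *.
rewrite (_ : _ - V = (X / F l q - Y * W / (F l q * F l q) - U) + (U - V)); last first.
  by have gen (x y z w : Cx R) : x - y - w = x - y - z + (z - w) by ring; exact: gen.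
rewrite K; set y := F l q - 1 in j0 *.
have iF : nm (F l q)^-1 <= 2.
  by rewrite nmV -[2]invrK lef_pV2 ?posrE; [lra|lra|].
have iF2 : nm (F l q * F l q)^-1 <= 4.
  rewrite invfM nmM (_ : 4 = 2 * 2); last by ring.
  by apply: ler_pM; rewrite ?nm_ge0.
have yk : nm ((- y) ^+ k) <= eta ^+ k by rewrite nmX nmN lerXn2r ?nnegrE ?nm_ge0.
have P2 x1 x2 (b1 b2 : R) : nm x1 <= b1 -> nm x2 <= b2 -> nm (x1 * x2) <= b1 * b2.
  by move=> *; rewrite nmM; apply: ler_pM; rewrite ?nm_ge0.
have B1 : nm (X * (- y) ^+ k) <= eta ^+ k.+1 by rewrite exprS; exact: P2.
have B2 : nm ((-1) ^+ k * k%:R * y ^+ k.-1 * (Y * W)) <= k%:R * eta ^+ k.+1.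
  have [k0|kp] := posnP k; first by rewrite k0 mulr0 !mul0r nm0.
  have -> : k%:R * eta ^+ k.+1 = 1 * k%:R * eta ^+ k.-1 * (eta * eta) :> R.
    by rewrite -{2}(prednK kp) !exprS; ring.
  apply: (P2); last exact: P2.
  apply: (P2); last by rewrite nmX lerXn2r ?nnegrE ?nm_ge0.
  apply: (P2); first by rewrite nmX nmN nm1 expr1n.
  by rewrite -rc_nat nm_rc normr_nat.
have B3 : nm (Y * W * (- y) ^+ k) <= eta ^+ k.+1.
  apply: (@le_trans _ _ (eta * eta * eta ^+ k)); first by apply: (P2) yk; exact: P2.
  rewrite exprS -mulrA ler_piMl ?mulr_ge0 ?exprn_ge0 //; lra.
apply: le_trans (nmD _ _) _.
have B4 : nm ((X * (- y) ^+ k + (-1) ^+ k * k%:R * y ^+ k.-1 * (Y * W)) / F l q) <= (eta ^+ k.+1 + k%:R * eta ^+ k.+1) * 2.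
  by apply: (P2) => //; apply: le_trans (nmD _ _) _; exact: lerD.
have B5 : nm (Y * W * (- y) ^+ k / (F l q * F l q)) <= eta ^+ k.+1 * 4 by exact: P2.
have B6 := nmB ((X * (- y) ^+ k + (-1) ^+ k * k%:R * y ^+ k.-1 * (Y * W)) / F l q) (Y * W * (- y) ^+ k / (F l q * F l q)).
exact: (remainder_sum B6 B4 B5 q3 h2).
Qed.
End LogComparison.

(** * Logarithmic derivatives *)

Section LogOperators.
Variables (R : realType) (m : nat).
Notation n := m.+1.
Notation S := (R * Cn R n)%type.
Implicit Types (a b : option ('I_n * bool)) (f g : S -> Cx R).

(** The factor by which [lop] differs from [dd]. *)
Definition chi a (q : S) : Cx R :=
  if a is Some (j, b) then (if j == ord0 then (if b then (zc q.2)^* else zc q.2) else 1) else 1.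
Lemma lopE a f q : lop a f q = chi a q * dd a f q.
Proof. by case: a => [[j b]|] /=; rewrite ?wirtE ?pderNE ?mul1r. Qed.
Lemma chi_sc a (l : R) q : chi a (sc (ray l) q) = rc (sca (ray l) a) * chi a q.
Proof.
case: a => [[j b]|] /=; last by rewrite mul1r.
rewrite /ray; case: eqP => _; last by rewrite mul1r.
by rewrite /zc mxE /ray eqxx; case: b => //; rewrite rmorphM /= rc_conj.
Qed.
(** The operators z d_z and its conjugate are invariant under dilations of z, and the remaining ones
    do not involve z. An estimate at the point (l z, w) thus becomes one for the pulled-back
    function at the fixed point (z, w). *)
Lemma lops_sc s f (l : R) q : l != 0 -> lops s f (sc (ray l) q) = lops s (fun q => f (sc (ray l) q)) q.
Proof.
move=> l0; have r0 (j : 'I_n) : ray l j != 0 by rewrite /ray; case: (j == ord0); [exact: l0|exact: oner_neq0].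
elim: s q => [//|a s IH] q /=.
rewrite !lopE -(_ : (fun q => lops s f (sc (ray l) q)) = lops s (fun q => f (sc (ray l) q))); last by apply/funext.
by rewrite (dd_sc_any _ _ _ r0) chi_sc; ring.
Qed.

Section On.
Variables (O : set S) (oO : open O).
Notation sm := (smooth_st O).
Lemma lops_eq s f g q : (forall q', O q' -> f q' = g q') -> O q -> lops s f q = lops s g q.
Proof.
move=> fg; elim: s q => [|a s IH] q Oq /=; first exact: fg.
by rewrite !lopE (dd_eq oO a IH Oq).
Qed.
Lemma sm_chi a : sm (chi a).
Proof.
case: a => [[j b]|] /=; last exact: (sm_cst oO).
rewrite /chi; case: (j == ord0); last exact: (sm_cst oO).
by case: b; [apply: (sm_conj oO)|]; exact: (sm_coord oO).
Qed.
Lemma sm_lop a f : sm f -> sm (lop a f).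
Proof. by move=> F; apply: (sm_eq oO _ (smM oO (sm_chi a) (sm_dd oO a F))) => q _; rewrite lopE. Qed.
Lemma sm_lops s f : sm f -> sm (lops s f).
Proof. by move=> F; elim: s => [|a s IH]; [exact: F|exact: (sm_lop a IH)]. Qed.
Lemma lops_lin s (c : Cx R) f g q : sm f -> sm g -> O q -> lops s (fun q => f q + c * g q) q = lops s f q + c * lops s g q.
Proof.
move=> F G; elim: s q => [//|a s IH] q Oq /=.
rewrite !lopE (dd_eq oO a IH Oq) (ddD _ (sm_lops s F) (smZ oO _ (sm_lops s G)) Oq) (ddZ oO _ _ (sm_lops s G) Oq).
by ring.
Qed.
Definition chid a b : Cx R := if a is Some (j, _) then ((j == ord0) && (b == a))%:R else 0.
Lemma dd_chi a b q : chi b q * dd b (chi a) q = chid a b * chi a q.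
Proof.
case: a => [[j c]|] /=; last by rewrite dd_cst mulr0 mul0r.
rewrite /chi; case: (eqVneq j ord0) => [->|j0] /=; last by rewrite dd_cst mulr0 mul0r.
have oT : open (setT : set S) by exact: openT.
case: c => /=.
  rewrite (@dd_conj R n setT (fun q : S => zc q.2) b q (sm_coord oT ord0)) // dd_coord.
  have -> : (flip b == Some (ord0, false)) = (b == Some (ord0, true)).
    by apply/eqP/eqP => [|->] //; case: b => [[j1 []]|] //= [->].
  have [->|_] := eqVneq b _; first by rewrite eqxx /= rmorph1 mulr1 mul1r.
  by rewrite rmorph0 mulr0 mul0r.
rewrite dd_coord; have [->|_] := eqVneq b _; first by rewrite eqxx /= mulr1 mul1r.
by rewrite mulr0 mul0r.
Qed.
Hypothesis Oz : forall q, O q -> zc q.2 != 0.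
Lemma chi_neq0 a q : O q -> chi a q != 0.
Proof.
move=> /Oz z0; case: a => [[j b]|] /=; last exact: oner_neq0.
by rewrite /chi; case: (j == ord0); [case: b; rewrite ?conjC_eq0|exact: oner_neq0].
Qed.
(** [chi a] is an eigenfunction of every operator [lop b], so division by it changes a logarithmic
    derivative only by a constant multiple of the function. *)
Lemma lop_chiV a b f q : sm f -> O q ->
  lop b (fun q => (chi a q)^-1 * f q) q = (chi a q)^-1 * (lop b f q + (- chid a b) * f q).
Proof.
move=> F Oq; have c0 := chi_neq0 a Oq; have sc1 := sm_chi a.
have sV := smV oO (fun q' O' => chi_neq0 a O') sc1.
rewrite !lopE (ddM _ sV F Oq) (ddV oO _ (fun q' O' => chi_neq0 a O') sc1 Oq).
have D := dd_chi a b q.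
have -> : chi b q * (- dd b (chi a) q / (chi a q * chi a q) * f q + (chi a q)^-1 * dd b f q) =
  - (chi b q * dd b (chi a) q) / (chi a q * chi a q) * f q + (chi a q)^-1 * (chi b q * dd b f q).
  have gen (x y z u v w : Cx R) : x * (- y * z * u + v * w) = - (x * y) * z * u + v * (x * w) by ring.
  exact: gen.
rewrite D; have gen (x y u v : Cx R) : x != 0 -> - (y * x) / (x * x) * u + x^-1 * v = x^-1 * (v + - y * u).
  by move=> x0; field; exact: x0.
exact: gen.
Qed.
End On.
End LogOperators.

(** * Families that are small with all their logarithmic derivatives *)

Section SmallFamilies.
Variables (R : realType) (m : nat).
Notation n := m.+1.
Notation S := (R * Cn R n)%type.
Variables (q : S) (Om : R -> set S).
Hypothesis oOm : forall l, open (Om l).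
Hypothesis Omq : \forall l \near (0 : R)^'+, Om l q.
Hypothesis Omz : forall l q', Om l q' -> zc q'.2 != 0.
Variable K : nat.
Implicit Type F G : R -> S -> Cx R.

Definition lo F := (forall l, smooth_st (Om l) (F l)) /\
  forall s (e : R), 0 < e -> \forall l \near (0 : R)^'+, nm (lops s (F l) q) <= e * l ^+ K.

Lemma lo_lop a F : lo F -> lo (fun l => lop a (F l)).
Proof.
move=> [sF H]; split=> [l|s e e0]; first exact: (sm_lop (@oOm l)).
by have := H (rcons s a) e e0; apply: filterS => l; rewrite /lops foldr_rcons.
Qed.
Lemma lo_lin (c : Cx R) F G : lo F -> lo G -> lo (fun l q => F l q + c * G l q).
Proof.
move=> [sF H1] [sG H2]; split=> [l|s e e0]; first exact: (smD (@oOm l) (sF l) (smZ (@oOm l) c (sG l))).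
have c0 : 0 < nm c + 1 by have := nm_ge0 c; lra.
have e2 : 0 < e / 2 by lra.
have e3 : 0 < e / 2 / (nm c + 1) by rewrite divr_gt0.
apply: filterS (filterI (filterI (H1 s _ e2) (H2 s _ e3)) (filterI Omq (pos1 R))) => l [[h1 h2] [Ol /andP[l0 l1]]].
rewrite (lops_lin (@oOm l) _ _ (sF l) (sG l) Ol); apply: le_trans (nmD _ _) _; rewrite nmM.
have h3 : nm c * nm (lops s (G l) q) <= (nm c + 1) * (e / 2 / (nm c + 1) * l ^+ K).
  by apply: ler_pM; rewrite ?nm_ge0 //; lra.
rewrite mulrA [(nm c + 1) * _]mulrC divfK ?gt_eqF // in h3.
move: h1 h3; move: (l ^+ K) (nm _) (_ * nm _) => *; lra.
Qed.
(** An ordinary derivative is a logarithmic one divided by [chi a]. By [lop_chiV] this factor moves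
    out through any word at the cost of scalar multiples of shorter words, and at the fixed point q,
    where z is not zero, it is a constant. *)
Lemma lo_dd a F : lo F -> lo (fun l => dd a (F l)).
Proof.
move=> H.
have E : forall s F, lo F -> forall e : R, 0 < e -> \forall l \near (0 : R)^'+, nm (lops s (fun q => (chi a q)^-1 * F l q) q) <= e * l ^+ K.
  elim/last_ind => [|s b IH] {H}F H e e0.
    have c0 : 0 < nm (chi a q)^-1 + 1 by have := nm_ge0 (chi a q)^-1; lra.
    have e3 : 0 < e / (nm (chi a q)^-1 + 1) by rewrite divr_gt0.
    have [_ h] := H; have := h [::] _ e3; apply: filterS => l /= h1; rewrite nmM.
    apply: (@le_trans _ _ ((nm (chi a q)^-1 + 1) * (e / (nm (chi a q)^-1 + 1) * l ^+ K))).
      by apply: ler_pM; rewrite ?nm_ge0 //; lra.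
    by rewrite mulrA [_ * (e / _)]mulrC divfK // gt_eqF.
  have L := IH _ (lo_lin (- chid R a b) (lo_lop b H) H) e e0.
  apply: filterS (filterI Omq L) => l [Ol]; rewrite {2}/lops foldr_rcons.
  congr (nm _ <= _); symmetry; have [sF _] := H.
  by apply: (lops_eq (@oOm l) s _ Ol) => z Oz'; rewrite (lop_chiV (@oOm l) (@Omz l) a b (sF l) Oz').
have [sF _] := H; split=> [l|s e e0]; first exact: (sm_dd (@oOm l) a (sF l)).
apply: filterS (filterI Omq (E s _ (lo_lop a H) e e0)) => l [Ol].
congr (nm _ <= _); apply: (lops_eq (@oOm l) s _ Ol) => z Oz'.
by rewrite lopE (mulKf (chi_neq0 (@Omz l) a Oz')).
Qed.
Lemma lo_small F (e : R) : lo F -> 0 < e -> \forall l \near (0 : R)^'+, nm (F l q) <= e * l ^+ K.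
Proof. by move=> [_ H] e0; exact: (H [::] e e0). Qed.
Lemma lo_jo a b F : lo F -> jo q a b Om K F.
Proof.
move=> H; have [sF _] := H; split; first by apply: nearW.
move=> e e0; have h1 := lo_small H e0; have h2 := lo_small (lo_dd a H) e0.
have h3 := lo_small (lo_dd b H) e0; have h4 := lo_small (lo_dd a (lo_dd b H)) e0.
by apply: filterS (filterI (filterI h1 h2) (filterI h3 h4)) => l [[? ?] [? ?]]; split.
Qed.
End SmallFamilies.

(** * Flows on the cone *)

Section Homogeneity.
Variables (R : realType) (n : nat).
Notation S := (R * Cn R n)%type.
Variables (O : set S) (oO : open O).
Lemma dd_homog rho (f : S -> Cx R) (c : R) a q : (forall j, rho j != 0) -> c != 0 ->
  (forall q, O q -> f (sc rho q) = rc c * f q) -> O q -> dd a f (sc rho q) = rc (c / sca rho a) * dd a f q.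
Proof.
move=> r0 c0 H Oq; have s0 : sca rho a != 0 by case: a => [[j b]|] /=; [exact: r0|exact: oner_neq0].
have := dd_sc_any a f q r0; rewrite (dd_eq oO a H Oq) (dd_scale_any _ _ _ c0) => E.
have -> : rc (c / sca rho a) * dd a f q = rc (sca rho a)^-1 * (rc c * dd a f q) by rewrite rcM; ring.
by rewrite E mulrA -rcM mulVf // rc1 mul1r.
Qed.
Lemma sm_time : smooth_st O (fun q => rc q.1).
Proof.
apply/smooth_stP => k.
have C q : {for q, continuous (fun q : S => rc q.1)} by apply: cvg_rc; exact: cvg_fst.
case: k => [|k]; first by split=> // q _; exact: C.
apply: (@Ck_intro R n O oO k _ (fun a q => if a is None then 1 else 0)) => [q _|a q _|a]; first exact: C.
- case: a => [[j b]|]; first by rewrite /Defs.shift /=; exact: is_cderC.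
  rewrite -(rc1 R); apply: is_cder_rc => /=.
  have := is_deriveD (is_derive_cst q.1 (0 : R) (1 : R)) (is_derive_id (0 : R) (1 : R)).
  by rewrite add0r.
- by case: a => [jb|]; exact: (Ck_cst oO).
Qed.
Lemma dd_time q : dd None (fun q : S => rc q.1) q = 1.
Proof.
rewrite ddE; apply: pd_cder; rewrite -(rc1 R); apply: is_cder_rc => /=.
by have := is_deriveD (is_derive_cst q.1 (0 : R) (1 : R)) (is_derive_id (0 : R) (1 : R)); rewrite add0r.
Qed.
Lemma upto_slice A (t : R) (V : set (Cn R n)) (f : S -> Cx R) : open V -> (forall p, V p -> A (t, p)) -> smooth_upto A f ->
  smooth_st [set q | V q.2] (fun q => f (t, q.2)).
Proof.
move=> oV VA H s q Vq; have [ O1 [f1 [oO1 Oq F E]]] := H (t, q.2) (VA _ Vq).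
have oVq : open [set q : S | V q.2].
  by rewrite (_ : [set q : S | V q.2] = snd @^-1` V) //; apply: open_comp => // x _; exact: cvg_snd.
have oI := openI (open_slice oO1 (t := t)) oVq.
have F2 : smooth_st ([set q | O1 (t, q.2)] `&` [set q | V q.2]) (fun q => f (t, q.2)).
  have F1 := sm_sub (@subIsetl _ [set q | O1 (t, q.2)] [set q : S | V q.2]) (sm_slice oO1 (t := t) F).
  by apply: (sm_eq oI _ F1) => x [x1 x2]; rewrite E //; exact: VA.
by apply: F2.
Qed.
Lemma dd2_ln (f : S -> R) a b q : (forall q, O q -> 0 < f q) -> smooth_st O (fun q => rc (f q)) -> O q ->
  dd a (dd b (fun q => rc (ln (f q)))) q =
  dd a (dd b (fun q => rc (f q))) q / rc (f q) -
  dd a (fun q => rc (f q)) q * dd b (fun q => rc (f q)) q / (rc (f q) * rc (f q)).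
Proof.
move=> f0 F Oq; have n0 q' : O q' -> rc (f q') != 0 by move=> /f0 h; rewrite rc_eq0 gt_eqF.
rewrite (dd_eq oO a (fun q' O' => dd_ln b f0 F O') Oq) (ddM _ (sm_dd oO b F) (smV oO n0 F) Oq) (ddV oO _ n0 F Oq).
have gen (x y z u v : Cx R) : x * u + y * (- z * v) = x * u - z * y * v by ring.
exact: gen.
Qed.
End Homogeneity.

Lemma det_congr (R : realType) (n : nat) (A B : 'M[Cx R]_n) (k : R) (x : 'I_n -> R) :
  (forall i j, B i j = rc (k * x i * x j) * A i j) -> \det B = rc (k ^+ n * (\prod_i x i) ^+ 2) * \det A.
Proof.
move=> H; pose L := diag_mx (\row_i rc (x i)).
have -> : B = rc k *: (L *m A *m L).
  apply/matrixP => i j; rewrite mxE H mul_mx_diag mul_diag_mx !mxE !rcM.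
  have gen (a b c d : Cx R) : a * b * c * d = a * (b * d * c) by ring.
  exact: gen.
rewrite detZ !det_mulmx det_diag.
have -> : \prod_i (\row_i rc (x i)) 0 i = rc (\prod_i x i) by rewrite rc_prod; apply: eq_bigr => i _; rewrite mxE.
have gen (a b c : Cx R) : a * (b * c * b) = a * (b * b) * c by ring.
by rewrite gen rcM !rcX expr2.
Qed.
Lemma det_map_horner (R : realType) (n : nat) (A : 'M[{poly Cx R}]_n) x : (\det A).[x] = \det (\matrix_(i, j) (A i j).[x]).
Proof.
rewrite -horner_evalE -det_map_mx; congr (\det _); apply/matrixP => i j; by rewrite !mxE.
Qed.

(** * Homogeneity of the cone metric *)

Section ConeScaling.
Variables (R : realType) (m : nat).
Notation n := m.+1.
Notation S := (R * Cn R n)%type.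
Variables (O : set S) (s2 : Cn R n -> R) (om Rc : Cn R n -> 'M[Cx R]_n).
Hypothesis oO : open O.
Hypothesis s2_sc : forall (l : R) p, s2 (scp (ray l) p) = l ^+ 2 * s2 p.
Hypothesis omE : forall (q : S) i j, om q.2 i j = dd (Some (i, false)) (dd (Some (j, true)) (fun q : S => rc (s2 q.2)^-1)) q.
Hypothesis om_smooth : forall i j, smooth_st O (fun q => om q.2 i j).
Hypothesis om_pos : forall q, O q -> hermpos (om q.2).
Let lnom (q : S) : Cx R := rc (ln (cre (\det (om q.2)))).
Hypothesis RcE : forall (q : S) i j, Rc q.2 i j = - dd (Some (i, false)) (dd (Some (j, true)) lnom) q.

Lemma ray_neq0 (l : R) (j : 'I_n) : l != 0 -> ray l j != 0.
Proof. by move=> l0; rewrite /ray; case: (j == ord0); [exact: l0|exact: oner_neq0]. Qed.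
Lemma om_sc (l : R) (q : S) i j : l != 0 -> om (sc (ray l) q).2 i j = rc (l ^- 2 / ray l j / ray l i) * om q.2 i j.
Proof.
move=> l0; have l2 : l ^- 2 != 0 by rewrite invr_neq0 // expf_neq0.
have oT : open (setT : set S) by exact: openT.
have r0 j' := ray_neq0 j' l0.
rewrite (omE (sc (ray l) q)) (omE q).
have E1 q' : setT q' -> dd (Some (j, true)) (fun q : S => rc (s2 q.2)^-1) (sc (ray l) q') =
    rc (l ^- 2 / ray l j) * dd (Some (j, true)) (fun q : S => rc (s2 q.2)^-1) q'.
  by apply: (dd_homog oT (rho := ray l) _ r0 l2) => z _; rewrite s2_sc invfM rcM.
apply: (dd_homog oT (rho := ray l) _ r0 _ E1) => //.
by rewrite mulf_neq0 // invr_neq0.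
Qed.
Definition detk (l : R) : R := l ^- 2 ^+ n * (\prod_(i < n) (ray l i)^-1) ^+ 2.
Lemma detk_gt0 (l : R) : l != 0 -> 0 < detk l.
Proof.
move=> l0; apply: mulr_gt0; first by rewrite exprn_gt0 // invr_gt0 exprn_even_gt0.
rewrite exprn_even_gt0 //=; apply/prodf_neq0 => i _; exact: (invr_neq0 (ray_neq0 i l0)).
Qed.
Lemma det_om_sc (l : R) (q : S) : l != 0 -> \det (om (sc (ray l) q).2) = rc (detk l) * \det (om q.2).
Proof.
move=> l0; apply: (@det_congr R n (om q.2) _ (l ^- 2) (fun i => (ray l i)^-1)) => i j.
by rewrite (om_sc _ _ _ l0) mulrAC.
Qed.
Lemma lnom_sc (l : R) q : l != 0 -> O q -> lnom (sc (ray l) q) = lnom q + rc (ln (detk l)).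
Proof.
move=> l0 Oq; rewrite /lnom (det_om_sc _ l0) -rcD; congr (rc _).
have [_ d0] := hermpos_det (om_pos Oq); have k0 := detk_gt0 l0.
by rewrite creM creK cim_rc mul0r subr0 lnM ?posrE // addrC.
Qed.
Lemma sm_lnom : smooth_st O lnom. Proof. exact: (sm_lndet oO om_smooth om_pos). Qed.
(** The dilation multiplies det(omega_0) by a positive constant, so its logarithm changes by an
    additive constant that d dbar kills. Hence Ric(omega_0) is invariant, whereas omega_0 has degree
    -2. *)
Lemma Rc_sc (l : R) q i j : l != 0 -> O q -> Rc (sc (ray l) q).2 i j = rc ((ray l j)^-1 / ray l i) * Rc q.2 i j.
Proof.
move=> l0 Oq; have r0 j' := ray_neq0 j' l0.
rewrite (RcE (sc (ray l) q)) (RcE q) mulrN; congr (- _).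
have E1 q' : O q' -> dd (Some (j, true)) lnom (sc (ray l) q') = rc (ray l j)^-1 * dd (Some (j, true)) lnom q'.
  move=> O'; have h1 := dd_sc_any (Some (j, true)) lnom q' r0.
  have h2 := dd_eq oO (Some (j, true)) (fun z Oz => lnom_sc l0 Oz) O'.
  have h3 := ddD (Some (j, true)) sm_lnom (sm_cst oO (rc (ln (detk l)))) O'; rewrite dd_cst addr0 in h3.
  have gen (x : R) (A B C : Cx R) : x != 0 -> A = rc x * B -> A = C -> B = rc x^-1 * C.
    by move=> x0 -> <-; rewrite mulrA -rcM mulVf // rc1 mul1r.
  exact: (gen _ _ _ _ (r0 j) h1 (etrans h2 h3)).
have h : (ray l j)^-1 != 0 by rewrite invr_neq0.
exact: (dd_homog oO (rho := ray l) (Some (i, false)) r0 h E1 Oq).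
Qed.
End ConeScaling.

(** * The flow pulled back by dilations *)

Section PulledFlow.
Variables (R : realType) (m : nat).
Notation n := m.+1.
Notation S := (R * Cn R n)%type.
Variables (O O1 : set S) (s2 : Cn R n -> R) (om Rc : Cn R n -> 'M[Cx R]_n) (G : S -> 'M[Cx R]_n) (W : S -> Cx R).
Hypothesis oO : open O.
Hypothesis s2_sc : forall (l : R) p, s2 (scp (ray l) p) = l ^+ 2 * s2 p.
Hypothesis omE : forall (q : S) i j, om q.2 i j = dd (Some (i, false)) (dd (Some (j, true)) (fun q : S => rc (s2 q.2)^-1)) q.
Hypothesis om_smooth : forall i j, smooth_st O (fun q => om q.2 i j).
Hypothesis om_pos : forall q, O q -> hermpos (om q.2).
Let lnom (q : S) : Cx R := rc (ln (cre (\det (om q.2)))).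
Hypothesis RcE : forall (q : S) i j, Rc q.2 i j = - dd (Some (i, false)) (dd (Some (j, true)) lnom) q.
Hypothesis oO1 : open O1.
Hypothesis O1O : O1 `<=` O.
Hypothesis sW : smooth_st O1 W.
Hypothesis sG : forall i j, smooth_st O1 (fun q => G q i j).
Hypothesis pG : forall q, O1 q -> hermpos (G q).
Let lnG (q : S) : Cx R := rc (ln (cre (\det (G q)))).
Hypothesis GE : forall q i j, O1 q -> G q i j = om q.2 i j - rc q.1 * Rc q.2 i j + dd (Some (i, false)) (dd (Some (j, true)) W) q.
Hypothesis GF : forall q i j, O1 q -> dd None (fun q => G q i j) q = dd (Some (i, false)) (dd (Some (j, true)) lnG) q.

Lemma sm_Rc i j : smooth_st O (fun q => Rc q.2 i j).
Proof.
have h := sm_dd oO (Some (i, false)) (sm_dd oO (Some (j, true)) (sm_lnom oO om_smooth om_pos)).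
by apply: (sm_eq oO _ (smN oO h)) => q _; rewrite RcE.
Qed.
(** The term - t Ric(omega_0) of G contributes - Ric(omega_0) = d dbar log det(omega_0) to the time
    derivative; moved to the other side, it leaves the logarithm of a ratio of determinants. *)
Lemma potential_flow q i j : O1 q -> dd None (dd (Some (i, false)) (dd (Some (j, true)) W)) q =
  dd (Some (i, false)) (dd (Some (j, true)) (fun q => lnG q - lnom q)) q.
Proof.
move=> Oq; have sm1 := sm_sub O1O (om_smooth i j); have sR := sm_sub O1O (sm_Rc i j).
have st := sm_time oO1; have sn := sm_sub O1O (sm_lnom oO om_smooth om_pos).
have sg := sm_lndet oO1 sG pG; have sWij := sm_dd oO1 (Some (i, false)) (sm_dd oO1 (Some (j, true)) sW).
have E1 q' : O1 q' -> dd (Some (j, true)) (fun q => lnG q - lnom q) q' = dd (Some (j, true)) lnG q' - dd (Some (j, true)) lnom q'.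
  by move=> O'; exact: (ddB oO1 _ sg sn O').
rewrite (dd_eq oO1 _ E1 Oq) (ddB oO1 _ (sm_dd oO1 _ sg) (sm_dd oO1 _ sn) Oq) -(GF _ _ Oq).
rewrite (dd_eq oO1 None (fun z Oz => GE i j Oz) Oq) (ddD _ (smB oO1 sm1 (smM oO1 st sR)) sWij Oq).
rewrite (ddB oO1 _ sm1 (smM oO1 st sR) Oq) (ddM _ st sR Oq) dd_time.
rewrite (@dd_static _ _ (fun q : S => om q.2 i j)) // (@dd_static _ _ (fun q : S => Rc q.2 i j)) // RcE.
have gen (x y t : Cx R) : x = 0 - (1 * - y + t * 0) + x - y by ring.
exact: gen.
Qed.

Variable l : R.
Hypothesis l0 : l != 0.
Hypothesis Oinv : forall q, O1 (sc (ray l) q) -> O q.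
Let Ol : set S := [set q | O1 (sc (ray l) q)].
Let Wl (q : S) : Cx R := W (sc (ray l) q).
(** For V the pulled-back potential this is l^2 times the pull-back of G by (z, w) |-> (l z, w); the
    factor l^2 offsets the degree -2 of omega_0. *)
Definition pulled (V : S -> Cx R) (q : S) : 'M[Cx R]_n := \matrix_(i, j)
  (om q.2 i j + rc (l ^+ 2) * (- (rc q.1 * Rc q.2 i j) + dd (Some (i, false)) (dd (Some (j, true)) V) q)).
Definition pulled_ratio V q : Cx R := \det (invmx (om q.2) *m pulled V q).
Let r0 j := @ray_neq0 R m l j l0.
Let oOl : open Ol. Proof. exact: open_sc. Qed.

Lemma dd2_sc_any (f : S -> Cx R) a b q : dd a (dd b (fun q => f (sc (ray l) q))) q =
  rc (sca (ray l) a * sca (ray l) b) * dd a (dd b f) (sc (ray l) q).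
Proof.
have b0 : sca (ray l) b != 0 by case: b => [[j c]|] /=; [exact: r0|exact: oner_neq0].
have -> : dd b (fun q => f (sc (ray l) q)) = fun q => rc (sca (ray l) b) * dd b f (sc (ray l) q).
  by apply/funext => z; exact: (dd_sc_any _ _ _ r0).
by rewrite (dd_scale_any _ _ _ b0) (dd_sc_any _ _ _ r0) mulrA -rcM mulrC [X in rc X]mulrC mulrC.
Qed.
Lemma G_sc q i j : Ol q -> G (sc (ray l) q) i j = rc (l ^- 2 * (ray l i)^-1 * (ray l j)^-1) * pulled Wl q i j.
Proof.
move=> Oq; have Oq' := Oinv Oq.
rewrite (GE _ _ Oq) (om_sc s2_sc omE _ _ _ l0) (Rc_sc oO s2_sc omE om_smooth om_pos RcE _ _ l0 Oq') mxE.
rewrite dd2_sc_any /=; move: (om _ _ _) (Rc _ _ _) (dd _ _ _) => x y z.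
have := r0 i; have := r0 j; move: (ray l i) (ray l j) => a b b0 a0.
have zE : z = rc (a^-1 / b) * (rc (a * b) * z).
  by rewrite mulrA -rcM mulrACA !mulVf // mulr1 rc1 mul1r.
have e : rc (l ^- 2 * a^-1 * b^-1) * rc (l ^+ 2) = rc (a^-1 / b).
  by rewrite -rcM; congr rc; field; rewrite ?l0 ?a0 ?b0.
rewrite {1}zE [RHS]mulrDr [rc (l ^- 2 * a^-1 * b^-1) * (rc (l ^+ 2) * _)]mulrA e; move: (rc (a * b) * z) => w.
have -> : rc (l ^- 2 / b / a) = rc (l ^- 2 * a^-1 * b^-1) by rewrite mulrAC.
have -> : rc (b^-1 / a) = rc (a^-1 / b) by rewrite mulrC.
by move: (rc _) (rc _) (rc _) => k k' k''; ring.
Qed.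
Lemma pulled_ratioE q : Ol q -> pulled_ratio Wl q = \det (G (sc (ray l) q)) / \det (om (sc (ray l) q).2).
Proof.
move=> Oq; have k0 : rc (detk m l) != 0 by rewrite rc_eq0 gt_eqF // detk_gt0.
rewrite /pulled_ratio det_mulmx det_inv (det_om_sc s2_sc omE _ l0).
rewrite (@det_congr R n (pulled Wl q) _ (l ^- 2) (fun i => (ray l i)^-1)); last by move=> i j; exact: G_sc.
have d0 : \det (om q.2) != 0 by have := hermpos_unit (om_pos (Oinv Oq)); rewrite unitmxE unitfE.
rewrite -/(detk m l); have gen (x y z : Cx R) : x != 0 -> y != 0 -> y^-1 * z = x * z / (x * y).
  by move=> x0 y0; field; rewrite x0 y0.
exact: gen.
Qed.
Lemma pulled_ratio_pos q : Ol q -> rc (cre (pulled_ratio Wl q)) = pulled_ratio Wl q /\ 0 < cre (pulled_ratio Wl q) /\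
  rc (ln (cre (pulled_ratio Wl q))) = lnG (sc (ray l) q) - lnom (sc (ray l) q).
Proof.
move=> Oq; have [e1 h1] := hermpos_det (pG Oq); have [e2 h2] := hermpos_det (om_pos (O1O Oq)).
have E : pulled_ratio Wl q = rc (cre (\det (G (sc (ray l) q))) / cre (\det (om (sc (ray l) q).2))).
  by rewrite pulled_ratioE // e1 e2 !creK -rcV -rcM.
rewrite E creK; split=> //; split; first exact: divr_gt0.
by rewrite ln_div ?posrE // rcB.
Qed.
Lemma sm_pulled i j : smooth_st Ol (fun q => pulled Wl q i j).
Proof.
have sWl : smooth_st Ol Wl := sm_sc oO1 (rho := ray l) sW.
have sub : Ol `<=` O by move=> q; exact: Oinv.
have s1 := sm_sub sub (om_smooth i j); have sR := sm_sub sub (sm_Rc i j).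
have sWij := sm_dd oOl (Some (i, false)) (sm_dd oOl (Some (j, true)) sWl).
have h := smD oOl s1 (smZ oOl (rc (l ^+ 2)) (smD oOl (smN oOl (smM oOl (sm_time oOl) sR)) sWij)).
by apply: (sm_eq oOl _ h) => q _; rewrite mxE.
Qed.
Lemma sm_pulled_ratio : smooth_st Ol (pulled_ratio Wl).
Proof.
have sub : Ol `<=` O by move=> q; exact: Oinv.
apply: (sm_det oOl) => i j.
have h k : smooth_st Ol (fun q => invmx (om q.2) i k * pulled Wl q k j).
  apply: (smM oOl _ (sm_pulled k j)).
  apply: (sm_invmx oOl) => [i' j'|q Oq]; first exact: (sm_sub sub (om_smooth i' j')).
  exact: (hermpos_unit (om_pos (sub _ Oq))).
by apply: (sm_eq oOl _ (sm_sum oOl _ _ h)) => q _; rewrite mxE.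
Qed.
(** A ratio of determinants is invariant under pull-back, and its logarithm is the one in
    [potential_flow]. The second derivative of that logarithm is written out in F, a form that also
    makes sense for the complex polynomials with which F will be compared. *)
Lemma pulled_flow q i j : Ol q -> let F := pulled_ratio Wl in
  dd None (dd (Some (i, false)) (dd (Some (j, true)) Wl)) q =
  dd (Some (i, false)) (dd (Some (j, true)) F) q / F q
  - dd (Some (i, false)) F q * dd (Some (j, true)) F q / (F q * F q).
Proof.
move=> Oq F.
have e q' : Ol q' -> F q' = rc (cre (F q')) by move=> O'; have [h _] := pulled_ratio_pos O'; exact: esym.
have pos q' : Ol q' -> 0 < cre (F q') by move=> O'; have [_ [h _]] := pulled_ratio_pos O'.
have eln q' : Ol q' -> rc (ln (cre (F q'))) = lnG (sc (ray l) q') - lnom (sc (ray l) q').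
  by move=> O'; have [_ [_ h]] := pulled_ratio_pos O'.
have sF : smooth_st Ol (fun q => rc (cre (F q))) by apply: (sm_eq oOl _ sm_pulled_ratio); exact: e.
have D b q' : Ol q' -> dd b F q' = dd b (fun q => rc (cre (F q))) q' by move=> O'; exact: (dd_eq oOl b e O').
have K := dd2_ln oOl (Some (i, false)) (Some (j, true)) pos sF Oq.
rewrite (dd_eq oOl (Some (i, false)) (fun z Oz => D (Some (j, true)) z Oz) Oq) !D // {1 2 3}(e _ Oq).
rewrite {}[RHS](esym K).
have K2 q' : Ol q' -> dd (Some (j, true)) (fun q => rc (ln (cre (F q)))) q' = dd (Some (j, true)) (fun q => lnG (sc (ray l) q) - lnom (sc (ray l) q)) q'.
  by move=> O'; exact: (dd_eq oOl _ eln O').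
rewrite (dd_eq oOl (Some (i, false)) K2 Oq) (dd2_sc_any (fun q => lnG q - lnom q)) /= -(potential_flow _ _ Oq).
have c0 : ray l i * ray l j != 0 by rewrite mulf_neq0.
have -> : dd (Some (i, false)) (dd (Some (j, true)) Wl) = fun q => rc (ray l i * ray l j) * dd (Some (i, false)) (dd (Some (j, true)) W) (sc (ray l) q).
  by apply/funext => z; exact: dd2_sc_any.
by rewrite (dd_scale_any _ _ _ c0) (dd_sc_any _ _ _ r0) /= rc1 mul1r.
Qed.
End PulledFlow.

(** * Evolution of the coefficients of an expansion *)

Section LocalExpansion.
Variables (R : realType) (m : nat).
Notation n := m.+1.
Notation S := (R * Cn R n)%type.
Variables (O O1 : set S) (s2 : Cn R n -> R) (om Rc : Cn R n -> 'M[Cx R]_n) (G : S -> 'M[Cx R]_n) (W : S -> Cx R).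
Variables (wl : nat -> S -> Cx R) (q : S).
Hypothesis oO : open O.
Hypothesis Oz : forall q', O q' -> zc q'.2 != 0.
Hypothesis s2_sc : forall (l : R) p, s2 (scp (ray l) p) = l ^+ 2 * s2 p.
Hypothesis omE : forall (q : S) i j, om q.2 i j = dd (Some (i, false)) (dd (Some (j, true)) (fun q : S => rc (s2 q.2)^-1)) q.
Hypothesis om_smooth : forall i j, smooth_st O (fun q => om q.2 i j).
Hypothesis om_pos : forall q, O q -> hermpos (om q.2).
Hypothesis RcE : forall (q : S) i j, Rc q.2 i j =
  - dd (Some (i, false)) (dd (Some (j, true)) (fun q : S => rc (ln (cre (\det (om q.2)))))) q.
Hypothesis oO1 : open O1.
Hypothesis O1O : O1 `<=` O.
Hypothesis sW : smooth_st O1 W.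
Hypothesis sG : forall i j, smooth_st O1 (fun q => G q i j).
Hypothesis pG : forall q, O1 q -> hermpos (G q).
Hypothesis GE : forall q i j, O1 q -> G q i j = om q.2 i j - rc q.1 * Rc q.2 i j + dd (Some (i, false)) (dd (Some (j, true)) W) q.
Hypothesis GF : forall q i j, O1 q -> dd None (fun q => G q i j) q =
  dd (Some (i, false)) (dd (Some (j, true)) (fun q => rc (ln (cre (\det (G q)))))) q.
Hypothesis Oinv : forall l q, O1 (sc (ray l) q) -> O q.
Hypothesis Oq : O q.
Hypothesis O1q : \forall l \near (0 : R)^'+, O1 (sc (ray l) q).
Hypothesis swl : forall i, smooth_st O (wl i).
Hypothesis wl_hom : forall i (l : R) q', 0 < l < 1 -> O q' -> wl i (sc (ray l) q') = rc (l ^+ i) * wl i q'.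
Hypothesis small : forall K s (e : R), 0 < e -> \forall l \near (0 : R)^'+,
  nm (lops s (fun q => W q - \sum_(i < K.+1) wl i q) (sc (ray l) q)) <= e * l ^+ K.

Let Om (l : R) : set S := [set q | O1 (sc (ray l) q)].
Let oOm l : open (Om l). Proof. exact: open_sc. Qed.
Let OmO l : Om l `<=` O. Proof. by move=> z; exact: Oinv. Qed.
Let Omz l q' : Om l q' -> zc q'.2 != 0. Proof. by move=> /(@OmO l)/Oz. Qed.
Variable k : nat.
Let E (l : R) (q : S) : Cx R := W (sc (ray l) q) - \sum_(i < k.+1) wl i (sc (ray l) q).
Let Wl (l : R) (q : S) : Cx R := W (sc (ray l) q).

Lemma lo_E : lo q Om k E.
Proof.
have sE : smooth_st O1 (fun q => W q - \sum_(i < k.+1) wl i q).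
  apply: (smB oO1 sW); apply: (sm_sum oO1) => i; exact: (sm_sub O1O (swl i)).
split=> [l|s e e0]; first exact: (sm_sc oO1 (rho := ray l) sE).
apply: filterS (filterI (pos1 R) (small k s e0)) => l [/andP[l0 _]].
by rewrite lops_sc // gt_eqF.
Qed.
Lemma WlE (l : R) q' : 0 < l < 1 -> Om l q' -> Wl l q' = E l q' + \sum_(i < k.+1) rc (l ^+ i) * wl i q'.
Proof.
move=> hl O'; rewrite /E /Wl -[LHS](subrK (\sum_(i < k.+1) wl i (sc (ray l) q'))); congr (_ + _).
by apply: eq_bigr => i _; rewrite wl_hom //; exact: (OmO O').
Qed.
Lemma dd_sumwl (l : R) a (f : nat -> S -> Cx R) (e : S -> Cx R) q' : (forall i, smooth_st O (f i)) -> smooth_st (Om l) e -> Om l q' ->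
  dd a (fun q => e q + \sum_(i < k.+1) rc (l ^+ i) * f i q) q' = dd a e q' + \sum_(i < k.+1) rc (l ^+ i) * dd a (f i) q'.
Proof.
move=> sf se O'.
have s1 : smooth_st (Om l) (fun q => \sum_(i < k.+1) rc (l ^+ i) * f i q).
  by apply: (sm_sum (@oOm l)) => i; apply: (smZ (@oOm l)); exact: (sm_sub (@OmO l) (sf i)).
rewrite (ddD _ se s1 O'); congr (_ + _).
rewrite (dd_sum (@oOm l) (index_enum 'I_k.+1) xpredT (F := fun (i : 'I_k.+1) q => rc (l ^+ i) * f i q) a (fun i => smZ (@oOm l) _ (sm_sub (@OmO l) (sf i))) O').
apply: eq_bigr => i _.
exact: (ddZ (@oOm l) _ _ (sm_sub (@OmO l) (sf i)) O').
Qed.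
Lemma dd_Wl (l : R) a q' : 0 < l < 1 -> Om l q' ->
  dd a (Wl l) q' = dd a (E l) q' + \sum_(i < k.+1) rc (l ^+ i) * dd a (wl i) q'.
Proof.
move=> hl O'; have [sE _] := lo_E; rewrite (dd_eq (@oOm l) a (fun z Oz => WlE hl Oz) O').
exact: (dd_sumwl _ swl (sE l) O').
Qed.
Lemma dd2_Wl (l : R) a b q' : 0 < l < 1 -> Om l q' ->
  dd a (dd b (Wl l)) q' = dd a (dd b (E l)) q' + \sum_(i < k.+1) rc (l ^+ i) * dd a (dd b (wl i)) q'.
Proof.
move=> hl O'; have [sE _] := lo_E; rewrite (dd_eq (@oOm l) a (fun z Oz => dd_Wl b hl Oz) O').
exact: (dd_sumwl _ (fun i => sm_dd oO b (swl i)) (sm_dd (@oOm l) b (sE l)) O').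
Qed.
Lemma dd3_Wl (l : R) a b c q' : 0 < l < 1 -> Om l q' ->
  dd c (dd a (dd b (Wl l))) q' = dd c (dd a (dd b (E l))) q' + \sum_(i < k.+1) rc (l ^+ i) * dd c (dd a (dd b (wl i))) q'.
Proof.
move=> hl O'; have [sE _] := lo_E; rewrite (dd_eq (@oOm l) c (fun z Oz => dd2_Wl a b hl Oz) O').
exact: (dd_sumwl _ (fun i => sm_dd oO a (sm_dd oO b (swl i))) (sm_dd (@oOm l) a (sm_dd (@oOm l) b (sE l))) O').
Qed.

(** The coefficient of l^j in [pulled]. The index exceeds the weight by two because omega_0 has
    weight -2; the indexing is that of [soliton_part]. *)
Definition part (j : nat) (q : S) : 'M[Cx R]_n :=
  match j with
  | 0 => om q.2
  | 1 => 0
  | i.+2 => \matrix_(c, d) ((if i is 0 then - (rc q.1 * Rc q.2 c d) else 0)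
                            + dd (Some (c, false)) (dd (Some (d, true)) (wl i)) q)
  end.
Lemma sm_part j c d : smooth_st O (fun q => part j q c d).
Proof.
case: j => [|[|i]]; first exact: om_smooth.
  by apply: (sm_eq oO _ (sm_cst oO 0)) => z _; rewrite mxE.
have sw := sm_dd oO (Some (c, false)) (sm_dd oO (Some (d, true)) (swl i)).
have sR := smN oO (smM oO (sm_time oO) (sm_Rc oO om_smooth om_pos RcE c d)).
case: i sw => [|i] sw; first by apply: (sm_eq oO _ (smD oO sR sw)) => z _; rewrite mxE.
by apply: (sm_eq oO _ sw) => z _; rewrite mxE add0r.
Qed.
Lemma sm_inv c d : smooth_st O (fun q => invmx (om q.2) c d).
Proof. by apply: (sm_invmx oO om_smooth) => z /om_pos; exact: hermpos_unit. Qed.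
Definition Mx j q : 'M[Cx R]_n := invmx (om q.2) *m part j q.
Lemma sm_Mx j c d : smooth_st O (fun q => Mx j q c d).
Proof.
by apply: (sm_eq oO _ (sm_sum oO (index_enum 'I_n) xpredT (fun e => smM oO (sm_inv c e) (sm_part j e d)))) => z _; rewrite mxE.
Qed.
Definition MxPoly q : {poly Cx R} := \det (\sum_(j < k.+1) 'X^j *: map_mx polyC (Mx j q)).

Lemma part_sum (l : R) q' c d : 0 < l < 1 -> Om l q' ->
  pulled om Rc l (Wl l) q' c d - \sum_(j < k.+3) rc (l ^+ j) * part j q' c d =
  rc (l ^+ 2) * dd (Some (c, false)) (dd (Some (d, true)) (E l)) q'.
Proof.
move=> hl O'; rewrite 2!big_ord_recl mxE dd2_Wl // expr0 rc1 mul1r [part 1 _ _ _]mxE mulr0 add0r.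
rewrite (_ : \sum_(i < k.+1) rc (l ^+ lift ord0 (lift ord0 i)) * _ = rc (l ^+ 2) * (- (rc q'.1 * Rc q'.2 c d) + \sum_(i < k.+1) rc (l ^+ i) * dd (Some (c, false)) (dd (Some (d, true)) (wl i)) q')).
  have gen (x y z u : Cx R) r : x + r * (y + (z + u)) - (x + r * (y + u)) = r * z by ring.
  exact: gen.
transitivity (\sum_(i < k.+1) (rc (l ^+ 2) * (if i == ord0 then - (rc q'.1 * Rc q'.2 c d) else 0) +
    rc (l ^+ 2) * (rc (l ^+ i) * dd (Some (c, false)) (dd (Some (d, true)) (wl i)) q'))).
  apply: eq_bigr => i _; rewrite !lift0 [part _ _ _ _]mxE mulrDr [in RHS]mulrA -[in RHS]rcM -[in RHS]exprD.
  have -> : (i == ord0) = (i == 0%N :> nat) by [].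
  by case: (nat_of_ord i) => [|i'] /=; [rewrite addn0|rewrite !mulr0].
rewrite big_split /= -!mulr_sumr -mulrDr; congr (_ * (_ + _)).
by rewrite big_ord_recl eqxx big1 ?addr0.
Qed.

Section Direction.
Variables (a b : option ('I_n * bool)).
Notation jb := (jb q a b Om).
Notation jo := (jo q a b Om).
Lemma jo_eqO (F F' : R -> S -> Cx R) : (\forall l \near (0 : R)^'+, forall q', Om l q' -> F l q' = F' l q') -> jo k F -> jo k F'.
Proof.
move=> H [sF h]; split.
  by apply: filterS (filterI H sF) => l [h1 h2]; apply: (sm_eq (@oOm l) _ h2) => z Oz'; exact: h1.
move=> e e0; apply: filterS (filterI (filterI H O1q) (h e e0)) => l [[h1 h3] h2].
exact: (jle_eq (@oOm l) h3 h1 h2).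
Qed.
Let jo_sum' := @jo_sum R n q a b Om oOm O1q k.
(** An expansion of the potential up to weight k determines the coefficients up to l^(k+2); the last
    two are o(l^k) and are dropped, to match the polynomial in the soliton equation. *)
Lemma jo_entry c d : jo k (fun l q => (invmx (om q.2) *m pulled om Rc l (Wl l) q) c d - \sum_(j < k.+1) rc (l ^+ j) * Mx j q c d).
Proof.
have b1 e : jb (fun _ q => invmx (om q.2) c e) by exact: (jb_smooth q a b OmO (sm_inv c e)).
have b2 : jb (fun l _ => rc l ^+ 2) by exact: jb_rcX.
have j1 e : jo k (fun l => dd (Some (e, false)) (dd (Some (d, true)) (E l))).
  exact: (lo_jo oOm O1q Omz a b (lo_dd oOm O1q Omz _ (lo_dd oOm O1q Omz _ lo_E))).
have j2 e := joM oOm O1q (j1 e) (jbM oOm O1q (b1 e) b2).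
have J := jo_sum' (index_enum 'I_n) j2.
have T i : (k < i)%N -> jo k (fun l q => rc (l ^+ i) * Mx i q c d).
  move=> ki; have sf : \forall l \near (0 : R)^'+, smooth_st (Om l) (fun q => Mx i q c d).
    by apply: nearW => l; exact: (sm_sub (@OmO l) (sm_Mx i c d)).
  exact: (jo_pow a b oOm O1q ki sf).
have J2 := joD oOm O1q J (joD oOm O1q (T k.+1 (leqnn _)) (T k.+2 (leqW (leqnn _)))).
apply: jo_eqO J2; apply: filterS (pos1 R) => l hl q' O'.
have H e := part_sum e d hl O'.
rewrite [in RHS]mxE.
have -> : \sum_(j < k.+1) rc (l ^+ j) * Mx j q' c d = \sum_(j < k.+3) rc (l ^+ j) * Mx j q' c d - (rc (l ^+ k.+1) * Mx k.+1 q' c d + rc (l ^+ k.+2) * Mx k.+2 q' c d).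
  by rewrite 2![in RHS]big_ord_recr /=; ring.
have gen (x y z t : Cx R) : x = y - z -> x + t = y - (z - t) by move=> ->; ring.
apply: gen.
have -> : \sum_(j < k.+3) rc (l ^+ j) * Mx j q' c d = \sum_e invmx (om q'.2) c e * \sum_(j < k.+3) rc (l ^+ j) * part j q' e d.
  under eq_bigr do rewrite mxE mulr_sumr.
  by rewrite exchange_big /=; apply: eq_bigr => e _; rewrite mulr_sumr; apply: eq_bigr => j _; rewrite mulrCA.
rewrite -sumrB; apply: eq_bigr => e _; rewrite -mulrBr H rcX.
by move: (dd _ _ _) => x; ring.
Qed.
Lemma jb_Mxsum c d : jb (fun l q => \sum_(j < k.+1) rc (l ^+ j) * Mx j q c d).
Proof.
apply: (jb_sum oOm O1q) => j; apply: (jbM oOm O1q); last by exact: (jb_smooth q a b OmO (sm_Mx j c d)).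
by apply: jb_ext (jb_rcX q a b oOm j) => l z; rewrite rcX.
Qed.
Lemma horner_MxPoly (l : R) q' : (MxPoly q').[rc l] = \det (\matrix_(c, d) \sum_(j < k.+1) rc (l ^+ j) * Mx j q' c d).
Proof.
rewrite det_map_horner; congr (\det _); apply/matrixP => c d; rewrite !mxE summxE horner_sum.
by apply: eq_bigr => j _; rewrite !mxE hornerM hornerXn hornerC rcX.
Qed.
Lemma smp_MxPoly : smp O MxPoly.
Proof.
apply: (smp_det oO) => c d.
apply: (smp_ext (P := fun q => \sum_(j < k.+1) 'X^j * (Mx j q c d)%:P)) => [z|].
  by rewrite summxE; apply: eq_bigr => j _; rewrite !mxE.
apply: (smp_sum oO) => j; apply: (smpM oO); first exact: (smp_cst oO).
by apply: (smp_C oO); exact: sm_Mx.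
Qed.
Lemma MxPoly0 q' : O q' -> (MxPoly q')`_0 = 1.
Proof.
move=> O'; rewrite -horner_coef0 -(rc0 R) horner_MxPoly (_ : \matrix_(c, d) _ = 1%:M) ?det1 //.
apply/matrixP => c d; rewrite mxE big_ord_recl big1 => [|i _]; last by rewrite expr0n /= rc0 mul0r.
by rewrite expr0 rc1 mul1r addr0 /Mx /= mulVmx // hermpos_unit //; exact: om_pos.
Qed.
Lemma jo_ratio : jo k (fun l q => pulled_ratio om Rc l (Wl l) q - (MxPoly q).[rc l]).
Proof.
have b1 c d : jb (fun l q => (invmx (om q.2) *m pulled om Rc l (Wl l) q) c d).
  apply: jb_ext (jbD oOm O1q (jo_jb (jo_entry c d)) (jb_Mxsum c d)) => l z; exact: subrK.
have b2 c d : jb (fun l q => (\matrix_(c, d) \sum_(j < k.+1) rc (l ^+ j) * Mx j q c d) c d).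
  by apply: jb_ext (jb_Mxsum c d) => l z; rewrite mxE.
have b3 c d : jo k (fun l q => (invmx (om q.2) *m pulled om Rc l (Wl l) q) c d - (\matrix_(c, d) \sum_(j < k.+1) rc (l ^+ j) * Mx j q c d) c d).
  by apply: jo_ext (jo_entry c d) => l z; rewrite [(\matrix_(_, _) _) _ _ in RHS]mxE.
by apply: jo_ext (jo_det oOm O1q b1 b2 b3) => l z; rewrite horner_MxPoly.
Qed.
End Direction.

(** [pulled_flow] equates the time derivative of d dbar of the pulled-back potential with an
    expression that [log_comparison] approximates by a polynomial in l. The left side is polynomial
    as well, up to three derivatives of the remainder of the expansion. *)
Lemma coefficient_flow i j :
  dd None (dd (Some (i, false)) (dd (Some (j, true)) (wl k))) q =
  dd (Some (i, false)) (dd (Some (j, true)) (fun q => formal_log_coef k (MxPoly q))) q.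
Proof.
set a := Some (i, false); set b := Some (j, true).
have [Z Zk HZ] := log_comparison oOm O1q oO Oq OmO smp_MxPoly MxPoly0 (jo_ratio a b).
rewrite -Zk.
(* The difference of the two sides as a polynomial in l. It is o(l^k), so its coefficients up to
   index k vanish. *)
pose N := \poly_(c < k.+1) dd None (dd a (dd b (wl c))) q - Z.
suff : N`_k = 0 by rewrite coefB coef_poly ltnSn => /eqP; rewrite subr_eq0 => /eqP.
apply: (@small_poly R k N) (leqnn k) => e e0; have e2 : 0 < e / 2 by lra.
have lE := lo_dd oOm O1q Omz None (lo_dd oOm O1q Omz a (lo_dd oOm O1q Omz b lo_E)).
apply: filterS (filterI (filterI (pos1 R) O1q) (filterI (HZ _ e2) (lo_small lE e2))) => l [[hl Ol] [[F0 h1] h2]].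
have l0 : l != 0 by rewrite gt_eqF //; case/andP: hl.
have PF := pulled_flow oO s2_sc omE om_smooth om_pos RcE oO1 O1O sW sG pG GE GF l0 (@Oinv l) i j Ol.
cbv zeta in PF; rewrite -/(Wl l) -/a -/b in PF; rewrite -PF dd3_Wl // in h1.
have NE : N.[rc l] = (\sum_(c < k.+1) rc (l ^+ c) * dd None (dd a (dd b (wl c))) q) - Z.[rc l].
  rewrite /N hornerD hornerN horner_poly; congr (_ - _); apply: eq_bigr => c _; by rewrite rcX mulrC.
rewrite NE; move: h1 h2; move: (\sum_(c < _) _) (Z.[_]) (dd _ _ _) => x y z h1 h2.
rewrite (_ : x - y = (z + x - y) - z); last by ring.
apply: le_trans (nmB _ _) _; move: h1 h2; move: (nm _) (nm _) (l ^+ k) => *; lra.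
Qed.
End LocalExpansion.

Lemma is_cder_id (R : realType) (s : R) : is_cder (fun s => rc s) s 1.
Proof. by rewrite -(rc1 R); apply: is_cder_rc; exact: is_derive_id. Qed.
Lemma is_cder_invX (R : realType) (k : nat) (s : R) : s != 0 -> is_cder (fun s => (rc s)^-1 ^+ k) s (- k%:R * (rc s)^-1 ^+ k.+1).
Proof.
move=> s0; have r0 : rc s != 0 by rewrite rc_eq0.
elim: k => [|k IH].
  by rewrite oppr0 mul0r; apply: (is_cder_ext _ (is_cderC 1 s)) => x; rewrite expr0.
have h := is_cderM (is_cderV r0 (is_cder_id s)) IH.
have := is_cder_eq _ h; move=> /(_ (- k.+1%:R * (rc s)^-1 ^+ k.+2)) H.
apply: (is_cder_ext _ (H _)) => [x|]; first by rewrite exprS.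
rewrite !exprS -(natr1 k); have gen (x y z : Cx R) : x != 0 -> -1 / (x * x) * y + x^-1 * (- z * (x^-1 * y)) = - (z + 1) * (x^-1 * (x^-1 * y)).
  by move=> x0; field; exact: x0.
exact: gen.
Qed.

Section Euler.
Variables (R : realType) (m : nat).
Notation n := m.+1.
Notation S := (R * Cn R n)%type.
Variables (O : set S) (oO : open O) (f : S -> Cx R) (k : nat).
Hypothesis sf : smooth_st O f.
Hypothesis wf : forall q, O q -> zc q.2 * dd (Some (ord0, false)) f q + (zc q.2)^* * dd (Some (ord0, true)) f q = k%:R * f q.
(** Along the ray, s^(-k) f(s z, w) has derivative zero by Euler's relation, and is compared at s =
    1 and s = l. *)
Lemma euler_weight (l : R) q : 0 < l < 1 -> (forall s, l <= s <= 1 -> O (sc (ray s) q)) -> f (sc (ray l) q) = rc (l ^+ k) * f q.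
Proof.
move=> /andP[l0 l1] H.
pose v : Cn R n := zc q.2 *: delta_mx 0 ord0.
have D s : l <= s <= 1 -> is_cder (fun s => f (sc (ray s) q)) s (rc s^-1 * (k%:R * f (sc (ray s) q))).
  move=> hs; have s0 : s != 0 by rewrite gt_eqF //; case/andP: hs => h _; exact: lt_le_trans h.
  apply/is_cder_shift; have := is_cder_along oO v sf (H s hs).
  have -> : along v f (sc (ray s) q) = rc s^-1 * (k%:R * f (sc (ray s) q)).
    rewrite -wf; last exact: H.
    rewrite /along (bigD1 ord0) //= big1 ?addr0; last first.
      by move=> j j0; rewrite !mxE eqxx (negbTE j0) /= mulr0 (rmorph0 (Num.conj : {rmorphism _ -> _})) !mul0r addr0.
    have e : rc s^-1 * rc s = 1 by rewrite -rcM mulVf.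
    rewrite !mxE !eqxx mulr1 /zc mxE /ray eqxx rmorphM /= rc_conj.
    have gen (a b c d x y : Cx R) : a * b = 1 -> c * x + d * y = a * (b * c * x + b * d * y).
      by move=> h; rewrite -[LHS]mul1r -h; ring.
    exact: gen.
  apply: is_cder_ext => h; congr (f (_, _)); apply/rowP => j; rewrite !mxE eqxx /=.
  rewrite /ray; case: (eqVneq j ord0) => [->|j0] /=; last by rewrite !mulr0 addr0.
  by rewrite mulr1 rcD mulrDl.
pose phi (s : R) := (rc s)^-1 ^+ k * f (sc (ray s) q).
have D2 s : l <= s <= 1 -> is_cder phi s 0.
  move=> hs; have s0 : s != 0 by rewrite gt_eqF //; case/andP: hs => h _; exact: lt_le_trans h.
  have := is_cderM (is_cder_invX k s0) (D s hs); apply: is_cder_eq.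
  rewrite exprS -rcV; move: (rc s^-1) (_ ^+ k) (f _) => x y z; ring.
have c0 : phi @ l^'+ --> phi l.
  by apply: cvg_at_right_filter; apply: (is_cder_continuous (D2 l _)); rewrite lexx ltW.
have := @time_increment R phi (fun=> 0) l 1 0 l1.
move=> /(_ _ c0) h; have {}h : nm (phi 1 - phi l) <= 2 * 0 * (1 - l).
  by apply: h => t /andP[h1 h2]; split; [apply: D2; rewrite (ltW h1) h2|rewrite nm0].
rewrite mulr0 mul0r in h.
have /eqP : phi 1 - phi l == 0 by rewrite -nm_eq0 eq_le h nm_ge0.
move=> /eqP; rewrite subr_eq0 => /eqP e.
have q1 : sc (ray 1) q = q.
  rewrite /sc; case: (q) => t p; congr (_, _); apply/rowP => j; rewrite mxE /ray.
  by case: (j == ord0); rewrite rc1 mul1r.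
have l00 : rc l != 0 by rewrite rc_eq0 gt_eqF.
have e1 : phi 1 = f q by rewrite /phi q1 rc1 invr1 expr1n mul1r.
by rewrite -e1 e /phi mulrA rcX -exprMn (divff l00) expr1n mul1r.
Qed.
End Euler.

(** * The formal logarithm under rescaling of the variable *)

Section FormalScaling.
Variable R : realType.
Lemma coef_comp_scale (p : {poly Cx R}) c k : (p \Po (c *: 'X))`_k = c ^+ k * p`_k.
Proof.
rewrite comp_polyE coef_sum.
transitivity (\sum_(i < size p) (if k == i :> nat then c ^+ k * p`_k else 0)).
  apply: eq_bigr => i _; rewrite coefZ exprZn coefZ coefXn.
  by case: eqP => [->|_]; rewrite ?mulr1 ?mulr0 // mulrC.
have [h|h] := ltnP k (size p); last first.
  rewrite (nth_default _ h) mulr0 big1 // => i _; case: eqP => // e; by have := ltn_ord i; rewrite -e ltnNge h.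
by rewrite (bigD1 (Ordinal h)) //= eqxx big1 ?addr0 // => i /negbTE ni; rewrite eq_sym; rewrite -val_eqE /= in ni; rewrite ni.
Qed.
Lemma formal_log_scale k (p : {poly Cx R}) c : formal_log_coef k (p \Po (c *: 'X)) = c ^+ k * formal_log_coef k p.
Proof.
rewrite /formal_log_coef -coef_comp_scale; congr ((polyseq _)`_k); rewrite [RHS]raddf_sum; apply: eq_bigr => l _.
by rewrite /= comp_polyZ rmorphXn /= comp_polyB comp_polyC.
Qed.
(** Substitute c X for X. With c the square root of t this is the homogeneity of the formal soliton
    in time. *)
Lemma formal_log_det (n k : nat) (A B : nat -> 'M[Cx R]_n) c : (forall j, (j <= k)%N -> B j = c ^+ j *: A j) ->
  formal_log_coef k (\det (\sum_(j < k.+1) 'X^j *: map_mx polyC (B j))) =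
  c ^+ k * formal_log_coef k (\det (\sum_(j < k.+1) 'X^j *: map_mx polyC (A j))).
Proof.
move=> H; rewrite -formal_log_scale; congr formal_log_coef.
rewrite -(det_map_mx (comp_poly (c *: 'X))); congr (\det _); apply/matrixP => i j.
rewrite mxE !summxE raddf_sum; apply: eq_bigr => l _; rewrite H ?leq_ord // !mxE.
rewrite /= comp_polyM comp_polyC comp_Xn_poly exprZn polyCM -mul_polyC.
by rewrite mulrA [_ * 'X^l]mulrC.
Qed.
End FormalScaling.

(** * The coefficients of an expansion *)

Section UptoLimits.
Variables (R : realType) (n : nat).
Notation S := (R * Cn R n)%type.
Lemma upto_cw0 (A : set S) (f : S -> Cx R) : smooth_upto A f -> cw A f.
Proof.
move=> H q Aq; have [ O [f1 [oO Oq F' E]]] := H q Aq; rewrite (E q Oq Aq).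
have c : f1 @ within A (nbhs q) --> f1 q by apply: cvg_within_filter; exact: (sm_cts F' Oq).
apply: cvg_trans c; apply: near_eq_cvg; have := near_O oO Oq; rewrite near_withinE; apply: filterS => x Ox Ax.
by rewrite (E x Ox Ax).
Qed.
Lemma cw_path (A : set S) (f : S -> Cx R) (t : R) p : cw A f -> A (t, p) -> (\forall s \near t^'+, A (s, p)) ->
  (fun s => f (s, p)) @ t^'+ --> f (t, p).
Proof.
move=> cf At HA.
have h : (fun s : R => ((s, p) : S)) @ t^'+ --> within A (nbhs ((t, p) : S)).
  move=> B /= [[V1 V2] /= [V10 V20] HV].
  have n1 : \forall x \near t^'+, V1 x by exact: (@cvg_at_right_filter _ _ id t _ cvg_id).
  have p2 : V2 p by exact: nbhs_singleton.
  by apply: filterS (filterI n1 HA) => x [v1 Ax]; apply: HV.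
exact: (cvg_comp _ _ h (cf _ At)).
Qed.
Lemma is_cder_time (O : set S) (f : S -> Cx R) t p : smooth_st O f -> O (t, p) -> is_cder (fun s => f (s, p)) t (dd None f (t, p)).
Proof. by move=> sf Oq; rewrite ddE; apply/is_cder_shift; exact: (sm_der None sf Oq). Qed.
End UptoLimits.
(** A holomorphic derivative does not see the conjugate of z, so the factor of the second operator
    passes through and no first-order term appears. *)
Lemma lops2 (R : realType) (m : nat) (O : set (R * Cn R m.+1)) (g : R * Cn R m.+1 -> Cx R) q i j : open O -> smooth_st O g -> O q ->
  lops [:: Some (i, false); Some (j, true)] g q =
  chi (Some (i, false)) q * chi (Some (j, true)) q * dd (Some (i, false)) (dd (Some (j, true)) g) q.
Proof.
move=> oO sg Oq; rewrite [LHS](lopE (Some (i, false)) (lop (Some (j, true)) g) q).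
rewrite (_ : lop (Some (j, true)) g = fun q => chi (Some (j, true)) q * dd (Some (j, true)) g q); last by apply/funext => z; rewrite lopE.
rewrite (ddM _ (sm_chi oO (Some (j, true))) (sm_dd oO _ sg) Oq) mulrDr !mulrA (dd_chi (Some (j, true)) (Some (i, false)) q).
by rewrite /chid (_ : (Some (i, false) == Some (j, true)) = false) ?andbF ?mul0r ?add0r //; apply/eqP => -[].
Qed.
Section ChartExpansion.
Variables (R : realType) (m : nat).
Notation n := m.+1.
Notation S := (R * Cn R n)%type.
Variables (dom : set (Cn R n)) (s2 : Cn R n -> R) (eps : R) (om Rc : Cn R n -> 'M[Cx R]_n).
Variables (G : S -> 'M[Cx R]_n) (W : S -> Cx R) (wl : nat -> S -> Cx R) (u : nat -> Cn R n -> R).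
Hypothesis odom : open dom.
Hypothesis dom_sc : forall (l : R) p, l != 0 -> dom p -> dom (scp (ray l) p).
Hypothesis dom_scI : forall (l : R) p, dom (scp (ray l) p) -> dom p.
Hypothesis dom_z : forall p, dom p -> zc p != 0.
Hypothesis s2_sc : forall (l : R) p, s2 (scp (ray l) p) = l ^+ 2 * s2 p.
Hypothesis s2_cts : forall p, dom p -> s2 @ p --> s2 p.
Hypothesis s2_pos : forall p, dom p -> 0 < s2 p.
Hypothesis eps0 : 0 < eps.
Let reg : set S := [set q | dom q.2 /\ 0 <= q.1 <= eps * (Num.sqrt (s2 q.2))^-1 ^+ 2].
Hypothesis Gsm : forall i j, smooth_upto reg (fun q => G q i j).
Hypothesis Gpos : forall q, reg q -> hermpos (G q).
Hypothesis GF : forall q i j, reg° q -> dd None (fun q => G q i j) q =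
  dd (Some (i, false)) (dd (Some (j, true)) (fun q => rc (ln (cre (\det (G q)))))) q.
Hypothesis G0 : forall p, dom p -> G (0, p) = om p.
Hypothesis omE : forall (q : S) i j, om q.2 i j = dd (Some (i, false)) (dd (Some (j, true)) (fun q : S => rc (s2 q.2)^-1)) q.
Hypothesis RcE : forall (q : S) i j, Rc q.2 i j =
  - dd (Some (i, false)) (dd (Some (j, true)) (fun q : S => rc (ln (cre (\det (om q.2)))))) q.
Hypothesis wl_upto : forall k, smooth_upto [set q | 0 <= q.1 /\ dom q.2] (wl k).
Hypothesis wl_weight : forall k q, 0 <= q.1 -> dom q.2 ->
  zc q.2 * dd (Some (ord0, false)) (wl k) q + (zc q.2)^* * dd (Some (ord0, true)) (wl k) q = k%:R * wl k q.
Hypothesis pot : forall t1 : R, 0 < t1 -> exists2 d : R, 0 < d &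
  let N := [set q : S | [/\ 0 <= q.1 <= t1, dom q.2 & s2 q.2 < d]] in
  smooth_upto N W /\ forall q i j, N q ->
    dd (Some (i, false)) (dd (Some (j, true)) W) q = G q i j - om q.2 i j + rc q.1 * Rc q.2 i j.
Hypothesis est : forall K s (t1 e : R) p, 0 < t1 -> 0 < e -> dom p -> exists2 d : R, 0 < d &
  forall t p', 0 < t <= t1 -> wc p' = wc p -> 0 < nm (zc p') < d ->
  nm (lops s (fun q => W q - \sum_(i < K.+1) wl i q) (t, p')) <= e * Num.sqrt (s2 p') ^+ K.
Hypothesis u_smooth : forall k, (0 < k)%N -> smooth_st [set q | dom q.2] (fun q => rc (u k q.2)).
Definition solp (j : nat) (p : Cn R n) : 'M[Cx R]_n :=
  match j with
  | 0 => om p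
  | 1 => 0
  | 2 => - Rc p
  | k.+2 => \matrix_(c, d) dd (Some (c, false)) (dd (Some (d, true)) (fun q : S => rc (u k q.2))) (0, p)
  end.
Hypothesis u_eq : forall k p, (0 < k)%N -> dom p ->
  formal_log_coef k (\det (\sum_(j < k.+1) 'X^j *: map_mx polyC (invmx (om p) *m solp j p)))
  = rc ((k%:R / 2%:R + 1) * u k p).

Let O : set S := [set q | 0 < q.1 /\ dom q.2].
Lemma oO0 : open [set q : S | dom q.2].
Proof. by rewrite (_ : [set q : S | dom q.2] = snd @^-1` dom) //; apply: open_comp => // x _; exact: cvg_snd. Qed.
Lemma oOt : open O.
Proof.
rewrite (_ : O = [set q : S | 0 < q.1] `&` [set q : S | dom q.2]); last by apply/seteqP; split=> z [].
apply: openI; last exact: oO0.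
rewrite (_ : [set q : S | 0 < q.1] = fst @^-1` [set x : R | 0 < x]) //.
by apply: open_comp; [move=> x _; exact: cvg_fst|exact: open_gt].
Qed.
Lemma reg0 p : dom p -> reg (0, p).
Proof. by move=> dp; split=> //=; rewrite lexx mulr_ge0 ?exprn_ge0 ?invr_ge0 ?sqrtr_ge0 // ltW. Qed.
Lemma om_sm i j : smooth_st [set q : S | dom q.2] (fun q => om q.2 i j).
Proof.
have := upto_slice odom reg0 (Gsm i j); apply: (sm_eq oO0) => q Oq.
by rewrite G0.
Qed.
Lemma om_p q : O q -> hermpos (om q.2).
Proof. by move=> [_ dq]; have := Gpos (reg0 dq); rewrite G0. Qed.
Let om_s i j : smooth_st O (fun q => om q.2 i j).
Proof. by apply: (sm_sub _ (om_sm i j)) => z []. Qed.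
Let swl k : smooth_st O (wl k).
Proof. by apply: upto_smooth oOt _ (wl_upto k) => z [h1 h2]; split=> //; exact: ltW. Qed.
Lemma wl_hom k (l : R) q : 0 < l < 1 -> O q -> wl k (sc (ray l) q) = rc (l ^+ k) * wl k q.
Proof.
move=> hl [q0 dq]; apply: (euler_weight oOt (swl k) _ hl) => [z [z0 dz]|s /andP[ls _]]; first exact: (wl_weight k (ltW z0) dz).
split=> //; apply: dom_sc => //; rewrite gt_eqF //; case/andP: hl => h _; exact: lt_le_trans ls.
Qed.

(** The flow is defined for t <= eps / |S|^2, so for times below t1 it suffices that |S|^2 < eps /
    t1; the other bound on |S|^2 is the one under which the potential exists. *)
Lemma window (t1 : R) : 0 < t1 -> exists2 d : R, 0 < d &
  let O1 := [set q : S | 0 < q.1 < t1 /\ (dom q.2 /\ s2 q.2 < d)] in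
  [/\ open O1, smooth_st O1 W, forall i j, smooth_st O1 (fun q => G q i j),
      forall q, O1 q -> hermpos (G q) /\ forall i j,
        G q i j = om q.2 i j - rc q.1 * Rc q.2 i j + dd (Some (i, false)) (dd (Some (j, true)) W) q /\
        dd None (fun q => G q i j) q = dd (Some (i, false)) (dd (Some (j, true)) (fun q => rc (ln (cre (\det (G q)))))) q
    & forall t p, 0 <= t < t1 -> dom p -> s2 p < d -> reg (t, p)].
Proof.
move=> t10; have [d0 d00 [sN EN]] := pot t10.
exists (Num.min d0 (eps / t1)) => [|O1]; first by rewrite lt_min d00 divr_gt0.
have oV : open [set p : Cn R n | dom p /\ s2 p < Num.min d0 (eps / t1)].
  rewrite openE => p [dp sp].
  have n1 : \forall p' \near p, dom p' by exact: (open_nbhs_nbhs (conj odom dp)).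
  by have := near_lt (s2_cts dp) sp => n2; apply: filterS (filterI n1 n2) => x [].
have oO1 : open O1 by exact: (open_slab oV).
have regt t p : 0 <= t < t1 -> dom p -> s2 p < Num.min d0 (eps / t1) -> reg (t, p).
  move=> /andP[ht0 ht1] dp; rewrite lt_min => /andP[_ h]; split=> //=; rewrite ht0 /=.
  have s0 := s2_pos dp; rewrite exprVn (sqr_sqrtr (ltW s0)) ler_pdivlMr //.
  rewrite ltr_pdivlMr // in h; rewrite mulrC; apply: le_trans (ltW h); rewrite ler_pM2l //; exact: ltW.
have O1r : O1 `<=` reg by move=> [t p] [/andP[h1 h2] [dp sp]]; apply: regt => //; rewrite (ltW h1).
have O1i q : O1 q -> reg° q by move=> Oq; apply: filterS (near_O oO1 Oq); exact: O1r.
have O1N : O1 `<=` [set q : S | [/\ 0 <= q.1 <= t1, dom q.2 & s2 q.2 < d0]].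
  move=> q [/andP[h1 h2] [dp]]; rewrite lt_min => /andP[sp _]; split=> //; by rewrite (ltW h1) (ltW h2).
split=> //; first exact: (upto_smooth oO1 O1N sN).
  by move=> i j; exact: (upto_smooth oO1 O1r (Gsm i j)).
move=> q Oq; split; first exact: (Gpos (O1r _ Oq)).
move=> i j; split; last exact: (GF i j (O1i _ Oq)).
rewrite (EN q i j (O1N _ Oq)); move: (G q i j) (om _ _ _) (Rc _ _ _) (rc _) => a b c d; ring.
Qed.

Lemma near_small (a c : R) : 0 <= a -> 0 < c -> \forall l \near (0 : R)^'+, l * a < c.
Proof.
move=> a0 c0; have a1 : 0 < a + 1 by lra.
apply/near_right0; exists (c / (a + 1)); first by rewrite divr_gt0.
move=> r /andP[r0]; rewrite ltr_pdivlMr // => h; apply: le_lt_trans h; rewrite ler_pM2l //; lra.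
Qed.
Lemma near_small2 (a c : R) : 0 <= a -> 0 < c -> \forall l \near (0 : R)^'+, l ^+ 2 * a < c.
Proof.
move=> a0 c0; apply: filterS (filterI (pos1 R) (near_small a0 c0)) => l [/andP[l0 l1] h]; apply: le_lt_trans h.
rewrite expr2 -mulrA; apply: ler_piMl; [exact: (mulr_ge0 (ltW l0) a0)|exact: ltW].
Qed.

Lemma coef_flow k q i j : O q ->
  dd None (dd (Some (i, false)) (dd (Some (j, true)) (wl k))) q =
  dd (Some (i, false)) (dd (Some (j, true)) (fun q => formal_log_coef k (MxPoly om Rc wl k q))) q.
Proof.
move=> Oq; have [q0 dq] := Oq; have t10 : 0 < q.1 + 1 by lra.
have [d d0] := window t10; set O1 := [set q | _] => -[oO1 sW sG HO1 _].
have Oinv (l : R) q' : O1 (sc (ray l) q') -> O q'.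
  by move=> [/andP[h1 _] [h2 _]]; split=> //; exact: dom_scI h2.
have O1O : O1 `<=` O by move=> z [/andP[h1 _] [h2 _]].
have O1q : \forall l \near (0 : R)^'+, O1 (sc (ray l) q).
  have h := near_small2 (ltW (s2_pos dq)) d0.
  apply: filterS (filterI (pos1 R) h) => l [/andP[l0 _] hl]; split; first by rewrite q0 /= ltrDl.
  by split; [apply: dom_sc => //; rewrite gt_eqF|rewrite s2_sc].
apply: (@coefficient_flow R m O O1 s2 om Rc G W wl q oOt _ s2_sc omE om_s om_p RcE oO1 O1O sW sG _ _ _ Oinv Oq O1q swl wl_hom).
- by move=> z [_ dz]; exact: dom_z.
- by move=> z Oz; have [] := HO1 _ Oz.
- by move=> z i' j' Oz; have [_ h] := HO1 _ Oz; have [] := h i' j'.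
- by move=> z i' j' Oz; have [_ h] := HO1 _ Oz; have [] := h i' j'.
move=> K s e e0.
have s0 : 0 < Num.sqrt (s2 q.2) ^+ K by rewrite exprn_gt0 // sqrtr_gt0 s2_pos.
(* [est] measures the error by |S|^K, which at the dilated point is l^K times its value at q. *)
have e1 : 0 < e / Num.sqrt (s2 q.2) ^+ K by rewrite divr_gt0.
have [de de0 H] := est K s t10 e1 dq.
apply: filterS (filterI (pos1 R) (near_small (nm_ge0 (zc q.2)) de0)) => l [/andP[l0 _] hl].
have := H q.1 (scp (ray l) q.2).
have -> : wc (scp (ray l) q.2) = wc q.2 by apply/rowP => c; rewrite !mxE /ray /= rc1 mul1r.
have zn : 0 < nm (zc q.2) by rewrite lt_neqAle nm_ge0 eq_sym nm_eq0 dom_z.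
have -> : nm (zc (scp (ray l) q.2)) = l * nm (zc q.2) by rewrite /zc mxE /ray eqxx nmM nm_rc gtr0_norm.
have h1 : 0 < q.1 <= q.1 + 1 by rewrite q0 /= lerDl ler01.
have h2 : 0 < l * nm (zc q.2) < de by rewrite mulr_gt0.
move=> /(_ h1 erefl h2); rewrite s2_sc sqrtrM ?sqr_ge0 // sqrtr_sqr gtr0_norm // exprMn.
by rewrite mulrCA divfK ?gt_eqF // mulrC.
Qed.

(** The estimates hold for t > 0 uniformly, so they survive as t -> 0. There G is omega_0 and d dbar
    of the potential disappears, which leaves a polynomial in l of size o(l^k) whose coefficients
    are the initial values in question. *)
Lemma initial_coef k p i j : dom p -> dd (Some (i, false)) (dd (Some (j, true)) (wl k)) (0, p) = 0.
Proof.
move=> dp; set a := Some (i, false); set b := Some (j, true).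
pose T c t := dd a (dd b (wl c)) (t, p).
have cT c : T c @ 0^'+ --> T c 0.
  have cA : cw [set q : S | 0 <= q.1 /\ dom q.2] (dds [:: (i, false); (j, true)] (wl c)).
    apply: (@upto_cw R n _ (fun t => [set p | 0 <= t /\ dom p])) (wl_upto c) => // t.
    have [h|h] := boolP (0 <= t).
      by rewrite (_ : [set p | _] = dom) //; apply/seteqP; split=> [p' []//|p' dp']; split.
    by rewrite (_ : [set p | _] = set0); [exact: open0|apply/seteqP; split=> [p' []//|p']].
  apply: (cw_path cA) => //.
  by apply: filterS (pos1 R) => s /andP[s0 _]; split=> //; exact: ltW.
pose N := \poly_(c < k.+1) T c 0.
suff : N`_k = 0 by rewrite coef_poly ltnSn.
apply: (@small_poly R k N) (leqnn k) => e e0.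
have [d d0] := window ltr01; set O1 := [set q | _] => -[oO1 sW sG HO1 regt].
have O1O : O1 `<=` O by move=> z [/andP[h1 _] [h2 _]].
have cn c : 0 < nm (chi c (0, p)).
  rewrite lt_neqAle nm_ge0 eq_sym nm_eq0 andbT.
  exact: (@chi_neq0 R m [set q | dom q.2] (fun q (h : dom q.2) => dom_z h) c (0, p) dp).
pose X := nm (chi a (0, p)) * nm (chi b (0, p)); have X0 : 0 < X by exact: mulr_gt0.
pose Y := Num.sqrt (s2 p) ^+ k; have Y0 : 0 < Y by rewrite exprn_gt0 // sqrtr_gt0 s2_pos.
have e1 : 0 < e * X / Y by rewrite divr_gt0 // mulr_gt0.
have [de de0 H] := est k [:: a; b] ltr01 e1 dp.
apply: filterS (filterI (pos1 R) (filterI (near_small (nm_ge0 (zc p)) de0) (near_small2 (ltW (s2_pos dp)) d0))).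
move=> l [hl [h1 h2]]; have /andP[l0 l1] := hl; have ln : l != 0 by rewrite gt_eqF.
have r0 c := @ray_neq0 R m l c ln.
pose pl := scp (ray l) p; have dpl : dom pl by exact: dom_sc.
have spl : s2 pl < d by rewrite /pl s2_sc.
(* For t > 0 this is d dbar of the pulled-back remainder of the expansion. The potential has been
   eliminated in favour of G, so that the expression has a limit as t -> 0. *)
pose h (t : R) : Cx R := rc (ray l i * ray l j) * (G (t, pl) i j - om pl i j + rc t * Rc pl i j) - \sum_(c < k.+1) rc (l ^+ c) * T c t.
have B t : 0 < t < 1 -> nm (h t) <= e * l ^+ k.
  move=> /andP[t0 t1]; pose E q := W q - \sum_(c < k.+1) wl c q.
  have Ol : O1 (sc (ray l) (t, p)) by split=> //=; rewrite t0 t1.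
  have sE : smooth_st O1 E by apply: (smB oO1 sW); apply: (sm_sum oO1) => c; exact: (sm_sub O1O (swl c)).
  have hE : h t = dd a (dd b (fun q => E (sc (ray l) q))) (t, p).
    rewrite (dd2_sc_any ln) /= /h.
    have sS : smooth_st O1 (fun q => \sum_(c < k.+1) wl c q) by apply: (sm_sum oO1) => c; exact: (sm_sub O1O (swl c)).
    have E1 q' : O1 q' -> dd b E q' = dd b W q' - \sum_(c < k.+1) dd b (wl c) q'.
      move=> O'; rewrite (ddB oO1 _ sW sS O'); congr (_ - _).
      exact: (dd_sum oO1 (index_enum 'I_k.+1) xpredT (F := fun (c : 'I_k.+1) => wl c) b (fun c => sm_sub O1O (swl c)) O').
    have sS2 : smooth_st O1 (fun q => \sum_(c < k.+1) dd b (wl c) q).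
      by apply: (sm_sum oO1) => c; exact: (sm_dd oO1 b (sm_sub O1O (swl c))).
    rewrite (dd_eq oO1 a E1 Ol) (ddB oO1 _ (sm_dd oO1 b sW) sS2 Ol).
    rewrite (dd_sum oO1 (index_enum 'I_k.+1) xpredT (F := fun (c : 'I_k.+1) => dd b (wl c)) a (fun c => sm_dd oO1 b (sm_sub O1O (swl c))) Ol).
    rewrite mulrBr; congr (_ - _).
      congr (_ * _); have [_ hG] := HO1 _ Ol; have [-> _] := hG i j; rewrite /= -/pl -/a -/b.
      by move: (om _ _ _) (Rc _ _ _) (rc t) (dd _ _ _) => x y z w; ring.
    rewrite mulr_sumr; apply: eq_bigr => c _.
    have Oq : O (t, p) by [].
    have lc : l ^+ c != 0 by rewrite expf_neq0.
    have E2 q' : O q' -> dd b (wl c) (sc (ray l) q') = rc (l ^+ c / ray l j) * dd b (wl c) q'.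
      exact: (dd_homog oOt (rho := ray l) b r0 lc (fun z Oz => wl_hom c hl Oz)).
    have lc2 : l ^+ c / ray l j != 0 by rewrite mulf_neq0 ?invr_neq0.
    rewrite (dd_homog oOt (rho := ray l) a r0 lc2 E2 Oq) /= mulrA -rcM; congr (rc _ * _).
    have gen (x y z : R) : x != 0 -> y != 0 -> z = x * y * (z / y / x).
      by move=> x0 y0; field; rewrite x0 y0.
    exact: gen.
  have := H t pl; have -> : wc pl = wc p by apply/rowP => c; rewrite !mxE /ray /= rc1 mul1r.
  have zn : 0 < nm (zc p) by rewrite lt_neqAle nm_ge0 eq_sym nm_eq0 dom_z.
  have -> : nm (zc pl) = l * nm (zc p) by rewrite /zc mxE /ray eqxx nmM nm_rc gtr0_norm.
  have g1 : 0 < t <= 1 by rewrite t0 ltW.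
  have g2 : 0 < l * nm (zc p) < de by rewrite mulr_gt0.
  move=> /(_ g1 erefl g2); rewrite s2_sc sqrtrM ?sqr_ge0 // sqrtr_sqr gtr0_norm // exprMn -/Y.
  have -> : (t, pl) = sc (ray l) (t, p) by [].
  rewrite (@lops_sc R m [:: a; b] E l (t, p) ln) (lops2 i j (open_sc oO1 (rho := ray l)) (sm_sc oO1 (rho := ray l) sE) Ol) -/a -/b -hE !nmM -/X.
  have -> : e * X / Y * (l ^+ k * Y) = X * (e * l ^+ k).
    have gen (x y z w : R) : y != 0 -> w * x / y * (z * y) = x * (w * z) by move=> y0; field; exact: y0.
    by apply: gen; rewrite gt_eqF.
  by rewrite ler_pM2l.
have ch : h @ 0^'+ --> h 0.
  rewrite /h; apply: cvgB; last first.
    by apply: cvg_sumC => c; apply: cvgM; [exact: cvg_cst|exact: cT].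
  apply: cvgM; first exact: cvg_cst.
  apply: cvgD.
    apply: cvgB; last exact: cvg_cst.
    apply: (cw_path (upto_cw0 (Gsm i j))); first exact: reg0.
    by apply: filterS (pos1 R) => s /andP[s0 s1]; apply: regt => //; rewrite ltW.
  apply: cvgM; last exact: cvg_cst.
  by apply: cvg_at_right_filter; apply: cvg_rc; exact: cvg_id.
have h0 : h 0 = - N.[rc l].
  rewrite /h G0 // subrr rc0 mul0r addr0 mulr0 sub0r horner_poly; congr (- _).
  by apply: eq_bigr => c _; rewrite rcX mulrC.
rewrite -nmN -h0; apply: (cvgr_to_le (cvg_nmf _ ch)); apply: filterS (pos1 R) => t; exact: B.
Qed.

(** The factor t^(k/2 + 1) of the soliton. The value 0 at k = 0 expresses that d dbar v_0 vanishes,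
    the soliton having no potential of weight 0. *)
Definition cf (k : nat) (t : R) : R := if k == 0%N then 0 else powR t (k%:R / 2%:R + 1).
Definition dcf (k : nat) (t : R) : R := if k == 0%N then 0 else (k%:R / 2%:R + 1) * Num.sqrt t ^+ k.
Lemma powR_half (k : nat) (t : R) : 0 <= t -> powR t (k%:R / 2%:R) = Num.sqrt t ^+ k.
Proof. by move=> t0; rewrite mulrC powRrM powR12_sqrt // powR_mulrn // sqrtr_ge0. Qed.
Lemma powR_half1 (k : nat) (t : R) : 0 <= t -> powR t (k%:R / 2%:R + 1) = Num.sqrt t ^+ k.+2.
Proof.
move=> t0; rewrite -powR_half //; congr powR; rewrite -(natr1 k.+1) -(natr1 k).
by field.
Qed.
Lemma cf_derive k (t : R) : 0 < t -> is_derive t 1 (cf k) (dcf k t).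
Proof.
move=> t0; rewrite /cf /dcf; case: (k == 0%N); first exact: is_derive_cst.
have := @is_derive1_powR R (k%:R / 2%:R + 1) t t0.
by rewrite addrK powR_half // ltW.
Qed.
Lemma cf_cvg k : cf k @ 0^'+ --> cf k 0.
Proof.
rewrite /cf; case: eqP => _; first exact: cvg_cst.
have h : (fun t : R => Num.sqrt t ^+ k.+2) @ 0^'+ --> Num.sqrt (0 : R) ^+ k.+2.
  apply: cvg_at_right_filter.
  have c : Num.sqrt @ (0 : R) --> Num.sqrt (0 : R) by exact: sqrt_continuous.
  elim: (k.+2) => [|c' IH].
    by rewrite expr0 (_ : (fun _ => _) = fun=> 1); [exact: cvg_cst|apply/funext => x; rewrite expr0].
  rewrite exprS (_ : (fun _ => _) = fun x : R => Num.sqrt x * Num.sqrt x ^+ c'); last by apply/funext => x; rewrite exprS.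
  exact: (cvgM c IH).
rewrite powR_half1 //; apply: cvg_trans h; apply: near_eq_cvg.
by apply: filterS (pos1 R) => t /andP[t0 _]; rewrite powR_half1 // ltW.
Qed.
Lemma cf0 k : cf k 0 = 0.
Proof. by rewrite /cf; case: eqP => // _; rewrite powR_half1 // sqrtr0 expr0n. Qed.

(** The parts of index at most k involve the coefficients only up to k - 2. By [IH] the part of
    index j is t^(j/2) times that of the soliton, so the formal logarithm acquires the factor
    t^(k/2), and the soliton equation evaluates it. *)
Lemma log_coef_value k (IH : forall l, (l < k)%N -> forall t p i j, 0 <= t -> dom p ->
    dd (Some (i, false)) (dd (Some (j, true)) (wl l)) (t, p) =
    rc (cf l t) * dd (Some (i, false)) (dd (Some (j, true)) (fun q : S => rc (u l q.2))) (0, p)) q : O q ->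
  formal_log_coef k (MxPoly om Rc wl k q) = rc (dcf k q.1) * rc (u k q.2).
Proof.
case: q => t p [/= t0 dp].
have [->|kp] := posnP k; first by rewrite /formal_log_coef big_geq // coef0 /dcf eqxx rc0 mul0r.
have B j : (j <= k)%N -> Mx om Rc wl j (t, p) = rc (Num.sqrt t) ^+ j *: (invmx (om p) *m solp j p).
  move=> jk; rewrite /Mx scalemxAr; congr (_ *m _); case: j jk => [|[|i]] jk; first by rewrite expr0 scale1r.
    by rewrite scaler0.
  have E c d := IH i (ltn_trans (ltnSn i) jk) t p c d (ltW t0) dp.
  apply/matrixP => c d; rewrite !mxE E; case: i jk E => [|i] jk E.
    by rewrite /cf eqxx rc0 mul0r addr0 !mxE -rcX sqr_sqrtr ?ltW // mulrN.
  by rewrite add0r /cf /= powR_half1 ?ltW // rcX !mxE.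
rewrite /MxPoly (formal_log_det B) u_eq // -rcX -!rcM; congr rc.
by rewrite /dcf (gtn_eqF kp); ring.
Qed.

(** For t > 0 both sides have the time derivative (k/2 + 1) t^(k/2) d dbar u_k, or zero when k = 0.
    Both are continuous up to t = 0 and vanish there. *)
Lemma expansion_coef k t p i j : 0 <= t -> dom p ->
  dd (Some (i, false)) (dd (Some (j, true)) (wl k)) (t, p) =
  rc (cf k t) * dd (Some (i, false)) (dd (Some (j, true)) (fun q : S => rc (u k q.2))) (0, p).
Proof.
elim/ltn_ind: k t p i j => k IH t p i j t0 dp.
have V := log_coef_value IH.
set a := Some (i, false); set b := Some (j, true); set U := dd a (dd b (fun q : S => rc (u k q.2))) (0, p).
have [->|tn] := eqVneq t 0; first by rewrite initial_coef // cf0 rc0 mul0r.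
have tp : 0 < t by rewrite lt_neqAle eq_sym tn.
have D s : 0 < s -> dd None (dd a (dd b (wl k))) (s, p) = rc (dcf k s) * U.
  move=> s0; have Os : O (s, p) by [].
  rewrite (coef_flow k i j Os) -/a -/b.
  have e1 q' : O q' -> dd b (fun q => formal_log_coef k (MxPoly om Rc wl k q)) q' = dd b (fun q => rc (dcf k q.1) * rc (u k q.2)) q'.
    by move=> O'; exact: (dd_eq oOt b V O').
  rewrite (dd_eq oOt a e1 Os).
  (* The derivatives are spatial, so the factor depending on time may be frozen at its value at time
     s and pulled out as a constant. *)
  rewrite [LHS](@dds_slice R n [:: (i, false); (j, true)] _ (fun q : S => rc (dcf k s) * rc (u k q.2)) s 0 p) //= -/a -/b.
  have [k0|kp] := posnP k.
    have z c : dd c (fun _ : S => (0 : Cx R)) = (fun _ : S => (0 : Cx R)) by apply/funext => z; exact: dd_cst.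
    rewrite (_ : (fun q : S => rc (dcf k s) * _) = fun=> 0) ?z; last by apply/funext => z'; rewrite /dcf k0 eqxx rc0 mul0r.
    by rewrite /dcf k0 eqxx rc0 mul0r.
  have su := u_smooth kp; have Op : [set q : S | dom q.2] (0, p) by [].
  have e2 q' : dom q'.2 -> dd b (fun q : S => rc (dcf k s) * rc (u k q.2)) q' = rc (dcf k s) * dd b (fun q : S => rc (u k q.2)) q'.
    by move=> O'; exact: (ddZ oO0 _ b su O').
  by rewrite (dd_eq oO0 a e2 Op) (ddZ oO0 _ a (sm_dd oO0 b su) Op).
pose f s := dd a (dd b (wl k)) (s, p) - rc (cf k s) * U.
have cA : cw [set q : S | 0 <= q.1 /\ dom q.2] (dds [:: (i, false); (j, true)] (wl k)).
  apply: (@upto_cw R n _ (fun t => [set p | 0 <= t /\ dom p])) (wl_upto k) => // s.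
  have [h|h] := boolP (0 <= s).
    by rewrite (_ : [set p | _] = dom) //; apply/seteqP; split=> [p' []//|p' dp']; split.
  by rewrite (_ : [set p | _] = set0); [exact: open0|apply/seteqP; split=> [p' []//|p']].
have cf' : f @ 0^'+ --> f 0.
  apply: cvgB; last by apply: cvgM; [apply: cvg_rc; exact: cf_cvg|exact: cvg_cst].
  apply: (cw_path cA) => //.
  by apply: filterS (pos1 R) => s /andP[s0 _]; split=> //; exact: ltW.
have H s : 0 < s <= t -> is_cder f s 0 /\ nm (0 : Cx R) <= 0.
  move=> /andP[s0 _]; split; last by rewrite nm0.
  have d1 := is_cder_time (sm_dd oOt a (sm_dd oOt b (swl k))) (conj s0 dp : O (s, p)).
  have d2 := is_cderN (is_cderM (is_cder_rc (cf_derive k s0)) (is_cderC U s)).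
  have := is_cderD d1 d2; apply: is_cder_eq; rewrite D // mulr0 addr0 subrr //.
have := @time_increment R f (fun=> 0) 0 t 0 tp H cf'; rewrite mulr0 mul0r => h.
have /eqP : nm (f t - f 0) == 0 by rewrite eq_le h nm_ge0.
move=> /eqP; rewrite nm_eq0 subr_eq0 => /eqP e.
have f0 : f 0 = 0 by rewrite /f initial_coef // cf0 rc0 mul0r subr0.
by move: e; rewrite f0 /f => /eqP; rewrite subr_eq0 => /eqP.
Qed.
End ChartExpansion.

(** * Charts of the cone *)

Section ConeChart.
Variables (R : realType) (m : nat) (M : complexManifold R m.+1) (D : set M) (L : lineBundle M).
Variables (h : forall x, L x -> R) (kappa : R).
Hypothesis hh : hermitian_metric h.
Hypothesis k0 : 0 < kappa.
Let hD := fun x (v : L x) => kappa * h v.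
Variables (x : M) (F : param R M m.+1) (f : set M * (forall x, L x)).
Hypothesis Dx : D x.
Hypothesis lF : local_param D x F.
Hypothesis ff : lb_frames f.
Notation n := m.+1.
Notation S := (R * Cn R n)%type.
Let psi : param R (total_space L) n := E_param F f.
Let E (p : Cn R n) : Cn R n := zw 0 (wc p).

Lemma polydisc_zw0 (w : Cn R m) : polydisc n (zw 0 w) <-> polydisc m w.
Proof.
split=> H j; first by have := H (lift ord0 j); rewrite mxE liftK.
by rewrite mxE; case: unliftP => [k _|_] /=; [exact: H|rewrite normr0].
Qed.
Lemma cvg_section p : E @ p --> E p.
Proof.
apply: (@cvg_row R _ (nbhs p) (nbhs_filter p)) => j; rewrite !mxE.
rewrite (_ : (fun _ => _) = fun p' : Cn R n => oapp (fun k => wc p' 0 k) 0 (unlift ord0 j)); last by apply/funext => z; rewrite mxE.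
case: (unliftP ord0 j) => [k _|_] /=; last exact: (@cvg_cst _ (0 : Cx R) _ (nbhs p) (nbhs_filter p)).
rewrite mxE (_ : (fun _ => _) = fun p' : Cn R n => p' 0 (lift ord0 k)); last by apply/funext => z; rewrite mxE.
exact: cvg_coord.
Qed.
Lemma cone_domE : pdom psi = [set p : Cn R n | zc p != 0] `&` E @^-1` (pdom F `&` F @^-1` f.1).
Proof.
have [_ dF _ _] := lF; apply/seteqP; split=> p /=.
  by move=> [h1 h2 h3]; split=> //; split=> //; rewrite dF; apply/polydisc_zw0.
by move=> [h1 [h2 h3]]; split=> //; apply/polydisc_zw0; rewrite -dF.
Qed.
Lemma open_cone_dom : open (pdom psi).
Proof.
rewrite cone_domE; apply: openI; first exact: open_neq0.
apply: open_comp => [p _|]; first exact: cvg_section.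
by have [[[_ _ pF _] _] _ _ _] := lF; apply: pF; exact: (lb_open ff).
Qed.
Lemma wc_ray (l : R) (p : Cn R n) : wc (scp (ray l) p) = wc p.
Proof. by apply/rowP => k; rewrite !mxE /ray /= rc1 mul1r. Qed.
Lemma zc_ray (l : R) (p : Cn R n) : zc (scp (ray l) p) = rc l * zc p.
Proof. by rewrite /zc mxE /ray eqxx. Qed.
Lemma cone_dom_sc (l : R) p : l != 0 -> pdom psi p -> pdom psi (scp (ray l) p).
Proof. by move=> l0 [h1 h2 h3]; split; rewrite ?wc_ray // zc_ray mulf_neq0 // rc_eq0. Qed.
Lemma cone_dom_scI (l : R) p : pdom psi (scp (ray l) p) -> pdom psi p.
Proof.
move=> [h1 h2 h3]; split; rewrite ?wc_ray // in h1 h2 h3 *.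
by apply: contraNneq h1 => e; rewrite zc_ray e mulr0.
Qed.
Lemma hD_scale y (a : Cx R) (v : L y) : hD (a *: v) = nm a ^+ 2 * hD v.
Proof.
have [H _ _] := hh; apply: rc_inj; rewrite /hD rcM H normE rcM rcX rcM; ring.
Qed.
Lemma S2_ray (l : R) p : S2 hD (psi (scp (ray l) p)) = l ^+ 2 * S2 hD (psi p).
Proof.
rewrite /S2 /= wc_ray zc_ray -scalerA hD_scale nm_rc real_normK ?num_real //.
Qed.
Lemma S2_gt0 p : pdom psi p -> 0 < S2 hD (psi p).
Proof.
move=> [z0 _ fp]; have [_ H _] := hh; rewrite /S2 /hD /= mulr_gt0 // H // scaler_eq0 negb_or z0 /=.
by have [] := lb_basis ff fp.
Qed.
Lemma cone_point_D p : pdom psi p -> D (F (E p)).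
Proof.
move=> [_ wp _]; have [[[_ iF _ _] _] dF _ FD] := lF.
have Ep : polydisc n (E p) by apply/polydisc_zw0.
apply: contrapT => nD.
have : (F @` polydisc n `&` ~` D) (F (E p)) by split=> //; exists (E p).
rewrite -FD => -[q [dq zq] e]; have qE : q = E p by apply: iF e; rewrite dF.
by move: zq; rewrite qE zc_zw eqxx.
Qed.
(** Smoothness of h is stated in charts of the atlas, while F belongs to the maximal atlas only. A
    transition map to an atlas chart at the base point is inserted, and |z|^2 is split off. *)
Lemma S2_cts p : pdom psi p -> (fun p => S2 hD (psi p)) @ p --> S2 hD (psi p).
Proof.
move=> dp; have [z0 wp fp] := dp; have [_ _ Hs] := hh.
have [[_ cF] dF _ _] := lF; have Ep : pdom F (E p) by rewrite dF; apply/polydisc_zw0.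
have [chi achi [p' dp' e]] := cm_cover (F (E p)).
have [cFc _] := cF chi achi; have [U [tau [Up [oU Ud Uc Ue] tauH]]] := cFc (E p) p' Ep dp' (esym e).
have sm := Hs f ff chi achi; set g := (fun y => rc (h (f.2 y))) in sm.
have ct : tau @ E p --> tau (E p).
  by apply: (@cvg_row R _ (nbhs (E p)) (nbhs_filter (E p))) => j; exact: (holo_map_cts tauH Up).
have cg : (fun q => g (chi q)) @ tau (E p) --> g (chi (tau (E p))).
  have c1 : {for ((0, tau (E p)) : S), continuous (fun q : S => (g \o chi) q.2)}.
    by apply: (sm_cts sm); split=> //; split; [exact: Uc|rewrite /= -Ue].
  have c2 : (fun q : Cn R n => ((0, q) : S)) @ tau (E p) --> ((0, tau (E p)) : S).
    by apply: (@cvg_pair2 R n _ (nbhs (tau (E p))) 0 (tau (E p)) (fun=> 0) id (nbhs_filter _)); [exact: cvg_cst|exact: cvg_id].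
  exact: (cvg_comp _ _ c2 c1).
have c1 : (fun q => g (F q)) @ E p --> g (F (E p)).
  have c2 := cvg_comp _ _ ct cg; rewrite (Ue _ Up) /=.
  apply: cvg_trans c2; apply: (@near_eq_cvg _ _ (nbhs (E p)) (nbhs_filter (E p))).
  have : \forall q \near E p, U q by exact: (open_nbhs_nbhs (conj oU Up)).
  by apply: (@filterS _ (nbhs (E p)) (nbhs_filter (E p)) U) => q Uq; rewrite /= -(Ue _ Uq).
have c3 := cvg_comp _ _ (@cvg_section p) c1.
have c4 := cvg_cre (nbhs_filter p) c3.
have c5 : (fun q : Cn R n => nm (zc q)) @ p --> nm (zc p) by exact: cvg_nm_coord.
have SE q : S2 hD (psi q) = nm (zc q) * nm (zc q) * (kappa * cre (g (F (E q)))).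
  by rewrite /S2 /= hD_scale expr2.
rewrite SE (_ : (fun p => _) = fun q => nm (zc q) * nm (zc q) * (kappa * cre (g (F (E q))))); last by apply/funext => q; rewrite SE.
have c6 := @cvgM R (Cn R n) (nbhs p) (nbhs_filter p) _ _ _ _ c5 c5.
have c7 := @cvgM R (Cn R n) (nbhs p) (nbhs_filter p) _ _ _ _ (@cvg_cst _ kappa _ (nbhs p) (nbhs_filter p)) c4.
exact: (@cvgM R (Cn R n) (nbhs p) (nbhs_filter p) _ _ _ _ c6 c7).
Qed.
Lemma cone_reg eps : [set q : S | pdom psi q.2 /\ cone_region D hD eps (q.1, psi q.2)] =
  [set q : S | pdom psi q.2 /\ 0 <= q.1 <= eps * (Num.sqrt (S2 hD (psi q.2)))^-1 ^+ 2].
Proof.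
apply/seteqP; split=> q [dq]; first by move=> [_ H].
move=> H; split=> //; split=> //; split; first exact: cone_point_D.
have [z0 _ fp] := dq; rewrite /= scaler_eq0 negb_or z0 /=.
by have [] := lb_basis ff fp.
Qed.
End ConeChart.

Theorem theorem1p4 (R : realType) (m : nat) (Xbar : complexManifold R m.+1)
    (D : set Xbar) (L : lineBundle Xbar) (sigma : forall x, L x)
    (h : forall x, L x -> R) (omegaD : tensor R Xbar m)
    (I : set R) (omegaX : R -> tensor R Xbar m.+1)
    (hcompact : compact [set: Xbar]) (hconnected : connected [set: Xbar])
    (hdiv : smooth_divisor D)
    (hsigma : defining_section D sigma)
    (hh : hermitian_metric h)
    (homegaD : kahler (D_params D) omegaD)
    (homegaX : kahler (X_params D) (omegaX 0))
    (hasym : conical_asymptotics D sigma h omegaD (omegaX 0))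
    (hflow : complete_kr_flow (X_params D) (~` D) I omegaX) :
  (forall t, I t -> conical_asymptotics D sigma h omegaD (omegaX t)) /\
  ((forall t, 0 <= t -> I t) ->
   forall (kappa : R), 0 < kappa ->
   let hD := fun x (v : L x) => kappa * h x v in
   conical_asymptotics1 D sigma hD omegaD (omegaX 0) ->
   curvature_form D hD omegaD ->
   forall (eps : R) (omegainf : R -> tensor R (total_space L) m.+1),
   0 < eps -> blowdown_limit D hD omegaX eps omegainf ->
   forall u, formal_soliton D hD u ->
   forall v, asymptotic_expansion D hD omegainf v ->
   forall t k psi p, 0 <= t -> E_params D psi -> pdom psi p ->
     exp_form hD v t k psi p = sol_form hD u t k psi p).
Proof.
split=> [t It x F Dx lF|_ kappa kappa0 hD _ _ eps ginf eps0 [kr ginf0 _] u hu v [vs vw [v0 [vpot vest]]] t k psi p t0 Epsi dp].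
  have [c c0 H] := hasym x F Dx lF; exists c; first exact: c0.
  exact: (conical_stable hflow hh homegaD Dx lF c0 It H).
have [x [F [f [Dx lF ff psiE]]]] := Epsi.
have [kr1 _] := kr; have [sW pW eW] := kr1 psi Epsi.
(* The identity concerns one chart at a time, so all data are turned into functions of its
   coordinates. *)
pose dom := pdom psi; pose s2 p := S2 hD (psi p); pose om := omega0 hD psi; pose Rc := Ric om.
pose G (q : R * Cn R m.+1) := ginf q.1 psi q.2; pose W (q : R * Cn R m.+1) := rc (v0 q.1 (psi q.2)).
pose wl (k : nat) (q : R * Cn R m.+1) := rc (v k q.1 (psi q.2)).
pose uu (k : nat) (p : Cn R m.+1) := u k (psi p).
have odom : open dom by rewrite /dom psiE; exact: (open_cone_dom lF ff).
have domsc (l : R) p' : l != 0 -> dom p' -> dom (scp (ray l) p') by rewrite /dom psiE; exact: cone_dom_sc.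
have domscI (l : R) p' : dom (scp (ray l) p') -> dom p' by rewrite /dom psiE; exact: cone_dom_scI.
have domz p' : dom p' -> zc p' != 0 by rewrite /dom psiE => -[].
have s2sc (l : R) p' : s2 (scp (ray l) p') = l ^+ 2 * s2 p' by rewrite /s2 psiE; exact: (S2_ray kappa hh).
have s2cts p' : dom p' -> s2 @ p' --> s2 p'.
  by have := @S2_cts R m Xbar D L h kappa hh x F f lF ff p'; rewrite -psiE.
have s2pos p' : dom p' -> 0 < s2 p' by rewrite /dom /s2 psiE; exact: (S2_gt0 hh kappa0 ff).
have regE : [set q : R * Cn R m.+1 | pdom psi q.2 /\ cone_region D hD eps (q.1, psi q.2)] =
   [set q : R * Cn R m.+1 | dom q.2 /\ 0 <= q.1 <= eps * (Num.sqrt (s2 q.2))^-1 ^+ 2].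
  by rewrite /dom /s2 psiE; exact: (cone_reg h kappa lF ff eps).
have omE (q : R * Cn R m.+1) i j : om q.2 i j = dd (Some (i, false)) (dd (Some (j, true)) (fun q => rc (s2 q.2)^-1)) q.
  by case: q => s q; rewrite mxE; exact: (dz_dzb_slice s i j (fun q : R * Cn R m.+1 => rc (s2 q.2)^-1) q).
have RcE (q : R * Cn R m.+1) i j : Rc q.2 i j = - dd (Some (i, false)) (dd (Some (j, true)) (fun q => rc (ln (cre (\det (om q.2)))))) q.
  by case: q => s q; rewrite !mxE; congr (- _); exact: (dz_dzb_slice s i j (fun q : R * Cn R m.+1 => rc (ln (cre (\det (om q.2))))) q).
have ddE2 (w : R -> total_space L -> R) s q i j : ddbar (fun p => w s (psi p)) q i j =
    dd (Some (i, false)) (dd (Some (j, true)) (fun q : R * Cn R m.+1 => rc (w q.1 (psi q.2)))) (s, q).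
  by rewrite mxE; exact: (dz_dzb_slice s i j (fun q : R * Cn R m.+1 => rc (w q.1 (psi q.2))) q).
have main : forall i j, dd (Some (i, false)) (dd (Some (j, true)) (wl k)) (t, p) =
  rc (cf k t) * dd (Some (i, false)) (dd (Some (j, true)) (fun q : R * Cn R m.+1 => rc (uu k q.2))) (0, p).
  move=> i j.
  apply: (@expansion_coef R m dom s2 eps om Rc G W wl uu odom domsc domscI domz s2sc s2cts s2pos eps0 _ _ _ _ omE RcE _ _ _ _ _ _ k t p i j t0 dp).
  - by move=> i' j'; rewrite -regE; exact: sW.
  - by move=> q; rewrite -regE; exact: pW.
  - move=> [s q] i' j'; rewrite -regE => Wq; have [_ e] := eW _ Wq; rewrite -pderNE e !mxE opprK.
    exact: (dz_dzb_slice s i' j' (fun q => rc (ln (cre (\det (G q))))) q).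
  - by move=> q dq; exact: (ginf0 psi q Epsi dq).
  - by move=> k'; exact: (vs k' psi Epsi).
  - move=> k' [s q] /= s0 dq; have := vw k' s s0 psi q Epsi dq.
    have e c : dd (Some c) (fun q : R * Cn R m.+1 => rc (v k' s (psi q.2))) (0, q) = dd (Some c) (wl k') (s, q).
      by apply: dd_slice.
    by cbv zeta; rewrite !lopE !e /chi eqxx.
  - move=> t1 t10; have [d d0 Hd] := vpot t1 t10; exists d => //; have [a b] := Hd psi Epsi; split=> //.
    have gen (A B C E : 'M[Cx R]_m.+1) c i' j' : A = B - C + c *: E -> A i' j' = B i' j' - C i' j' + c * E i' j'.
      by move=> ->; rewrite !mxE.
    move=> [s q] i' j' Nq; apply: etrans (esym (ddE2 v0 s q i' j')) _; exact: (gen _ _ _ _ _ _ _ (b (s, q) Nq)).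
  - move=> K s t1 e p' t10 e0 dp'.
    (* The expansion is used along one ray at a time, so the compact set of base points is a single
       point. The chart condition at z = 1 holds because the domain depends on z only through z <>
       0. *)
    have sub : [set wc p'] `<=` [set w | pdom psi (zw 1 w)].
      move=> w ->; move: dp'; rewrite /dom psiE => -[h1 h2 h3]; split; rewrite ?wc_zw // zc_zw; exact: oner_neq0.
    have cpt : compact [set wc p'] by exact: compact_set1.
    have [d d0 Hd] := vest K s t1 e psi [set wc p'] t10 e0 Epsi cpt sub; exists d => // s' q hs hw hz.
    have hz' : 0 < `|zc q| < rc d by rewrite normE -(rc0 R) !rc_lt.
    have := Hd s' q hs hw hz'; rewrite norm_le; congr (nm (lops s _ _) <= _); apply/funext => z.
    by rewrite rcB rc_sum.
  - move=> k' kp; have [us _ _] := hu k' kp; have := us psi Epsi.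
    by congr (smooth_st _ _); apply/seteqP; split=> q; [case|split].
  move=> k' p' kp dp'; have [_ _ ue] := hu k' kp; have <- := ue psi p' Epsi dp'.
  have e j' : solp om Rc uu j' p' = soliton_part hD u psi p' j'.
    case: j' => [|[|[|l]]]; [exact: erefl|exact: erefl|exact: erefl|].
    by apply/matrixP => c d; rewrite mxE [RHS](ddE2 (fun=> u l.+1) 0).
  have gen (A B : nat -> 'M[Cx R]_m.+1) (Z : 'M[Cx R]_m.+1) : A =1 B ->
      formal_log_coef k' (\det (\sum_(j' < k'.+1) 'X^j' *: map_mx polyC (Z *m A j'))) =
      formal_log_coef k' (\det (\sum_(j' < k'.+1) 'X^j' *: map_mx polyC (Z *m B j'))) by move=> /funext ->.
  exact: (gen (solp om Rc uu ^~ p') (soliton_part hD u psi p') (invmx (om p')) e).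
apply/matrixP => i j; rewrite /exp_form /sol_form mxE ddE2 main /cf.
(* In weight 0 both sides reduce to - t Ric(omega_0), because [cf 0] vanishes. *)
case: eqP => [->|_]; first by rewrite rc0 mul0r addr0.
by rewrite !mxE add0r; congr (_ * _); rewrite (dz_dzb_slice 0 i j (fun q : R * Cn R m.+1 => rc (u k (psi q.2)))).
Qed.
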